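(* Let $G$ be a simple compact Lie group whose root system has roots of two different lengths, and let $\rho$ be the irreducible complex representation of $G$ whose highest weight is the highest short root. Then the maximum of $\operatorname{Tr}\rho(g)$ for $g\in G$ is $\dim\rho$, and the minimum of $\operatorname{Tr}\rho(g)$ for $g\in G$ and the value of $\dim\rho$ are as follows: - type $B_n$ ($n\ge 2$): minimum $1-2n$, $\dim\rho=2n+1$; - type $C_n$ ($n\ge 2$): minimum $1-n$ if $n$ is odd and $-1-n$ if $n$ is even, $\dim\rho=2n^2-n-1$; - type $F_4$: minimum $-6$, $\dim\rho=26$; - type $G_2$: minimum $-2$, $\dim\rho=7$.
   Context: A simple compact Lie group is a connected, non-commutative compact Lie group all of whose proper closed normal subgroups are finite. The highest short root is the unique dominant short root (with respect to a choice of maximal torus and of positive roots). *)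

(* Defs.v *)
From HB Require Import structures.
From mathcomp Require Import all_boot all_order all_algebra.
From mathcomp Require Import complex.
From mathcomp Require Import all_classical all_reals all_analysis.
Set Implicit Arguments.
Unset Strict Implicit.
Unset Printing Implicit Defensive.
Import Order.TTheory GRing.Theory Num.Theory.
Import numFieldNormedType.Exports.
Local Open Scope classical_set_scope.
Local Open Scope ring_scope.

HB.mixin Record isTopologicalGroup G of Group G & Topological G := {
  mulg_continuous : continuous (fun p : G * G => (p.1 * p.2)%g) ;
  invg_continuous : continuous (fun x : G => (x^-1)%g)
}.

#[short(type="topologicalGroupType")]
HB.structure Definition TopologicalGroup :=
  {G of isTopologicalGroup G & Group G & Topological G}.

(* [f] is of class C^k at the points of [U], an open set: for k > 0, all
   directional derivatives exist on [U] and are of class C^(k-1). *)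
Fixpoint class_C (R : realType) (p q k : nat) (U : set 'rV[R]_p)
    (f : 'rV[R]_p -> 'rV[R]_q) : Prop :=
  (forall x, U x -> {for x, continuous f}) /\
  if k is k'.+1 then
    forall v, (forall x, U x -> derivable f x v) /\
              class_C k' U (fun x => 'D_v f x)
  else True.

Definition smooth_on (R : realType) (p q : nat) (U : set 'rV[R]_p)
    (f : 'rV[R]_p -> 'rV[R]_q) : Prop :=
  forall k, class_C k U f.

(* A homeomorphism from the open set [dom] of [M] onto an open set of R^d, with
   inverse [uncoord]; both maps are total, their values elsewhere are junk. *)
Record chart (R : realType) (M : topologicalType) (d : nat) := Chart {
  dom : set M ;
  coords : M -> 'rV[R]_d ;
  uncoord : 'rV[R]_d -> M ;
  dom_open : open dom ;
  codom_open : open (coords @` dom) ;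
  coordK : forall x, dom x -> uncoord (coords x) = x ;
  chart_continuous : forall x, dom x -> {for x, continuous coords} ;
  uncoord_continuous : forall u, (coords @` dom) u -> {for u, continuous uncoord}
}.

(* A smooth atlas on [G] for which the group operations are smooth.
   Second countability is omitted: it is automatic for compact [G]. *)
Record lie_structure (R : realType) (G : topologicalGroupType) (d : nat) :=
  LieStructure {
  atlas : set (chart R G d) ;
  atlas_cover : forall x, exists2 c, atlas c & dom c x ;
  atlas_compatible : forall c1 c2, atlas c1 -> atlas c2 ->
    smooth_on (coords c1 @` (dom c1 `&` dom c2)) (coords c2 \o uncoord c1) ;
  mulg_smooth : forall c1 c2 c3, atlas c1 -> atlas c2 -> atlas c3 ->
    smooth_on
      [set u : 'rV[R]_(d + d) |
        [/\ (coords c1 @` dom c1) (lsubmx u), (coords c2 @` dom c2) (rsubmx u)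
          & dom c3 (uncoord c1 (lsubmx u) * uncoord c2 (rsubmx u))%g]]
      (fun u => coords c3 (uncoord c1 (lsubmx u) * uncoord c2 (rsubmx u))%g) ;
  invg_smooth : forall c1 c2, atlas c1 -> atlas c2 ->
    smooth_on (coords c1 @` (dom c1 `&` [set x | dom c2 (x^-1)%g]))
              (fun u => coords c2 ((uncoord c1 u)^-1)%g)
}.

Definition normal_subgroup (G : topologicalGroupType) (N : set G) : Prop :=
  [/\ N 1%g,
      forall x y, N x -> N y -> N (x * y)%g,
      forall x, N x -> N (x^-1)%g
    & forall g x, N x -> N (g * x * g^-1)%g].

Definition simple_compact (G : topologicalGroupType) : Prop :=
  [/\ hausdorff_space G,
      compact [set: G],
      connected [set: G],
      exists x y : G, (x * y)%g <> (y * x)%g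
    & forall N : set G,
        normal_subgroup N -> closed N -> N <> setT -> finite_set N].

(* The adjoint action of [g] on the tangent space at 1, as a matrix acting on
   column vectors in the coordinates of a chart [c] around 1. *)
Definition Ad (R : realType) (G : topologicalGroupType) (d : nat)
    (c : chart R G d) (g : G) : 'M[R]_d :=
  (jacobian (fun u => coords c (g * uncoord c u * g^-1)%g) (coords c 1%g))^T.

(* [tau] induces an isomorphism of R^r / Z^r onto a torus of [G]. *)
Definition torus (R : realType) (G : topologicalGroupType) (r : nat)
    (tau : 'rV[R]_r -> G) : Prop :=
  [/\ continuous tau,
      forall x y, tau (x + y) = (tau x * tau y)%g
    & forall x, tau x = 1%g <-> forall i, x 0 i \is a Num.int].

Definition maximal_torus (R : realType) (G : topologicalGroupType) (r : nat)
    (tau : 'rV[R]_r -> G) : Prop :=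
  torus tau /\
  forall s (sigma : 'rV[R]_s -> G), torus sigma ->
    range tau `<=` range sigma -> range sigma = range tau.

Definition pairing (R : realType) (r : nat) (a x : 'rV[R]_r) : R :=
  (a *m x^T) 0 0.

Definition expi2pi (R : realType) (t : R) : R[i] :=
  (cos (2 * pi * t) +i* sin (2 * pi * t))%C.

(* The character group of the torus is Z^r inside 'rV[R]_r: [a] stands for
   tau x |-> exp (2 i pi <a, x>).  Integrality of a weight [a] is automatic,
   since the left-hand side below only depends on tau x. *)
Definition weight (R : realType) (G : topologicalGroupType) (r m : nat)
    (tau : 'rV[R]_r -> G) (V : G -> 'M[R[i]]_m) : set 'rV[R]_r :=
  [set a | exists2 v : 'cV[R[i]]_m, v != 0 &
             forall x, V (tau x) *m v = expi2pi (pairing a x) *: v].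

(* The nonzero weights of the complexified adjoint representation; they do not
   depend on the chart around 1. *)
Definition root_set (R : realType) (G : topologicalGroupType) (d r : nat)
    (L : lie_structure R G d) (tau : 'rV[R]_r -> G) : set 'rV[R]_r :=
  [set a | a != 0 /\
    exists c, [/\ atlas L c, dom c 1%g
                & weight tau (fun g => map_mx (real_complex R) (Ad c g)) a]].

(* [P] is the matrix of an element of the Weyl group N(T)/T on the Lie algebra
   R^r of T; its action on weights is dual: <a, x *m P> = <a *m P^T, x>. *)
Definition weyl_element (R : realType) (G : topologicalGroupType) (r : nat)
    (tau : 'rV[R]_r -> G) (P : 'M[R]_r) : Prop :=
  exists g : G, forall x, (g * tau x * g^-1)%g = tau (x *m P).

Definition ip (R : realType) (r : nat) (B : 'M[R]_r) (a b : 'rV[R]_r) : R :=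
  (a *m B *m b^T) 0 0.

Definition invariant_inner_product (R : realType) (G : topologicalGroupType)
    (r : nat) (tau : 'rV[R]_r -> G) (B : 'M[R]_r) : Prop :=
  [/\ forall a b, ip B a b = ip B b a,
      forall a, a != 0 -> 0 < ip B a a
    & forall P, weyl_element tau P ->
        forall a b, ip B (a *m P^T) (b *m P^T) = ip B a b].

(* A choice of positive roots is given by a vector [h] of the Lie algebra of the
   torus on which no root vanishes. *)
Definition regular_vector (R : realType) (r : nat) (Phi : set 'rV[R]_r)
    (h : 'rV[R]_r) : Prop :=
  forall a, Phi a -> pairing a h != 0.

Definition positive_roots (R : realType) (r : nat) (Phi : set 'rV[R]_r)
    (h : 'rV[R]_r) : set 'rV[R]_r :=
  [set a | Phi a /\ 0 < pairing a h].

Definition two_lengths (R : realType) (r : nat) (Phi : set 'rV[R]_r)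
    (B : 'M[R]_r) : Prop :=
  exists a b, [/\ Phi a, Phi b & ip B a a != ip B b b].

Definition short_root (R : realType) (r : nat) (Phi : set 'rV[R]_r)
    (B : 'M[R]_r) (a : 'rV[R]_r) : Prop :=
  Phi a /\ forall b, Phi b -> ip B a a <= ip B b b.

Definition dominant (R : realType) (r : nat) (Phi : set 'rV[R]_r)
    (B : 'M[R]_r) (h a : 'rV[R]_r) : Prop :=
  forall b, positive_roots Phi h b -> 0 <= ip B a b.

Definition highest_short_root (R : realType) (r : nat) (Phi : set 'rV[R]_r)
    (B : 'M[R]_r) (h a : 'rV[R]_r) : Prop :=
  short_root Phi B a /\ dominant Phi B h a.

Definition highest_weight (R : realType) (G : topologicalGroupType) (r m : nat)
    (tau : 'rV[R]_r -> G) (Phi : set 'rV[R]_r) (h : 'rV[R]_r)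
    (rho : G -> 'M[R[i]]_m) (a : 'rV[R]_r) : Prop :=
  weight tau rho a /\
  forall b, weight tau rho b ->
    exists2 s : seq 'rV[R]_r, (forall c, c \in s -> positive_roots Phi h c) &
      a - b = \sum_(c <- s) c.

(* Matrices act on column vectors; a subspace is given by the row space of [U],
   whence the transpose. *)
Definition irreducible_representation (R : realType) (G : topologicalGroupType)
    (m : nat) (rho : G -> 'M[R[i]]_m) : Prop :=
  [/\ continuous (rho : G -> 'M[R[i]^o]_m),
      rho 1%g = 1%:M,
      forall x y, rho (x * y)%g = rho x *m rho y,
      (0 < m)%N
    & forall U : 'M[R[i]]_m,
        (forall g, stablemx U (rho g)^T) -> U = 0 \/ row_full U].

(* Below, root systems are in Bourbaki's coordinates. *)

Definition evec (R : realType) (n : nat) (i : 'I_n) : 'rV[R]_n := delta_mx 0 i.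

(* all vectors s e_i + s' e_j with i != j and signs s, s' *)
Definition roots_ij (R : realType) (n : nat) : set 'rV[R]_n :=
  [set a | exists (i j : 'I_n) (b c : bool),
             i != j /\ a = (-1) ^+ b *: evec R i + (-1) ^+ c *: evec R j].

Definition roots_B (R : realType) (n : nat) : set 'rV[R]_n :=
  [set a | exists (i : 'I_n) (b : bool), a = (-1) ^+ b *: evec R i]
  `|` @roots_ij R n.

Definition roots_C (R : realType) (n : nat) : set 'rV[R]_n :=
  [set a | exists (i : 'I_n) (b : bool), a = (-1) ^+ b *: (2 *: evec R i)]
  `|` @roots_ij R n.

Definition roots_F4 (R : realType) : set 'rV[R]_4 :=
  @roots_B R 4 `|` [set a | forall i, `|a 0 i| = 2^-1].

Definition roots_G2 (R : realType) : set 'rV[R]_3 :=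
  [set a | exists i j : 'I_3, i != j /\ a = evec R i - evec R j]
  `|` [set a | exists (i j k : 'I_3) (b : bool),
        uniq [:: i; j; k] /\
        a = (-1) ^+ b *: (2 *: evec R i - evec R j - evec R k)].

(* An isomorphism of root systems, as an injective linear map; [Psi] need not
   span 'rV[R]_n. *)
Definition root_system_iso (R : realType) (r n : nat)
    (Phi : set 'rV[R]_r) (Psi : set 'rV[R]_n) : Prop :=
  exists f : 'M[R]_(r, n), row_free f /\ [set a *m f | a in Phi] = Psi.

(* The order of R[i] is partial:  z <= z' means
   that z' - z is a nonnegative real number. *)

Definition trace_values (R : realType) (G : topologicalGroupType) (m : nat)
    (rho : G -> 'M[R[i]]_m) : set R[i] :=
  [set \tr (rho g) | g in [set: G]].

Definition is_max (R : realType) (A : set R[i]) (z : R[i]) : Prop :=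
  A z /\ ubound A z.

Definition is_min (R : realType) (A : set R[i]) (z : R[i]) : Prop :=
  A z /\ lbound A z.

(* Main.v *)
(** The kernel of [rho] is finite, so roots, Weyl reflections and sl2-triples can be
    read off from the real Lie algebra of [rho G], on which the form Re tr (X Y) is
    negative definite.  Maximising real parts of traces over the compact group shows
    that the exponential is onto [rho G] and that every element of the Lie algebra is
    conjugate to one commuting with a regular element of the torus; hence every value
    of the trace is attained on the torus.

    A dominant weight other than [lam] is a sum of roots shorter than every root, hence
    zero: the nonzero weights are the short roots.  They have multiplicity one by
    irreducibility, and comparing the traces of the Casimir operator on the zero weight
    space and on the whole space yields the multiplicity k of the weight 0.  The values
    of the trace are thus k + sum over the short roots v of exp (2 i pi <v, xi>).  With
    c_i = cos (2 pi xi_i), and with the roots of F4 multiplied by 2, they are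
    1 + 2 sum c_i for B_n, n - 1 + 2 ((sum c_i)^2 - sum c_i^2) for C_n,
    2 + sum 2 (2 c_i^2 - 1) + 16 prod c_i for F4, and
    |sum exp (2 i pi xi_i)|^2 - 2 for G2. *)
Require Import Defs.
From mathcomp Require Import all_boot all_order all_algebra.
From mathcomp Require Import fingroup perm complex.
From mathcomp Require Import ring lra zify.
From mathcomp Require Import all_classical all_reals all_analysis.
Set Implicit Arguments.
Unset Strict Implicit.
Unset Printing Implicit Defensive.
Import Order.TTheory GRing.Theory Num.Theory.
Import numFieldNormedType.Exports.
Import ComplexField.Normc.
Local Open Scope classical_set_scope.
Local Open Scope ring_scope.
Local Open Scope complex_scope.
Local Notation Re := complex.Re.
Local Notation Im := complex.Im.

(** * Matrix norm and exponential *)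

(** Smoothness of the group law enters through one estimate: in a chart around 1 the product of u
    and w is u + w up to C|u||w|. With the continuity of [rho] it yields the differential D of [rho]
    at 1; from then on the arguments are about matrices. The exponential is the limit of (1 +
    A/2^k)^(2^k) because values of [rho] near 1 can replace the base, which places exp (D u) in rho
    G. No invariant hermitian form is built: bounded one-parameter groups already have
    diagonalisable generators with imaginary eigenvalues. A direction commuting with the torus need
    not generate a closed circle, whereas maximality of a torus only speaks of tori; a recurrence
    argument closes the circle. An isomorphism of root systems is merely linear, so Cartan numbers
    and lengths must be transferred without an isometry. The multiplicity k of the weight 0 solves k
    (r + N) = m s (4 / K) with m = k + s, where N and s count the roots and the short roots and K
    sums the squared Cartan numbers of the short roots against a fixed one. *)

Section Norm.
Variable R : realType.
Implicit Types m n p : nat.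

(** The operator norm for the supremum norm on columns: it is submultiplicative and at most 1 at the
    identity, which is what estimates on powers require. The default 0 covers matrices without
    rows. *)
Definition nrm m n (A : 'M[R[i]]_(m, n)) : R :=
  \big[Num.max/0]_i \sum_j normc (A i j).

Lemma normc_ge0 (z : R[i]) : 0 <= normc z.
Proof. by case: z => a b /=; rewrite sqrtr_ge0. Qed.

Lemma normcR (x : R) : normc x%:C = `|x|.
Proof. by rewrite /normc /= expr0n /= addr0 sqrtr_sqr. Qed.

Lemma nrm_leP m n (A : 'M[R[i]]_(m, n)) (c : R) : 0 <= c ->
  (forall i, \sum_j normc (A i j) <= c) -> nrm A <= c.
Proof. by move=> c0 h; apply: bigmax_le. Qed.

Lemma nrm_row m n (A : 'M[R[i]]_(m, n)) i : \sum_j normc (A i j) <= nrm A.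
Proof. by apply: le_bigmax. Qed.

Lemma nrm_ge0 m n (A : 'M[R[i]]_(m, n)) : 0 <= nrm A.
Proof. exact: bigmax_ge_id. Qed.

Lemma nrm_entry m n (A : 'M[R[i]]_(m, n)) i j : normc (A i j) <= nrm A.
Proof.
apply: le_trans (nrm_row A i); rewrite (bigD1 j) //= lerDl.
by apply: sumr_ge0 => k _; apply: normc_ge0.
Qed.

Lemma nrmD m n (A B : 'M[R[i]]_(m, n)) : nrm (A + B) <= nrm A + nrm B.
Proof.
apply: nrm_leP => [|i]; first by rewrite addr_ge0 ?nrm_ge0.
apply: le_trans (lerD (nrm_row A i) (nrm_row B i)).
rewrite -big_split; apply: ler_sum => j _; rewrite mxE; exact: le_normcD.
Qed.

Lemma nrm0 m n : nrm (0 : 'M[R[i]]_(m, n)) = 0.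
Proof.
apply/eqP; rewrite eq_le nrm_ge0 andbT; apply: nrm_leP => // i.
by rewrite big1 // => j _; rewrite mxE normc0.
Qed.

Lemma nrm_eq0 m n (A : 'M[R[i]]_(m, n)) : nrm A = 0 -> A = 0.
Proof.
move=> A0; apply/matrixP => i j; rewrite mxE; apply: eq0_normc.
by apply/eqP; rewrite eq_le normc_ge0 andbT -A0 nrm_entry.
Qed.

Lemma nrmZ m n (c : R[i]) (A : 'M[R[i]]_(m, n)) :
  nrm (c *: A) = normc c * nrm A.
Proof.
have h i : \sum_j normc ((c *: A) i j) = normc c * \sum_j normc (A i j).
  by rewrite mulr_sumr; apply: eq_bigr => j _; rewrite mxE normcM.
rewrite /nrm (big_morph (fun x => normc c * x) (id1 := 0) (op1 := Num.max)).
- by apply: eq_bigr => i _; rewrite h.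
- by move=> x y; rewrite maxr_pMr // normc_ge0.
- by rewrite mulr0.
Qed.

Lemma nrmZR m n (c : R) (A : 'M[R[i]]_(m, n)) :
  nrm (c%:C *: A) = `|c| * nrm A.
Proof. by rewrite nrmZ normcR. Qed.

Lemma nrmN m n (A : 'M[R[i]]_(m, n)) : nrm (- A) = nrm A.
Proof. by rewrite -scaleN1r nrmZ normcN normc1 mul1r. Qed.

Lemma nrm_subC m n (A B : 'M[R[i]]_(m, n)) : nrm (A - B) = nrm (B - A).
Proof. by rewrite -nrmN opprB. Qed.

Lemma nrmB m n (A B : 'M[R[i]]_(m, n)) : nrm (A - B) <= nrm A + nrm B.
Proof. by rewrite -(nrmN B) nrmD. Qed.

Lemma nrm_tri m n (B A C : 'M[R[i]]_(m, n)) :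
  nrm (A - C) <= nrm (A - B) + nrm (B - C).
Proof. by rewrite -[A - C](subrKA B) nrmD. Qed.

Lemma nrm_subl m n (A B : 'M[R[i]]_(m, n)) : nrm A <= nrm (A - B) + nrm B.
Proof. by rewrite -{1}(subrK B A) nrmD. Qed.

Lemma normc_sum (I : Type) (s : seq I) (P : pred I) (f : I -> R[i]) :
  normc (\sum_(k <- s | P k) f k) <= \sum_(k <- s | P k) normc (f k).
Proof.
elim/big_ind2: _ => [|x1 x2 y1 y2 h1 h2|//]; first by rewrite normc0.
exact: le_trans (le_normcD _ _) (lerD h1 h2).
Qed.

Lemma nrm_sum m n (I : Type) (s : seq I) (P : pred I) (f : I -> 'M[R[i]]_(m, n)) :
  nrm (\sum_(k <- s | P k) f k) <= \sum_(k <- s | P k) nrm (f k).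
Proof.
elim/big_ind2: _ => [|x1 x2 y1 y2 h1 h2|//]; first by rewrite nrm0.
exact: le_trans (nrmD _ _) (lerD h1 h2).
Qed.

Lemma nrm_mulmx m n p (A : 'M[R[i]]_(m, n)) (B : 'M[R[i]]_(n, p)) :
  nrm (A *m B) <= nrm A * nrm B.
Proof.
apply: nrm_leP => [|i]; first by rewrite mulr_ge0 ?nrm_ge0.
have -> : \sum_j normc ((A *m B) i j) = \sum_j normc (\sum_k A i k * B k j).
  by apply: eq_bigr => j _; rewrite mxE.
apply: (@le_trans _ _ (\sum_k normc (A i k) * \sum_j normc (B k j))).
  under [X in _ <= X]eq_bigr => k _ do rewrite mulr_sumr.
  rewrite exchange_big /=; apply: ler_sum => j _.
  apply: le_trans (normc_sum _ _ _) _.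
  by apply: ler_sum => k _; rewrite normcM.
apply: (@le_trans _ _ (\sum_k normc (A i k) * nrm B)).
  by apply: ler_sum => k _; rewrite ler_wpM2l ?normc_ge0 // nrm_row.
by rewrite -mulr_suml ler_wpM2r ?nrm_ge0 // nrm_row.
Qed.

Lemma nrmM n (A B : 'M[R[i]]_n) : nrm (A * B) <= nrm A * nrm B.
Proof. exact: nrm_mulmx. Qed.

Lemma nrm1 n : nrm (1 : 'M[R[i]]_n) <= 1.
Proof.
apply: nrm_leP => // i; rewrite (bigD1 i) //= big1 => [|j ji].
  by rewrite mxE eqxx normc1 addr0.
by rewrite mxE eq_sym (negbTE ji) normc0.
Qed.

Lemma nrmX n (A : 'M[R[i]]_n) k : nrm (A ^+ k) <= nrm A ^+ k.
Proof.
elim: k => [|k IH]; first by rewrite !expr0 nrm1.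
rewrite !exprS; apply: le_trans (nrmM _ _) _.
by rewrite ler_wpM2l ?nrm_ge0.
Qed.

Lemma nrm_tr n (A : 'M[R[i]]_n) : normc (\tr A) <= n%:R * nrm A.
Proof.
apply: le_trans (normc_sum _ _ _) _.
apply: (@le_trans _ _ (\sum_(i < n) nrm A)).
  by apply: ler_sum => i _; apply: nrm_entry.
by rewrite sumr_const card_ord mulr_natl.
Qed.

Lemma Re_le_normc (z : R[i]) : `|Re z| <= normc z.
Proof.
case: z => a b /=; rewrite -sqrtr_sqr ler_wsqrtr // lerDl; exact: sqr_ge0.
Qed.

Lemma Im_le_normc (z : R[i]) : `|Im z| <= normc z.
Proof.
case: z => a b /=; rewrite -sqrtr_sqr ler_wsqrtr // lerDr; exact: sqr_ge0.
Qed.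

Lemma normc_le_ReIm (z : R[i]) : normc z <= `|Re z| + `|Im z|.
Proof.
case: z => a b /=; rewrite -(ler_pXn2r (n := 2)) ?nnegrE ?sqrtr_ge0 ?addr_ge0 //.
rewrite sqr_sqrtr ?addr_ge0 ?sqr_ge0 // sqrrD !real_normK ?num_real //.
by rewrite addrAC lerDl mulrn_wge0 // mulr_ge0.
Qed.

(** The sequences u_k - 2c/2^k and u_k + 2c/2^k are increasing and decreasing respectively and
    enclose each other, so the supremum of the first is a limit with an explicit rate. *)
Lemma geo_real (u : nat -> R) (c : R) :
  (forall k, `|u k.+1 - u k| <= c / 2 ^+ k) ->
  exists l, forall k, `|u k - l| <= 2 * c / 2 ^+ k.
Proof.
move=> h.
have p k : 0 < 2 ^+ k :> R by rewrite exprn_gt0.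
have step k : c / 2 ^+ k = 2 * c / 2 ^+ k - 2 * c / 2 ^+ k.+1.
  by rewrite exprS; field; rewrite lt0r_neq0 // p.
pose v k := u k - 2 * c / 2 ^+ k; pose w k := u k + 2 * c / 2 ^+ k.
have vS k : v k <= v k.+1.
  by have := h k; rewrite /v ler_norml => /andP[]; have := step k; lra.
have wS k : w k.+1 <= w k.
  by have := h k; rewrite /w ler_norml => /andP[]; have := step k; lra.
have vw k : v k <= w k.
  have c0 : 0 <= c by have := h 0%N; rewrite expr0 divr1; apply: le_trans.
  have : 0 <= 2 * c / 2 ^+ k by rewrite divr_ge0 ?mulr_ge0 // ltW.
  by rewrite /v /w; lra.
have vm k j : v k <= v (k + j)%N.
  by elim: j => [|j IH]; rewrite ?addn0 // addnS (le_trans IH).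
have wm k j : w (k + j)%N <= w k.
  by elim: j => [|j IH]; rewrite ?addn0 // addnS (le_trans _ IH).
have vwkj k j : v k <= w j.
  by apply: le_trans (vm k j) _; apply: le_trans (vw _) _; rewrite addnC wm.
exists (sup (range v)) => k.
have hs : has_sup (range v).
  by split; [exists (v 0%N); exists 0%N | exists (w 0%N) => _ [j _ <-]].
have h1 : v k <= sup (range v) by case: hs => _ ub; apply: ub_le_sup => //; exists k.
have h2 : sup (range v) <= w k.
  by case: hs => ne _; apply: ge_sup => // _ [j _ <-].
by rewrite ler_norml; move: h1 h2; rewrite /v /w; lra.
Qed.

(** Real and imaginary parts of an entry contribute 2c each, and a row has n entries: hence the
    factors 4 and n. *)
Lemma geo_mx m n (u : nat -> 'M[R[i]]_(m, n)) (c : R) :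
  (forall k, nrm (u k.+1 - u k) <= c / 2 ^+ k) ->
  exists l : 'M[R[i]]_(m, n), forall k, nrm (u k - l) <= n%:R * (4 * c) / 2 ^+ k.
Proof.
move=> h.
have hr i j k : `|Re (u k.+1 i j) - Re (u k i j)| <= c / 2 ^+ k.
  apply: le_trans (h k); apply: le_trans (nrm_entry _ i j).
  by rewrite !mxE -raddfB; apply: Re_le_normc.
have hi i j k : `|Im (u k.+1 i j) - Im (u k i j)| <= c / 2 ^+ k.
  apply: le_trans (h k); apply: le_trans (nrm_entry _ i j).
  by rewrite !mxE -raddfB; apply: Im_le_normc.
have c0 : 0 <= c by have := h 0%N; rewrite expr0 divr1; apply: le_trans; apply: nrm_ge0.
have /choice [a ha] : forall ij : 'I_m * 'I_n, exists l, forall k, `|Re (u k ij.1 ij.2) - l| <= 2 * c / 2 ^+ k.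
  by move=> ij; apply: geo_real => k; apply: hr.
have /choice [b hb] : forall ij : 'I_m * 'I_n, exists l, forall k, `|Im (u k ij.1 ij.2) - l| <= 2 * c / 2 ^+ k.
  by move=> ij; apply: geo_real => k; apply: hi.
exists (\matrix_(i, j) (a (i, j) +i* b (i, j))) => k.
apply: nrm_leP => [|i]; first by rewrite divr_ge0 ?mulr_ge0 ?exprn_ge0.
apply: (@le_trans _ _ (\sum_(j < n) (4 * c / 2 ^+ k))); last first.
  by rewrite sumr_const card_ord -[leLHS]mulr_natl -!mulrA.
apply: ler_sum => j _; apply: le_trans (normc_le_ReIm _) _.
rewrite !mxE; have := ha (i, j) k; have := hb (i, j) k; case: (u k i j) => x y /=.
by move: (2 ^+ k) => z; lra.
Qed.

End Norm.

Ltac nrmgen := repeat match goal with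
  | |- context [@nrm ?R ?m ?n ?A] => generalize (@nrm R m n A); intro
  end.

(** * The matrix exponential as a limit of powers *)

Section Exp.
Variable R : realType.
Implicit Types m n p k : nat.

Lemma p2_gt0 k : 0 < 2 ^+ k :> R.
Proof. by rewrite exprn_gt0. Qed.

Lemma ler_exprn (x y : R) k : 0 <= x -> x <= y -> x ^+ k <= y ^+ k.
Proof. by move=> x0 xy; rewrite lerXn2r ?nnegrE // (le_trans x0). Qed.

Lemma geo_le0 (x K : R) : (forall k, x <= K / 2 ^+ k) -> x <= 0.
Proof.
move=> h; rewrite leNgt; apply/negP => x0.
have K0 : 0 < K by have := h 0%N; rewrite expr0 divr1; lra.
have [N hN] : exists N : nat, K / x < N%:R.
  by exists (Num.bound (K / x)); rewrite archi_boundP // divr_ge0 // ltW.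
have h2 : N%:R <= 2 ^+ N :> R by rewrite -natrX ler_nat ltnW // ltn_expl.
have := h N; rewrite ler_pdivlMr ?p2_gt0 // mulrC -ler_pdivlMr //; lra.
Qed.

(** Convergence at the rate 2^-k: the limits of matrices built below all have it, and uniqueness and
    products become arithmetic on the constants. *)
Definition cvm m n (u : nat -> 'M[R[i]]_(m, n)) L :=
  exists K, forall k, nrm (u k - L) <= K / 2 ^+ k.

Lemma cvm_unique m n (u : nat -> 'M[R[i]]_(m, n)) L L' :
  cvm u L -> cvm u L' -> L = L'.
Proof.
move=> [K h] [K' h']; apply/eqP; rewrite -subr_eq0; apply/eqP/nrm_eq0/eqP.
rewrite eq_le nrm_ge0 andbT; apply: (@geo_le0 _ (K + K')) => k.
apply: le_trans (nrm_tri (u k) _ _) _; rewrite nrm_subC mulrDl.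
by apply: lerD.
Qed.

Lemma cvm_cst m n (L : 'M[R[i]]_(m, n)) : cvm (fun=> L) L.
Proof. by exists 0 => k; rewrite subrr nrm0 mul0r. Qed.

Lemma cvmD m n (u v : nat -> 'M[R[i]]_(m, n)) L L' :
  cvm u L -> cvm v L' -> cvm (fun k => u k + v k) (L + L').
Proof.
move=> [K h] [K' h']; exists (K + K') => k; rewrite opprD addrACA mulrDl.
exact: le_trans (nrmD _ _) (lerD (h k) (h' k)).
Qed.

Lemma cvm_mul m n p (u : nat -> 'M[R[i]]_(m, n)) (v : nat -> 'M[R[i]]_(n, p)) L L' :
  cvm u L -> cvm v L' -> cvm (fun k => u k *m v k) (L *m L').
Proof.
move=> [K h] [K' h'].
have K0 : 0 <= K by have := h 0%N; rewrite expr0 divr1; apply/le_trans/nrm_ge0.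
have K0' : 0 <= K' by have := h' 0%N; rewrite expr0 divr1; apply/le_trans/nrm_ge0.
exists (nrm L * K' + K * (nrm L' + K')) => k.
have -> : u k *m v k - L *m L' = L *m (v k - L') + (u k - L) *m v k.
  by rewrite mulmxBr mulmxBl [RHS]addrC subrKA.
apply: le_trans (nrmD _ _) _; rewrite mulrDl.
apply: lerD; apply: le_trans (nrm_mulmx _ _) _.
  by rewrite -mulrA ler_wpM2l ?nrm_ge0.
rewrite mulrAC; apply: ler_pM; rewrite ?nrm_ge0 //.
have := h' k; have := nrm_subl (v k) L'.
suff : K' / 2 ^+ k <= K' by lra.
by rewrite ler_pdivrMr ?p2_gt0 // ler_peMr // exprn_ege1 // ler1n.
Qed.

Lemma eq_cvm m n (u v : nat -> 'M[R[i]]_(m, n)) L : u =1 v -> cvm u L -> cvm v L.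
Proof. by move=> uv [K h]; exists K => k; rewrite -uv. Qed.

Lemma nrm_cvm_le m n (u : nat -> 'M[R[i]]_(m, n)) L B c :
  cvm u L -> (forall k, nrm (u k - B) <= c) -> nrm (L - B) <= c.
Proof.
move=> [K h] h'; rewrite -subr_le0; apply: (@geo_le0 _ K) => k.
have := nrm_tri (u k) L B; have := h k; rewrite nrm_subC; have := h' k; lra.
Qed.

Lemma pow_bound (a : R) k : 0 <= a -> (1 + a / 2 ^+ k) ^+ (2 ^ k) <= expR a.
Proof.
move=> a0; apply: (@le_trans _ _ (expR (a / 2 ^+ k) ^+ (2 ^ k))).
  apply: ler_exprn; last exact: expR_ge1Dx.
  by rewrite addr_ge0 // divr_ge0 // ltW // p2_gt0.
by rewrite -expRM_natl natrX mulrC divfK // lt0r_neq0 // p2_gt0.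
Qed.

Section Square.
Variable n : nat.
Local Notation M := 'M[R[i]]_n.
Implicit Types (A B X Y : M).

Lemma mxsAl (c : R[i]) A B : c *: (A * B) = (c *: A) * B.
Proof. exact: scalemxAl. Qed.

Lemma mxsAr (c : R[i]) A B : c *: (A * B) = A * (c *: B).
Proof. exact: scalemxAr. Qed.

Lemma pow_diff X Y (r : R) N : 1 <= r -> nrm X <= r -> nrm Y <= r ->
  nrm (X ^+ N - Y ^+ N) <= N%:R * r ^+ N * nrm (X - Y).
Proof.
move=> r1 Xr Yr; have r0 : 0 <= r by lra.
elim: N => [|N IH]; first by rewrite !expr0 subrr nrm0 mul0r mul0r.
have -> : X ^+ N.+1 - Y ^+ N.+1 = X * (X ^+ N - Y ^+ N) + (X - Y) * Y ^+ N.
  by rewrite !exprS mulrBr mulrBl subrKA.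
apply: le_trans (nrmD _ _) _; rewrite [in leRHS]mulrSr [in leRHS]mulrDl [in leRHS]mulrDl mul1r.
apply: lerD; apply: le_trans (nrmM _ _) _.
  rewrite exprS mulrCA -!mulrA; apply: ler_pM; rewrite ?nrm_ge0 //.
  by rewrite mulrA.
rewrite mulrC ler_wpM2r ?nrm_ge0 //; apply: le_trans (nrmX _ _) _.
apply: (@le_trans _ _ (r ^+ N)); first by rewrite ler_exprn ?nrm_ge0.
by rewrite exprS ler_peMl ?exprn_ge0.
Qed.

(** An error of order 4^-k in the base changes the 2^k-th power by O(2^-k) only, so second order
    terms of the base do not affect the limit. *)
Lemma pow2_close (X Y : M) (a K : R) k : 0 <= a ->
  nrm X <= 1 + a / 2 ^+ k -> nrm Y <= 1 + a / 2 ^+ k ->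
  nrm (X - Y) <= K / (2 ^+ k) ^+ 2 ->
  nrm (X ^+ (2 ^ k) - Y ^+ (2 ^ k)) <= expR a * K / 2 ^+ k.
Proof.
move=> a0 hX hY hXY; have P := p2_gt0 k.
have r1 : 1 <= 1 + a / 2 ^+ k by rewrite lerDl divr_ge0 // ltW.
apply: le_trans (pow_diff _ r1 hX hY) _; rewrite natrX.
have h0 := pow_bound k a0.
apply: (@le_trans _ _ (2 ^+ k * expR a * (K / (2 ^+ k) ^+ 2))).
  apply: ler_pM => //; rewrite ?nrm_ge0 ?mulr_ge0 ?exprn_ge0 //; first by lra.
  by rewrite ler_wpM2l // ltW.
rewrite le_eqVlt; apply/orP; left; apply/eqP; field.
by rewrite lt0r_neq0.
Qed.

Definition pk k A : M := 1 + (2 ^- k)%:C *: A.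

Lemma nrm_pk k A : nrm (pk k A) <= 1 + nrm A / 2 ^+ k.
Proof.
apply: le_trans (nrmD _ _) _; apply: lerD; first exact: nrm1.
by rewrite nrmZR ger0_norm ?invr_ge0 ?exprn_ge0 // mulrC.
Qed.

Lemma commr_pk k A B : A * B = B * A -> GRing.comm (pk k A) B.
Proof.
move=> AB; rewrite /GRing.comm mulrDl mulrDr mul1r mulr1.
by rewrite -mxsAl -mxsAr AB.
Qed.

(** A limit of powers rather than a power series: by [expm_lim] the base may be replaced by any
    matrix with the same first order part, in particular by a value of the representation. *)
Definition expm : M -> M :=
  locked (fun A => xget 0 [set L | cvm (fun k => pk k A ^+ (2 ^ k)) L]).

(** The square of 1 + A/2^(k+1) exceeds 1 + A/2^k by A^2/4^(k+1); by [pow2_close] consecutive terms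
    then differ by O(2^-k). *)
Lemma expm_cvm A : cvm (fun k => pk k A ^+ (2 ^ k)) (expm A).
Proof.
suff [L hL] : exists L, cvm (fun k => pk k A ^+ (2 ^ k)) L.
  by rewrite /expm -lock; case: xgetP => // /(_ L); case.
set K := nrm A ^+ 2; set a := nrm A + K.
have K0 : 0 <= K by rewrite sqr_ge0.
have a0 : 0 <= a by rewrite addr_ge0 ?nrm_ge0.
have [|l hl] := @geo_mx R n n (fun k => pk k A ^+ (2 ^ k)) (expR a * K).
  move=> k; rewrite expnS exprM.
  have P := p2_gt0 k.
  have h : pk k.+1 A ^+ 2 - pk k A = ((2 ^- k.+1) ^+ 2)%:C *: A ^+ 2.
    rewrite rmorphXn /= !expr2 -scalerA mxsAr mxsAl /pk; set x := (2 ^- k.+1)%:C *: A.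
    have -> : (2 ^- k)%:C *: A = x + x.
      rewrite -scalerDl -rmorphD /=; congr (_%:C *: _).
      by rewrite exprS; field; rewrite lt0r_neq0 // p2_gt0.
    rewrite mulrDl mul1r mulrDr mulr1; move: (x * x) => y.
    by apply/matrixP => i j; rewrite !mxE; ring.
  have h2 : nrm (pk k.+1 A ^+ 2 - pk k A) <= K / (2 ^+ k) ^+ 2.
    rewrite h nrmZR mulrC ler_pM ?nrm_ge0 ?nrmX //.
    rewrite ger0_norm ?exprn_ge0 ?invr_ge0 ?exprn_ge0 // -[leRHS]exprVn.
    apply: ler_exprn; first by rewrite invr_ge0 exprn_ge0.
    by rewrite lef_pV2 ?posrE ?p2_gt0 // exprS ler_peMl ?ler1n // ltW // p2_gt0.
  apply: pow2_close => //.
    have := nrm_subl (pk k.+1 A ^+ 2) (pk k A); have := nrm_pk k A.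
    have : K / (2 ^+ k) ^+ 2 <= K / 2 ^+ k.
      rewrite ler_wpM2l // lef_pV2 ?posrE ?exprn_gt0 //.
      by rewrite -[leLHS]expr1 ler_weXn2l // exprn_ege1 // ler1n.
    by rewrite /a mulrDl; lra.
  have := nrm_pk k A; suff : nrm A / 2 ^+ k <= a / 2 ^+ k by lra.
  by apply: ler_wpM2r; rewrite ?lerDl // invr_ge0 exprn_ge0.
by exists l, (n%:R * (4 * (expR a * K))).
Qed.

(** Applied to products of two bases, to scalars of modulus 1, and to values of the representation
    near 1. *)
Lemma expm_lim (c : nat -> M) A (K : R) :
  (forall k, nrm (c k - pk k A) <= K / (2 ^+ k) ^+ 2) ->
  cvm (fun k => c k ^+ (2 ^ k)) (expm A).
Proof.
move=> h.
have K0 : 0 <= K.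
  by have := h 0%N; rewrite expr0 expr1n divr1; apply/le_trans/nrm_ge0.
have [K' hK'] := expm_cvm A; exists (expR (nrm A + K) * K + K') => k.
apply: le_trans (nrm_tri (pk k A ^+ (2 ^ k)) _ _) _; rewrite mulrDl.
apply: lerD => //; have P := p2_gt0 k; apply: pow2_close => //.
- by rewrite addr_ge0 ?nrm_ge0.
- have := nrm_subl (c k) (pk k A); have := nrm_pk k A; have := h k.
  have : K / (2 ^+ k) ^+ 2 <= K / 2 ^+ k.
    rewrite ler_wpM2l // lef_pV2 ?posrE ?exprn_gt0 //.
    by rewrite -[leLHS]expr1 ler_weXn2l // exprn_ege1 // ler1n.
  by rewrite mulrDl; lra.
- apply: le_trans (nrm_pk k A) _; rewrite lerD2l.
  by apply: ler_wpM2r; rewrite ?lerDl // invr_ge0 exprn_ge0.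
Qed.

Lemma expm_eq (c : nat -> M) A L (K : R) :
  (forall k, nrm (c k - pk k A) <= K / (2 ^+ k) ^+ 2) ->
  (forall k, c k ^+ (2 ^ k) = L) -> expm A = L.
Proof.
move=> h hL; apply: cvm_unique (expm_lim h) _.
by exists 0 => k; rewrite hL subrr nrm0 mul0r.
Qed.

Lemma expm0 : expm 0 = 1.
Proof.
apply: (@expm_eq (fun=> 1) _ _ 0) => k; last by rewrite expr1n.
by rewrite /pk scaler0 addr0 subrr nrm0 mul0r.
Qed.

(** The product of the two bases differs from the base of A + B by AB/4^k; commutation serves to
    split the power of the product. *)
Lemma expmD A B : A * B = B * A -> expm (A + B) = expm A * expm B.
Proof.
move=> AB.
have hl : cvm (fun k => (pk k A * pk k B) ^+ (2 ^ k)) (expm (A + B)).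
  apply: (@expm_lim _ _ (nrm (A * B))) => k.
  have -> : pk k A * pk k B - pk k (A + B) = ((2 ^- k) ^+ 2)%:C *: (A * B).
    rewrite rmorphXn /= expr2 -scalerA mxsAr mxsAl /pk scalerDr.
    rewrite mulrDl mul1r mulrDr mulr1; move: (_ * _) => C.
    by apply/matrixP => i j; rewrite !mxE; ring.
  rewrite nrmZR ger0_norm ?exprn_ge0 ?invr_ge0 ?exprn_ge0 // mulrC.
  by rewrite exprVn.
apply: cvm_unique hl _; have := cvm_mul (expm_cvm A) (expm_cvm B).
apply: eq_cvm => k; rewrite exprMn_comm //.
apply: commr_pk; apply: commr_sym; exact: commr_pk.
Qed.

Lemma expmN A : expm A * expm (- A) = 1.
Proof. by rewrite -expmD ?subrr ?expm0 // mulrN mulNr. Qed.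

Lemma expmNl A : expm (- A) * expm A = 1.
Proof. by rewrite -{2}(opprK A) expmN. Qed.

Lemma expmMn A N : expm (A *+ N) = expm A ^+ N.
Proof.
elim: N => [|N IH]; first by rewrite mulr0n expr0 expm0.
rewrite mulrS exprS -IH expmD //; elim: N {IH} => [|N IH]; first by rewrite mulr0n mulr0 mul0r.
by rewrite mulrS mulrDr mulrDl IH.
Qed.

Lemma nrm_expm A : nrm (expm A) <= expR (nrm A).
Proof.
rewrite -[expm A]subr0; apply: nrm_cvm_le (expm_cvm A) _ => k; rewrite subr0.
apply: le_trans (nrmX _ _) _; apply: le_trans (pow_bound k (nrm_ge0 A)).
by apply: ler_exprn; rewrite ?nrm_ge0 // nrm_pk.
Qed.

(** Passing from j to j + 1 adds (X - 1)(X^j - Y^j) and (X - Y)(Y^j - 1) to the remainder, each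
    carrying a factor x. With N = 2^k, x = a/2^k and N(X - Y) = A - B the bound stays finite as k
    grows. *)
Lemma pow_lin X Y (x : R) N : 0 <= x -> nrm (X - 1) <= x -> nrm (Y - 1) <= x ->
  nrm (X ^+ N - Y ^+ N - (X - Y) *+ N)
    <= 2 * x * N%:R ^+ 2 * (1 + x) ^+ N * nrm (X - Y).
Proof.
move=> x0 hX hY.
have r1 : 1 <= 1 + x by lra.
have hX' : nrm X <= 1 + x by have := nrm_subl X 1; have := nrm1 R n; lra.
have hY' : nrm Y <= 1 + x by have := nrm_subl Y 1; have := nrm1 R n; lra.
suff h j : (j <= N)%N -> nrm (X ^+ j - Y ^+ j - (X - Y) *+ j)
    <= j%:R * (2 * x * N%:R * (1 + x) ^+ N * nrm (X - Y)).
  apply: le_trans (h N _) _ => //; rewrite le_eqVlt; apply/orP; left.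
  by apply/eqP; rewrite expr2; ring.
elim: j => [|j IH] jN; first by rewrite !expr0 mulr0n !subrr nrm0 mul0r.
have -> : X ^+ j.+1 - Y ^+ j.+1 - (X - Y) *+ j.+1 =
  (X ^+ j - Y ^+ j - (X - Y) *+ j) + (X - 1) * (X ^+ j - Y ^+ j)
     + (X - Y) * (Y ^+ j - 1).
  rewrite !exprS mulrSr !(mulrBl, mulrBr) !(mul1r, mulr1).
  move: (X * X ^+ j) (X * Y ^+ j) (Y * Y ^+ j) (X ^+ j) (Y ^+ j) => a b c d e.
  move: ((X - Y) *+ j) => f.
  by apply/matrixP => i k; rewrite !mxE; ring.
set T := 2 * x * N%:R * (1 + x) ^+ N * nrm (X - Y).
have h1 : nrm ((X - 1) * (X ^+ j - Y ^+ j)) <= T / 2.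
  apply: le_trans (nrmM _ _) _.
  have -> : T / 2 = x * (N%:R * (1 + x) ^+ N * nrm (X - Y)) by rewrite /T; field.
  apply: ler_pM; rewrite ?nrm_ge0 //; apply: le_trans (pow_diff j r1 hX' hY') _.
  apply: ler_wpM2r; rewrite ?nrm_ge0 //.
  apply: ler_pM; rewrite ?ler_nat // ?exprn_ge0 ?addr_ge0 //; first exact: ltnW.
  by rewrite ler_weXn2l // ltnW.
have h2 : nrm ((X - Y) * (Y ^+ j - 1)) <= T / 2.
  apply: le_trans (nrmM _ _) _.
  have -> : T / 2 = nrm (X - Y) * (N%:R * (1 + x) ^+ N * x) by rewrite /T; field.
  apply: ler_wpM2l; rewrite ?nrm_ge0 // -[in leLHS](expr1n _ j).
  have r1' : nrm (1 : M) <= 1 + x by have := nrm1 R n; lra.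
  apply: le_trans (pow_diff j r1 hY' r1') _.
  apply: ler_pM; rewrite ?nrm_ge0 ?mulr_ge0 ?exprn_ge0 ?addr_ge0 //.
  apply: ler_pM; rewrite ?ler_nat // ?exprn_ge0 ?addr_ge0 //; first exact: ltnW.
  by rewrite ler_weXn2l // ltnW.
apply: le_trans (nrmD _ _) _; apply: le_trans (lerD (nrmD _ _) (lexx _)) _.
have -> : j.+1%:R * T = j%:R * T + T by rewrite -[j.+1%:R]natr1; ring.
have := IH (ltnW jN); rewrite -/T; lra.
Qed.

Lemma expm_lip A B (a : R) : nrm A <= a -> nrm B <= a ->
  nrm (expm A - expm B - (A - B)) <= 2 * a * expR a * nrm (A - B).
Proof.
move=> hA hB; have a0 : 0 <= a by apply: le_trans hA; apply: nrm_ge0.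
have hc : cvm (fun k => pk k A ^+ (2 ^ k) + (- 1%:M) *m pk k B ^+ (2 ^ k)) (expm A + (- 1%:M) *m expm B).
  by apply: cvmD (expm_cvm A) (cvm_mul (cvm_cst _) (expm_cvm B)).
have -> : expm A - expm B = expm A + (- 1%:M) *m expm B by rewrite mulNmx mul1mx.
apply: nrm_cvm_le hc _ => k; rewrite mulNmx mul1mx.
have P := p2_gt0 k.
have hx : 0 <= a / 2 ^+ k by rewrite divr_ge0 // ltW.
have hp C : nrm C <= a -> nrm (pk k C - 1) <= a / 2 ^+ k.
  move=> hC; rewrite /pk addrAC subrr add0r nrmZR ger0_norm ?invr_ge0 ?exprn_ge0 //.
  by rewrite mulrC ler_wpM2r ?invr_ge0 ?exprn_ge0.
have e : pk k A - pk k B = (2 ^- k)%:C *: (A - B).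
  by rewrite /pk opprD addrACA subrr add0r scalerBr.
have -> : A - B = (pk k A - pk k B) *+ (2 ^ k).
  rewrite e scalerMnl -rmorphMn /=.
  have -> : 2 ^- k *+ 2 ^ k = 1 :> R by rewrite -[LHS]mulr_natr natrX mulVf // lt0r_neq0.
  by rewrite rmorph1 scale1r.
apply: le_trans (pow_lin _ hx (hp _ hA) (hp _ hB)) _.
have -> : nrm ((pk k A - pk k B) *+ (2 ^ k)) = 2 ^+ k * nrm (pk k A - pk k B).
  rewrite -scaler_nat -[_%:R](rmorph_nat (real_complex R)) nrmZR.
  by rewrite natrX ger0_norm // exprn_ge0.
rewrite natrX [leRHS]mulrA; apply: ler_wpM2r; rewrite ?nrm_ge0 //.
have -> : 2 * (a / 2 ^+ k) * (2 ^+ k) ^+ 2 * (1 + a / 2 ^+ k) ^+ (2 ^ k) =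
  2 * a * 2 ^+ k * (1 + a / 2 ^+ k) ^+ (2 ^ k).
  by move: ((1 + _) ^+ _) => z; field; rewrite lt0r_neq0.
rewrite mulrAC; apply: ler_wpM2r; first by rewrite ltW.
by apply: ler_wpM2l; rewrite ?mulr_ge0 // pow_bound.
Qed.

(* Half the radius on which [expm] is a small perturbation of the identity. *)
Definition rad : R := (4 * expR 1)^-1.

Lemma rad_gt0 : 0 < rad.
Proof. by rewrite invr_gt0 mulr_gt0 // expR_gt0. Qed.

Lemma rad_le1 : rad <= 1 / 4.
Proof.
rewrite /rad mul1r lef_pV2 ?posrE ?mulr_gt0 ?expR_gt0 // ler_peMr //.
by have := @expR_ge1Dx R 1; lra.
Qed.

(** For [a <= 1] the factor 2 a e^a is at most 2 a e, that is [a / rad / 2]; at [a = rad] it equals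
    1/2, which makes the exponential a contraction away from a translation. *)
Lemma expm_lip_rad A B a : a <= 1 -> nrm A <= a -> nrm B <= a ->
  nrm (expm A - expm B - (A - B)) <= a / rad / 2 * nrm (A - B).
Proof.
move=> a1 hA hB; have a0 : 0 <= a by apply: le_trans hA; apply: nrm_ge0.
apply: le_trans (expm_lip hA hB) _; apply: ler_wpM2r; rewrite ?nrm_ge0 //.
have : expR a <= expR 1 by rewrite ler_expR.
rewrite /rad invrK -mulrA => h; have := ler_wpM2l a0 h; lra.
Qed.

Lemma expm_near A B : nrm A <= rad -> nrm B <= rad ->
  nrm (A - B) <= 2 * nrm (expm A - expm B).
Proof.
move=> hA hB; have r1 : rad <= 1 by have := rad_le1; lra.
have := expm_lip_rad r1 hA hB; rewrite divff ?lt0r_neq0 ?rad_gt0 //.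
have := nrm_subl (A - B) (expm A - expm B); rewrite (nrm_subC (A - B)); lra.
Qed.

Lemma expm_inj A B : nrm A <= rad -> nrm B <= rad -> expm A = expm B -> A = B.
Proof.
move=> hA hB e; apply/eqP; rewrite -subr_eq0; apply/eqP/nrm_eq0/eqP.
rewrite eq_le nrm_ge0 andbT; apply: le_trans (expm_near hA hB) _.
by rewrite e subrr nrm0 mulr0.
Qed.

Lemma expm1_lin A : nrm A <= 1 -> nrm (expm A - 1 - A) <= nrm A ^+ 2 / rad / 2.
Proof.
move=> hA; have := @expm_lip_rad A 0 (nrm A) hA (lexx _).
rewrite nrm0 expm0 subr0 => /(_ (nrm_ge0 _)); rewrite expr2; lra.
Qed.

(** The iteration A -> A + (h - exp A), started at 0, halves its error at each step since the
    remainder of the exponential is 1/2-Lipschitz on the ball of radius [rad]; the iterates keep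
    norm at most 2|h - 1|. *)
Lemma expm_log (h : M) : nrm (h - 1) <= rad / 2 ->
  exists2 A, nrm A <= 2 * nrm (h - 1) & expm A = h.
Proof.
move=> hh; have r1 := rad_le1; have r0 := rad_gt0.
have [e ee] : exists e, e = nrm (h - 1) by exists (nrm (h - 1)).
rewrite -ee in hh *.
have [u [u0 uS]] : exists u : nat -> M, u 0%N = 0 /\ forall j, u j.+1 = u j + (h - expm (u j)).
  by exists (fun j => iter j (fun A => A + (h - expm A)) 0).
have e0 : 0 <= e by rewrite ee nrm_ge0.
have pinv j : (2 ^+ j.+1)^-1 = (2 ^+ j)^-1 / 2 :> R.
  by rewrite exprS invfM mulrC.
have pp j : 0 < (2 ^+ j)^-1 :> R by rewrite invr_gt0 p2_gt0.
have [hu he] : (forall j, nrm (u j) <= 2 * e * (1 - (2 ^+ j)^-1)) /\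
           (forall j, nrm (h - expm (u j)) <= e / 2 ^+ j).
  suff H j : nrm (u j) <= 2 * e * (1 - (2 ^+ j)^-1) /\
             nrm (h - expm (u j)) <= e / 2 ^+ j by split => j; case: (H j).
  elim: j => [|j [IH1 IH2]]; first by rewrite u0 expr0 invr1 subrr mulr0 nrm0 expm0 mulr1 -ee.
  have h1 : nrm (u j.+1) <= 2 * e * (1 - (2 ^+ j.+1)^-1).
    rewrite uS; apply: le_trans (nrmD _ _) _; rewrite pinv; lra.
  split => //.
  have a1 : nrm (u j) <= rad.
    apply: le_trans IH1 _; have := pp j; move: (_^-1) => z z0; nra.
  have a2 : nrm (u j.+1) <= rad.
    apply: le_trans h1 _; have := pp j.+1; move: (_^-1) => z z0; nra.
  have r1' : rad <= 1 by lra.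
  have := expm_lip_rad r1' a2 a1; rewrite divff ?lt0r_neq0 // uS.
  have -> : u j + (h - expm (u j)) - u j = h - expm (u j) by rewrite addrC addKr.
  have -> : expm (u j + (h - expm (u j))) - expm (u j) - (h - expm (u j)) =
    expm (u j + (h - expm (u j))) - h by rewrite opprB addrA subrK.
  rewrite nrm_subC pinv => H; apply: le_trans H _.
  have -> : e * ((2 ^+ j)^-1 / 2) = 1 / 2 * (e / 2 ^+ j) by ring.
  by apply: ler_wpM2l.
have [|A hA] := @geo_mx R n n u e.
  by move=> k; rewrite uS addrC addKr; apply: he.
have cA : cvm u A by exists (n%:R * (4 * e)).
exists A.
  rewrite -[A]subr0; apply: nrm_cvm_le cA _ => k; rewrite subr0.
  apply: le_trans (hu k) _; have := pp k; move: (_^-1) => z z0; nra.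
have nA : nrm A <= rad.
  rewrite -[A]subr0; apply: nrm_cvm_le cA _ => k; rewrite subr0.
  apply: le_trans (hu k) _; have := pp k; move: (_^-1) => z z0; nra.
apply/eqP; rewrite -subr_eq0; apply/eqP/nrm_eq0/eqP.
rewrite eq_le nrm_ge0 andbT; apply: (@geo_le0 _ (2 * (n%:R * (4 * e)) + e)) => k.
have -> : (2 * (n%:R * (4 * e)) + e) / 2 ^+ k = 2 * (n%:R * (4 * e) / 2 ^+ k) + e / 2 ^+ k by ring.
apply: le_trans (nrm_tri (expm (u k)) _ _) _.
have a1 : nrm (u k) <= rad.
  apply: le_trans (hu k) _; have := pp k; move: (_^-1) => z z0; nra.
have r1' : rad <= 1 by lra.
have := expm_lip_rad r1' a1 nA; rewrite divff ?lt0r_neq0 //.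
have := nrm_subl (expm (u k) - expm A) (u k - A); have := hA k; have := he k.
have := nrm_ge0 (u k - A); rewrite (nrm_subC (expm A)) (nrm_subC (expm (u k)) h).
move: (n%:R * _ / _) (e / _) => a b; nrmgen; clear; lra.
Qed.

End Square.

(** Since V may be rectangular, this covers conjugation, eigenvectors and invariant subspaces at
    once. *)
Lemma expm_intertwine n p (A : 'M[R[i]]_n) (B : 'M[R[i]]_p) V :
  A *m V = V *m B -> expm A *m V = V *m expm B.
Proof.
move=> AB.
have h k : pk k A *m V = V *m pk k B.
  by rewrite mulmxDl mulmxDr mul1mx mulmx1 -scalemxAl -scalemxAr AB.
have hN k N : pk k A ^+ N *m V = V *m pk k B ^+ N.
  elim: N => [|N IH]; first by rewrite !expr0 mul1mx mulmx1.
  by rewrite exprS exprS -!mulmxE -mulmxA IH !mulmxA h.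
apply: cvm_unique (cvm_mul (expm_cvm A) (cvm_cst V)) _.
by apply: eq_cvm (cvm_mul (cvm_cst V) (expm_cvm B)) => k; rewrite hN.
Qed.

Definition cis (t : R) : R[i] := cos t +i* sin t.

Lemma cisD s t : cis (s + t) = cis s * cis t.
Proof. by rewrite /cis cosD sinD; simpc; congr (_ +i* _); ring. Qed.

Lemma cis0 : cis 0 = 1.
Proof. by rewrite /cis cos0 sin0. Qed.

Lemma cisMn t N : cis (t *+ N) = cis t ^+ N.
Proof.
by elim: N => [|N IH]; rewrite ?mulr0n ?cis0 // mulrS cisD IH exprS.
Qed.

Lemma normc_cis t : normc (cis t) = 1.
Proof. by rewrite /= cos2Dsin2 sqrtr1. Qed.

Lemma mvt0 (f df : R -> R) (x : R) : (forall y, is_derive y (1 : R) f (df y)) ->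
  exists2 c, `|c| <= `|x| & f x - f 0 = df c * x.
Proof.
move=> h.
have cf a b : {within `[a, b], continuous f}.
  apply: continuous_subspaceT => y; apply/differentiable_continuous/derivable1_diffP.
  by have [] := h y.
have [x0|x0] := leP 0 x.
  have [c] := @MVT_segment R f df 0 x x0 (fun y _ => h y) (cf _ _).
  rewrite in_itv /= => /andP[c0 cx] ->; exists c; last by rewrite subr0.
  by rewrite !ger0_norm.
have [c] := @MVT_segment R f df x 0 (ltW x0) (fun y _ => h y) (cf _ _).
rewrite in_itv /= => /andP[c0 cx] hc; exists c.
  by rewrite !ler0_norm ?lerN2 // ltW.
by rewrite -opprB hc sub0r mulrN opprK.
Qed.

Lemma sin_le (x : R) : `|sin x| <= `|x|.
Proof.
have [c _] := mvt0 x (fun y => is_derive_sin y); rewrite sin0 subr0 => ->.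
by rewrite normrM ler_piMl // cos_max.
Qed.

Lemma cos_le (x : R) : `|cos x - 1| <= `|x| /\ `|cos x - 1| <= x ^+ 2.
Proof.
have [c cx] := mvt0 x (fun y => is_derive_cos y); rewrite cos0 => ->.
rewrite normrM normrN; split; first by rewrite ler_piMl // sin_max.
rewrite -real_normK ?num_real // expr2 ler_wpM2r //.
exact: le_trans (sin_le c) cx.
Qed.

Lemma sin_lin (x : R) : `|sin x - x| <= x ^+ 2.
Proof.
have hd y : is_derive y (1 : R) (fun z : R => sin z - z) (cos y - 1).
  by apply: is_deriveB.
have [c cx] := mvt0 x hd; rewrite sin0 subr0 subr0 => ->.
rewrite normrM -[leRHS]real_normK ?num_real // expr2 ler_wpM2r //.
exact: le_trans (cos_le c).1 cx.
Qed.

Lemma cis_lin (x : R) : normc (cis x - (1 + (0 +i* x))) <= 2 * x ^+ 2.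
Proof.
apply: le_trans (normc_le_ReIm _) _; rewrite /cis; simpc => /=.
by have := (cos_le x).2; have := sin_lin x; lra.
Qed.

Lemma nrm_scalar n (z : R[i]) : nrm (z%:M : 'M[R[i]]_n) <= normc z.
Proof. by rewrite -scalemx1 nrmZ ler_piMr ?normc_ge0 ?nrm1. Qed.

Lemma scalar_mxX n (z : R[i]) N : (z%:M : 'M[R[i]]_n) ^+ N = (z ^+ N)%:M.
Proof.
elim: N => [|N IH]; first by rewrite !expr0.
by rewrite !exprS IH -mulmxE -scalar_mxM.
Qed.

(** The bases cis (t/2^k) agree with 1 + it/2^k to second order, and their 2^k-th powers are
    constantly cis t. *)
Lemma expm_cis n (t : R) : expm ((0 +i* t)%:M : 'M[R[i]]_n) = (cis t)%:M.
Proof.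
apply: (@expm_eq n (fun k => (cis (t / 2 ^+ k))%:M) (0 +i* t)%:M (cis t)%:M (2 * t ^+ 2)) => k.
  have -> : pk k (0 +i* t)%:M = (1 + (0 +i* (t / 2 ^+ k)))%:M :> 'M[R[i]]_n.
    rewrite /pk raddfD /=; congr (_ + _); rewrite scale_scalar_mx; congr (_%:M).
    by rewrite /real_complex_def; simpc; congr (_ +i* _); rewrite mulrC.
  rewrite -raddfB; apply: le_trans (nrm_scalar _ _) _.
  by apply: le_trans (cis_lin _) _; rewrite expr_div_n mulrA.
rewrite scalar_mxX -cisMn; congr ((cis _)%:M).
by rewrite -[LHS]mulr_natr natrX divfK // lt0r_neq0 // p2_gt0.
Qed.

End Exp.

(** * Second order estimates in charts *)

Lemma subr4AC (V : zmodType) (a b c d : V) : a - b - (c - d) = a - c - (b - d).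
Proof. by rewrite !opprD !opprK addrACA. Qed.

Section Smooth.
Variable R : realType.

Lemma line_deriv p q (f : 'rV[R]_p -> 'rV[R]_q) (x v : 'rV[R]_p) (t : R) j :
  derivable f (x + t *: v) v ->
  is_derive t (1 : R) (fun s : R => f (x + s *: v) 0 j) ('D_v f (x + t *: v) 0 j).
Proof.
move=> df.
have e : (fun h : R => h^-1 *: (f (x + (h *: (1 : R) + t) *: v) 0 j - f (x + t *: v) 0 j)) =
   (fun A : 'rV[R]_q => A 0 j) \o (fun h : R => h^-1 *: (f (h *: v + (x + t *: v)) - f (x + t *: v))).
  apply/funext => h /=; rewrite !mxE; congr (_ *: (f _ 0 j - _)).
  by rewrite scalerDl [h *: (1 : R)]mulr1 addrCA.
have c : (fun h : R => h^-1 *: (f (x + (h *: (1 : R) + t) *: v) 0 j - f (x + t *: v) 0 j)) @ 0^' -->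
     ('D_v f (x + t *: v) 0 j).
  rewrite e; apply: continuous_cvg; last exact: df.
  exact: coord_continuous.
split; first by apply/cvg_ex; eexists; exact: c.
exact: cvg_lim c.
Qed.

Lemma mvt_between (f df : R -> R) (s K : R) :
  (forall t, `|t| <= `|s| -> is_derive t (1 : R) f (df t) /\ `|df t| <= K) ->
  `|f s - f 0| <= K * `|s|.
Proof.
move=> h.
have hd t : `|t| <= `|s| -> is_derive t (1 : R) f (df t) by case/h.
have hc t : `|t| <= `|s| -> {for t, continuous f}.
  by move=> /hd [d _]; apply/differentiable_continuous/derivable1_diffP.
have cw a b : (forall t, t \in `[a, b] -> `|t| <= `|s|) -> {within `[a, b], continuous f}.
  move=> hab; apply: continuous_in_subspaceT => t; rewrite inE /= => tab.
  by apply: hc; apply: hab.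
have [s0|s0] := leP 0 s.
  have ab t : t \in `[0, s] -> `|t| <= `|s|.
    by rewrite in_itv /= => /andP[t0 ts]; rewrite !ger0_norm.
  have ab' t : t \in `]0, s[ -> `|t| <= `|s|.
    by move=> /subset_itv_oo_cc; apply: ab.
  have [c /ab /h [_ hK] e] := @MVT_segment R f df 0 s s0 (fun t ht => hd t (ab' t ht)) (cw _ _ ab).
  by rewrite e subr0 normrM ler_wpM2r.
have ab t : t \in `[s, 0] -> `|t| <= `|s|.
  by rewrite in_itv /= => /andP[t0 ts]; rewrite !ler0_norm ?lerN2 // ltW.
have ab' t : t \in `]s, 0[ -> `|t| <= `|s|.
  by move=> /subset_itv_oo_cc; apply: ab.
have [c /ab /h [_ hK] e] := @MVT_segment R f df s 0 (ltW s0) (fun t ht => hd t (ab' t ht)) (cw _ _ ab).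
by rewrite distrC e sub0r normrM normrN ler_wpM2r.
Qed.

Lemma mxnorm_le p q (A : 'M[R]_(p, q)) (c : R) : 0 <= c ->
  (forall i j, `|A i j| <= c) -> `|A| <= c.
Proof.
by move=> c0 h; rewrite [leLHS]/Num.norm /= mx_normrE; apply: bigmax_le.
Qed.

Lemma mxnorm_entry p q (A : 'M[R]_(p, q)) i j : `|A i j| <= `|A|.
Proof.
rewrite [leRHS]/Num.norm /= mx_normrE.
by apply: (le_bigmax _ (fun ij : 'I_p * 'I_q => `|A ij.1 ij.2|) (i, j)).
Qed.

Lemma line_bound p q (f : 'rV[R]_p -> 'rV[R]_q) (x v : 'rV[R]_p) (s K : R) :
  (forall t, `|t| <= `|s| -> derivable f (x + t *: v) v /\
                             `|'D_v f (x + t *: v)| <= K) ->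
  `|f (x + s *: v) - f x| <= K * `|s|.
Proof.
move=> h.
have K0 : 0 <= K by have [|_] := h 0; rewrite ?normr0 //; apply: le_trans.
apply: mxnorm_le => [|i j]; first by rewrite mulr_ge0.
rewrite ord1 !mxE.
have := @mvt_between (fun t => f (x + t *: v) 0 j) (fun t => 'D_v f (x + t *: v) 0 j) s K.
rewrite scale0r addr0; apply => t /h [d dK]; split; first exact: line_deriv.
by apply: le_trans dK; apply: mxnorm_entry.
Qed.

(** Coordinates are changed one at a time; the intermediate points remain in the ball because the
    norm is the maximum of the coordinates. Working along axes is imposed by [class_C], which
    controls one direction at a time. *)
Lemma axis_lip d q (h : 'rV[R]_d -> 'rV[R]_q) (e K : R) :
  (forall x i (s : R), `|x| <= e -> `|x + s *: delta_mx 0 i| <= e ->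
     `|h (x + s *: delta_mx 0 i) - h x| <= K * `|s|) ->
  0 <= K -> forall u w, `|u| <= e -> `|w| <= e ->
    `|h u - h w| <= d%:R * K * `|u - w|.
Proof.
move=> H K0 u w hu hw; have e0 : 0 <= e by apply: le_trans hu.
pose v k : 'rV[R]_d := \row_j (if (j < k)%N then u 0 j else w 0 j).
have hv k : `|v k| <= e.
  apply: mxnorm_le => // i j; rewrite mxE; case: ifP => _.
    by apply: le_trans hu; apply: mxnorm_entry.
  by apply: le_trans hw; apply: mxnorm_entry.
suff S k : (k <= d)%N -> `|h (v k) - h w| <= k%:R * K * `|u - w|.
  have := S d (leqnn _); congr (`|h _ - _| <= _).
  by apply/rowP => j; rewrite mxE ltn_ord.
elim: k => [|k IH] kd.
  have -> : v 0%N = w by apply/rowP => j; rewrite mxE.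
  by rewrite subrr normr0 mul0r mul0r.
have -> : k.+1%:R * K * `|u - w| = K * `|u - w| + k%:R * K * `|u - w|.
  by rewrite -[k.+1%:R]natr1; ring.
rewrite -[h _ - h w](subrKA (h (v k))); apply: le_trans (ler_normD _ _) _.
apply: lerD; last by apply: IH; apply: ltnW.
pose i := Ordinal kd.
have e1 : v k.+1 = v k + (u 0 i - w 0 i) *: delta_mx 0 i.
  apply/rowP => j; rewrite !mxE eqxx /=; have [->|ji] := eqVneq j i.
    by rewrite /= ltnn ltnSn mulr1 addrC subrK.
  rewrite mulr0 addr0 ltnS leq_eqVlt.
  suff -> : (val j == k) = false by [].
  by apply/negP => /eqP jk; move/negP: ji; apply; apply/eqP/val_inj.
rewrite e1; apply: le_trans (H _ _ _ _ _) _ => //; first by rewrite -e1.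
by apply: ler_wpM2l => //; have := mxnorm_entry (u - w) 0 i; rewrite !mxE.
Qed.

Lemma near_norm d (P : set 'rV[R]_d) (x : 'rV[R]_d) :
  nbhs x P <-> exists2 e : R, 0 < e & forall u, `|u| <= e -> P (x + u).
Proof.
split.
  move=> /nbhs_normP [e /= e0 h]; exists (e / 2); first by rewrite divr_gt0.
  move=> u hu; apply: h => /=; rewrite opprD addNKr normrN.
  by apply: le_lt_trans hu _; rewrite ltr_pdivrMr // ltr_pMr // ltr1n.
case=> e e0 h; apply: filterS (nbhsx_ballx x e e0) => y.
rewrite -ball_normE /= => hy.
have -> : y = x + (y - x) by rewrite addrC subrK.
by apply: h; rewrite distrC ltW.
Qed.

Lemma row_mx_norm d (u w : 'rV[R]_d) (e : R) : 0 <= e -> `|u| <= e -> `|w| <= e ->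
  `|row_mx u w| <= e.
Proof.
move=> e0 hu hw; apply: mxnorm_le => // i j; rewrite mxE; case: splitP => k _.
  by apply: le_trans hu; apply: mxnorm_entry.
by apply: le_trans hw; apply: mxnorm_entry.
Qed.

(** The second derivatives along one axis of each block are continuous, hence bounded near x; the
    mean value inequality is applied once in each block, which produces the two factors |u| and
    |w|. *)
Lemma mixed_diff d q (U : set 'rV[R]_(d + d)) (g : 'rV[R]_(d + d) -> 'rV[R]_q)
  (x : 'rV[R]_(d + d)) :
  class_C 2 U g -> nbhs x U ->
  exists2 e : R, 0 < e & exists2 C : R, 0 <= C & forall u w : 'rV[R]_d,
    `|u| <= e -> `|w| <= e ->
    `|g (x + row_mx u w) - g (x + row_mx u 0) - g (x + row_mx 0 w) + g x|
      <= C * `|u| * `|w|.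
Proof.
move=> [_ gC] Ux.
pose a i : 'rV[R]_(d + d) := row_mx (delta_mx 0 i) 0.
pose b i : 'rV[R]_(d + d) := row_mx 0 (delta_mx 0 i).
pose D2 (ik : 'I_d * 'I_d) := 'D_(b ik.2) (fun y => 'D_(a ik.1) g y).
have Ux0 : U x by apply: nbhs_singleton.
have d2c ik : \forall y \near x, `|D2 ik y| <= `|D2 ik x| + 1.
  have [_ [_ h]] := gC (a ik.1); have [_ [hc _]] := h (b ik.2).
  have := hc x Ux0; rewrite -/(D2 ik) => {}hc.
  have /cvgrPdist_lt /(_ 1 ltr01) : (D2 ik) @ x --> D2 ik x by exact: hc.
  apply: filterS => y hy; rewrite -[D2 ik y](subKr (D2 ik x)).
  by apply: le_trans (ler_normB _ _) _; rewrite lerD2l ltW.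
have /near_norm [e0 e00 h0] : \forall y \near x, U y /\ forall ik, `|D2 ik y| <= `|D2 ik x| + 1.
  apply: filterI => //.
  exact: (@filter_forall _ _ (fun ik => [set y | `|D2 ik y| <= `|D2 ik x| + 1]) (nbhs x) _ d2c).
pose K : R := \sum_ik (`|D2 ik x| + 1).
have K0 : 0 <= K by apply: sumr_ge0 => ik _; rewrite addr_ge0.
have hK y ik : `|y| <= e0 -> `|D2 ik (x + y)| <= K.
  move=> /h0 [_ /(_ ik) h]; apply: le_trans h _; rewrite /K (bigD1 ik) //= lerDl.
  by apply: sumr_ge0 => k _; rewrite addr_ge0.
have hU y : `|y| <= e0 -> U (x + y) by move=> /h0 [].
(* Two points of the ball of radius [e] that differ along an axis differ by at most 2 e, so every
   point met below has norm at most 3 e < e0. *)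
pose e := e0 / 4; have e_gt0 : 0 < e by rewrite /e; lra.
have nd i : `|delta_mx 0 i : 'rV[R]_d| <= 1.
  apply: mxnorm_le => // p j; rewrite mxE; case: (_ && _); rewrite ?normr1 ?normr0 //.
exists e => //; exists (d%:R * (d%:R * K)); first by rewrite !mulr_ge0.
have step z (s : R) i : `|z| <= e -> `|z + s *: delta_mx 0 i : 'rV[R]_d| <= e -> `|s| <= 2 * e.
  move=> hz hzs; have := mxnorm_entry (z + s *: delta_mx 0 i) 0 i.
  have := mxnorm_entry z 0 i; rewrite !mxE !eqxx mulr1 => h1 h2.
  have : `|s| <= `|z 0 i + s| + `|z 0 i|.
    by rewrite -{1}(addrK (z 0 i) s) [s + _]addrC ler_normB.
  lra.
have big (z y : 'rV[R]_d) s t i k : `|z| <= e -> `|y| <= e -> `|s| <= 2 * e -> `|t| <= 2 * e ->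
    `|row_mx (z + s *: delta_mx 0 i) (y + t *: delta_mx 0 k) : 'rV[R]_(d + d)| <= e0.
  have aux (z' : 'rV[R]_d) s' i' : `|z'| <= e -> `|s'| <= 2 * e -> `|z' + s' *: delta_mx 0 i'| <= e0.
    move=> h1 h2; apply: le_trans (ler_normD _ _) _; rewrite normrZ.
    have : `|s'| * `|delta_mx 0 i' : 'rV[R]_d| <= `|s'| by rewrite ler_piMr.
    by rewrite /e in h1 h2; lra.
  by move=> *; apply: row_mx_norm; [exact: ltW| exact: aux | exact: aux].
have h1 i (s : R) (z : 'rV[R]_d) : `|z| <= e -> `|z + s *: delta_mx 0 i| <= e ->
  forall w w' : 'rV[R]_d, `|w| <= e -> `|w'| <= e ->
  `|(g (x + row_mx (z + s *: delta_mx 0 i) w) - g (x + row_mx z w)) -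
    (g (x + row_mx (z + s *: delta_mx 0 i) w') - g (x + row_mx z w'))| <= d%:R * (K * `|s|) * `|w - w'|.
  move=> hz hzs; have hs := step _ _ _ hz hzs.
  apply: (@axis_lip d q (fun w => g (x + row_mx (z + s *: delta_mx 0 i) w) - g (x + row_mx z w))); last by rewrite mulr_ge0.
  move=> y k t hy hyt; have ht := step _ _ _ hy hyt.
  (* The derivative of [phi] along [a i] is a difference of first derivatives of [g] at points
     separated by [t *: b k], to which the mean value inequality applies again. *)
  pose phi (v : 'rV[R]_(d + d)) := g (v + t *: b k) - g v.
  have -> : g (x + row_mx (z + s *: delta_mx 0 i) (y + t *: delta_mx 0 k)) -
     g (x + row_mx z (y + t *: delta_mx 0 k)) -
     (g (x + row_mx (z + s *: delta_mx 0 i) y) - g (x + row_mx z y)) =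
     phi (x + row_mx z y + s *: a i) - phi (x + row_mx z y).
    have E1 : x + row_mx z y + s *: a i = x + row_mx (z + s *: delta_mx 0 i) y.
      by rewrite /a scale_row_mx scaler0 -addrA add_row_mx addr0.
    have E2 : x + row_mx z y + t *: b k = x + row_mx z (y + t *: delta_mx 0 k).
      by rewrite /b scale_row_mx scaler0 -addrA add_row_mx addr0.
    have E3 : x + row_mx (z + s *: delta_mx 0 i) y + t *: b k =
        x + row_mx (z + s *: delta_mx 0 i) (y + t *: delta_mx 0 k).
      by rewrite /b scale_row_mx scaler0 -addrA add_row_mx addr0.
    by rewrite /phi E1 E2 E3; exact: subr4AC.
  have dga v : `|v| <= e0 -> derivable g (x + v) (a i).
    by move=> hv; have [h _] := gC (a i); apply: h; apply: hU.
  have pos1 p : `|p| <= `|s| -> `|row_mx z y + p *: a i| <= e0.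
    move=> hp; rewrite /a scale_row_mx scaler0 add_row_mx addr0.
    by have := big z y p 0 i k hz hy (le_trans hp hs); rewrite scale0r addr0; apply; rewrite normr0; lra.
  have pos2 p t' : `|p| <= `|s| -> `|t'| <= `|t| -> `|row_mx z y + p *: a i + t' *: b k| <= e0.
    move=> hp ht'; rewrite /a /b !scale_row_mx !scaler0 !add_row_mx !addr0.
    by apply: big => //; [exact: le_trans hs | exact: le_trans ht].
  have dphi p : `|p| <= `|s| ->
     is_derive (x + row_mx z y + p *: a i) (a i) phi
       ('D_(a i) g (x + row_mx z y + p *: a i + t *: b k) - 'D_(a i) g (x + row_mx z y + p *: a i)).
    move=> hp; apply: is_deriveB.
      have D1 : derivable g (x + row_mx z y + p *: a i + t *: b k) (a i).
        by rewrite -!addrA; apply: dga; rewrite !addrA; apply: pos2.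
      have e2 : (fun h : R => h^-1 *: (((fun v => g (v + t *: b k)) \o shift (x + row_mx z y + p *: a i)) (h *: a i) -
           (fun v => g (v + t *: b k)) (x + row_mx z y + p *: a i))) =
        (fun h : R => h^-1 *: ((g \o shift (x + row_mx z y + p *: a i + t *: b k)) (h *: a i) - g (x + row_mx z y + p *: a i + t *: b k))).
        by apply/funext => h0' /=; rewrite !addrA.
      by split; rewrite /derivable /derive e2.
    by apply: DeriveDef => //; rewrite -addrA; apply: dga; apply: pos1.
  have -> : K * `|s| * `|t| = (K * `|t|) * `|s| by ring.
  apply: line_bound => p hp; have [D1 D2e] := dphi p hp; split => //; rewrite D2e.
  apply: (@line_bound (d + d) q ('D_(a i) g) (x + row_mx z y + p *: a i) (b k) t K) => t' ht'.
  have hin : `|row_mx z y + p *: a i + t' *: b k| <= e0 by apply: pos2.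
  have [_ [_ h]] := gC (a i); have [h2 _] := h (b k); split.
    by apply: h2; rewrite -!addrA; apply: hU; rewrite !addrA.
  by have := hK _ (i, k) hin; rewrite /D2 /= !addrA.
move=> u w hu hw.
have n0 : `|0 : 'rV[R]_d| <= e by rewrite normr0 ltW.
have h2 : `|(g (x + row_mx u w) - g (x + row_mx u 0)) - (g (x + row_mx 0 w) - g (x + row_mx 0 0))|
    <= d%:R * (d%:R * K * `|w|) * `|u - 0|.
  apply: (@axis_lip d q (fun u => g (x + row_mx u w) - g (x + row_mx u 0)) e) => //; last by rewrite !mulr_ge0.
  move=> z i s hz hzs; have := h1 i s z hz hzs w 0 hw n0; rewrite subr0.
  have -> : d%:R * (K * `|s|) * `|w| = d%:R * K * `|w| * `|s| by ring.
  by rewrite subr4AC.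
rewrite row_mx0 addr0 subr0 opprB addrA in h2.
apply: le_trans (_ : _ <= d%:R * (d%:R * K * `|w|) * `|u|) _; last first.
  by rewrite le_eqVlt; apply/orP; left; apply/eqP; ring.
by rewrite addrAC in h2.
Qed.

End Smooth.

(** * Neighbourhoods in a topological group *)

Section TG.
Variable G : topologicalGroupType.
Implicit Types (x y g : G) (W : set G).

Lemma tg_mul x y W : nbhs (x * y)%g W ->
  exists A B : set G, [/\ nbhs x A, nbhs y B & forall a b, A a -> B b -> W (a * b)%g].
Proof.
move=> hW; have := @mulg_continuous G (x, y) W hW.
case=> -[A B] /= [hA hB] h; exists A, B; split => // a b Aa Bb.
by apply: (h (a, b)).
Qed.

Lemma tg_inv x W : nbhs (x^-1)%g W -> nbhs x (fun a => W (a^-1)%g).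
Proof. by move=> hW; apply: (@invg_continuous G x W hW). Qed.

Lemma tg_mull g x W : nbhs (g * x)%g W -> nbhs x (fun a => W (g * a)%g).
Proof.
move=> /tg_mul [A [B [hA hB h]]]; apply: filterS hB => b Bb.
by apply: h => //; apply: nbhs_singleton hA.
Qed.

Lemma tg_mulr g x W : nbhs (x * g)%g W -> nbhs x (fun a => W (a * g)%g).
Proof.
move=> /tg_mul [A [B [hA hB h]]]; apply: filterS hA => b Bb.
by apply: h => //; apply: nbhs_singleton hB.
Qed.

Lemma tg_mul1 W : nbhs (1%g : G) W ->
  exists2 A : set G, nbhs 1%g A & forall a b, A a -> A b -> W (a * b)%g.
Proof.
rewrite -{1}[1%g]mulg1 => /tg_mul [A [B [hA hB h]]]; exists (A `&` B).
  exact: filterI.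
by move=> a b [Aa _] [_ Bb]; apply: h.
Qed.

Lemma tg_div1 W : nbhs (1%g : G) W ->
  exists2 A : set G, nbhs 1%g A & forall a b, A a -> A b -> W (a^-1 * b)%g.
Proof.
move=> /tg_mul1 [A hA h]; exists (A `&` (fun a => A (a^-1)%g)).
  by apply: filterI => //; apply: tg_inv; rewrite invg1.
by move=> a b [Aa Aa'] [Ab Ab']; apply: h.
Qed.

End TG.

(** * The group law in a chart around 1 *)

Section LocalCoords.
Variables (R : realType) (G : topologicalGroupType) (d : nat).

(* [e] is a local parametrization around 1 and [k] the coordinates, with error
   bound [C] for the group law, on the ball of radius [r]. *)
Record local_coords (e : 'rV[R]_d -> G) (k : G -> 'rV[R]_d) (r C : R) : Prop := {
  lc_r : 0 < r ;
  lc_C : 0 <= C ;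
  lc_e0 : e 0 = 1%g ;
  lc_ke : forall u, `|u| <= r -> k (e u) = u ;
  lc_mul : forall u w, `|u| <= r -> `|w| <= r ->
    e (k (e u * e w)%g) = (e u * e w)%g /\
    `|k (e u * e w)%g - u - w| <= C * `|u| * `|w| ;
  lc_near : forall s, 0 < s -> \forall g \near (1%g : G), `|k g| <= s /\ e (k g) = g ;
  lc_cont : forall W : set G, nbhs 1%g W ->
    exists2 s : R, 0 < s & forall u, `|u| <= s -> W (e u) }.

Variables (L : lie_structure R G d) (c : chart R G d).
Hypotheses (ac : atlas L c) (dc : dom c 1%g).

Definition cparam (u : 'rV[R]_d) := uncoord c (coords c 1%g + u).
Definition ccoord (g : G) := coords c g - coords c 1%g.

(** As 1 is neutral, the mixed second difference of the multiplication in the chart is the product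
    minus u minus w, so [mixed_diff] is the required error bound. *)
Lemma local_coords_chart : exists r C, local_coords cparam ccoord r C.
Proof.
set u0 := coords c 1%g.
have c0 : (coords c @` dom c) u0 by exists 1%g.
have e0 : cparam 0 = 1%g by rewrite /cparam addr0 coordK.
have hcont W : nbhs (1%g : G) W -> exists2 s : R, 0 < s & forall u, `|u| <= s -> W (cparam u).
  move=> hW; apply/(@near_norm R d (fun v => W (uncoord c v)) u0).
  have h : {for u0, continuous (uncoord c)} by apply: uncoord_continuous.
  by apply: h; rewrite /u0 coordK.
have [r1 r1_gt0 hr1] : exists2 s : R, 0 < s & forall u, `|u| <= s -> (coords c @` dom c) (u0 + u).
  by apply/(@near_norm R d (coords c @` dom c) u0); apply: open_nbhs_nbhs; split => //; apply: codom_open.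
have ndom : nbhs (1%g : G) (dom c) by apply: open_nbhs_nbhs; split => //; apply: dom_open.
have [A hA hAm] := tg_mul1 ndom.
have [r2 r2_gt0 hr2] := hcont _ hA.
have hm u w : `|u| <= r2 -> `|w| <= r2 -> dom c (cparam u * cparam w)%g.
  by move=> hu hw; apply: hAm; apply: hr2.
pose g (v : 'rV[R]_(d + d)) := coords c (uncoord c (lsubmx v) * uncoord c (rsubmx v))%g.
have smooth := @mulg_smooth _ _ _ L c c c ac ac ac 2.
set U := (X in class_C _ X _) in smooth.
pose x := row_mx u0 u0.
have hU : nbhs x U.
  apply/(@near_norm R _ U x); exists (Num.min r1 r2); first by rewrite lt_min r1_gt0.
  move=> y; rewrite le_min => /andP[hy1 hy2].
  have hl : `|lsubmx y| <= `|y|.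
    by apply: mxnorm_le => // i j; rewrite mxE; apply: mxnorm_entry.
  have hr : `|rsubmx y| <= `|y|.
    by apply: mxnorm_le => // i j; rewrite mxE; apply: mxnorm_entry.
  rewrite /U /= !linearD /= !row_mxKl !row_mxKr; split.
  - by apply: hr1; apply: le_trans hy1.
  - by apply: hr1; apply: le_trans hy1.
  - by apply: hm; apply: le_trans hy2.
have [r3 r3_gt0 [C C0 hC]] := mixed_diff smooth hU.
pose r := Num.min r1 (Num.min r2 r3).
have ke u : `|u| <= r1 -> ccoord (cparam u) = u.
  move=> /hr1 [a da ea]; rewrite /ccoord /cparam -/u0 -ea coordK // ea.
  by rewrite addrC addKr.
exists r, C; split => //.
- by rewrite !lt_min r1_gt0 r2_gt0.
- by move=> u; rewrite le_min => /andP[hu _]; apply: ke.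
- move=> u w; rewrite !le_min => /and3P[hu1 hu2 hu3] /and3P[hw1 hw2 hw3]; split.
    by rewrite /cparam /ccoord -/u0 addrC subrK coordK //; apply: hm.
  have := hC u w hu3 hw3; congr (`|_| <= _).
  have gE a b : coords c (uncoord c (lsubmx (x + row_mx a b)) * uncoord c (rsubmx (x + row_mx a b)))%g =
      coords c (cparam a * cparam b)%g.
    by rewrite add_row_mx row_mxKl row_mxKr.
  have gx : coords c (uncoord c (lsubmx x) * uncoord c (rsubmx x))%g = u0.
    by rewrite row_mxKl row_mxKr /u0 coordK // mulg1.
  rewrite !gE gx e0 mulg1 mul1g.
  have e1 (a : 'rV[R]_d) : `|a| <= r1 -> coords c (cparam a) = u0 + a.
    by move=> /ke; rewrite /ccoord -/u0 => /eqP; rewrite subr_eq addrC => /eqP.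
  rewrite !e1 // /ccoord -/u0.
  by apply/rowP => i; rewrite !mxE; ring.
- move=> s s0.
  have h : {for (1%g : G), continuous (coords c)} by apply: chart_continuous.
  have h2 : nbhs u0 (fun v => `|v - u0| <= s).
    by apply/(@near_norm R d (fun v => `|v - u0| <= s) u0); exists s => // v; rewrite addrC addKr.
  apply: filterS (filterI ndom (h _ h2)) => a [da /= ha]; split=> //.
  by rewrite /cparam /ccoord -/u0 addrC subrK coordK.
Qed.

End LocalCoords.

Section Rho.
Variables (R : realType) (G : topologicalGroupType) (m : nat).
Variable rho : G -> 'M[R[i]]_m.

Lemma rho_near : continuous (rho : G -> 'M[R[i]^o]_m) -> forall g0 (e : R), 0 < e ->
  \forall g \near g0, nrm (rho g - rho g0) < e.
Proof.
move=> hc g0 e e0.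
have hij (ij : 'I_m * 'I_m) : \forall g \near g0, normc (rho g ij.1 ij.2 - rho g0 ij.1 ij.2) < e / m.+1%:R.
  have h : (fun g => (rho g ij.1 ij.2 : R[i]^o)) @ g0 --> (rho g0 ij.1 ij.2 : R[i]^o).
    apply: (@cvg_comp _ _ _ (rho : G -> 'M[R[i]^o]_m) (fun A : 'M[R[i]^o]_m => A ij.1 ij.2)).
      exact: hc.
    exact: coord_continuous.
  have e0' : 0 < (e / m.+1%:R)%:C :> R[i] by rewrite ltcR divr_gt0 // ltr0n.
  have /cvgrPdist_lt /(_ _ e0') := h; apply: filterS => g.
  by rewrite distrC normc_def ltcR; case: (_ - _).
have := @filter_forall G _ (fun ij => [set g | normc (rho g ij.1 ij.2 - rho g0 ij.1 ij.2) < e / m.+1%:R]) (nbhs g0) (nbhs_filter g0) hij.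
apply: filterS => g /= hg.
apply: (@le_lt_trans _ _ (m%:R * (e / m.+1%:R))); last first.
  by rewrite mulrCA gtr_pMr // ltr_pdivrMr ?ltr0n // mul1r ltr_nat.
apply: nrm_leP => [|i]; first by rewrite mulr_ge0 // divr_ge0 // ltW.
rewrite -[m in m%:R]card_ord mulr_natl -sumr_const; apply: ler_sum => j _.
by rewrite !mxE ltW //; apply: (hg (i, j)).
Qed.

End Rho.

(** * The differential of the representation *)

Lemma ler_norm_subD (R : realType) (V : normedModType R) (x v u : V) :
  `|x| <= `|x - v - u| + `|v + u|.
Proof.
by apply: le_trans (ler_normD _ _); rewrite -[x - v - u]addrA -opprD subrK.
Qed.

Lemma nat_floor (R : realType) (x : R) : 0 <= x ->
  exists n : nat, n%:R <= x < n.+1%:R.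
Proof.
by move=> x0; exists (Num.truncn x); apply: truncn_itv.
Qed.

Section Cvm.
Variable R : realType.

Lemma cvm_tail m n (u : nat -> 'M[R[i]]_(m, n)) L k0 (K : R) :
  (forall k, nrm (u (k0 + k)%N - L) <= K / 2 ^+ k) -> cvm u L.
Proof.
move=> h; have K0 : 0 <= K by have := h 0%N; rewrite expr0 divr1; apply/le_trans/nrm_ge0.
exists (K * 2 ^+ k0 + \sum_(j < k0) nrm (u j - L) * 2 ^+ j) => k.
rewrite ler_pdivlMr ?p2_gt0 //.
have [kk|kk] := ltnP k k0.
  apply: ler_wpDl; first by rewrite mulr_ge0 // exprn_ge0.
  rewrite (bigD1 (Ordinal kk)) //= lerDl sumr_ge0 // => j _.
  by rewrite mulr_ge0 ?nrm_ge0 ?exprn_ge0.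
apply: ler_wpDr.
  by apply: sumr_ge0 => j _; rewrite mulr_ge0 ?nrm_ge0 ?exprn_ge0.
rewrite -(subnKC kk); have := h (k - k0)%N.
rewrite ler_pdivlMr ?p2_gt0 // => h'.
by rewrite exprD mulrCA [leRHS]mulrC ler_wpM2l ?exprn_ge0.
Qed.

Lemma nrmMn m n (A : 'M[R[i]]_(m, n)) N : nrm (A *+ N) = N%:R * nrm A.
Proof.
rewrite -scaler_nat -[N%:R](rmorph_nat (real_complex R) N) nrmZR ger0_norm //.
Qed.

Lemma exists_p2 (a b : R) : 0 < b -> exists k : nat, a / 2 ^+ k <= b.
Proof.
move=> b0; have [N hN] : exists N : nat, a / b <= N%:R.
  have [ab|ab] := leP 0 (a / b); last by exists 0%N; rewrite ltW.
  by have [N /andP[_ h]] := nat_floor ab; exists N.+1; rewrite ltW.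
exists N; rewrite ler_pdivrMr ?p2_gt0 // mulrC -ler_pdivrMr //.
by apply: le_trans hN _; rewrite -natrX ler_nat ltnW // ltn_expl.
Qed.

(** With p the integer part of x = 2^k b, the defect T (b u) - b T u multiplied by 2^k is T ((x - p)
    u) - (x - p) T u, which is bounded because 0 <= x - p < 1; hence the defect is O(2^-k) for all k
    and vanishes. *)
Lemma additive_linear d m n (T : 'rV[R]_d -> 'M[R[i]]_(m, n)) (K s : R) : 0 < s ->
  (forall u w, T (u + w) = T u + T w) ->
  (forall u, `|u| <= s -> nrm (T u) <= K * `|u|) ->
  (forall (a : R) u, T (a *: u) = a%:C *: T u) /\ forall u, nrm (T u) <= K * `|u|.
Proof.
move=> s0 TD Tb.
have T0 : T 0 = 0 by apply: (addrI (T 0)); rewrite -TD !addr0.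
have TN u : T (- u) = - T u by apply: (addrI (T u)); rewrite -TD !subrr T0.
have TM u N : T (u *+ N) = T u *+ N.
  by elim: N => [|N IH]; rewrite ?mulr0n // !mulrS TD IH.
have TMr u (N : nat) : T (N%:R *: u) = (N%:R)%:C *: T u.
  by rewrite scaler_nat TM -scaler_nat rmorph_nat.
have Tb2 u : nrm (T u) <= K * `|u|.
  have [k hk] := exists_p2 `|u| s0; have P := p2_gt0 R k.
  have -> : T u = (2 ^+ k)%:C *: T ((2 ^+ k)^-1 *: u).
    by rewrite -natrX -TMr scalerA divff ?scale1r // natrX lt0r_neq0.
  rewrite nrmZR ger0_norm ?exprn_ge0 //.
  have nu : `|(2 ^+ k)^-1 *: u| = `|u| / 2 ^+ k.
    by rewrite normrZ ger0_norm ?invr_ge0 ?exprn_ge0 // mulrC.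
  have := Tb ((2 ^+ k)^-1 *: u); rewrite nu => /(_ hk) h.
  have := ler_wpM2l (ltW P) h; congr (_ <= _); field; exact: lt0r_neq0.
split=> // a u; suff H b : 0 <= b -> T (b *: u) = b%:C *: T u.
  have [a0|a0] := leP 0 a; first exact: H.
  rewrite -{1}[a]opprK scaleNr TN H ?oppr_ge0 1?ltW //.
  by rewrite rmorphN scaleNr opprK.
move=> b0; apply/eqP; rewrite -subr_eq0; apply/eqP/nrm_eq0/eqP.
rewrite eq_le nrm_ge0 andbT; apply: (@geo_le0 R _ (2 * K * `|u|)) => k.
have P := p2_gt0 R k; rewrite ler_pdivlMr //.
have x0 : 0 <= b * 2 ^+ k by rewrite mulr_ge0 // ltW.
have [p /andP[p1 p2]] := nat_floor x0.
set x := b * 2 ^+ k in x0 p1 p2 *.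
have e : (2 ^+ k)%:C *: (T (b *: u) - b%:C *: T u) =
    T ((x - p%:R) *: u) - (x - p%:R)%:C *: T u.
  rewrite scalerBr scalerA -rmorphM /= -/x -natrX -TMr scalerA natrX [_ * b]mulrC -/x.
  have -> : T (x *: u) = T ((x - p%:R) *: u) + (p%:R)%:C *: T u.
    by rewrite -TMr -TD -scalerDl subrK.
  have -> : x%:C *: T u = (x - p%:R)%:C *: T u + (p%:R)%:C *: T u.
    by rewrite -scalerDl -rmorphD /= subrK.
  by rewrite opprD addrACA subrr addr0.
have <- : nrm ((2 ^+ k)%:C *: (T (b *: u) - b%:C *: T u)) = nrm (T (b *: u) - b%:C *: T u) * 2 ^+ k.
  by rewrite nrmZR ger0_norm ?exprn_ge0 // mulrC.
rewrite e; apply: le_trans (nrmB _ _) _; rewrite nrmZR.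
have q : `|x - p%:R| <= 1 
  by rewrite ger0_norm ?subr_ge0 //; move: p2; rewrite -natr1; lra.
have h1 := Tb2 ((x - p%:R) *: u); rewrite normrZ in h1.
have Ku : 0 <= K * `|u| by apply: le_trans (Tb2 u); apply: nrm_ge0.
have h2 : `|x - p%:R| * nrm (T u) <= K * `|u|.
  apply: le_trans (Tb2 u); apply: ler_piMl => //; exact: nrm_ge0.
have h3 : K * (`|x - p%:R| * `|u|) <= K * `|u|.
  by rewrite mulrCA; apply: ler_piMl.
by rewrite -mulrA; lra.
Qed.

End Cvm.

Section Lie.
Variables (R : realType) (G : topologicalGroupType) (d m : nat).
Variables (rho : G -> 'M[R[i]]_m) (e : 'rV[R]_d -> G) (k : G -> 'rV[R]_d) (r C : R).
Hypothesis lc : local_coords e k r C.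
Hypothesis rho1 : rho 1%g = 1.
Hypothesis rhoM : forall x y, rho (x * y)%g = rho x * rho y.
Hypothesis rhoN : forall g0 (a : R), 0 < a -> \forall g \near g0, nrm (rho g - rho g0) < a.

Local Notation F := (fun u => rho (e u)).

Lemma rhoX g n : rho (g ^+ n)%g = rho g ^+ n.
Proof. by elim: n => [|n IH]; rewrite ?expg0 ?expr0 // expgS rhoM IH exprS. Qed.

Lemma F_cont0 (a : R) : 0 < a -> exists2 s : R, 0 < s & forall u, `|u| <= s -> nrm (F u - 1) <= a.
Proof.
move=> a0; have [s s0 h] := lc_cont lc (rhoN 1%g a0).
by exists s => // u /h /=; rewrite rho1 => /ltW.
Qed.

(** Powers of a small element follow the line j u up to second order. The condition [C * s <= 1]
    keeps v within twice the expected length, so that the group law estimate applies again at the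
    next step. *)
Lemma e_pow (s : R) u j : s <= r -> C * s <= 1 -> 2 * (j%:R * `|u|) <= s ->
  exists v, [/\ (e u ^+ j)%g = e v, `|v| <= 2 * (j%:R * `|u|)
                & `|v - j%:R *: u| <= C * (j%:R * `|u|) ^+ 2].
Proof.
move=> sr Cs; have C0 := lc_C lc; have r0 := lc_r lc.
have u0 : 0 <= `|u| by [].
elim: j => [|j IH] hj.
  exists 0; rewrite expg0 (lc_e0 lc) normr0 scale0r subr0 normr0 mul0r mulr0.
  by split => //; rewrite expr0n mulr0.
have j1 : j.+1%:R = j%:R + 1 :> R by rewrite -natr1.
have j0 : 0 <= j%:R :> R by [].
rewrite j1 in hj *.
have ju : 0 <= j%:R * `|u| by rewrite mulr_ge0.
have [|v [ev nv dv]] := IH; first by rewrite mulrDl in hj; lra.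
have ur : `|u| <= r by rewrite mulrDl in hj; lra.
have vr : `|v| <= r by rewrite mulrDl in hj; lra.
have [h1 h2] := lc_mul lc vr ur.
exists (k (e v * e u)%g); rewrite expgSr ev h1.
set x := k _ in h2 *; have v0 : 0 <= `|v| by [].
have Cv : C * `|v| * `|u| <= 2 * C * (j%:R * `|u|) * `|u|.
  by rewrite ler_wpM2r // -mulrA mulrCA ler_wpM2l // mulrCA [leRHS]mulrC -mulrA [_ * 2]mulrC.
have Cv2 : C * `|v| * `|u| <= `|u|.
  apply: ler_piMl => //; apply: le_trans Cs; apply: ler_wpM2l => //.
  by rewrite mulrDl in hj; lra.
split => //.
  have : `|x| <= `|x - v - u| + (`|v| + `|u|).
    apply: le_trans (lerD (lexx _) (ler_normD v u)).
    exact: ler_norm_subD.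
  lra.
have -> : x - (j%:R + 1) *: u = (x - v - u) + (v - j%:R *: u).
  by apply/rowP => i; rewrite !mxE; ring.
apply: le_trans (ler_normD _ _) _; apply: le_trans (lerD h2 dv) _.
by have := sqr_ge0 `|u|; rewrite mulrDl sqrrD; have := mulr_ge0 C0 (sqr_ge0 `|u|); nra.
Qed.

(** A continuous homomorphism is automatically Lipschitz at 1. Let A = rho (e u), with N of order
    s/|u| chosen so that A, ..., A^N stay within 1/2 of 1. The identity N(A - 1) = (A^N - 1) - (A -
    1) sum (A^i - 1) gives N|A - 1| <= 1/2 + N|A - 1|/2, so |A - 1| is O(1/N) = O(|u|). *)
Lemma F_lip0 : exists K s : R, [/\ 0 <= K, 0 < s & forall u, `|u| <= s -> nrm (F u - 1) <= K * `|u|].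
Proof.
have C0 := lc_C lc; have r0 := lc_r lc.
have h2 : 0 < 1 / 2 :> R by lra.
have [s1 s1_gt0 hs1] := F_cont0 h2.
pose s := Num.min (Num.min s1 r) (1 / (C + 1)).
have s_gt0 : 0 < s by rewrite !lt_min s1_gt0 r0 divr_gt0 //; lra.
have [ss1 sr sC] : [/\ s <= s1, s <= r & s <= 1 / (C + 1)].
  by rewrite /s !ge_min !lexx /= !orbT.
have Cs : C * s <= 1.
  apply: (@le_trans _ _ (C * (1 / (C + 1)))); first by rewrite ler_wpM2l.
  by rewrite mul1r ler_pdivrMr; lra.
exists (4 / s), (s / 2); split; [by rewrite divr_ge0 // ltW|by lra|].
move=> u hu; have [->|u0] := eqVneq u 0.
  by rewrite (lc_e0 lc) rho1 subrr nrm0 normr0 mulr0.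
have nu : 0 < `|u| by rewrite normr_gt0.
pose x := s / (2 * `|u|).
have x1 : 1 <= x by rewrite /x ler_pdivlMr; lra.
have [|N /andP[N1 N2]] := @nat_floor R x; first by lra.
have Nx : x < N%:R + 1 by rewrite natr1.
have N0 : 1 <= N%:R :> R.
  by rewrite ler1n lt0n; apply/eqP => N0; move: Nx; rewrite N0; lra.
set A := rho (e u); set a := nrm (A - 1).
have hp j : (j <= N)%N -> nrm (A ^+ j - 1) <= 1 / 2.
  move=> jN; have [|v [ev nv _]] := @e_pow s u j sr Cs.
    apply: (@le_trans _ _ (2 * (x * `|u|))).
      by rewrite ler_wpM2l // ler_wpM2r // (le_trans _ N1) // ler_nat.
    by rewrite /x le_eqVlt; apply/orP; left; apply/eqP; field; rewrite lt0r_neq0.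
  rewrite /A -rhoX ev; apply: hs1; apply: le_trans ss1; apply: le_trans nv _.
  apply: (@le_trans _ _ (2 * (x * `|u|))).
    by rewrite ler_wpM2l // ler_wpM2r // (le_trans _ N1) // ler_nat.
  by rewrite /x le_eqVlt; apply/orP; left; apply/eqP; field; rewrite lt0r_neq0.
have eN : (A - 1) *+ N = (A ^+ N - 1) - (A - 1) * \sum_(i < N) (A ^+ i - 1).
  rewrite sumrB mulrBr -subrX1 sumr_const card_ord mulrnAr mulr1.
  by rewrite subKr.
have hN : N%:R * a <= 1 / 2 + a * (N%:R / 2).
  have -> : N%:R * a = nrm ((A - 1) *+ N).
    by rewrite nrmMn.
  rewrite eN; apply: le_trans (nrmB _ _) _; apply: lerD; first exact: hp.
  apply: le_trans (nrmM _ _) _; rewrite ler_wpM2l ?nrm_ge0 //.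
  apply: le_trans (nrm_sum _ _ _) _.
  apply: (@le_trans _ _ (\sum_(i < N) (1 / 2))).
    by apply: ler_sum => i _; apply: hp; apply: ltnW.
  by rewrite sumr_const card_ord -[leLHS]mulr_natl mul1r.
have aN : a * N%:R <= 1 by move: hN; rewrite [a * (_ / _)]mulrA [N%:R * a]mulrC; lra.
have a0 : 0 <= a by apply: nrm_ge0.
have ax : a * x <= 2.
  have : a * x <= a * (N%:R + N%:R) by rewrite ler_wpM2l //; lra.
  by rewrite mulrDr; lra.
rewrite -ler_pdivrMr //; have : a * x = (a / `|u|) * (s / 2).
  by rewrite /x; field; rewrite lt0r_neq0.
move=> eax; rewrite ler_pdivlMr //; move: ax; rewrite eax mulrA ler_pdivrMr //; lra.
Qed.

(** Translation reduces to [F_lip0]: e p = e q * e w, where the group law estimate at p forces |w|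
    <= 2|p - q|. *)
Lemma F_lip : exists K s : R, [/\ 0 <= K, 0 < s &
  forall p q, `|p| <= s -> `|q| <= s -> nrm (F p - F q) <= K * `|p - q|].
Proof.
have C0 := lc_C lc; have r0 := lc_r lc.
have [K [s1 [K0 s1_gt0 hK]]] := F_lip0.
pose t := Num.min s1 r; have t_gt0 : 0 < t by rewrite lt_min s1_gt0.
have [A hA hdiv] := tg_div1 (lc_near lc t_gt0).
have [s2 s2_gt0 hs2] := lc_cont lc hA.
have [s3 s3_gt0 hs3] := F_cont0 ltr01.
pose s := Num.min (Num.min s2 s3) (Num.min r (1 / (2 * (C + 1)))).
have s_gt0 : 0 < s by rewrite !lt_min s2_gt0 s3_gt0 r0 divr_gt0 //; lra.
have [ss2 ss3 sr sC] : [/\ s <= s2, s <= s3, s <= r & s <= 1 / (2 * (C + 1))].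
  by rewrite /s !ge_min !lexx /= !orbT.
have Cs : C * s <= 1 / 2.
  apply: (@le_trans _ _ (C * (1 / (2 * (C + 1))))); first by rewrite ler_wpM2l.
  by rewrite mul1r ler_pdivrMr; lra.
exists (2 * (2 * K)), s; split; [by rewrite !mulr_ge0|by []|].
move=> p q hp hq.
have [] := hdiv (e q) (e p) (hs2 _ (le_trans hq ss2)) (hs2 _ (le_trans hp ss2)).
set w := k _ => hw ew.
have ep : e p = (e q * e w)%g by rewrite ew mulVKg.
have [wr ws] : `|w| <= r /\ `|w| <= s1.
  by split; apply: (le_trans hw); rewrite /t ge_min lexx ?orbT.
have [_ h2] := lc_mul lc (le_trans hq sr) wr.
rewrite -ep (lc_ke lc (le_trans hp sr)) in h2.
have nw : `|w| <= 2 * `|p - q|.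
  have : `|w| <= `|p - q - w| + `|p - q|.
    by rewrite -{1}[w](subKr (p - q)) [leRHS]addrC; apply: ler_normB.
  have : C * `|q| * `|w| <= 1 / 2 * `|w|.
    by rewrite ler_wpM2r // (le_trans _ Cs) // ler_wpM2l.
  lra.
rewrite ep rhoM -{2}[rho (e q)]mulr1 -mulrBr; apply: le_trans (nrmM _ _) _.
have nq : nrm (rho (e q)) <= 2.
  by have := hs3 q (le_trans hq ss3); have := nrm_subl (rho (e q)) 1; have := nrm1 R m; lra.
rewrite -mulrA; apply: ler_pM; rewrite ?nrm_ge0 //.
by apply: le_trans (hK _ ws) _; rewrite -mulrA mulrCA ler_wpM2l.
Qed.

(** Let e x = e u * e w. Then F x - F u - F w + 1 = (F u - 1)(F w - 1), and x differs from u + w by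
    at most C|u||w|, so [F_lip] bounds the rest. *)
Lemma F_quad : exists K s : R, [/\ 0 <= K, 0 < s &
  forall u w, `|u| <= s -> `|w| <= s ->
    nrm (F (u + w) - F u - F w + 1) <= K * `|u| * `|w|].
Proof.
have C0 := lc_C lc; have r0 := lc_r lc.
have [K1 [s1 [K10 s1_gt0 hK1]]] := F_lip0.
have [K2 [s2 [K20 s2_gt0 hK2]]] := F_lip.
pose s := Num.min (Num.min s1 (s2 / 4)) (Num.min r (1 / (C + 1))).
have s_gt0 : 0 < s by rewrite !lt_min s1_gt0 r0 !divr_gt0 //; lra.
have [ss1 ss2 sr sC] : [/\ s <= s1, s <= s2 / 4, s <= r & s <= 1 / (C + 1)].
  by rewrite /s !ge_min !lexx /= !orbT.
have Cs : C * s <= 1.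
  apply: (@le_trans _ _ (C * (1 / (C + 1)))); first by rewrite ler_wpM2l.
  by rewrite mul1r ler_pdivrMr; lra.
exists (K2 * C + K1 * K1), s; split; [by rewrite addr_ge0 ?mulr_ge0|by []|].
move=> u w hu hw.
have [h1 h2] := lc_mul lc (le_trans hu sr) (le_trans hw sr).
set x := k _ in h1 h2.
have Cuw : C * `|u| * `|w| <= `|w|.
  by apply: ler_piMl => //; apply: le_trans Cs; apply: ler_wpM2l.
have nuw : `|u + w| <= s2 by have := ler_normD u w; lra.
have nx : `|x| <= s2.
  have : `|x| <= `|x - u - w| + (`|u| + `|w|).
    apply: le_trans (lerD (lexx _) (ler_normD u w)).
    exact: ler_norm_subD.
  lra.
have -> : rho (e (u + w)) - rho (e u) - rho (e w) + 1 =
   (rho (e (u + w)) - rho (e x)) + (rho (e u) - 1) * (rho (e w) - 1).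
  rewrite h1 rhoM mulrBl mulrBr mulr1 mul1r.
  move: (rho (e u) * rho (e w)) (rho _) (rho _) (rho _) => a b c c'.
  by apply/matrixP => i j; rewrite !mxE; ring.
apply: le_trans (nrmD _ _) _; rewrite -[leRHS]mulrA [leRHS]mulrDl; apply: lerD.
  apply: le_trans (hK2 _ _ nuw nx) _; rewrite -mulrA ler_wpM2l // mulrA.
  by apply: le_trans h2; rewrite distrC opprD addrA.
apply: le_trans (nrmM _ _) _.
have := hK1 _ (le_trans hu ss1); have := hK1 _ (le_trans hw ss1) => a1 a2.
have -> : K1 * K1 * (`|u| * `|w|) = (K1 * `|u|) * (K1 * `|w|) by ring.
by apply: ler_pM => //; apply: nrm_ge0.
Qed.

Record rep_diff (D : 'rV[R]_d -> 'M[R[i]]_m) (s K : R) : Prop := {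
  df_s : 0 < s ;
  df_K : 0 <= K ;
  dfD : forall u w, D (u + w) = D u + D w ;
  dfZ : forall (a : R) u, D (a *: u) = a%:C *: D u ;
  df_bound : forall u, nrm (D u) <= K * `|u| ;
  df_approx : forall u, `|u| <= s -> nrm (F u - 1 - D u) <= K * `|u| ^+ 2 ;
  df_lip : forall p q, `|p| <= s -> `|q| <= s -> nrm (F p - F q) <= K * `|p - q| }.

(** D u is the limit of 2^j (F (u/2^j) - 1): the bilinear bound of [F_quad] makes the sequence
    geometric, makes its limit additive, and gives the quadratic remainder. *)
Lemma F_diff : exists (D : 'rV[R]_d -> 'M[R[i]]_m) (s K : R), rep_diff D s K.
Proof.
have [K1 [s1 [K10 s1_gt0 hK1]]] := F_lip0.
have [K2 [s2 [K20 s2_gt0 hK2]]] := F_lip.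
have [K [s3 [K0 s3_gt0 hK]]] := F_quad.
pose s := Num.min s1 (Num.min s2 s3).
have s_gt0 : 0 < s by rewrite !lt_min s1_gt0 s2_gt0.
have [ss1 ss2 ss3] : [/\ s <= s1, s <= s2 & s <= s3].
  by rewrite /s !ge_min !lexx /= !orbT.
pose f u := rho (e u) - 1.
pose a u j := (2 ^+ j)%:C *: f ((2 ^+ j)^-1 *: u).
have nsc (u : 'rV[R]_d) j : `|(2 ^+ j)^-1 *: u| = `|u| / 2 ^+ j.
  by rewrite normrZ ger0_norm ?invr_ge0 ?exprn_ge0 // mulrC.
have hf u w : `|u| <= s -> `|w| <= s -> nrm (f (u + w) - f u - f w) <= K * `|u| * `|w|.
  move=> hu hw; have := hK u w (le_trans hu ss3) (le_trans hw ss3).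
  congr (nrm _ <= _); rewrite /f; move: (rho _) (rho _) (rho _) => A B B'.
  by apply/matrixP => i j; rewrite !mxE; ring.
have sub (u : 'rV[R]_d) j : `|u| <= s -> `|(2 ^+ j)^-1 *: u| <= s.
  move=> hu; rewrite nsc; apply: le_trans hu; rewrite ler_pdivrMr ?p2_gt0 //.
  by rewrite ler_peMr // exprn_ege1 // ler1n.
have step u j : `|u| <= s -> nrm (a u j.+1 - a u j) <= K * `|u| ^+ 2 / 2 ^+ j.
  move=> hu; have P := p2_gt0 R j; set v := (2 ^+ j.+1)^-1 *: u.
  have ev : (2 ^+ j)^-1 *: u = v + v.
    rewrite /v -scalerDl exprS; congr (_ *: u); field; exact: lt0r_neq0.
  have -> : a u j.+1 - a u j = - ((2 ^+ j)%:C *: (f (v + v) - f v - f v)).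
    rewrite /a -/v ev exprS rmorphM /= mulrC -scalerA.
    have -> : 2%:C *: f v = f v + f v.
      by rewrite -[2]/(1 + 1) rmorphD rmorph1 scalerDl scale1r.
    move: (f v) (f (v + v)) (_%:C) => Y X c.
    by apply/matrixP => i1 i2; rewrite !mxE; ring.
  rewrite nrmN nrmZR ger0_norm ?exprn_ge0 //.
  have hv := hf v v (sub u j.+1 hu) (sub u j.+1 hu).
  apply: le_trans (ler_wpM2l (ltW P) hv) _; rewrite nsc exprS.
  have -> : 2 ^+ j * (K * (`|u| / (2 * 2 ^+ j)) * (`|u| / (2 * 2 ^+ j))) = K * `|u| ^+ 2 / 2 ^+ j / 4.
    by field; rewrite lt0r_neq0.
  have : 0 <= K * `|u| ^+ 2 / 2 ^+ j by rewrite divr_ge0 ?mulr_ge0 ?exprn_ge0.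
  lra.
have small u : `|u| <= s -> exists2 L, cvm (a u) L & nrm (f u - L) <= m%:R * (4 * (K * `|u| ^+ 2)).
  move=> hu; have [l hl] := geo_mx (fun j => step u j hu).
  exists l; first by exists (m%:R * (4 * (K * `|u| ^+ 2))).
  by have := hl 0%N; rewrite /a expr0 invr1 scale1r rmorph1 scale1r mulr1.
have /choice [T hT] : forall u, exists L, cvm (a u) L.
  move=> u; have [j0 hj0] := exists_p2 `|u| s_gt0.
  have [|L [K' hL] _] := small ((2 ^+ j0)^-1 *: u); first by rewrite nsc.
  exists ((2 ^+ j0)%:C *: L); apply: (@cvm_tail _ _ _ _ _ j0 (2 ^+ j0 * K')) => j.
  have -> : a u (j0 + j)%N = (2 ^+ j0)%:C *: a ((2 ^+ j0)^-1 *: u) j.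
    rewrite /a [in RHS]scalerA -rmorphM /= -exprD; congr (_ *: f _).
    by rewrite scalerA exprD invfM mulrC.
  rewrite -scalerBr nrmZR ger0_norm ?exprn_ge0 // -mulrA.
  by rewrite ler_wpM2l ?exprn_ge0.
have TD u w : T (u + w) = T u + T w.
  apply: (cvm_unique (hT _)).
  have h0 : cvm (fun j => a (u + w) j - a u j - a w j) 0.
    have [j0 hj0] := exists_p2 (Num.max `|u| `|w|) s_gt0.
    apply: (@cvm_tail _ _ _ _ _ j0 (K * `|u| * `|w|)) => j; rewrite subr0.
    rewrite /a [_ *: (u + w)]scalerDr -!scalerBr nrmZR ger0_norm ?exprn_ge0 //.
    have P := p2_gt0 R (j0 + j); have Pj := p2_gt0 R j0; have Pj' := p2_gt0 R j.
    have le1 : (2 ^+ (j0 + j))^-1 <= (2 ^+ j0)^-1 :> R.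
      by rewrite lef_pV2 ?posrE // ler_weXn2l ?ler1n // leq_addr.
    have hh (v : 'rV[R]_d) : `|v| <= Num.max `|u| `|w| -> `|(2 ^+ (j0 + j))^-1 *: v| <= s.
      move=> hv; rewrite nsc; apply: le_trans hj0.
      by apply: ler_pM => //; rewrite invr_ge0 ltW.
    have := hf _ _ (hh u _) (hh w _); rewrite !le_max !lexx orbT => /(_ isT isT) h.
    apply: le_trans (ler_wpM2l (ltW P) h) _; rewrite !nsc.
    have -> : 2 ^+ (j0 + j) * (K * (`|u| / 2 ^+ (j0 + j)) * (`|w| / 2 ^+ (j0 + j))) = K * `|u| * `|w| / 2 ^+ (j0 + j).
      by field; rewrite lt0r_neq0.
    by rewrite ler_wpM2l ?mulr_ge0 // lef_pV2 ?posrE // ler_weXn2l ?ler1n // leq_addl.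
  have := cvmD h0 (cvmD (hT u) (hT w)); rewrite add0r; apply: eq_cvm => j.
  by rewrite [a u j + a w j]addrC addrA !subrK.
have ap u : `|u| <= s -> nrm (f u - T u) <= m%:R * (4 * K) * `|u| ^+ 2.
  move=> hu; have [L cL hL] := small u hu; rewrite (cvm_unique (hT u) cL).
  by rewrite -!mulrA.
have Q0 : 0 <= m%:R * (4 * K) by rewrite !mulr_ge0.
move: (m%:R * (4 * K)) Q0 ap => Q Q0 ap.
have Tb u : `|u| <= s -> nrm (T u) <= (K1 + Q * s) * `|u|.
  move=> hu; have := ap u hu; have := hK1 u (le_trans hu ss1); have := nrm_subl (T u) (f u).
  rewrite (nrm_subC (T u)) -/(f u) => h1 h2 h3.
  have : Q * `|u| ^+ 2 <= Q * s * `|u|.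
    by rewrite expr2 [leLHS]mulrA ler_wpM2r // ler_wpM2l.
  by rewrite mulrDl; lra.
have [TZ Tb2] := additive_linear s_gt0 TD Tb.
have Qs : 0 <= Q * s by rewrite mulr_ge0 // ltW.
exists T, s, (K1 + Q * s + Q + K2); split => //.
- by rewrite !addr_ge0.
- by move=> u; apply: le_trans (Tb2 u) _; rewrite ler_wpM2r //; lra.
- by move=> u hu; apply: le_trans (ap u hu) _; rewrite ler_wpM2r ?sqr_ge0 //; lra.
- move=> p q hp hq; apply: le_trans (hK2 _ _ (le_trans hp ss2) (le_trans hq ss2)) _.
  by rewrite ler_wpM2r //; lra.
Qed.

End Lie.

(** * Continuity tests and open subgroups *)

Section Topo.
Variable R : realType.

Lemma cont_real (T : topologicalType) (f : T -> R) (x : T) :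
  (forall a : R, 0 < a -> \forall y \near x, `|f y - f x| < a) -> {for x, continuous f}.
Proof.
move=> h; apply/cvgrPdist_lt => a /h; apply: filterS => y.
by rewrite distrC.
Qed.

Lemma nrm_dist m n (A B : 'M[R[i]]_(m, n)) : `|nrm A - nrm B| <= nrm (A - B).
Proof.
rewrite ler_norml; have := nrm_subl A B; have := nrm_subl B A.
by rewrite (nrm_subC B A); nrmgen; lra.
Qed.

Lemma cont_nrm (T : topologicalType) m (f : T -> 'M[R[i]]_m) L :
  (forall x (a : R), 0 < a -> \forall y \near x, nrm (f y - f x) < a) ->
  continuous (fun x => nrm (f x - L)).
Proof.
move=> h x; apply: cont_real => a /(h x); apply: filterS => y hy.
apply: le_lt_trans hy; apply: le_trans (nrm_dist _ _) _.
by rewrite opprB addrA subrK.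
Qed.

(** A subgroup containing a neighbourhood of 1 is open, and so is its complement, a union of
    cosets. *)
Lemma conn_subgroup (G : topologicalGroupType) (S : set G) :
  connected [set: G] ->
  (forall x y, S x -> S y -> S (x * y)%g) -> (forall x, S x -> S (x^-1)%g) ->
  nbhs 1%g S -> forall g, S g.
Proof.
move=> cG SM SV S1.
have Sn x : S x -> nbhs x S.
  move=> Sx; have : nbhs x (fun y => S (x^-1 * y)%g) by apply: tg_mull; rewrite mulVg.
  by apply: filterS => y Sy; rewrite -(mulVKg x y); apply: SM.
have Cn x : ~ S x -> nbhs x (~` S).
  move=> Sx; have : nbhs x (fun y => S (x^-1 * y)%g) by apply: tg_mull; rewrite mulVg.
  apply: filterS => y Sy Sy'; apply: Sx.
  have -> : x = (y * (x^-1 * y)^-1)%g.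
    by apply: (@mulIg _ (x^-1 * y)%g); rewrite mulgVK mulVKg.
  by apply: SM => //; apply: SV.
have -> : S = [set: G]; last by [].
apply: cG; first by exists 1%g; apply: nbhs_singleton S1.
  by exists S; [rewrite openE => x /Sn | rewrite setTI].
exists S; last by rewrite setTI.
rewrite -[S]setCK; apply: open_closedC; rewrite openE => x /Cn.
by [].
Qed.

Lemma lip_cont_at d (f : 'rV[R]_d -> R) v (s K : R) : 0 < s -> 0 <= K ->
  (forall w, `|w| <= s -> `|f (v + w) - f v| <= K * `|w|) -> {for v, continuous f}.
Proof.
move=> s0 K0 h; apply: cont_real => a a0.
apply/(@near_norm R d (fun y => `|f y - f v| < a) v).
exists (Num.min s (a / (2 * (K + 1)))).
  by rewrite lt_min s0 divr_gt0 // mulr_gt0 //; lra.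
move=> u; rewrite le_min => /andP[us ua]; apply: le_lt_trans (h u us) _.
apply: (@le_lt_trans _ _ (K * (a / (2 * (K + 1))))); first by rewrite ler_wpM2l.
rewrite mulrA ltr_pdivrMr; last by lra.
nra.
Qed.

End Topo.

Section RealVec.
Variables (R : realType) (m : nat).
Local Notation M := 'M[R[i]]_m.

(** The real coordinates of a complex matrix; on them [pinvmx] provides a real-linear left inverse
    of an injective differential. *)
Definition rvec (A : M) : 'rV[R]_(m * m + m * m) :=
  row_mx (mxvec (map_mx (@Re R) A)) (mxvec (map_mx (@Im R) A)).

Lemma rvecD A B : rvec (A + B) = rvec A + rvec B.
Proof.
rewrite /rvec add_row_mx -!linearD /=; congr (row_mx (mxvec _) (mxvec _)).
  by apply/matrixP => i j; rewrite !mxE raddfD.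
by apply/matrixP => i j; rewrite !mxE raddfD.
Qed.

Lemma rvecZ (a : R) A : rvec (a%:C *: A) = a *: rvec A.
Proof.
rewrite /rvec scale_row_mx -!linearZ /=; congr (row_mx (mxvec _) (mxvec _)).
  by apply/matrixP => i j; rewrite !mxE; case: (A i j) => x y /=; ring.
by apply/matrixP => i j; rewrite !mxE; case: (A i j) => x y /=; ring.
Qed.

Lemma rvec_inj A : rvec A = 0 -> A = 0.
Proof.
move=> e; apply/matrixP => i j; rewrite mxE.
have := congr1 lsubmx e; have := congr1 rsubmx e; rewrite row_mxKl row_mxKr !linear0.
move=> /(congr1 vec_mx); rewrite mxvecK linear0 => /matrixP /(_ i j); rewrite !mxE => e1.
move=> /(congr1 vec_mx); rewrite mxvecK linear0 => /matrixP /(_ i j); rewrite !mxE => e2.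
by move: e1 e2; case: (A i j) => x y /= -> ->.
Qed.

Lemma rvec_norm A : `|rvec A| <= nrm A.
Proof.
apply: mxnorm_le => [|i j]; first exact: nrm_ge0.
rewrite (ord1 i) /rvec mxE; case: splitP => k _; case/mxvec_indexP: k => p q; rewrite mxvecE mxE.
  by apply: le_trans (nrm_entry A p q); apply: Re_le_normc.
by apply: le_trans (nrm_entry A p q); apply: Im_le_normc.
Qed.

Lemma mulmx_norm p q (v : 'rV[R]_p) (A : 'M[R]_(p, q)) :
  `|v *m A| <= `|v| * (p%:R * `|A|).
Proof.
apply: mxnorm_le => [|i j]; first by rewrite !mulr_ge0.
rewrite mxE; apply: le_trans (ler_norm_sum _ _ _) _.
apply: (@le_trans _ _ (\sum_(k < p) (`|v| * `|A|))).
  apply: ler_sum => k _; rewrite normrM; apply: ler_pM => //; exact: mxnorm_entry.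
by rewrite sumr_const card_ord -[leLHS]mulr_natl mulrCA.
Qed.

Lemma real_linear_inv d (D : 'rV[R]_d -> M) :
  (forall u w, D (u + w) = D u + D w) -> (forall (a : R) u, D (a *: u) = a%:C *: D u) ->
  (forall u, D u = 0 -> u = 0) ->
  exists (J : M -> 'rV[R]_d) (K : R), [/\ 0 <= K,
    forall A B, J (A + B) = J A + J B, forall (a : R) A, J (a%:C *: A) = a *: J A,
    forall u, J (D u) = u & forall A, `|J A| <= K * nrm A].
Proof.
move=> DD DZ Dinj.
have D0 : D 0 = 0 by rewrite -[0 in LHS](scale0r (0 : 'rV[R]_d)) DZ scale0r.
pose A := \matrix_(i < d) rvec (D (delta_mx 0 i)).
have rv0 : rvec 0 = 0 by rewrite -[0 in LHS](scale0r (0 : M)) -[0 in LHS]/(0%:C) rvecZ scale0r.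
have eA u : u *m A = rvec (D u).
  rewrite {2}[u]row_sum_delta mulmx_sum_row.
  have -> : D (\sum_j u 0 j *: delta_mx 0 j) = \sum_j (u 0 j)%:C *: D (delta_mx 0 j).
    by rewrite (big_morph D DD D0); apply: eq_bigr => j _; rewrite DZ.
  rewrite (big_morph rvec rvecD rv0); apply: eq_bigr => j _.
  by rewrite rvecZ /A rowK.
have fA : row_free A.
  rewrite -kermx_eq0; apply/eqP/row_matrixP => j; rewrite row0.
  apply: Dinj; apply: rvec_inj; rewrite -eA -row_mul mulmx_ker row0 //.
exists (fun X => rvec X *m pinvmx A), ((m * m + m * m)%:R * `|pinvmx A|); split.
- by rewrite mulr_ge0.
- by move=> X Y; rewrite rvecD mulmxDl.
- by move=> a X; rewrite rvecZ scalemxAl.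
- by move=> u; rewrite -eA mulmxKp.
- by move=> X; rewrite [leRHS]mulrC; apply: le_trans (mulmx_norm _ _) _; rewrite ler_wpM2r ?mulr_ge0 // rvec_norm.
Qed.

End RealVec.

Lemma expm_lim_tail (R : realType) n (c : nat -> 'M[R[i]]_n) A (K : R) k0 :
  (forall k, nrm (c (k0 + k)%N - pk (k0 + k) A) <= K / (2 ^+ (k0 + k)) ^+ 2) ->
  cvm (fun k => c k ^+ (2 ^ k)) (expm A).
Proof.
move=> h; have K0 : 0 <= K.
  have := h 0%N; rewrite ler_pdivlMr ?exprn_gt0 // => h0.
  by apply: le_trans h0; rewrite mulr_ge0 ?nrm_ge0 // !exprn_ge0.
pose c' k := if (k < k0)%N then pk k A else c k.
have [|K' hK'] := @expm_lim R n c' A K.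
  move=> k; rewrite /c'; case: ltnP => kk.
    by rewrite subrr nrm0 divr_ge0 // !exprn_ge0.
  by rewrite -(subnKC kk).
have K'0 : 0 <= K' by have := hK' 0%N; rewrite expr0 divr1; apply/le_trans/nrm_ge0.
apply: (@cvm_tail _ _ _ _ _ k0 K') => k; have := hK' (k0 + k)%N.
rewrite /c' ltnNge leq_addr /= => h1; apply: le_trans h1 _.
by rewrite ler_wpM2l // lef_pV2 ?posrE ?p2_gt0 // ler_weXn2l ?ler1n // leq_addl.
Qed.

Lemma aux_72 (R : realType) (c y x K KJ : R) : 0 <= c * K * KJ ^+ 2 * (c * y) ->
  c * K * KJ ^+ 2 * x <= c * K * KJ ^+ 2 * (2 * c * y) ->
  16 * (c * K * KJ ^+ 2) * x <= 72 * (c * c * K * KJ ^+ 2) * y.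
Proof. lra. Qed.

Lemma aux_sum (R : realType) (p e c y x : R) :
  p * y * x + c * (e * c * 2 * y * x) <= (c * (e * c * 2) + p) * y * x.
Proof. by rewrite le_eqVlt; apply/orP; left; apply/eqP; ring. Qed.

Lemma aux_half (R : realType) (x z : R) : x <= z -> z <= 1 / 2 * x -> x <= 0.
Proof. lra. Qed.

Lemma aux_lt8 (R : realType) (p q b : R) : 0 < b -> p <= b / 8 -> q <= 2 * p -> 2 * q < b.
Proof. lra. Qed.

(** * The image of the representation near the identity *)

Section Lie3.
Variables (R : realType) (G : topologicalGroupType) (d m : nat).
Variables (rho : G -> 'M[R[i]]_m) (e : 'rV[R]_d -> G) (k : G -> 'rV[R]_d) (r C : R).
Hypothesis lc : local_coords e k r C.
Hypothesis rho1 : rho 1%g = 1.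
Hypothesis rhoM : forall x y, rho (x * y)%g = rho x * rho y.
Hypothesis rhoN : forall g0 (a : R), 0 < a -> \forall g \near g0, nrm (rho g - rho g0) < a.
Hypothesis cptG : compact [set: G].
Hypothesis conG : connected [set: G].
Variables (D : 'rV[R]_d -> 'M[R[i]]_m) (s K : R).
Hypothesis hD : rep_diff rho e D s K.
Hypothesis kerV : exists2 V : set G, nbhs 1%g V & forall g, V g -> rho g = 1 -> g = 1%g.

Local Notation F := (fun u => rho (e u)).

Lemma rhoV g : rho g * rho (g^-1)%g = 1.
Proof. by rewrite -rhoM mulgV. Qed.

Lemma rhoVl g : rho (g^-1)%g * rho g = 1.
Proof. by rewrite -rhoM mulVg. Qed.

Lemma D0 : D 0 = 0.
Proof. by rewrite -[0 in LHS](scale0r (0 : 'rV[R]_d)) (dfZ hD) scale0r. Qed.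

Lemma DN u : D (- u) = - D u.
Proof. by rewrite -scaleN1r (dfZ hD) rmorphN rmorph1 scaleN1r. Qed.

(** The value of [rho] at u/2^j is 1 + D u/2^j up to O(4^-j), so it may serve as the base of the
    exponential. *)
Lemma F_expm u : cvm (fun j => F ((2 ^+ j)^-1 *: u) ^+ (2 ^ j)) (expm (D u)).
Proof.
have [j0 hj0] := exists_p2 `|u| (df_s hD).
apply: (@expm_lim_tail _ _ _ _ (K * `|u| ^+ 2) j0) => j.
have P := p2_gt0 R (j0 + j).
have nsc : `|(2 ^+ (j0 + j))^-1 *: u| = `|u| / 2 ^+ (j0 + j).
  by rewrite normrZ ger0_norm ?invr_ge0 ?exprn_ge0 // mulrC.
have hs : `|(2 ^+ (j0 + j))^-1 *: u| <= s.
  rewrite nsc; apply: le_trans hj0; rewrite ler_wpM2l //.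
  by rewrite lef_pV2 ?posrE ?p2_gt0 // ler_weXn2l ?ler1n // leq_addr.
have := df_approx hD hs; rewrite (dfZ hD) /pk opprD addrA => h.
by apply: le_trans h _; rewrite nsc expr_div_n mulrA.
Qed.

(** The distance from rho x to L attains its minimum on the compact group, and the sequence forces
    this minimum to be 0. *)
Lemma rho_closed (g : nat -> G) L : cvm (fun j => rho (g j)) L -> exists x, rho x = L.
Proof.
move=> [c hc].
have cf := continuous_subspaceT (A := [set: G]) (cont_nrm (L := L) rhoN).
have [|x _ hx] := compact_EVT_min _ cptG cf; first by exists 1%g.
exists x; apply/eqP; rewrite -subr_eq0; apply/eqP/nrm_eq0/eqP.
rewrite eq_le nrm_ge0 andbT; apply: (@geo_le0 R _ c) => j.
by apply: le_trans (hc j); apply: hx; rewrite inE.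
Qed.

Lemma expm_rho u : exists g, rho g = expm (D u).
Proof.
apply: (@rho_closed (fun j => e ((2 ^+ j)^-1 *: u) ^+ (2 ^ j))%g).
by apply: eq_cvm (F_expm u) => j; rewrite (rhoX rho1 rhoM).
Qed.

(** If D Y = 0, the elements e (Y/2^j)^(2^j) = e v_j have images tending to 1, while by [e_pow] the
    v_j stay in a compact annulus around 0. The minimum of |F - 1| there is 0, so some non-zero w in
    the annulus has rho (e w) = 1, against the injectivity of [rho] near 1. *)
Lemma D_inj u : D u = 0 -> u = 0.
Proof.
move=> Du; apply/eqP; apply: contraT => u0; exfalso.
have nu : 0 < `|u| by rewrite normr_gt0.
have [V hV kV] := kerV.
have [s1 s1_gt0 hs1] := lc_cont lc hV.
have C0 := lc_C lc; have r0 := lc_r lc; have s0 := df_s hD.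
pose t := Num.min (Num.min s1 s) (Num.min r (1 / (C + 1))).
have t_gt0 : 0 < t by rewrite !lt_min s1_gt0 r0 s0 !divr_gt0 //; lra.
have [ts1 ts tr tC] : [/\ t <= s1, t <= s, t <= r & t <= 1 / (C + 1)].
  by rewrite /t !ge_min !lexx /= !orbT.
have Ct : C * t <= 1.
  apply: (@le_trans _ _ (C * (1 / (C + 1)))); first by rewrite ler_wpM2l.
  by rewrite mul1r ler_pdivrMr; lra.
pose a : R := t / 4; have a0 : 0 < a by rewrite /a; lra.
pose Y := (a / `|u|) *: u.
have nY : `|Y| = a.
  by rewrite normrZ ger0_norm ?divr_ge0 ?ltW // divfK // lt0r_neq0.
have DY : D Y = 0 by rewrite (dfZ hD) Du scaler0.
have /choice [v hv] : forall j, exists v : 'rV[R]_d, [/\ (e ((2 ^+ j)^-1 *: Y) ^+ (2 ^ j))%g = e v,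
   `|v| <= 2 * a & a / 2 <= `|v|].
  move=> j; have P := p2_gt0 R j; set w := (2 ^+ j)^-1 *: Y.
  have nw : (2 ^ j)%:R * `|w| = a.
    rewrite normrZ ger0_norm ?invr_ge0 ?exprn_ge0 // nY natrX mulrA divff ?mul1r //.
  have [|v [ev nv dv]] := e_pow (u := w) (j := (2 ^ j)%N) lc tr Ct; first by rewrite nw /a; lra.
  exists v; split => //; first by rewrite -nw.
  rewrite nw natrX scalerA divff ?lt0r_neq0 // scale1r in dv.
  have : `|Y| <= `|v - Y| + `|v|.
    by rewrite -{1}[Y](subKr v) [leRHS]addrC; apply: ler_normB.
  rewrite nY.
  have : C * a ^+ 2 <= a / 4.
    have : C * a <= 1 / 4 by rewrite /a mulrA; lra.
    have -> : a / 4 = 1 / 4 * a by ring.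
    by move=> h; rewrite expr2 mulrA ler_wpM2r // ltW.
  lra.
pose A := [set v : 'rV[R]_d | a / 2 <= `|v| /\ `|v| <= 2 * a].
have cA : compact A.
  apply: bounded_closed_compact.
    exists (2 * a); split; first exact: num_real.
    by move=> x hx w [_ hw]; apply: le_trans hw _; apply: ltW.
  have -> : A = (fun w : 'rV[R]_d => `|w|) @^-1` `[a / 2, 2 * a].
    apply/seteqP; split=> w /=; rewrite in_itv /=; first by move=> [-> ->].
    by move/andP.
  apply: closed_comp; last exact: interval_closed.
  by move=> w _; apply: norm_continuous.
have small w : `|w| <= t -> rho (e w) = 1 -> w = 0.
  move=> hw h1; have e1 := kV _ (hs1 w (le_trans hw ts1)) h1.
  rewrite -(lc_ke lc (le_trans hw tr)) e1 -(lc_e0 lc) (lc_ke lc) // normr0 ltW //.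
have A0 : A !=set0 by exists (v 0%N); case: (hv 0%N).
have cf : {within A, continuous (fun w => nrm (F w - 1))}.
  apply: continuous_in_subspaceT => w; rewrite inE => -[hw1 hw2].
  apply: (@lip_cont_at R d _ w (t / 2) K); [by lra|exact: df_K hD|].
  move=> w' hw'.
  have b1 : `|w + w'| <= s by have := ler_normD w w'; rewrite /a in hw2; lra.
  have b2 : `|w| <= s by rewrite /a in hw2; lra.
  have := df_lip hD b1 b2; rewrite [w + w' - w]addrC addKr => h; apply: le_trans h.
  by apply: le_trans (nrm_dist _ _) _; rewrite opprB addrA subrK.
have [w] := EVT_min_rV A0 cA cf; rewrite inE => -[hw1 hw2] hmin.
have : nrm (F w - 1) <= 0.
  have [c hc] := F_expm Y; apply: (@geo_le0 R _ c) => j.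
  have [ev hv1 hv2] := hv j.
  have := hc j; rewrite DY expm0 -(rhoX rho1 rhoM) ev => h; apply: le_trans h.
  by apply: hmin; rewrite inE.
move=> h; have e1 : rho (e w) = 1.
  apply/eqP; rewrite -subr_eq0; apply/eqP/nrm_eq0/eqP.
  by rewrite eq_le h nrm_ge0.
have w0 : w = 0 by apply: small => //; rewrite /a in hw2; lra.
by move: hw1; rewrite w0 normr0; lra.
Qed.

(** An element whose image is close to 1 need not be close to 1, but only close to the kernel: the
    translates of [W] by the kernel form an open set, off which compactness keeps rho g away from
    1. *)
Lemma near_F (a : R) : 0 < a -> exists2 b : R, 0 < b &
  forall g, nrm (rho g - 1) < b -> exists2 u, `|u| <= a & rho g = F u.
Proof.
move=> a0; pose W := [set g | `|k g| <= a /\ e (k g) = g].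
have hW : nbhs (1%g : G) W by apply: filterS (lc_near lc a0).
pose B := [set g : G | exists2 h, rho h = 1 & interior W (h * g)%g].
have oB : open B.
  rewrite openE => g [h rh Wh].
  have : nbhs g (fun x => interior W (h * x)%g).
    by apply: tg_mull; apply: open_nbhs_nbhs; split => //; apply: open_interior.
  by apply: filterS => x Wx; exists h.
have cB : compact (~` B).
  by apply: subclosed_compact cptG _ => //; apply: open_closedC.
have inB g : B g -> exists2 u, `|u| <= a & rho g = F u.
  move=> [h rh /interior_subset [h1 h2]]; exists (k (h * g)%g) => //.
  by rewrite h2 rhoM rh mul1r.
have [B0|/nonemptyPn B0] := pselect ((~` B) !=set0); last first.
  by exists 1 => // g _; apply: inB; apply: contrapT => nB; have : (~` B) g by []; rewrite B0.
have cf := continuous_subspaceT (A := ~` B) (cont_nrm (L := 1) rhoN).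
have [x] := compact_EVT_min B0 cB cf; rewrite inE => nBx hx.
exists (nrm (rho x - 1)).
  rewrite lt_neqAle nrm_ge0 andbT eq_sym; apply/eqP => /nrm_eq0/eqP.
  rewrite subr_eq0 => /eqP r1; apply: nBx; exists (x^-1)%g; first by rewrite -[LHS]mul1r -r1 rhoV.
  by rewrite mulVg.
move=> g hg; apply: inB; apply: contrapT => nB.
by have := hx g; rewrite inE => /(_ nB); rewrite leNgt hg.
Qed.

Section WithInverse.
Variables (J : 'M[R[i]]_m -> 'rV[R]_d) (KJ : R).
Hypotheses (KJ0 : 0 <= KJ) (JD : forall A B, J (A + B) = J A + J B)
  (JZ : forall (a : R) A, J (a%:C *: A) = a *: J A)
  (DK : forall u, J (D u) = u) (Jb : forall A, `|J A| <= KJ * nrm A).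

Lemma JN A : J (- A) = - J A.
Proof. by rewrite -scaleN1r -(rmorphN1 (real_complex R)) JZ scaleN1r. Qed.

(** Let A be the logarithm of rho g, B its projection to the range of D and X = A - B. Multiplying
    by exp (-B) turns rho g into rho g' = 1 + X + o(X), which is also F u with u = O(X). Its
    component off the range of D is X to first order and O(X^2) by differentiability of [rho], so X
    = 0. *)
Lemma near_expm (a : R) : 0 < a -> exists2 b : R, 0 < b &
  forall g, nrm (rho g - 1) < b -> exists2 u, `|u| <= a & rho g = expm (D u).
Proof.
move=> a0.
have r0 := rad_gt0 R; have r1 := rad_le1 R; have s0 := df_s hD; have K0 := df_K hD.
(* [P] projects onto the range of D and [Q] below is the complementary projection. *)
pose P A := D (J A).
have PD A B : P (A + B) = P A + P B by rewrite /P JD (dfD hD).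
have PN A : P (- A) = - P A by rewrite /P JN DN.
have Pb A : nrm (P A) <= (K * KJ) * nrm A.
  by apply: le_trans (df_bound hD _) _; rewrite -mulrA ler_wpM2l.
pose Q A := A - P A.
have [c cE] : exists c : R, c = 1 + K * KJ by eexists.
have KKJ : 0 <= K * KJ by rewrite mulr_ge0.
have c1 : 1 <= c by rewrite cE lerDl.
have Qb A : nrm (Q A) <= c * nrm A.
  by apply: le_trans (nrmB _ _) _; rewrite cE mulrDl mul1r lerD2l.
have [E1 E1E] : exists E1 : R, E1 = 2 * expR 1 by eexists.
have [E2 E2E] : exists E2 : R, E2 = 1 / rad R by eexists.
have e1 : 1 <= expR 1 :> R by have := @expR_ge1Dx R 1; lra.
have E1p : 1 <= E1 by rewrite E1E; lra.
have E2p : 1 <= E2 by rewrite E2E ler_pdivlMr // mul1r; lra.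
pose t1 := Num.min s (1 / (2 * (KJ * K + 1))).
have KJK : 0 <= KJ * K by rewrite mulr_ge0.
have t1_gt0 : 0 < t1 by rewrite lt_min s0 divr_gt0 //; lra.
have lowF u : `|u| <= t1 -> `|u| <= 2 * KJ * nrm (F u - 1).
  rewrite le_min => /andP[us ut].
  have h1 : `|u| <= KJ * nrm (D u) by rewrite -{1}[u]DK.
  have h2 := df_approx hD us.
  have h3 : nrm (D u) <= nrm (F u - 1) + K * `|u| ^+ 2.
    apply: le_trans (nrm_subl (D u) (F u - 1)) _; rewrite addrC lerD2l.
    by rewrite nrm_subC.
  have h4 : KJ * (K * `|u| ^+ 2) <= `|u| / 2.
    rewrite expr2 !mulrA [leRHS]mulrC ler_wpM2r //.
    have : KJ * K * `|u| <= KJ * K * (1 / (2 * (KJ * K + 1))) by rewrite ler_wpM2l.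
    move=> h; apply: le_trans h _; rewrite mul1r ler_pdivrMr; lra.
  have h5 : KJ * nrm (D u) <= KJ * nrm (F u - 1) + KJ * (K * `|u| ^+ 2).
    by rewrite -mulrDr ler_wpM2l.
  by rewrite -mulrA; move: (KJ * nrm (F u - 1)) (KJ * nrm (D u)) (KJ * (K * _)) h1 h4 h5 => x y z; lra.
have [b1 b1_gt0 hb1] := near_F t1_gt0.
have [c3 c3E] : exists c3 : R, c3 = c * ((E1 + E2) * c * 2) + 72 * (c * c * K * KJ ^+ 2) by eexists.
have c30 : 1 <= c3.
  have : 0 <= 72 * (c * c * K * KJ ^+ 2) by rewrite !mulr_ge0 ?exprn_ge0 //; lra.
  have : 1 <= c * ((E1 + E2) * c * 2).
    rewrite mulr_ege1 // mulr_ege1 ?ler1n // mulr_ege1 //; lra.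
  by rewrite c3E; lra.
(* The four bounds respectively keep A and B within [rad], make [J A] of norm at most [a], bring rho
   g' into the range of [near_F], and give the factor 1/2 in the final comparison of X with
   itself. *)
pose y := Num.min (Num.min (rad R / (2 * c)) (a / (KJ + 1))) (Num.min (b1 / (8 * c)) (1 / (2 * c3))).
have y_gt0 : 0 < y.
  have c_gt0 : 0 < c by exact: lt_le_trans ltr01 c1.
  have c3_gt0 : 0 < c3 by exact: lt_le_trans ltr01 c30.
  have KJ1 : 0 < KJ + 1 by exact: ltr_wpDl KJ0 ltr01.
  by rewrite !lt_min !divr_gt0 // mulr_gt0.
have [y1 y2 y3 y4] : [/\ y <= rad R / (2 * c), y <= a / (KJ + 1), y <= b1 / (8 * c) & y <= 1 / (2 * c3)].
  by rewrite /y !ge_min !lexx /= !orbT.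
exists (Num.min (rad R / 2) (y / 2)); first by rewrite lt_min !divr_gt0.
move=> g; rewrite lt_min => /andP[hg1 hg2].
have [A nA eA] := expm_log (ltW hg1).
have nA' : nrm A <= y by lra.
pose B := P A; pose X := A - B.
have nB : nrm B <= c * y.
  apply: le_trans (Pb A) _; apply: (@le_trans _ _ (K * KJ * y)); first by rewrite ler_wpM2l.
  by apply: ler_wpM2r; [exact: ltW | rewrite cE lerDr].
have cy : c * y <= rad R / 2.
  have := ler_wpM2l (le_trans ler01 c1) y1; congr (_ <= _); field; lra.
have nAr : nrm A <= c * y by apply: le_trans nA' _; rewrite ler_peMl // ltW.
have QX : Q X = X.
  by rewrite /Q /X PD PN /B /P DK subrr subr0.
have [h hh] : exists h, rho h = expm (- B) by rewrite -DN; apply: expm_rho.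
pose g' := (h * g)%g.
have eg' : rho g' = expm (- B) * expm A by rewrite rhoM hh eA.
have a1 : c * y <= 1 by lra.
have lip : nrm (expm A - expm B - X) <= c * y / rad R / 2 * nrm X.
  exact: expm_lip_rad.
have nX0 := nrm_ge0 X.
have lip' : nrm (expm A - expm B) <= 2 * nrm X.
  have := nrm_subl (expm A - expm B) X.
  have : c * y / rad R / 2 * nrm X <= 1 * nrm X.
    by rewrite ler_wpM2r // ler_pdivrMr // ler_pdivrMr //; lra.
  lra.
have nB1 : nrm (expm (- B) - 1) <= 2 * expR 1 * (c * y).
  have := @expm_lip R m (- B) 0 (nrm B); rewrite nrm0 nrmN => /(_ (lexx _) (nrm_ge0 _)).
  rewrite expm0 subr0 nrmN => hB.
  have := nrm_subl (expm (- B) - 1) (- B); rewrite nrmN.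
  have n0 := nrm_ge0 B.
  have e2 : expR (nrm B) <= expR 1 by rewrite ler_expR; lra.
  have : 2 * nrm B * expR (nrm B) * nrm B <= 2 * 1 / 2 * expR 1 * nrm B.
    rewrite ler_wpM2r // ler_pM ?mulr_ge0 ?expR_ge0 //; lra.
  have : 1 <= expR 1 :> R by have := @expR_ge1Dx R 1; lra.
  have : 2 * expR 1 * nrm B <= 2 * expR 1 * (c * y) by rewrite ler_wpM2l //; lra.
  nra.
rewrite -E1E in nB1.
have eE : rho g' - 1 - X = (expm (- B) - 1) * (expm A - expm B) + (expm A - expm B - X).
  rewrite eg' mulrBl mulrBr mul1r expmNl.
  by rewrite [RHS]addrA subrK.
have nE : nrm (rho g' - 1 - X) <= (E1 + E2) * c * 2 * y * nrm X.
  rewrite eE; apply: le_trans (nrmD _ _) _.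
  have h1 : nrm ((expm (- B) - 1) * (expm A - expm B)) <= E1 * (c * y) * (2 * nrm X).
    by apply: le_trans (nrmM _ _) _; apply: ler_pM; rewrite ?nrm_ge0.
  have h2 : c * y / rad R / 2 * nrm X <= E2 * (c * y) * (2 * nrm X).
    have : 0 <= c * y / rad R * nrm X by rewrite mulr_ge0 ?divr_ge0 // ?mulr_ge0 //; try exact: ltW; exact: le_trans ler01 c1.
    move=> hx; have -> : c * y / rad R / 2 * nrm X = c * y / rad R * nrm X / 2 by ring.
    have -> : E2 * (c * y) * (2 * nrm X) = 2 * (c * y / rad R * nrm X) by rewrite E2E; ring.
    lra.
  have -> : (E1 + E2) * c * 2 * y * nrm X = E1 * (c * y) * (2 * nrm X) + E2 * (c * y) * (2 * nrm X) by ring.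
  by apply: lerD => //; apply: le_trans lip h2.
have c3y : c3 * y <= 1 / 2.
  have := ler_wpM2l (le_trans ler01 c30) y4; congr (_ <= _); field; lra.
have hsm : 0 <= 72 * (c * c * K * KJ ^+ 2).
  by rewrite !mulr_ge0 ?exprn_ge0 //; exact: le_trans ler01 c1.
have k1 : c * ((E1 + E2) * c * 2) * y <= 1 / 2.
  by apply: le_trans c3y; apply: ler_wpM2r; [exact: ltW | rewrite c3E lerDl].
have c_ge0 : 0 <= c := le_trans ler01 c1.
have kE : 0 <= (E1 + E2) * c * 2 * y.
  apply: mulr_ge0; last exact: ltW.
  apply: mulr_ge0 => //; apply: mulr_ge0 => //.
  by apply: addr_ge0; [exact: le_trans ler01 E1p | exact: le_trans ler01 E2p].
have k2 : (E1 + E2) * c * 2 * y <= 1.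
  have : 0 <= (E1 + E2) * c * 2 * y by exact: kE.
  by move: k1; rewrite -mulrA; move: ((E1 + E2) * c * 2 * y) => z; nra.
have n3 : nrm (rho g' - 1) <= 2 * nrm X.
  have := nrm_subl (rho g' - 1) X; have : (E1 + E2) * c * 2 * y * nrm X <= nrm X by rewrite ler_piMl.
  lra.
have nX : nrm X <= 2 * c * y by have := nrmB A B; rewrite -/X; lra.
have [|u hu ru] := hb1 g'.
  apply: le_lt_trans n3 _; move: nX; have : c * y <= b1 / 8.
    have := ler_wpM2l (le_trans ler01 c1) y3; congr (_ <= _); field; lra.
  have -> : 2 * c * y = 2 * (c * y) by ring.
  by move=> h1 h2; apply: aux_lt8 h1 h2.
have hu2 := lowF u hu; rewrite -ru in hu2.
have QD v : Q (D v) = 0 by rewrite /Q /P DK subrr.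
have QDD Z Z' : Q (Z + Z') = Q Z + Q Z' by rewrite /Q PD opprD addrACA.
have QN Z : Q (- Z) = - Q Z by rewrite /Q PN opprD.
have hu3 : `|u| <= 4 * KJ * nrm X.
  apply: le_trans hu2 _; have -> : 4 * KJ * nrm X = 2 * KJ * (2 * nrm X) by ring.
  by rewrite ler_wpM2l // mulr_ge0.
have q1 : nrm (Q (rho g' - 1)) <= c * (K * (16 * KJ ^+ 2 * nrm X ^+ 2)).
  have -> : Q (rho g' - 1) = Q (rho g' - 1 - D u) by rewrite (QDD (rho g' - 1)) QN QD oppr0 addr0.
  apply: le_trans (Qb _) _; rewrite ler_wpM2l //.
  rewrite ru; apply: le_trans (df_approx hD _) _.
    by move: hu; rewrite le_min => /andP[].
  rewrite ler_wpM2l //; have -> : 16 * KJ ^+ 2 * nrm X ^+ 2 = (4 * KJ * nrm X) ^+ 2 by ring.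
  by rewrite ler_exprn.
have q2 : nrm (Q (rho g' - 1 - X)) <= c * ((E1 + E2) * c * 2 * y * nrm X).
  by apply: le_trans (Qb _) _; rewrite ler_wpM2l.
have q3 : nrm X <= nrm (Q (rho g' - 1)) + nrm (Q (rho g' - 1 - X)).
  rewrite -{1}QX; have -> : Q X = Q (rho g' - 1) - Q (rho g' - 1 - X).
    by rewrite -QN -QDD opprB addrCA subrr addr0.
  exact: nrmB.
have q4 : c * (K * (16 * KJ ^+ 2 * nrm X ^+ 2)) <= 72 * (c * c * K * KJ ^+ 2) * y * nrm X.
  have -> : c * (K * (16 * KJ ^+ 2 * nrm X ^+ 2)) = 16 * (c * K * KJ ^+ 2) * nrm X * nrm X by ring.
  rewrite ler_wpM2r //.
  have h0 : 0 <= c * K * KJ ^+ 2 by rewrite !mulr_ge0 ?exprn_ge0.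
  have := ler_wpM2l h0 nX.
  have := mulr_ge0 h0 (mulr_ge0 c_ge0 (ltW y_gt0)).
  exact: aux_72.
have X0 : nrm X = 0.
  apply/eqP; rewrite eq_le nX0 andbT; have := ler_wpM2r nX0 c3y; apply: aux_half.
  apply: le_trans q3 _; apply: le_trans (lerD (le_trans q1 q4) q2) _.
  by rewrite c3E; apply: aux_sum.
have AB : A = B by apply/eqP; rewrite -subr_eq0; apply/eqP/nrm_eq0.
exists (J A); last by rewrite -eA {1}AB.
apply: le_trans (Jb A) _; apply: (@le_trans _ _ (KJ * (a / (KJ + 1)))).
  by rewrite ler_wpM2l // (le_trans nA').
have KJ1 : 0 < KJ + 1 by exact: ltr_wpDl KJ0 ltr01.
rewrite mulrCA; apply: ler_piMr; first exact: ltW.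
by rewrite ler_pdivrMr // mul1r lerDl.
Qed.

End WithInverse.
End Lie3.

(** * The adjoint action through the representation *)

Section Lie4.
Variables (R : realType) (G : topologicalGroupType) (d m : nat).
Variables (rho : G -> 'M[R[i]]_m) (e : 'rV[R]_d -> G) (k : G -> 'rV[R]_d) (r C : R).
Hypothesis lc : local_coords e k r C.
Hypothesis rho1 : rho 1%g = 1.
Hypothesis rhoM : forall x y, rho (x * y)%g = rho x * rho y.
Hypothesis rhoN : forall g0 (a : R), 0 < a -> \forall g \near g0, nrm (rho g - rho g0) < a.
Variables (D : 'rV[R]_d -> 'M[R[i]]_m) (s K : R).
Hypothesis hD : rep_diff rho e D s K.
Variables (J : 'M[R[i]]_m -> 'rV[R]_d) (KJ : R).
Hypotheses (KJ0 : 0 <= KJ) (JD : forall A B, J (A + B) = J A + J B)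
  (JZ : forall (a : R) A, J (a%:C *: A) = a *: J A)
  (DK : forall u, J (D u) = u) (Jb : forall A, `|J A| <= KJ * nrm A).

(** Stands for differentiation at 0: a first order term dominated by a second order one for all
    small t cannot be positive. *)
Lemma small_eq0 (x K' a : R) : 0 < a -> 0 <= K' ->
  (forall t, 0 < t -> t <= a -> t * x <= K' * t ^+ 2) -> x <= 0.
Proof.
move=> a0 K0 h; rewrite leNgt; apply/negP => x0.
pose t := Num.min a (x / (2 * (K' + 1))).
have K1 : 0 < K' + 1 by exact: ltr_wpDl K0 ltr01.
have t0 : 0 < t by rewrite lt_min a0 divr_gt0 // mulr_gt0.
have ta : t <= a by rewrite /t ge_min lexx.
have tx : t <= x / (2 * (K' + 1)) by rewrite /t ge_min lexx orbT.
have := h t t0 ta; rewrite expr2 mulrA [K' * t]mulrC -mulrA ler_pM2l //.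
apply/negP; rewrite -ltNge; apply: (@le_lt_trans _ _ (K' * (x / (2 * (K' + 1))))).
  by rewrite ler_wpM2l.
rewrite mulrA ltr_pdivrMr ?mulr_gt0 //; nra.
Qed.

(** Through D, conjugation in coordinates agrees with conjugation by rho g up to O(|u|^2). That the
    conjugate of D u is again in the range of D follows by applying this to t u and dividing by
    t. *)
Lemma Ad_diff g : exists L : 'M[R]_d,
  (forall u, D (u *m L) = rho g * D u * rho (g^-1)%g) /\
  exists K' a : R, [/\ 0 < a, 0 <= K' & forall u, `|u| <= a ->
    `|k (g * e u * g^-1)%g - u *m L| <= K' * `|u| ^+ 2].
Proof.
have s0 := df_s hD; have K0 := df_K hD.
pose X u := rho g * D u * rho (g^-1)%g.
pose c := nrm (rho g) * nrm (rho (g^-1)%g).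
have c0 : 0 <= c by rewrite mulr_ge0 ?nrm_ge0.
have nc A : nrm (rho g * A * rho (g^-1)%g) <= c * nrm A.
  apply: le_trans (nrmM _ _) _; rewrite /c mulrAC ler_wpM2r ?nrm_ge0 //.
  exact: nrmM.
have XD u w : X (u + w) = X u + X w by rewrite /X (dfD hD) mulrDr mulrDl.
have XZ (a : R) u : X (a *: u) = a%:C *: X u by rewrite /X (dfZ hD) -mxsAr -mxsAl.
pose L := \matrix_(i < d) J (X (delta_mx 0 i)).
have J0 : J 0 = 0.
  by rewrite -[0 in LHS](scale0r (0 : 'M[R[i]]_m)) -[0 in LHS](rmorph0 (real_complex R)) JZ scale0r.
have X0 : X 0 = 0 by rewrite /X (D0 hD) mulr0 mul0r.
have eL u : u *m L = J (X u).
  rewrite {2}[u]row_sum_delta mulmx_sum_row (big_morph X XD X0) (big_morph J JD J0).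
  by apply: eq_bigr => j _; rewrite XZ JZ /L rowK.
pose a1 := Num.min s (1 / (2 * (KJ * K + 1))).
have KJK : 0 <= KJ * K by rewrite mulr_ge0.
have KJK1 : 0 < KJ * K + 1 by exact: ltr_wpDl KJK ltr01.
have a1_gt0 : 0 < a1 by rewrite lt_min s0 divr_gt0 // mulr_gt0.
have [b b0 hb] : exists2 b : R, 0 < b & forall u, `|u| <= b ->
    `|k (g * e u * g^-1)%g| <= a1 /\ e (k (g * e u * g^-1)%g) = (g * e u * g^-1)%g.
  apply: (lc_cont lc (W := fun x => `|k (g * x * g^-1)%g| <= a1 /\ e (k (g * x * g^-1)%g) = (g * x * g^-1)%g)).
  apply: (@tg_mull G g 1%g (fun y => `|k (y * g^-1)%g| <= a1 /\ e (k (y * g^-1)%g) = (y * g^-1)%g)).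
  apply: (@tg_mulr G (g^-1)%g (g * 1)%g (fun y => `|k y| <= a1 /\ e (k y) = y)).
  by rewrite mulg1 mulgV; apply: filterS (lc_near lc a1_gt0).
pose a := Num.min b s.
have a0 : 0 < a by rewrite lt_min b0.
have est : exists2 K1 : R, 0 <= K1 & forall u, `|u| <= a ->
    nrm (D (k (g * e u * g^-1)%g) - X u) <= K1 * `|u| ^+ 2.
  pose c1 := 2 * KJ * c * (K + K).
  exists (K * (2 * KJ * (c * (K * a + K))) ^+ 2 + c * K).
    by apply: addr_ge0; [apply: mulr_ge0 => //; apply: sqr_ge0 | apply: mulr_ge0].
  move=> u; rewrite le_min => /andP[ub us]; have [hk1 hk2] := hb u ub.
  set v := k _ in hk1 hk2 *.
  have vs : `|v| <= s by apply: le_trans hk1 _; rewrite /a1 ge_min lexx.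
  have va : `|v| <= 1 / (2 * (KJ * K + 1)) by apply: le_trans hk1 _; rewrite /a1 ge_min lexx orbT.
  have Fv : rho (e v) = rho g * rho (e u) * rho (g^-1)%g by rewrite hk2 !rhoM.
  have dF : rho (e v) - 1 - X u = rho g * (rho (e u) - 1 - D u) * rho (g^-1)%g.
    by rewrite Fv /X !mulrBr !mulrBl mulr1 (rhoV rho1 rhoM).
  have h1 : nrm (rho (e v) - 1 - X u) <= c * K * `|u| ^+ 2.
    rewrite dF; apply: le_trans (nc _) _; rewrite -mulrA ler_wpM2l //.
    by apply: (df_approx hD); exact: us.
  have h2 := df_approx hD vs.
  have h3 : nrm (D v - X u) <= K * `|v| ^+ 2 + c * K * `|u| ^+ 2.
    apply: le_trans (nrm_tri (rho (e v) - 1) _ _) _; apply: lerD => //.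
    by rewrite nrm_subC.
  have h4 : nrm (X u) <= c * K * `|u|.
    by apply: le_trans (nc _) _; rewrite -mulrA ler_wpM2l // (df_bound hD).
  have u0 : 0 <= `|u| by [].
  have ua : `|u| <= a by rewrite /a le_min ub us.
  have h5 : `|v| <= 2 * KJ * (c * (K * a + K)) * `|u|.
    have e1 : `|v| <= KJ * nrm (D v) by rewrite -{1}[v]DK.
    have e2 : nrm (D v) <= K * `|v| ^+ 2 + c * K * `|u| ^+ 2 + c * K * `|u|.
      by apply: le_trans (nrm_subl _ (X u)) _; apply: lerD.
    have e3 : KJ * (K * `|v| ^+ 2) <= `|v| / 2.
      rewrite expr2 !mulrA [leRHS]mulrC ler_wpM2r //.
      apply: (@le_trans _ _ (KJ * K * (1 / (2 * (KJ * K + 1))))); first by rewrite ler_wpM2l.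
      by rewrite mul1r ler_pdivrMr ?mulr_gt0 //; lra.
    have e4 : c * K * `|u| ^+ 2 <= c * K * a * `|u|.
      by rewrite expr2 mulrA ler_wpM2r // ler_wpM2l // mulr_ge0.
    have e5 : KJ * nrm (D v) <= KJ * (K * `|v| ^+ 2) + KJ * (c * K * a * `|u|) + KJ * (c * K * `|u|).
      rewrite -!mulrDr ler_wpM2l //; apply: le_trans e2 _.
      by apply: lerD => //; apply: lerD.
    have -> : 2 * KJ * (c * (K * a + K)) * `|u| = 2 * (KJ * (c * K * a * `|u|) + KJ * (c * K * `|u|)) by ring.
    move: (KJ * (c * K * a * `|u|)) (KJ * (c * K * `|u|)) (KJ * (K * _)) (KJ * nrm _) e1 e3 e5 => x y z w; lra.
  apply: le_trans h3 _; rewrite mulrDl; apply: lerD => //.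
  rewrite -mulrA ler_wpM2l // -exprMn; apply: ler_exprn => //.
have [K1 K10 hK1] := est.
have J2 u : `|u| <= a -> `|k (g * e u * g^-1)%g - u *m L| <= KJ * K1 * `|u| ^+ 2.
  move=> ua; rewrite eL -[k _]DK -(JN JZ).
  rewrite -JD; apply: le_trans (Jb _) _; rewrite -mulrA ler_wpM2l //.
  exact: hK1.
have DL u : D (u *m L) = X u.
  apply/eqP; rewrite -subr_eq0; apply/eqP/nrm_eq0/eqP; rewrite eq_le nrm_ge0 andbT.
  have [->|u0] := eqVneq u 0; first by rewrite mul0mx (D0 hD) X0 subrr nrm0.
  have nu : 0 < `|u| by rewrite normr_gt0.
  pose K2 := (K * (KJ * K1) + K1) * `|u| ^+ 2.
  have K20 : 0 <= K2 by rewrite !mulr_ge0 ?exprn_ge0 // addr_ge0 // !mulr_ge0.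
  apply: (@small_eq0 _ K2 (a / `|u|)) => //; first by rewrite divr_gt0.
  move=> t t0 ta.
  have nt : `|t *: u| = t * `|u| by rewrite normrZ gtr0_norm.
  have hta : `|t *: u| <= a by rewrite nt -ler_pdivlMr.
  have -> : t * nrm (D (u *m L) - X u) = nrm (D ((t *: u) *m L) - X (t *: u)).
    by rewrite -scalemxAl (dfZ hD) XZ -scalerBr nrmZR gtr0_norm.
  apply: le_trans (nrm_tri (D (k (g * e (t *: u) * g^-1)%g)) _ _) _.
  have := hK1 _ hta; have := J2 _ hta; rewrite nt exprMn => h1 h2.
  have -> : K2 * t ^+ 2 = K * (KJ * K1 * (t ^+ 2 * `|u| ^+ 2)) + K1 * (t ^+ 2 * `|u| ^+ 2).
    by rewrite /K2; ring.
  apply: lerD => //; rewrite nrm_subC -(DN hD) -(dfD hD).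
  by apply: le_trans (df_bound hD _) _; rewrite ler_wpM2l.
exists L; split; first exact: DL.
by exists (KJ * K1), a; split => //; rewrite mulr_ge0.
Qed.

End Lie4.

Section ChartAd.
Variables (R : realType) (G : topologicalGroupType) (d : nat).
Variables (c : chart R G d).

Lemma jacobian_quad (f : 'rV[R]_d -> 'rV[R]_d) (x : 'rV[R]_d) (L : 'M[R]_d) (K a : R) :
  0 < a -> 0 <= K ->
  (forall u, `|u| <= a -> `|f (x + u) - f x - u *m L| <= K * `|u| ^+ 2) ->
  jacobian f x = L.
Proof.
move=> a0 K0 h.
have Lc : continuous (mulmxr L : 'rV[R]_d -> 'rV[R]_d).
  move=> u; apply/(@cvgrPdist_lt R 'rV[R]_d _ _ (nbhs_filter u)) => b b0.
  have dL : 0 < d%:R * `|L| + 1 by rewrite ltr_wpDl // mulr_ge0.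
  apply/(@near_norm R d (fun y => `|mulmxr L u - mulmxr L y| < b) u).
  exists (b / (2 * (d%:R * `|L| + 1))); first by rewrite divr_gt0 // mulr_gt0.
  move=> w hw; rewrite /= mulmxDl opprD addrA subrr add0r normrN.
  apply: le_lt_trans (mulmx_norm _ _) _.
  apply: (@le_lt_trans _ _ (b / (2 * (d%:R * `|L| + 1)) * (d%:R * `|L|))).
    by rewrite ler_wpM2r // mulr_ge0.
  rewrite mulrAC ltr_pdivrMr ?mulr_gt0 //.
  have nn : 0 <= d%:R * `|L| by exact: mulr_ge0.
  by rewrite ltr_pM2l //; move: (d%:R * `|L|) nn => z; lra.
have e : 'd f x = mulmxr L :> ('rV[R]_d -> 'rV[R]_d).
  apply: diff_unique => //; apply/eqaddoP => b b0.
  apply/(@near_norm R d (fun u => `|(f \o shift x - (cst (f x) + mulmxr L)) u| <= b * `|u|) 0).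
  exists (Num.min a (b / (K + 1))).
    by rewrite lt_min a0 divr_gt0 // ltr_wpDl.
  move=> u; rewrite le_min add0r => /andP[ua ub].
  rewrite !fctE /= [u + x]addrC opprD addrA; apply: le_trans (h u ua) _.
  rewrite expr2 mulrA ler_wpM2r //; apply: (@le_trans _ _ (K * (b / (K + 1)))).
    by rewrite ler_wpM2l.
  by rewrite mulrA ler_pdivrMr ?ltr_wpDl //; nra.
apply/row_matrixP => i; rewrite !rowE /jacobian mul_rV_lin1 e.
by [].
Qed.

Lemma Ad_quad (g : G) (L : 'M[R]_d) (K a : R) : dom c 1%g -> 0 < a -> 0 <= K ->
  (forall u, `|u| <= a -> `|ccoord c (g * cparam c u * g^-1)%g - u *m L| <= K * `|u| ^+ 2) ->
  (Ad c g)^T = L.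
Proof.
move=> dc a0 K0 h; rewrite /Ad trmxK; apply: (@jacobian_quad _ _ _ K a) => // u ua.
have := h u ua; rewrite /ccoord /cparam coordK // mulg1 mulgV.
by [].
Qed.

End ChartAd.

Ltac gmx := repeat match goal with |- context [?A * ?B] => let z := fresh "z" in set z := A * B; clearbody z end;
  apply/matrixP => ? ?; rewrite !mxE; ring.

Section Expm.
Variables (R : realType) (m : nat).
Implicit Types X Y : 'M[R[i]]_m.

Lemma expm1_le X : nrm X <= rad R -> nrm (expm X - 1) <= 2 * nrm X.
Proof.
move=> h; have r1 := rad_le1 R; have r0 := rad_gt0 R.
have := @expm_lip_rad R m X 0 (rad R); rewrite nrm0 expm0 subr0 divff ?lt0r_neq0 //.
move=> /(_ _ h (ltW r0)) h1; have {h1} : nrm (expm X - 1 - X) <= 1 / 2 * nrm X by apply: h1; lra.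
have := nrm_subl (expm X - 1) X; have := nrm_ge0 X.
by nrmgen; lra.
Qed.

Lemma small_scale X (a : R) : 0 < a -> exists2 s : R, 0 < s &
  forall t, `|t| <= s -> nrm (t%:C *: X) <= a.
Proof.
move=> a0; have n1 : 0 < nrm X + 1 by rewrite ltr_wpDl ?nrm_ge0.
exists (a / (nrm X + 1)); first by rewrite divr_gt0.
move=> t ht; rewrite nrmZR; apply: (@le_trans _ _ (a / (nrm X + 1) * nrm X)).
  by rewrite ler_wpM2r ?nrm_ge0.
by rewrite mulrAC ler_pdivrMr // ler_pM2l // lerDl.
Qed.

Lemma realZZ (a b : R) X : a%:C *: (b%:C *: X) = (a * b)%:C *: X.
Proof. by rewrite scalerA rmorphM. Qed.

Lemma realZKV (a : R) X : a != 0 -> a^-1%:C *: (a%:C *: X) = X.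
Proof. by move=> a0; rewrite realZZ mulVf // rmorph1 scale1r. Qed.

End Expm.

(** The Lie algebra of rho G, described by one-parameter groups so as not to depend on a chart. Its
    linear structure comes from [adapted], where it is the range of a linear map. *)
Definition lalg (R : realType) (G : topologicalGroupType) m (rho : G -> 'M[R[i]]_m) :
    set 'M[R[i]]_m :=
  [set X | forall s : R, exists g, rho g = expm (s%:C *: X)].

(* [D] is the differential of [rho] at 1 in the coordinates of [c]. *)
Record adapted (R : realType) (G : topologicalGroupType) (d m : nat)
    (rho : G -> 'M[R[i]]_m) (c : chart R G d) (D : 'rV[R]_d -> 'M[R[i]]_m) : Prop := {
  adD : forall u w, D (u + w) = D u + D w ;
  adZ : forall (a : R) u, D (a *: u) = a%:C *: D u ;
  ad_inj : forall u, D u = 0 -> u = 0 ;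
  ad_range : forall X, lalg rho X <-> exists u, X = D u ;
  ad_bound : exists2 K : R, 0 <= K & forall u, nrm (D u) <= K * `|u| ;
  ad_Ad : forall g u, D (u *m (Ad c g)^T) = rho g * D u * rho (g^-1)%g }.

(** * The Lie algebra of the image *)

Section Package.
Variables (R : realType) (G : topologicalGroupType) (d m : nat).
Variables (L : lie_structure R G d) (rho : G -> 'M[R[i]]_m).
Hypothesis hG : simple_compact G.
Hypothesis rho1 : rho 1%g = 1.
Hypothesis rhoM : forall x y, rho (x * y)%g = rho x * rho y.
Hypothesis rhoN : forall g0 (a : R), 0 < a -> \forall g \near g0, nrm (rho g - rho g0) < a.
Hypothesis rho_nt : exists g, rho g <> 1.

(** Simplicity enters here: the kernel is a closed normal subgroup, proper since [rho] is not
    trivial. *)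
Lemma ker_finite : finite_set [set g | rho g = 1].
Proof.
have [_ _ _ _ hs] := hG; apply: hs.
- split=> //= [x y hx hy|x hx|g x hx]; first by rewrite rhoM hx hy mulr1.
    by rewrite -[LHS]mul1r -hx (rhoV rho1 rhoM).
  by rewrite !rhoM hx mulr1 (rhoV rho1 rhoM).
- rewrite -(setCK [set g | _]); apply: open_closedC; rewrite openE => g /= hg.
  have n0 : 0 < nrm (rho g - 1).
    rewrite lt_neqAle nrm_ge0 andbT eq_sym; apply/eqP => /nrm_eq0/eqP.
    by rewrite subr_eq0 => /eqP.
  by apply: filterS (rhoN g n0) => x /= hx h1; move: hx; rewrite h1 nrm_subC ltxx.
- by move=> h; have [g hg] := rho_nt; apply: hg; have : [set: G] g by []; rewrite -h.
Qed.

Lemma ker_discrete : exists2 V : set G, nbhs 1%g V & forall g, V g -> rho g = 1 -> g = 1%g.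
Proof.
have [hh _ _ _ _] := hG.
exists (~` ([set g | rho g = 1] `\ 1%g)).
  apply: open_nbhs_nbhs; split; last by move=> -[_ /=]; apply.
  apply: closed_openC; apply: (iffLR accessible_finite_set_closed (hausdorff_accessible hh)).
  exact: finite_setD ker_finite.
by move=> g /= h1 h2; apply: contrapT => h3; apply: h1.
Qed.

Section OneChart.
Variables (c : chart R G d) (ac : atlas L c) (dc : dom c 1%g).

(** For X in the Lie algebra and t small, exp (t X) is close to 1 and lies in rho G, so it is some
    exp (D u) with D u small; injectivity of the exponential near 0 gives t X = D u. *)
Lemma chart_package : exists (D : 'rV[R]_d -> 'M[R[i]]_m), [/\ adapted rho c D,
  forall a : R, 0 < a -> exists2 b : R, 0 < b &
    forall g, nrm (rho g - 1) < b -> exists X, [/\ lalg rho X, nrm X <= a & rho g = expm X]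
  & forall W : set G, nbhs 1%g W -> exists2 a : R, 0 < a &
    forall X, lalg rho X -> nrm X <= a -> exists2 g, W g & rho g = expm X].
Proof.
have [hh cptG conG _ _] := hG.
have [r [C lc]] := local_coords_chart ac dc.
have [D [s [K hD]]] := F_diff lc rho1 rhoM rhoN.
have kerV := ker_discrete.
have inj := D_inj lc rho1 rhoM hD kerV.
have [J [KJ [KJ0 JD JZ DK Jb]]] := real_linear_inv (dfD hD) (dfZ hD) inj.
have near := near_expm lc rho1 rhoM rhoN cptG hD KJ0 JD JZ DK Jb.
have r0 := rad_gt0 R; have K0 := df_K hD; have K1 : 0 < K + 1 by exact: ltr_wpDl K0 ltr01.
have rng u : lalg rho (D u).
  move=> t; have [g hg] := expm_rho rho1 rhoM rhoN cptG hD (t *: u).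
  by exists g; rewrite hg (dfZ hD).
have DKb (a : R) u : 0 <= a -> `|u| <= a / (K + 1) -> nrm (D u) <= a.
  move=> a0 hu; apply: le_trans (df_bound hD _) _.
  apply: (@le_trans _ _ (K * (a / (K + 1)))); first by rewrite ler_wpM2l.
  rewrite mulrCA; apply: ler_piMr => //.
  by rewrite ler_pdivrMr // mul1r lerDl.
have range X : lalg rho X <-> exists u, X = D u.
  split; last by case=> u ->.
  move=> hX; have [|b b0 hb] := near (rad R / (K + 1)); first by rewrite divr_gt0.
  have [|t t0 ht] := @small_scale R m X (Num.min (rad R) (b / 3)).
    by rewrite lt_min r0 divr_gt0.
  have /ht : `|t| <= t by rewrite gtr0_norm.
  rewrite le_min => /andP[h1 h2].
  have [g hg] := hX t.
  have [|u hu ru] := hb g.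
    rewrite hg; apply: le_lt_trans (expm1_le h1) _; move: h2 b0; nrmgen; lra.
  exists (t^-1 *: u); rewrite (dfZ hD) -[LHS](@realZKV R m t) ?lt0r_neq0 //; congr (_ *: _).
  apply: expm_inj => //; last by rewrite -hg.
  exact: DKb (ltW r0) hu.
exists D; split.
- split=> //; [exact: dfD hD|exact: dfZ hD| |].
    by exists K => //; exact: df_bound hD.
  move=> g u; have [A [hA1 [K' [a [a0 K'0 hA2]]]]] := Ad_diff lc rho1 rhoM hD KJ0 JD JZ DK Jb g.
  by rewrite (Ad_quad dc a0 K'0 hA2) hA1.
- move=> a a0; have [|b b0 hb] := near (a / (K + 1)); first by rewrite divr_gt0.
  exists b => // g /hb [u hu ru]; exists (D u); split => //.
  exact: DKb (ltW a0) hu.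
- move=> W hW; have [s1 s10 hs1] := lc_cont lc hW.
  have [b b0 hb] := near_F lc rho1 rhoM rhoN cptG s10.
  exists (Num.min (rad R) (b / 3)); first by rewrite lt_min r0 divr_gt0.
  move=> X hX; rewrite le_min => /andP[h1 h2].
  have [g] := hX 1; rewrite rmorph1 scale1r => hg.
  have [|u hu ru] := hb g.
    rewrite hg; apply: le_lt_trans (expm1_le h1) _; move: h2 b0; nrmgen; lra.
  by exists (cparam c u); [exact: hs1 | rewrite -ru].
Qed.

End OneChart.

Lemma adapted_ex c : atlas L c -> dom c 1%g -> exists D, adapted rho c D.
Proof. by move=> ac dc; have [D []] := chart_package ac dc; exists D. Qed.

Lemma small_log (a : R) : 0 < a -> exists2 b : R, 0 < b &
  forall g, nrm (rho g - 1) < b -> exists X, [/\ lalg rho X, nrm X <= a & rho g = expm X].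
Proof.
by have [c ac dc] := atlas_cover L 1%g; have [D [_ h _]] := chart_package ac dc; apply: h.
Qed.

Lemma small_lift (W : set G) : nbhs 1%g W -> exists2 a : R, 0 < a &
  forall X, lalg rho X -> nrm X <= a -> exists2 g, W g & rho g = expm X.
Proof.
by have [c ac dc] := atlas_cover L 1%g; have [D [_ _ h]] := chart_package ac dc; apply: h.
Qed.

(** A connected group is generated by any neighbourhood of 1, where rho g is an exponential.
    Carrying the property for g and its inverse together makes the set a subgroup. *)
Lemma gen_expm (P : 'M[R[i]]_m -> Prop) :
  (forall X Y, P X -> P Y -> P (X * Y)) -> (forall X, lalg rho X -> P (expm X)) ->
  forall g, P (rho g).
Proof.
move=> PM PX g; have [_ _ conG _ _] := hG.
suff : forall g, P (rho g) /\ P (rho (g^-1)%g) by case/(_ g).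
apply: conn_subgroup => //.
- by move=> x y [h1 h2] [h3 h4]; rewrite invgM !rhoM; split; apply: PM.
- by move=> x [h1 h2]; rewrite invgK.
- have [b b0 hb] := small_log (@ltr01 R).
  have := rhoN 1%g b0; rewrite rho1; apply: filterS => x /hb [X [hX _ ex]].
  split; first by rewrite ex; apply: PX.
  have -> : rho (x^-1)%g = expm (- X).
    rewrite -[LHS]mul1r -(expmNl X) -mulrA -ex (rhoV rho1 rhoM) mulr1 //.
  apply: PX => s; have [y hy] := hX (- s); exists y; rewrite hy.
  by rewrite rmorphN scaleNr scalerN.
Qed.

Lemma lalgD X Y : lalg rho X -> lalg rho Y -> lalg rho (X + Y).
Proof.
have [c ac dc] := atlas_cover L 1%g; have [D hD] := adapted_ex ac dc.
move=> /(ad_range hD) [u ->] /(ad_range hD) [w ->]; apply/(ad_range hD).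
by exists (u + w); rewrite (adD hD).
Qed.

Lemma lalgZ (a : R) X : lalg rho X -> lalg rho (a%:C *: X).
Proof. by move=> hX s; have [g hg] := hX (s * a); exists g; rewrite realZZ. Qed.

Lemma lalgN X : lalg rho X -> lalg rho (- X).
Proof. by move=> /(lalgZ (-1)); rewrite rmorphN1 scaleN1r. Qed.

Lemma lalg0 : lalg rho 0.
Proof. by move=> s; exists 1%g; rewrite scaler0 expm0. Qed.

Lemma lalgB X Y : lalg rho X -> lalg rho Y -> lalg rho (X - Y).
Proof. by move=> hX hY; apply: lalgD => //; apply: lalgN. Qed.

Lemma expm_conj g X : expm (rho g * X * rho (g^-1)%g) = rho g * expm X * rho (g^-1)%g.
Proof.
have : expm (rho g * X * rho (g^-1)%g) * rho g = rho g * expm X.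
  apply: expm_intertwine; rewrite !mulmxE -mulrA (rhoVl rho1 rhoM) mulr1 //.
by move=> <-; rewrite -[RHS]mulrA (rhoV rho1 rhoM) mulr1.
Qed.

Lemma lalg_conj g X : lalg rho X -> lalg rho (rho g * X * rho (g^-1)%g).
Proof.
move=> hX s; have [y hy] := hX s; exists (g * y * g^-1)%g.
by rewrite !rhoM hy -expm_conj mxsAl mxsAr.
Qed.

(** The defect X - D (J X) vanishes on the Lie algebra and is Lipschitz in X. *)
Lemma lalg_closed X : (forall a : R, 0 < a -> exists2 Z, lalg rho Z & nrm (X - Z) <= a) ->
  lalg rho X.
Proof.
have [c ac dc] := atlas_cover L 1%g; have [D hD] := adapted_ex ac dc => hX.
have [J [KJ [KJ0 JD JZ DK Jb]]] := real_linear_inv (adD hD) (adZ hD) (ad_inj hD).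
have [K K0 Kb] := ad_bound hD.
apply/(ad_range hD); exists (J X); apply/eqP; rewrite -subr_eq0; apply/eqP/nrm_eq0/eqP.
rewrite eq_le nrm_ge0 andbT; apply/ler_addgt0Pl => a a0; rewrite addr0.
have KK : 0 < K * KJ + 1 by rewrite ltr_wpDl // mulr_ge0.
have [|Z /(ad_range hD) [u uZ] hZ] := hX (a / (K * KJ + 1)); first by rewrite divr_gt0.
have -> : X - D (J X) = (X - Z) - D (J (X - Z)).
  have DN' w : D (- w) = - D w by rewrite -scaleN1r (adZ hD) rmorphN1 scaleN1r.
  rewrite JD (JN JZ) (adD hD) uZ DK DN' opprD opprK.
  by rewrite addrACA [- D u + _]addrC subrr addr0.
apply: le_trans (nrmB _ _) _.
have h1 : nrm (D (J (X - Z))) <= K * KJ * nrm (X - Z).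
  by apply: le_trans (Kb _) _; rewrite -mulrA ler_wpM2l.
apply: (@le_trans _ _ ((K * KJ + 1) * nrm (X - Z))).
  by rewrite mulrDl mul1r addrC lerD2r.
by rewrite mulrC -ler_pdivlMr.
Qed.

Lemma conj_diff (X Y : 'M[R[i]]_m) : exists2 K : R, 0 <= K & forall t : R, 0 < t -> t <= 1 ->
  nrm (expm (t%:C *: X) * Y * expm (- (t%:C *: X)) - Y - t%:C *: (X * Y - Y * X)) <= K * t ^+ 2.
Proof.
have [c c0 cb] : exists2 c : R, 0 <= c & forall t : R, 0 < t -> t <= 1 -> forall s : R, `|s| = t ->
    nrm (expm (s%:C *: X) - 1 - s%:C *: X) <= c * t ^+ 2.
  exists (2 * nrm X * expR (nrm X) * nrm X); first by rewrite !mulr_ge0 ?nrm_ge0 ?expR_ge0.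
  move=> t t0 t1 s st.
  have := @expm_lip R m (s%:C *: X) 0 (t * nrm X); rewrite nrm0 expm0 subr0 nrmZR st.
  move=> /(_ (lexx _)) h; have {}h := h (mulr_ge0 (ltW t0) (nrm_ge0 X)).
  apply: le_trans h _.
  have -> : 2 * (t * nrm X) * expR (t * nrm X) * (t * nrm X) = 2 * nrm X * expR (t * nrm X) * nrm X * t ^+ 2 by ring.
  have n0 := nrm_ge0 X.
  apply: ler_wpM2r; first by rewrite exprn_ge0 // ltW.
  apply: ler_wpM2r => //; apply: ler_wpM2l; first exact: mulr_ge0.
  by rewrite ler_expR ler_piMl.
have nX := nrm_ge0 X; have nY := nrm_ge0 Y; have e0 := expR_ge0 (nrm X).
exists (c * nrm Y * expR (nrm X) + nrm Y * c + nrm X * nrm Y * (nrm X + c)).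
  by rewrite !addr_ge0 ?mulr_ge0 ?addr_ge0.
move=> t t0 t1; set A := expm _; set B := expm _.
have hA := cb t t0 t1 t (gtr0_norm t0); rewrite -/A in hA.
have hB := cb t t0 t1 (- t); rewrite normrN (gtr0_norm t0) rmorphN scaleNr -/B in hB.
have {}hB := hB erefl.
have nB : nrm B <= expR (nrm X).
  by apply: le_trans (nrm_expm _) _; rewrite nrmN nrmZR gtr0_norm // ler_expR ler_piMl.
have t2 : 0 <= t ^+ 2 by rewrite exprn_ge0 // ltW.
pose x : 'M[R[i]]_m := t%:C *: X.
have -> : A * Y * B - Y - t%:C *: (X * Y - Y * X) =
    (A - 1 - x) * Y * B + (Y * (B - 1 - - x) + x * Y * (B - 1)).
  rewrite scalerBr mxsAl mxsAr -/x.
  by rewrite !(mulrBl, mulrBr, mulrDl, mulrDr, mulrN, mulNr, mul1r, mulr1, opprK, mulrA); gmx.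
apply: le_trans (nrmD _ _) _; rewrite [leRHS]mulrDl [in leRHS]mulrDl -[leRHS]addrA; apply: lerD.
  apply: le_trans (nrmM _ _) _.
  have h1 : nrm ((A - 1 - x) * Y) <= c * t ^+ 2 * nrm Y.
    by apply: le_trans (nrmM _ _) _; rewrite ler_wpM2r.
  apply: le_trans (ler_pM (nrm_ge0 _) (nrm_ge0 _) h1 nB) _.
  by rewrite le_eqVlt; apply/orP; left; apply/eqP; ring.
apply: le_trans (nrmD _ _) _; apply: lerD.
  apply: le_trans (nrmM _ _) _; rewrite -mulrA ler_wpM2l //.
have nx : nrm x = t * nrm X by rewrite nrmZR gtr0_norm.
have h2 : nrm (B - 1) <= t * (nrm X + c).
  have := nrm_subl (B - 1) (- x); rewrite nrmN nx => h; apply: le_trans h _.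
  rewrite mulrDr addrC lerD2l; apply: le_trans hB _.
  by rewrite expr2 [leRHS]mulrC mulrA ler_piMr // mulr_ge0 // ltW.
apply: le_trans (nrmM _ _) _.
have h1 : nrm (x * Y) <= t * nrm X * nrm Y by rewrite -nx; exact: nrmM.
apply: le_trans (ler_pM (nrm_ge0 _) (nrm_ge0 _) h1 h2) _.
by rewrite le_eqVlt; apply/orP; left; apply/eqP; ring.
Qed.

(** The bracket is the limit of (exp (tX) Y exp (-tX) - Y)/t, and these quotients lie in the Lie
    algebra. *)
Lemma lalg_bracket X Y : lalg rho X -> lalg rho Y -> lalg rho (X * Y - Y * X).
Proof.
move=> hX hY; apply: lalg_closed => a a0.
have [K K0 hK] := conj_diff X Y.
pose t := Num.min 1 (a / (K + 1)).
have K1 : 0 < K + 1 by exact: ltr_wpDl K0 ltr01.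
have t0 : 0 < t by rewrite lt_min ltr01 divr_gt0.
have t1 : t <= 1 by rewrite /t ge_min lexx.
have ta : t <= a / (K + 1) by rewrite /t ge_min lexx orbT.
have [g hg] := hX t.
have hgV : rho (g^-1)%g = expm (- (t%:C *: X)).
  by rewrite -[LHS]mul1r -(expmNl (t%:C *: X)) -mulrA -hg (rhoV rho1 rhoM) mulr1.
exists (t^-1%:C *: (rho g * Y * rho (g^-1)%g - Y)).
  by apply: lalgZ; apply: lalgB => //; apply: lalg_conj.
have tn : t != 0 by rewrite lt0r_neq0.
rewrite -[X * Y - _](realZKV _ tn) -scalerBr nrmZR nrm_subC hg hgV.
rewrite gtr0_norm ?invr_gt0 // mulrC ler_pdivrMr //.
apply: le_trans (hK t t0 t1) _; rewrite expr2 mulrA; apply: ler_wpM2r; first exact: ltW.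
rewrite mulrC; apply: (@le_trans _ _ (a / (K + 1) * K)); first by rewrite ler_wpM2r.
by rewrite mulrAC ler_pdivrMr // ler_pM2l // lerDl.
Qed.

End Package.

(** * Semisimplicity *)

Lemma nuniq_perm (T : eqType) (s : seq T) : ~~ uniq s -> exists z t, perm_eq s [:: z, z & t].
Proof.
elim: s => //= x s IH; rewrite negb_and negbK; have [xs _|_ /= /IH [z [t h]]] := boolP (x \in s).
  by exists x, (rem x s); rewrite perm_cons perm_to_rem.
exists z, (x :: t); rewrite -(perm_cons x) in h; apply: (perm_trans h).
by apply/seq.permP => p /=; rewrite addnCA; congr (_ + _)%N; rewrite addnCA.
Qed.

(** Over a closed field a repeated factor of the minimal polynomial could be cancelled once, as no
    vector needs the square of a linear factor; so its roots are simple. *)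
Lemma ss_diag (F : closedFieldType) n (A : 'M[F]_n) :
  (forall (z : F) (u : 'rV_n), u *m (A - z%:M) *m (A - z%:M) = 0 -> u *m (A - z%:M) = 0) ->
  diagonalizable A.
Proof.
case: n A => [|n] A h; first by exists 1%:M; rewrite ?unitmx1 //; apply/is_diag_mxP => -[].
apply/diagonalizableP; have [rs] := closed_field_poly_normal (mxminpoly A).
rewrite (eqP (mxminpoly_monic A)) scale1r => ers.
exists rs; last by rewrite ers.
apply: contraT => /nuniq_perm [z [t ht]]; exfalso.
pose q := \prod_(x <- t) ('X - x%:P).
have ep : mxminpoly A = q * ('X - z%:P) * ('X - z%:P).
  by rewrite ers (perm_big _ ht) !big_cons /= mulrC [X in X * _ = _]mulrC.
have hz : horner_mx A ('X - z%:P) = A - z%:M.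
  by rewrite rmorphB /= horner_mx_X horner_mx_C.
have h0 : horner_mx A (q * ('X - z%:P)) = 0.
  rewrite (rmorphM (horner_mx A)) /= hz; apply/row_matrixP => i; rewrite row0 -mulmxE row_mul.
  apply: h; rewrite -!row_mul mulmxE -hz -!rmorphM /= -ep mx_root_minpoly row0 //.
have := mxminpoly_min h0; rewrite ep => /dvdp_leq.
have mq : q * ('X - z%:P) \is monic by rewrite monicMl ?monicXsubC // monic_prod_XsubC.
rewrite monic_neq0 // => /(_ isT); rewrite size_Mmonic ?monicXsubC ?monic_neq0 //.
by rewrite size_XsubC addn2 ltnn.
Qed.

Lemma pow_bdd (R : realType) (a c : R) : 0 <= a -> (forall n, a ^+ n <= c) -> a <= 1.
Proof.
move=> a0 h; rewrite leNgt; apply/negP => a1.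
have B n : 1 + n%:R * (a - 1) <= a ^+ n.
  elim: n => [|n IH]; first by rewrite mul0r addr0 expr0.
  rewrite exprS; apply: (@le_trans _ _ (a * (1 + n%:R * (a - 1)))); last by rewrite ler_wpM2l.
  have : 0 <= n%:R * (a - 1) * (a - 1) by rewrite !mulr_ge0 // subr_ge0 ltW.
  rewrite -natr1; nra.
have c0 : 0 <= c by apply: le_trans (h 0%N).
have d0 : 0 < a - 1 by rewrite subr_gt0.
have [n hn] := nat_floor (divr_ge0 c0 (ltW d0)).
have := h n.+1; have := B n.+1; move: hn => /andP[_]; rewrite ltr_pdivrMr //; lra.
Qed.

Section Bdd.
Variables (R : realType) (m : nat).
Implicit Types (X : 'M[R[i]]_m) (u : 'rV[R[i]]_m).

(** Takes the place of being skew-hermitian: it passes from the compact group to its Lie algebra at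
    no cost and suffices for an imaginary, semisimple spectrum. *)
Definition bdd X := exists c, forall t : R, nrm (expm (t%:C *: X)) <= c.

Lemma le_all_eq0 (x c : R) : 0 <= x -> (forall n : nat, n%:R * x <= c) -> x = 0.
Proof.
move=> x0 h; apply/eqP; rewrite eq_le x0 andbT leNgt; apply/negP => xp.
have c0 : 0 <= c by have := h 0%N; rewrite mul0r.
have [n /andP[_ hn]] := nat_floor (divr_ge0 c0 (ltW xp)).
by have := h n.+1; rewrite leNgt -ltr_pdivrMr // hn.
Qed.

(** Here u exp (tX) = u + t uX, which grows linearly in t unless uX = 0. *)
Lemma bdd_nilp X u : bdd X -> u *m X *m X = 0 -> u *m X = 0.
Proof.
move=> [c hc] h.
have key (t : R) : u *m expm (t%:C *: X) = u + t%:C *: (u *m X).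
  have := cvm_mul (cvm_cst u) (expm_cvm (t%:C *: X)).
  have pw (a : R[i]) N : u *m (1 + a *: X) ^+ N = u + (N%:R * a) *: (u *m X).
    elim: N => [|N IH]; first by rewrite expr0 mulmx1 mul0r scale0r addr0.
    rewrite exprSr -mulmxE mulmxA IH mulmxDr mulmx1 -scalemxAr mulmxDl -scalemxAl h scaler0 addr0.
    by rewrite -addrA -scalerDl -natr1 mulrDl mul1r.
  move=> h1; apply: cvm_unique h1 _; apply: eq_cvm (cvm_cst _) => k.
  rewrite /pk scalerA pw; congr (_ + _ *: _).
  rewrite mulrA natrX.
  have -> : 2 ^+ k * (2 ^- k)%:C = 1 :> R[i].
    have -> : (2 ^+ k : R[i]) = (2 ^+ k)%:C by rewrite rmorphXn /= rmorph_nat.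
    by rewrite -rmorphM divff ?rmorph1 // lt0r_neq0 ?p2_gt0.
  by rewrite mul1r.
apply/nrm_eq0/(@le_all_eq0 _ (nrm u * c + nrm u)) => // [|n]; first exact: nrm_ge0.
have -> : n%:R * nrm (u *m X) = nrm ((n%:R)%:C *: (u *m X)) by rewrite nrmZR ger0_norm.
have -> : (n%:R)%:C *: (u *m X) = u *m expm ((n%:R)%:C *: X) - u by rewrite key addrC addKr.
apply: le_trans (nrmB _ _) _; rewrite lerD2r; apply: le_trans (nrm_mulmx _ _) _.
by rewrite ler_wpM2l ?nrm_ge0.
Qed.

Lemma scale_Im (t a : R) : t%:C * (0 +i* a) = (0 +i* (t * a)) :> R[i].
Proof. by apply/eqP; rewrite eq_complex /= !mul0r mulr0 subr0 addr0 !eqxx. Qed.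

Lemma bdd_shift X (a : R) : bdd X -> bdd (X + (0 +i* a)%:M).
Proof.
move=> [c hc]; exists c => t; rewrite scalerDr scale_scalar_mx scale_Im.
rewrite expmD; last by rewrite -!mulmxE scalar_mxC.
rewrite expm_cis; apply: le_trans (nrmM _ _) _.
apply: le_trans (hc t); rewrite -[leRHS]mulr1 ler_wpM2l ?nrm_ge0 //.
by apply: le_trans (nrm_scalar _ _) _; rewrite normc_cis.
Qed.

(** The eigenvalue of exp (tX) on u has bounded powers, hence modulus at most 1; it is 1 + t z +
    O(t^2), and small t of both signs give Re z = 0. *)
Lemma bdd_eig X u (z : R[i]) : bdd X -> u != 0 -> u *m X = z *: u -> Re z = 0.
Proof.
move=> [c hc] u0 hu.
have nu : 0 < nrm u by rewrite lt_neqAle nrm_ge0 andbT eq_sym; apply: contra u0 => /eqP/nrm_eq0 ->.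
have key (t : R) : exists2 w : R[i], u *m expm (t%:C *: X) = w *: u & normc w <= 1.
  pose W := expm ((t%:C * z)%:M : 'M[R[i]]_1).
  have hW : u *m expm (t%:C *: X) = W 0 0 *: u.
    rewrite -(expm_intertwine (A := (t%:C * z)%:M)); last first.
      by rewrite mul_scalar_mx -scalemxAr hu scalerA.
    by rewrite -/W [W]mx11_scalar mul_scalar_mx !mxE eqxx mulr1n.
  exists (W 0 0) => //; apply: (@pow_bdd _ _ c); first exact: normc_ge0.
  move=> n; rewrite -(ler_pM2r nu).
  have hn : u *m expm (t%:C *: X) ^+ n = W 0 0 ^+ n *: u.
    elim: n => [|n IH]; first by rewrite !expr0 mulmx1 scale1r.
    by rewrite exprSr -mulmxE mulmxA IH -scalemxAl hW scalerA exprSr.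
  have -> : normc (W 0 0) ^+ n * nrm u = nrm (W 0 0 ^+ n *: u).
    rewrite nrmZ; congr (_ * _); elim: n {hn} => [|n IH]; first by rewrite !expr0 normc1.
    by rewrite !exprS normcM IH.
  rewrite -hn -expmMn -scaler_nat scalerA -(rmorph_nat (real_complex R)) -rmorphM mulrC.
  by apply: le_trans (nrm_mulmx _ _) _; rewrite [leRHS]mulrC ler_wpM2l ?nrm_ge0 ?hc.
have r0 := rad_gt0 R; have n0 := nrm_ge0 X.
pose K := nrm X ^+ 2 / rad R / 2.
have K0 : 0 <= K by rewrite divr_ge0 // divr_ge0 ?exprn_ge0 // ltW.
have N1 : 0 < nrm X + 1 by exact: ltr_wpDl.
have est (t : R) : `|t| <= 1 / (nrm X + 1) -> t * Re z <= K * t ^+ 2.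
  move=> ht; have nt : nrm (t%:C *: X) <= 1.
    rewrite nrmZR; apply: (@le_trans _ _ (1 / (nrm X + 1) * nrm X)); first by rewrite ler_wpM2r.
    by rewrite mulrAC mul1r ler_pdivrMr // mul1r lerDl.
  have [w hw w1] := key t.
  have h1 : normc (w - 1 - t%:C * z) <= K * t ^+ 2.
    rewrite -(ler_pM2r nu) -nrmZ.
    have -> : (w - 1 - t%:C * z) *: u = u *m (expm (t%:C *: X) - 1 - t%:C *: X).
      by rewrite !mulmxBr mulmx1 hw -scalemxAr hu !scalerBl scale1r scalerA.
    apply: le_trans (nrm_mulmx _ _) _; rewrite mulrC ler_wpM2r ?nrm_ge0 //.
    apply: le_trans (expm1_lin nt) _; rewrite nrmZR exprMn real_normK ?num_real //.
    by rewrite /K le_eqVlt; apply/orP; left; apply/eqP; ring.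
  have := le_trans (Re_le_normc _) h1; have := le_trans (Re_le_normc _) w1.
  case: (w) => w1' w2; case: (z) => z1 z2 /=.
  rewrite !mul0r !subr0 => h2 h3.
  have h4 := le_trans (ler_norm _) h2; move: h3; rewrite ler_norml => /andP[h3 _].
  by move: (K * t ^+ 2) (t * z1) h3 => p q h3; lra.
have e1 : Re z <= 0.
  apply: (@small_eq0 _ _ K (1 / (nrm X + 1))) => //; first by rewrite divr_gt0.
  by move=> t t0 ht; apply: est; rewrite gtr0_norm.
have e2 : - Re z <= 0.
  apply: (@small_eq0 _ _ K (1 / (nrm X + 1))) => //; first by rewrite divr_gt0.
  by move=> t t0 ht; have := est (- t); rewrite normrN gtr0_norm // sqrrN mulNr -mulrN; apply.
by apply/eqP; rewrite eq_le e1 -oppr_le0 e2.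
Qed.

Lemma bdd_diag X : bdd X -> diagonalizable X.
Proof.
move=> hX; apply: ss_diag => z u h; set v := u *m (X - z%:M).
have [//|v0] := eqVneq v 0.
have hv : v *m X = z *: v.
  by apply/eqP; rewrite -subr_eq0 -mul_mx_scalar -mulmxBr /v h.
have hz := bdd_eig hX v0 hv.
have e : X - z%:M = X + (0 +i* - Im z)%:M.
  congr (_ + _); rewrite -raddfN /=; congr _%:M.
  by case: (z) hz => a b /= ->; rewrite /GRing.opp /= oppr0.
by rewrite /v e; apply: bdd_nilp; [exact: bdd_shift | rewrite -e].
Qed.

Lemma bdd_spec X : bdd X -> exists P (D : 'rV[R[i]]_m), [/\ P \in unitmx,
  P *m X = diag_mx D *m P & forall j, Re (D 0 j) = 0].
Proof.
move=> hX; have [P uP /diagonalizable_forPex [D /(simmxP uP) hD]] := bdd_diag hX.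
exists P, D; split=> // j; apply: (bdd_eig (u := row j P) hX).
  apply/eqP => h0; have : row j P *m invmx P = 0 by rewrite h0 mul0mx.
  rewrite -row_mul mulmxV // => /rowP/(_ j); rewrite !mxE eqxx => /eqP.
  by rewrite oner_eq0.
by rewrite -row_mul hD row_mul row_diag_mx -scalemxAl -rowE.
Qed.

(** The eigenvalues are imaginary, so the real part of tr X^2 is minus the sum of the squares of
    their imaginary parts. *)
Lemma bdd_tr2 X : bdd X -> Re (\tr (X * X)) <= 0 /\ (Re (\tr (X * X)) = 0 -> X = 0).
Proof.
move=> /bdd_spec [P [D [uP hD D0]]].
have eX : X = invmx P *m diag_mx D *m P by rewrite -mulmxA -hD mulKmx.
have -> : \tr (X * X) = \sum_j D 0 j * D 0 j.
  rewrite -[X * X](mulKmx uP) mxtrace_mulC -mulmxE mulmxA hD -[_ *m X]mulmxA hD mulmxA mulmxK //.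
  by rewrite mulmx_diag mxtrace_diag; apply: eq_bigr => j _; rewrite mxE.
have -> : Re (\sum_j D 0 j * D 0 j) = - \sum_j Im (D 0 j) ^+ 2.
  rewrite raddf_sum -sumrN; apply: eq_bigr => j _.
  by have := D0 j; case: (D 0 j) => a b /= ->; rewrite mul0r sub0r expr2.
split; first by rewrite oppr_le0 sumr_ge0 // => j _; rewrite sqr_ge0.
move/eqP; rewrite oppr_eq0 psumr_eq0 => [/allP h|j _]; last exact: sqr_ge0.
have -> : X = 0.
  rewrite eX; suff -> : D = 0 by rewrite raddf0 mulmx0 mul0mx.
  apply/rowP => j; have := h j (mem_index_enum _); rewrite /= sqrf_eq0 => /eqP.
  by have := D0 j; case: (D 0 j) => a b /= -> ->; rewrite mxE.
by [].
Qed.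

End Bdd.

Section LalgSpec.
Variables (R : realType) (G : topologicalGroupType) (d m : nat).
Variables (L : lie_structure R G d) (rho : G -> 'M[R[i]]_m).
Hypothesis hG : simple_compact G.
Hypothesis rhoN : forall g0 (a : R), 0 < a -> \forall g \near g0, nrm (rho g - rho g0) < a.

Lemma rho_bounded : exists c, forall g, nrm (rho g) <= c.
Proof.
have [_ cptG _ _ _] := hG.
have cf := continuous_subspaceT (A := [set: G]) (cont_nrm (L := 0) rhoN).
have [|x _ hx] := compact_EVT_max _ cptG cf; first by exists 1%g.
exists (nrm (rho x - 0)) => g; rewrite -[rho g]subr0.
by apply: hx; rewrite inE.
Qed.

Lemma lalg_bdd X : lalg rho X -> bdd X.
Proof.
by have [c hc] := rho_bounded; move=> hX; exists c => t; have [g <-] := hX t.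
Qed.

Lemma lalg_tr2 X : lalg rho X -> Re (\tr (X * X)) <= 0 /\ (Re (\tr (X * X)) = 0 -> X = 0).
Proof. by move/lalg_bdd; exact: bdd_tr2. Qed.

(** Both X and iX would have a nonpositive trace form, and these two values are opposite. *)
Lemma lalg_i X : lalg rho X -> lalg rho ((0 +i* 1) *: X) -> X = 0.
Proof.
move=> /lalg_tr2 [h1 h2] /lalg_tr2 [h3 _]; apply: h2; apply/eqP; rewrite eq_le h1 /=.
move: h3; rewrite -mxsAl -mxsAr scalerA linearZ /=.
have -> : (0 +i* 1) * (0 +i* 1) = -1 :> R[i].
  by rewrite -expr2 sqr_i.
by rewrite mulN1r raddfN oppr_le0.
Qed.

End LalgSpec.

(** * Surjectivity of the exponential, conjugation into the torus *)

Section Mc.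
Variables (R : realType) (T : topologicalType) (m : nat).

Definition mcont (f : T -> 'M[R[i]]_m) :=
  forall x (a : R), 0 < a -> \forall y \near x, nrm (f y - f x) < a.

Lemma mcont_cst A : mcont (fun=> A).
Proof. by move=> x a a0; apply: nearW => y; rewrite subrr nrm0. Qed.

Lemma mcontM f g : mcont f -> mcont g -> mcont (fun x => f x * g x).
Proof.
move=> hf hg x a a0.
have [F0 G0] : 0 < nrm (f x) + 1 /\ 0 < nrm (g x) + 1 by split; rewrite ltr_wpDl ?nrm_ge0.
have b1 : 0 < Num.min 1 (a / (2 * (nrm (f x) + 1))) by rewrite lt_min ltr01 divr_gt0 ?mulr_gt0.
have b2 : 0 < a / (2 * (nrm (g x) + 1)) by rewrite divr_gt0 ?mulr_gt0.
apply: filterS2 (hg x _ b1) (hf x _ b2) => y; rewrite lt_min => /andP[h1 h2] h3.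
have -> : f y * g y - f x * g x = (f y - f x) * g y + f x * (g y - g x).
  by rewrite mulrBl mulrBr addrA subrK.
apply: le_lt_trans (nrmD _ _) _.
have n1 : nrm (g y) <= nrm (g x) + 1.
  by apply: le_trans (nrm_subl _ (g x)) _; rewrite addrC lerD2l ltW.
have e1 : nrm ((f y - f x) * g y) < a / 2.
  apply: le_lt_trans (nrmM _ _) _; apply: (@le_lt_trans _ _ (nrm (f y - f x) * (nrm (g x) + 1))).
    by rewrite ler_wpM2l ?nrm_ge0.
  by rewrite -ltr_pdivlMr // -mulrA -invfM.
have e2 : nrm (f x * (g y - g x)) <= a / 2.
  apply: le_trans (nrmM _ _) _.
  apply: (@le_trans _ _ ((nrm (f x) + 1) * (a / (2 * (nrm (f x) + 1))))).
    by apply: ler_pM; rewrite ?nrm_ge0 ?lerDl // ltW.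
  by have := lt0r_neq0 F0; move: (nrm (f x) + 1) => p p0; rewrite le_eqVlt; apply/orP; left; apply/eqP; field.
by move: e1 e2; move: (nrm _) (nrm _) => p q; lra.
Qed.

Lemma retr_cont f : mcont f -> continuous (fun x => Re (\tr (f x))).
Proof.
move=> hf x; apply: cont_real => a a0.
have m0 : 0 < m.+1%:R :> R by rewrite ltr0n.
apply: filterS (hf x _ (divr_gt0 a0 m0)) => y hy.
rewrite -raddfB -raddfB /=; apply: le_lt_trans (Re_le_normc _) _.
apply: le_lt_trans (nrm_tr _) _; apply: (@le_lt_trans _ _ (m.+1%:R * nrm (f y - f x))).
  by rewrite ler_wpM2r ?nrm_ge0 // ler_nat.
by rewrite mulrC -ltr_pdivlMr.
Qed.

Lemma mcont_closed f A : mcont f -> closed [set x | f x = A].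
Proof.
move=> hf; rewrite -(setCK [set x | _]); apply: open_closedC; rewrite openE => x /= hx.
have n0 : 0 < nrm (f x - A).
  by rewrite lt_neqAle nrm_ge0 andbT eq_sym; apply/eqP => /nrm_eq0/eqP; rewrite subr_eq0 => /eqP.
by apply: filterS (hf x _ n0) => y /= hy h1; move: hy; rewrite h1 nrm_subC ltxx.
Qed.

End Mc.

Section PowerBounded.
Variables (R : realType) (m : nat) (A A' : 'M[R[i]]_m) (c : R).
Hypotheses (AA' : A * A' = 1) (hA : forall n, nrm (A ^+ n) <= c) (hA' : forall n, nrm (A' ^+ n) <= c).

Lemma pb_le1 (B : 'M[R[i]]_m) (u : 'rV[R[i]]_m) (z : R[i]) : (forall n, nrm (B ^+ n) <= c) ->
  u != 0 -> u *m B = z *: u -> normc z <= 1.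
Proof.
move=> hB u0 hu; have nu : 0 < nrm u.
  by rewrite lt_neqAle nrm_ge0 andbT eq_sym; apply: contra u0 => /eqP/nrm_eq0 ->.
apply: (@pow_bdd _ _ c); first exact: normc_ge0.
move=> n; rewrite -(ler_pM2r nu).
have -> : normc z ^+ n * nrm u = nrm (u *m B ^+ n).
  elim: n => [|n IH]; first by rewrite !expr0 mulmx1 mul1r.
  by rewrite !exprS -mulmxE mulmxA hu -scalemxAl nrmZ -IH mulrA.
by apply: le_trans (nrm_mulmx _ _) _; rewrite mulrC ler_wpM2r ?nrm_ge0.
Qed.

Lemma pb_ge1 (u : 'rV[R[i]]_m) (z : R[i]) : u != 0 -> u *m A = z *: u -> normc z = 1.
Proof.
move=> u0 hu; apply/eqP; rewrite eq_le (pb_le1 hA u0 hu) /=.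
have h1 : u = z *: (u *m A') by rewrite scalemxAl -hu -mulmxA mulmxE AA' mulmx1.
have z0 : z != 0 by apply: contra u0 => /eqP z0; rewrite h1 z0 scale0r.
have h2 : u *m A' = z^-1 *: u by rewrite {2}h1 scalerA mulVf // scale1r.
have n0 : 0 < normc z.
  by rewrite lt_neqAle normc_ge0 andbT eq_sym; apply: contra z0 => /eqP/eq0_normc ->.
have := pb_le1 hA' u0 h2; rewrite -(ler_pM2l n0) mulr1; congr (_ <= _).
by rewrite -normcM divff // normc1.
Qed.

Lemma pb_diag : diagonalizable A.
Proof.
apply: ss_diag => z u h; set v := u *m (A - z%:M).
have [//|v0] := eqVneq v 0; exfalso.
have hv : v *m A = z *: v.
  by apply/eqP; rewrite -subr_eq0 -mul_mx_scalar -mulmxBr /v h.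
have nz := pb_ge1 v0 hv.
have hu : u *m A = z *: u + v by rewrite /v mulmxBr mul_mx_scalar addrC subrK.
have key n : u *m A ^+ n.+1 = z ^+ n.+1 *: u + (n.+1%:R * z ^+ n) *: v.
  elim: n => [|n IH]; first by rewrite !expr1 expr0 mulr1 scale1r hu.
  rewrite exprSr -mulmxE mulmxA IH mulmxDl -!scalemxAl hu hv scalerDr !scalerA -exprSr.
  rewrite -addrA -scalerDl; congr (_ + _ *: _).
  by rewrite -mulrA -exprSr -[n.+2%:R]natr1 [RHS]mulrDl mul1r addrC.
have pz n : normc (z ^+ n) = 1.
  by elim: n => [|n IH]; rewrite ?expr0 ?normc1 // exprS normcM IH nz mulr1.
have : nrm v = 0.
  apply: (@le_all_eq0 _ _ (nrm u * c + nrm u)); first exact: nrm_ge0.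
  case=> [|n]; first by rewrite mul0r addr_ge0 ?mulr_ge0 ?nrm_ge0 // (le_trans _ (hA 0)) ?nrm_ge0.
  have -> : n.+1%:R * nrm v = nrm ((n.+1%:R * z ^+ n) *: v).
    rewrite nrmZ normcM pz mulr1; congr (_ * _).
    by rewrite -(rmorph_nat (real_complex R)) normcR ger0_norm.
  have -> : (n.+1%:R * z ^+ n) *: v = u *m A ^+ n.+1 - z ^+ n.+1 *: u by rewrite key addrC addKr.
  apply: le_trans (nrmB _ _) _; rewrite nrmZ pz mul1r lerD2r.
  by apply: le_trans (nrm_mulmx _ _) _; rewrite ler_wpM2l ?nrm_ge0.
by move/nrm_eq0/eqP; rewrite (negbTE v0).
Qed.

(** The m eigenvalues have modulus 1, so each real part is at most 1; equality makes all of them 1,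
    and a diagonalisable matrix with this spectrum is the identity. *)
Lemma pb_trace : Re (\tr A) <= m%:R /\ (Re (\tr A) = m%:R -> A = 1).
Proof.
have [P uP /diagonalizable_forPex [D /(simmxP uP) hD]] := pb_diag.
have eA : A = invmx P *m diag_mx D *m P by rewrite -mulmxA -hD mulKmx.
have nD j : normc (D 0 j) = 1.
  apply: (@pb_ge1 (row j P)).
    apply/eqP => h0; have : row j P *m invmx P = 0 by rewrite h0 mul0mx.
    by rewrite -row_mul mulmxV // => /rowP/(_ j); rewrite !mxE eqxx => /eqP; rewrite oner_eq0.
  by rewrite -row_mul hD row_mul row_diag_mx -scalemxAl -rowE.
have -> : \tr A = \sum_j D 0 j.
  by rewrite eA mxtrace_mulC mulmxA mulmxV // mul1mx mxtrace_diag.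
have le1 j : Re (D 0 j) <= 1.
  by apply: le_trans (ler_norm _) _; rewrite -(nD j) Re_le_normc.
have em : m%:R = \sum_(j < m) 1 :> R by rewrite sumr_const card_ord.
rewrite raddf_sum /=; split; first by rewrite em ler_sum.
move=> /eqP; rewrite em -subr_eq0 -sumrB -oppr_eq0 -sumrN psumr_eq0 => [/allP h|j _]; last first.
  by rewrite opprB subr_ge0.
rewrite eA; suff -> : diag_mx D = 1%:M by rewrite mulmx1 mulVmx.
rewrite -diag_const_mx; congr diag_mx; apply/rowP => j; rewrite mxE.
have := h j (mem_index_enum _); rewrite /= opprB subr_eq0 => /eqP.
have := nD j; case: (D 0 j) => a b /= hn ha; move: hn; rewrite -ha expr1n => hn.
have : (1 + b ^+ 2) = 1.
  by rewrite -[LHS]sqr_sqrtr ?hn ?expr1n // addr_ge0 ?sqr_ge0.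
move/eqP; rewrite -subr_eq0 addrC addKr sqrf_eq0 => /eqP ->.
by [].
Qed.

End PowerBounded.

Section Conj.
Variables (R : realType) (G : topologicalGroupType) (d m : nat).
Variables (L : lie_structure R G d) (rho : G -> 'M[R[i]]_m).
Hypothesis hG : simple_compact G.
Hypothesis rho1 : rho 1%g = 1.
Hypothesis rhoM : forall x y, rho (x * y)%g = rho x * rho y.
Hypothesis rhoN : forall g0 (a : R), 0 < a -> \forall g \near g0, nrm (rho g - rho g0) < a.
Hypothesis rho_nt : exists g, rho g <> 1.

Local Notation f := (fun g => Re (\tr (rho g))).

Lemma rho_pow g n : exists h, rho h = rho g ^+ n.
Proof.
elim: n => [|n [h hh]]; first by exists 1%g.
by exists (g * h)%g; rewrite rhoM hh exprS.
Qed.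

Lemma rho_trace g : f g <= m%:R /\ (f g = m%:R -> rho g = 1).
Proof.
have [c hc] := rho_bounded hG rhoN.
apply: (@pb_trace R m (rho g) (rho (g^-1)%g) c); first by rewrite (rhoV rho1 rhoM).
- by move=> n; have [h <-] := rho_pow g n.
- by move=> n; have [h <-] := rho_pow (g^-1)%g n.
Qed.

(** The equality case of [rho_trace], made quantitative by compactness: the trace stays away from m
    where rho g stays away from 1. *)
Lemma trace_near1 (b : R) : 0 < b -> exists2 a : R, 0 < a &
  forall g, m%:R - f g <= a -> nrm (rho g - 1) < b.
Proof.
move=> b0; have [_ cptG _ _ _] := hG.
pose A := [set g : G | b <= nrm (rho g - 1)].
have cA : compact A.
  apply: subclosed_compact cptG _ => //.
  have := cont_nrm (L := 1) rhoN => cn.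
  have -> : A = (fun g => nrm (rho g - 1)) @^-1` [set x | b <= x] by [].
  by apply: closed_comp => [x _|]; [exact: cn | exact: closed_ge].
have [A0|/nonemptyPn A0] := pselect (A !=set0); last first.
  exists 1 => // g _; rewrite ltNge; apply/negP => h; have : A g by [].
  by rewrite A0.
have cf := continuous_subspaceT (A := A) (retr_cont rhoN).
have [x] := compact_EVT_max A0 cA cf; rewrite inE /A /= => bx hx.
have [t1 t2] := rho_trace x.
have tx : f x < m%:R.
  rewrite lt_neqAle t1 andbT; apply/eqP => /t2 r1.
  by move: bx; rewrite r1 subrr nrm0 leNgt b0.
exists ((m%:R - f x) / 2); first by rewrite divr_gt0 // subr_gt0.
move=> g hg; rewrite ltNge; apply/negP => h.
have := hx g; rewrite inE => /(_ h) h1.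
by move: (f x) (f g) tx hg h1 => p q; lra.
Qed.

Definition gprod (l : seq G) : G := foldr (fun x y => (x * y)%g) 1%g l.
Definition fsum (l : seq G) : R := \sum_(x <- l) f x.
(** Trace sum and product of all factorizations of length N. Keeping only these two values lets
    compactness be proved by induction on N, with one factor of G at a time. *)
Definition facset N := [set p : R * G | exists2 l, size l = N & p = (fsum l, gprod l)].

Lemma rho_gprod l : rho (gprod l) = \prod_(x <- l) rho x.
Proof. by elim: l => [|x l IH]; rewrite /= ?big_nil // big_cons rhoM IH. Qed.

Lemma compact_facset N : compact (facset N).
Proof.
have [_ cptG _ _ _] := hG.
elim: N => [|N IH].
  have -> : facset 0 = [set (0, 1%g)]; last exact: compact_set1.
  apply/seteqP; split=> p /=; first by case=> l /size0nil -> ->; rewrite /fsum big_nil.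
  by move=> ->; exists [::] => //; rewrite /fsum big_nil.
pose phi (p : G * (R * G)) : R * G := (f p.1 + p.2.1, (p.1 * p.2.2)%g).
have -> : facset N.+1 = phi @` ([set: G] `*` facset N).
  apply/seteqP; split=> p /=.
    case=> -[//|x l] [sl] ->; exists (x, (fsum l, gprod l)).
      by split=> //; exists l.
    by rewrite /phi /= /fsum big_cons.
  case=> -[x q] [_ [l sl /= ->]] <-; exists (x :: l); first by rewrite /= sl.
  by rewrite /phi /= /fsum big_cons.
apply: continuous_compact; last exact: compact_setX.
apply: continuous_subspaceT => p W [[A B] [/= hA hB] hAB].
have c1 : (fun q : G * (R * G) => f q.1) @ nbhs p --> f p.1.
  by move=> S hS; exact: (@cvg_fst G (R * G) (nbhs p.1) (nbhs p.2) _ _ (@retr_cont R G m rho rhoN p.1 S hS)).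
have c2 : (fun q : G * (R * G) => q.2.1) @ nbhs p --> p.2.1.
  move=> S hS; exact: (@cvg_snd G (R * G) (nbhs p.1) (nbhs p.2) _ _ (@cvg_fst R G (nbhs p.2.1) (nbhs p.2.2) _ S hS)).
have n1 : nbhs p (fun q : G * (R * G) => A (f q.1 + q.2.1)).
  exact: (@cvgD R R (G * (R * G))%type (nbhs p) _ _ _ _ _ c1 c2 A hA).
have [A' [B' [hA' hB' hm]]] := tg_mul hB.
have n2 : nbhs p (fun q : G * (R * G) => A' q.1).
  exact: (@cvg_fst G (R * G) (nbhs p.1) (nbhs p.2) _ A' hA').
have n3 : nbhs p (fun q : G * (R * G) => B' q.2.2).
  exact: (@cvg_snd G (R * G) (nbhs p.1) (nbhs p.2) _ _ (@cvg_snd R G (nbhs p.2.1) (nbhs p.2.2) _ B' hB')).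
apply: filterS3 n1 n2 n3 => q h1 h2 h3; apply: hAB; split=> //=.
exact: hm.
Qed.

Lemma fac_max l : exists l0, [/\ size l0 = size l, rho (gprod l0) = rho (gprod l) &
  forall l1, size l1 = size l -> rho (gprod l1) = rho (gprod l) -> fsum l1 <= fsum l0].
Proof.
pose K := facset (size l) `&` [set p | rho p.2 = rho (gprod l)].
have cK : compact K.
  apply: compact_closedI; first exact: compact_facset.
  have -> : [set p : R * G | rho p.2 = rho (gprod l)] = snd @^-1` [set g | rho g = rho (gprod l)] by [].
  by apply: closed_comp => [x _|]; [exact: cvg_snd | exact: mcont_closed].
have K0 : K !=set0 by exists (fsum l, gprod l); split=> //; exists l.
have cf : {within K, continuous (fst : R * G -> R)}.
  by apply: continuous_subspaceT => x; exact: cvg_fst.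
have [p] := compact_EVT_max K0 cK cf; rewrite inE => -[[l0 s0 ->] /= r0] hmax.
exists l0; split=> // l1 s1 r1; apply: (hmax (fsum l1, gprod l1)).
by rewrite inE; split=> //; exists l1.
Qed.

Lemma gprod_cat l1 l2 : gprod (l1 ++ l2) = (gprod l1 * gprod l2)%g.
Proof. by elim: l1 => [|x l IH]; rewrite /= ?mul1g // IH mulgA. Qed.

Lemma retr_le (A : 'M[R[i]]_m) : `|Re (\tr A)| <= m%:R * nrm A.
Proof. exact: le_trans (Re_le_normc _) (nrm_tr _). Qed.

Lemma trB (A B : 'M[R[i]]_m) : \tr (A - B) = \tr A - \tr B.
Proof. exact: raddfB. Qed.

Lemma retrD (A B : 'M[R[i]]_m) : Re (\tr (A + B)) = Re (\tr A) + Re (\tr B).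
Proof. by rewrite !raddfD. Qed.

Lemma retrN (A : 'M[R[i]]_m) : Re (\tr (- A)) = - Re (\tr A).
Proof. by rewrite !raddfN. Qed.

(** First order condition at a maximum under the moves (x, y) -> (x h, h^-1 y), which preserve the
    product, along h with image exp (tX). *)
Lemma crit_pair x y : (forall h, f (x * h)%g + f (h^-1 * y)%g <= f x + f y) ->
  forall X, lalg rho X -> Re (\tr ((rho x - rho y) * X)) <= 0.
Proof.
move=> hmax X hX.
have r0 := rad_gt0 R; have nX := nrm_ge0 X.
pose K0 := nrm X ^+ 2 / rad R / 2.
have K00 : 0 <= K0 by rewrite divr_ge0 // divr_ge0 ?exprn_ge0 // ltW.
have N1 : 0 < nrm X + 1 by exact: ltr_wpDl.
apply: (@small_eq0 _ _ (m%:R * ((nrm (rho x) + nrm (rho y)) * K0)) (1 / (nrm X + 1))).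
- by rewrite divr_gt0.
- by apply: mulr_ge0 => //; apply: mulr_ge0 => //; apply: addr_ge0; exact: nrm_ge0.
move=> t t0 ht; have [h hh] := hX t.
have hV : rho (h^-1)%g = expm (- (t%:C *: X)).
  by rewrite -[LHS]mul1r -(expmNl (t%:C *: X)) -mulrA -hh (rhoV rho1 rhoM) mulr1.
have nt : nrm (t%:C *: X) <= 1.
  rewrite nrmZR gtr0_norm //; apply: (@le_trans _ _ (1 / (nrm X + 1) * nrm X)); first by rewrite ler_wpM2r.
  by rewrite mulrAC mul1r ler_pdivrMr // mul1r lerDl.
have est : nrm (t%:C *: X) ^+ 2 / rad R / 2 = K0 * t ^+ 2.
  by rewrite nrmZR gtr0_norm // /K0; ring.
have h1 := expm1_lin nt; rewrite est in h1.
have h2 : nrm (expm (- (t%:C *: X)) - 1 + t%:C *: X) <= K0 * t ^+ 2.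
  by have := @expm1_lin R m (- (t%:C *: X)); rewrite nrmN est opprK; apply.
set E1 := expm _ - 1 - _ in h1; set E2 := expm _ - 1 + _ in h2.
have := hmax h; rewrite !rhoM hh hV.
have -> : rho x * expm (t%:C *: X) = rho x + (rho x * (t%:C *: X) + rho x * E1).
  by rewrite /E1 !mulrBr mulr1; gmx.
have -> : expm (- (t%:C *: X)) * rho y = rho y + (- ((t%:C *: X) * rho y) + E2 * rho y).
  by rewrite /E2 !(mulrBl, mulrDl) mul1r; gmx.
rewrite !raddfD /= raddfN raddfN /=.
have -> : t * Re (\tr ((rho x - rho y) * X)) =
   Re (\tr (rho x * (t%:C *: X))) - Re (\tr (t%:C *: X * rho y)).
  rewrite mulrBl !raddfB /= -mxsAl -mxsAr !linearZ /= [\tr (X * _)]mxtrace_mulC -mulmxE.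
  by case: (\tr _) => ? ?; case: (\tr _) => ? ? /=; ring.
have e1 : `|Re (\tr (rho x * E1))| <= m%:R * (nrm (rho x) * (K0 * t ^+ 2)).
  apply: le_trans (retr_le _) _; rewrite ler_wpM2l //; apply: le_trans (nrmM _ _) _.
  by rewrite ler_wpM2l ?nrm_ge0.
have e2 : `|Re (\tr (E2 * rho y))| <= m%:R * (nrm (rho y) * (K0 * t ^+ 2)).
  apply: le_trans (retr_le _) _; rewrite ler_wpM2l //; apply: le_trans (nrmM _ _) _.
  by rewrite mulrC ler_wpM2l ?nrm_ge0.
have -> : m%:R * ((nrm (rho x) + nrm (rho y)) * K0) * t ^+ 2 =
  m%:R * (nrm (rho x) * (K0 * t ^+ 2)) + m%:R * (nrm (rho y) * (K0 * t ^+ 2)) by ring.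
move: e1 e2; rewrite !ler_norml => /andP[e1 _] /andP[e2 _].
move: (Re _) (Re _) (Re _) (Re _) (Re _) (Re _) e1 e2 => a1 a2 a3 a4 a5 a6.
move: (m%:R * _) (m%:R * _) => b1 b2; lra.
Qed.

(* Compactness of the unit sphere makes the negative definiteness uniform. *)
Lemma lalg_negdef : exists2 c : R, 0 < c &
  forall X, lalg rho X -> Re (\tr (X * X)) <= - c * nrm X ^+ 2.
Proof.
have [ch ac dc] := atlas_cover L 1%g; have [D hD] := adapted_ex hG rho1 rhoM rhoN rho_nt ac dc.
have [K K0 Kb] := ad_bound hD.
have DN' w : D (- w) = - D w by rewrite -scaleN1r (adZ hD) rmorphN1 scaleN1r.
pose A := [set v : 'rV[R]_d | `|v| = 1].
have cA : compact A.
  apply: bounded_closed_compact.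
    exists 1; split; first exact: num_real.
    by move=> x hx w /= ->; exact: ltW.
  have -> : A = (fun w : 'rV[R]_d => `|w|) @^-1` [set 1] by [].
  apply: closed_comp; last exact: closed_eq.
  by move=> w _; apply: norm_continuous.
pose q v := Re (\tr (D v * D v)).
have cq : continuous q.
  move=> v; apply: (@lip_cont_at R d _ v 1 (m%:R * (K ^+ 2 * (2 * `|v| + 1)))) => //.
    by rewrite !mulr_ge0 ?exprn_ge0 ?addr_ge0 ?mulr_ge0.
  move=> w hw; rewrite /q -raddfB -raddfB /= (adD hD).
  have -> : (D v + D w) * (D v + D w) - D v * D v = D v * D w + D w * (D v + D w).
    by rewrite mulrDl mulrDr; gmx.
  apply: le_trans (retr_le _) _; rewrite -mulrA ler_wpM2l //.
  apply: le_trans (nrmD _ _) _.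
  have n1 := Kb v; have n2 := Kb w.
  have n3 : nrm (D v + D w) <= K * (`|v| + 1).
    apply: le_trans (nrmD _ _) _; rewrite mulrDr; apply: lerD => //.
    by apply: le_trans n2 _; rewrite ler_wpM2l.
  have m1 := le_trans (nrmM (D v) (D w)) (ler_pM (nrm_ge0 _) (nrm_ge0 _) n1 n2).
  have m2 := le_trans (nrmM (D w) (D v + D w)) (ler_pM (nrm_ge0 _) (nrm_ge0 _) n2 n3).
  apply: le_trans (lerD m1 m2) _; rewrite le_eqVlt; apply/orP; left; apply/eqP; ring.
have qZ (a : R) v : q (a *: v) = a ^+ 2 * q v.
  rewrite /q (adZ hD) -mxsAl -mxsAr scalerA linearZ /= -rmorphM.
  by case: (\tr _) => x y /=; ring.
have key : exists2 c : R, 0 < c & forall v, q v <= - c * `|v| ^+ 2.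
  have [A0|/nonemptyPn A0] := pselect (A !=set0); last first.
    exists 1 => // v; have [->|v0] := eqVneq v 0.
      have := qZ 0 v; rewrite scale0r expr0n /= mul0r => ->.
      by rewrite normr0 expr0n mulr0.
    exfalso; have : A (`|v|^-1 *: v); last by rewrite A0.
    by rewrite /A /= normrZ normfV normr_id mulVf ?normr_eq0.
  have [v] := compact_EVT_max A0 cA (continuous_subspaceT cq); rewrite inE => nv hv.
  have [h1 h2] := lalg_tr2 hG rhoN ((iffRL (ad_range hD _)) (ex_intro _ v erefl)).
  have qv : q v < 0.
    rewrite lt_neqAle h1 andbT; apply/eqP => /h2 /(ad_inj hD) v0.
    by move: nv; rewrite v0 /A /= normr0 => /esym/eqP; rewrite oner_eq0.
  exists (- q v); first by rewrite oppr_gt0.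
  move=> w; rewrite opprK; have [->|w0] := eqVneq w 0.
    have := qZ 0 w; rewrite scale0r expr0n /= mul0r => ->.
    by rewrite normr0 expr0n mulr0.
  have nw : `|w| != 0 by rewrite normr_eq0.
  have := hv (`|w|^-1 *: w); rewrite inE /A /= normrZ normfV normr_id mulVf // => /(_ erefl).
  by rewrite qZ exprVn mulrC ler_pdivrMr // exprn_gt0 // normr_gt0.
have [c c0 hc] := key.
have K1 : 0 < (K + 1) ^+ 2 by rewrite exprn_gt0 // ltr_wpDl.
exists (c / (K + 1) ^+ 2); first by rewrite divr_gt0.
move=> X /(ad_range hD) [v ->]; apply: le_trans (hc v) _.
rewrite !mulNr lerN2 mulrAC ler_pdivrMr // -mulrA; apply: ler_wpM2l; first exact: ltW.
rewrite mulrC -exprMn.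
apply: ler_exprn; first exact: nrm_ge0.
by apply: le_trans (Kb v) _; rewrite ler_wpM2r // lerDl.
Qed.

Lemma lalg_tr_Re X : lalg rho X -> Re (\tr X) = 0.
Proof.
move=> /(lalg_bdd hG rhoN) /bdd_spec [P [D [uP hD D0]]].
have -> : \tr X = \sum_j D 0 j.
  by rewrite -[X](mulKmx uP) mxtrace_mulC hD mulmxK // mxtrace_diag.
by rewrite raddf_sum /= big1.
Qed.

(** On exponentials, cutting exp X into n + 1 equal factors costs a total trace defect O(1/(n + 1)):
    the trace of X has real part 0, so each defect is quadratic in X/(n + 1). *)
Lemma fine_fac g (a : R) : 0 < a ->
  exists l, [/\ (0 < size l)%N, rho (gprod l) = rho g & \sum_(x <- l) (m%:R - f x) <= a].
Proof.
move=> a0; suff : forall a : R, 0 < a -> exists l, [/\ (0 < size l)%N, \prod_(x <- l) rho x = rho g &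
    \sum_(x <- l) (m%:R - f x) <= a].
  by move=> /(_ a a0) [l [h1 h2 h3]]; exists l; rewrite rho_gprod.
pose P (A : 'M[R[i]]_m) := forall a : R, 0 < a -> exists l, [/\ (0 < size l)%N, \prod_(x <- l) rho x = A &
    \sum_(x <- l) (m%:R - f x) <= a].
apply: (gen_expm L hG rho1 rhoM rhoN rho_nt (P := P)).
  move=> A B hA hB b b0; have b2 : 0 < b / 2 by rewrite divr_gt0.
  have [l1 [s1 <- h1]] := hA _ b2; have [l2 [s2 <- h2]] := hB _ b2.
  exists (l1 ++ l2); rewrite size_cat addn_gt0 s1 !big_cat; split=> //=.
  by apply: le_trans (lerD h1 h2) _; rewrite -splitr.
move=> X hX b b0.
have r0 := rad_gt0 R; have nX := nrm_ge0 X.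
pose K0 := m%:R * (nrm X ^+ 2 / rad R / 2).
have K00 : 0 <= K0 by rewrite mulr_ge0 // divr_ge0 // divr_ge0 ?exprn_ge0 // ltW.
have [n /andP[_ hn]] := nat_floor (addr_ge0 nX (divr_ge0 K00 (ltW b0))).
have n0 : 0 < n.+1%:R :> R by rewrite ltr0n.
have n1 : n.+1%:R != 0 :> R by rewrite lt0r_neq0.
have [h hh] := hX (n.+1%:R^-1); exists (nseq n.+1 h); split=> //.
  have -> : \prod_(x <- nseq n.+1 h) rho x = rho h ^+ n.+1.
    by elim: n.+1 => [|k IH]; rewrite ?big_nil ?expr0 //= big_cons IH exprS.
  rewrite hh -expmMn -scaler_nat scalerA -(rmorph_nat (real_complex R)) -rmorphM divff //.
  by rewrite rmorph1 scale1r.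
have -> : \sum_(x <- nseq n.+1 h) (m%:R - f x) = n.+1%:R * (m%:R - f h).
  rewrite -mulr_natl; elim: n.+1 => [|k IH]; first by rewrite big_nil mulr0n mul0r.
  by rewrite /= big_cons IH -[k.+1%:R]natr1; ring.
set Y := (n.+1%:R^-1)%:C *: X in hh.
have hY : lalg rho Y by apply: lalgZ.
have nY : nrm Y = nrm X / n.+1%:R by rewrite nrmZR ger0_norm ?invr_ge0 // mulrC.
have Xb := divr_ge0 K00 (ltW b0).
have nY1 : nrm Y <= 1.
  by rewrite nY ler_pdivrMr // mul1r; apply: le_trans (ltW hn); rewrite lerDl.
have h1 : m%:R - f h <= m%:R * (nrm Y ^+ 2 / rad R / 2).
  have -> : m%:R - f h = - Re (\tr (expm Y - 1 - Y)).
    have -> : Re (\tr (expm Y - 1 - Y)) = Re (\tr (expm Y)) - m%:R; last by rewrite opprB hh.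
    by rewrite !retrD !retrN (lalg_tr_Re hY) subr0 mxtrace1 -(rmorph_nat (real_complex R)).
  apply: le_trans (ler_norm _) _; rewrite normrN; apply: le_trans (retr_le _) _.
  by rewrite ler_wpM2l // expm1_lin.
apply: (@le_trans _ _ (n.+1%:R * (m%:R * (nrm Y ^+ 2 / rad R / 2)))); first by rewrite ler_pM2l.
have -> : n.+1%:R * (m%:R * (nrm Y ^+ 2 / rad R / 2)) = K0 / n.+1%:R.
  rewrite nY /K0; move: (n.+1%:R : R) n1 (nrm X) (rad R) (lt0r_neq0 r0) => N N1 x y y0.
  by field; rewrite N1 y0.
rewrite ler_pdivrMr // mulrC -ler_pdivrMr //; apply: le_trans (ltW hn).
by rewrite lerDr.
Qed.

Lemma fsum_cat l1 l2 : fsum (l1 ++ l2) = fsum l1 + fsum l2.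
Proof. by rewrite /fsum big_cat. Qed.

Lemma all_adj_eq l : (forall l1 x y l2, l = l1 ++ x :: y :: l2 -> rho x = rho y) ->
  forall x0, (0 < size l)%N -> \prod_(x <- l) rho x = rho (head x0 l) ^+ size l.
Proof.
elim: l => // x l IH h x0 _; case: l IH h => [|y l] IH h.
  by rewrite big_cons big_nil mulr1 expr1.
have hl l1 z z' l2 : y :: l = l1 ++ z :: z' :: l2 -> rho z = rho z'.
  by move=> e; apply: (h (x :: l1) z z' l2); rewrite e.
by rewrite big_cons (IH hl x0 isT) /= -(h [::] x y l erefl) -exprS.
Qed.

(* Among all factorizations of [rho g] with a given number of factors, one of
   maximal trace sum has all its factors equal and close to 1. *)
Lemma expm_surj g : exists2 X, lalg rho X & rho g = expm X.
Proof.
have [c c0 hc] := lalg_negdef; have r0 := rad_gt0 R; have r1 := rad_le1 R.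
(* With this choice the quadratic error m (a / rad / 2)|Z|^2 met below is at most half of the c|Z|^2
   given by negative definiteness. *)
pose a := Num.min (rad R) (rad R * c / (m%:R + 1)).
have m1 : 0 < m%:R + 1 :> R by rewrite ltr_wpDl.
have a0 : 0 < a by rewrite lt_min r0 divr_gt0 // mulr_gt0.
have [b b0 hb] := small_log L hG rho1 rhoM rhoN rho_nt a0.
have [e e0 he] := trace_near1 b0.
have [l [sl rl hl]] := fine_fac g e0.
have [l0 [s0 r0' hmax]] := fac_max l.
have sum0 : \sum_(x <- l0) (m%:R - f x) <= e.
  have sm (l' : seq G) : \sum_(x <- l') (m%:R - f x) = m%:R * (size l')%:R - fsum l'.
    rewrite sumrB; congr (_ - _); rewrite big_const_seq count_predT iter_addr_0.
    by rewrite (mulr_natr (m%:R : R)).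
  by apply: le_trans hl; rewrite !sm s0 lerD2l lerN2; apply: hmax.
have near x l1 l2 : l0 = l1 ++ x :: l2 -> exists X, [/\ lalg rho X, nrm X <= a & rho x = expm X].
  move=> el; apply: hb; apply: he; apply: le_trans sum0.
  rewrite el big_cat big_cons /= addrCA lerDl addr_ge0 // sumr_ge0 // => y _;
    by rewrite subr_ge0; have [] := rho_trace y.
have adj l1 x y l2 : l0 = l1 ++ x :: y :: l2 -> rho x = rho y.
  move=> el; have [X [hX nX eX]] := near x l1 (y :: l2) el.
  have [|Y [hY nY eY]] := near y (l1 ++ [:: x]) l2; first by rewrite -catA.
  have cr := @crit_pair x y.
  have {}cr : forall X, lalg rho X -> Re (\tr ((rho x - rho y) * X)) <= 0.
    apply: cr => h; have := hmax (l1 ++ (x * h)%g :: (h^-1 * y)%g :: l2).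
    rewrite -s0 el !size_cat /= => /(_ erefl); rewrite -r0' el !gprod_cat /=.
    have -> : (x * h * (h^-1 * y * gprod l2) = x * (y * gprod l2))%g.
      by rewrite !mulgA -[(x * h * h^-1)%g]mulgA mulgV mulg1.
    move=> /(_ erefl).
    by rewrite !fsum_cat /fsum !big_cons; move: (f _) (f _) (f x) (f y) => p q u v; lra.
  (* Criticality makes Re tr ((rho x - rho y) Z) nonnegative. Since rho x - rho y is Z up to a small
     multiple of |Z|, this is close to Re tr Z^2 <= - c|Z|^2, so Z = 0. *)
  pose Z := X - Y; have hZ : lalg rho Z by apply: (lalgB L).
  have nZ := nrm_ge0 Z.
  have := cr _ (lalgN hZ); rewrite mulrN !raddfN /= oppr_le0 => h0.
  have h1 := hc _ hZ.
  have [ar ac] : a <= rad R /\ a <= rad R * c / (m%:R + 1) by rewrite /a !ge_min !lexx orbT.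
  have a1 : a <= 1 by lra.
  have h2 : nrm (expm X - expm Y - Z) <= a / rad R / 2 * nrm Z by exact: expm_lip_rad.
  have h3 : - (m%:R * (a / rad R / 2 * nrm Z * nrm Z)) <= Re (\tr ((rho y - rho x + Z) * Z)).
    have : `|Re (\tr ((rho y - rho x + Z) * Z))| <= m%:R * (a / rad R / 2 * nrm Z * nrm Z).
      apply: le_trans (retr_le _) _; rewrite ler_wpM2l //; apply: le_trans (nrmM _ _) _.
      rewrite ler_wpM2r // -nrmN; apply: le_trans h2; rewrite eX eY.
      by rewrite opprD opprB.
    by rewrite ler_norml => /andP[].
  have h4 : Re (\tr ((rho y - rho x + Z) * Z)) = - Re (\tr ((rho x - rho y) * Z)) + Re (\tr (Z * Z)).
    by rewrite -[rho y - rho x]opprB mulrDl mulNr !raddfD /= !raddfN.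
  have h5 : m%:R * (a / rad R / 2 * nrm Z * nrm Z) <= c / 2 * nrm Z ^+ 2.
    have -> : m%:R * (a / rad R / 2 * nrm Z * nrm Z) = (m%:R * a / rad R) / 2 * nrm Z ^+ 2 by ring.
    rewrite ler_wpM2r ?exprn_ge0 // ler_wpM2r // ler_pdivrMr // mulrC [c * _]mulrC.
    apply: (@le_trans _ _ (a * (m%:R + 1))); first by rewrite ler_wpM2l ?lerDl // ltW.
    by rewrite -ler_pdivlMr.
  have h6 : nrm Z ^+ 2 <= 0.
    rewrite -(ler_pM2l c0) mulr0.
    move: h5; have -> : c / 2 * nrm Z ^+ 2 = (c * nrm Z ^+ 2) / 2 by ring.
    move: h0 h1 h3 h4; rewrite mulNr.
    move: (c * nrm Z ^+ 2) (Re (\tr (Z * Z))) (Re (\tr ((rho x - rho y) * Z))) => p q u.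
    by move: (Re _) (m%:R * _) => v w; lra.
  have Z0 : Z = 0.
    by apply/nrm_eq0/eqP; rewrite -sqrf_eq0 eq_le h6 exprn_ge0.
  by rewrite eX eY; congr expm; apply/eqP; rewrite -subr_eq0 -/Z Z0.
have := all_adj_eq adj 1%g; rewrite -rho_gprod r0' rl s0 => /(_ sl) hg.
have [|X [hX _ eX]] := near (head 1%g l0) [::] (behead l0).
  by move: sl; rewrite -s0; case: (l0).
exists (((size l)%:R : R)%:C *: X); first exact: lalgZ.
by rewrite hg eX -expmMn -scaler_nat rmorph_nat.
Qed.

(* Maximise the real part of the trace of [rho g * X * rho g^-1 * H]. *)
Lemma hunt X H : lalg rho X -> lalg rho H ->
  exists g, rho g * X * rho (g^-1)%g * H = H * (rho g * X * rho (g^-1)%g).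
Proof.
move=> hX hH; have [_ cptG _ _ _] := hG.
have rhoN' : mcont (fun g => rho (g^-1)%g).
  move=> g a a0; have := rhoN (g^-1)%g a0; exact: tg_inv.
pose q g := rho g * X * rho (g^-1)%g * H.
have mq : mcont q.
  apply: mcontM; last exact: mcont_cst.
  by apply: mcontM => //; apply: mcontM => //; exact: mcont_cst.
have cf := continuous_subspaceT (A := [set: G]) (retr_cont mq).
have [|g _ hmax] := compact_EVT_max _ cptG cf; first by exists 1%g.
exists g; set X' := rho g * X * rho (g^-1)%g.
have hX' : lalg rho X' by apply: (lalg_conj rho1 rhoM).
have [Y eY] : exists Y, Y = X' * H - H * X' by eexists.
have hY : lalg rho Y by rewrite eY; apply: (lalg_bracket L).
suff Y0 : Y = 0 by apply/eqP; rewrite -subr_eq0 -eY Y0.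
have [h1 h2] := lalg_tr2 hG rhoN hY.
apply: h2; apply/eqP; rewrite eq_le h1 /= -oppr_le0.
(* Along exp (- t Y) the derivative of the maximised function is - Re tr Y^2; it cannot be positive
   at a maximum, while Re tr Y^2 <= 0. *)
have [K K0 hK] := conj_diff (- Y) X'.
apply: (@small_eq0 _ _ (m%:R * (K * nrm H)) 1) => //; first by rewrite !mulr_ge0 ?nrm_ge0.
move=> t t0 t1; have := hK t t0 t1; set E := expm _ * X' * _ - X' - _ => hE.
have [h hh] := lalgN hY t.
have hV : rho (h^-1)%g = expm (- (t%:C *: - Y)).
  by rewrite -[LHS]mul1r -(expmNl (t%:C *: - Y)) -mulrA -hh (rhoV rho1 rhoM) mulr1.
have := hmax (h * g)%g; rewrite inE => /(_ I).
have -> : q (h * g)%g = X' * H + (t%:C *: (- Y * X' - X' * - Y) * H + E * H).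
  rewrite /q rhoM; have -> : rho ((h * g)^-1)%g = rho (g^-1)%g * rho (h^-1)%g by rewrite -rhoM invgM.
  have -> : rho h * rho g * X * (rho (g^-1)%g * rho (h^-1)%g) = X' + (t%:C *: (- Y * X' - X' * - Y) + E).
    by rewrite /E [t%:C *: _ + _]addrC subrK addrC subrK hh hV /X' !mulrA.
  by rewrite !mulrDl.
have -> : q g = X' * H by [].
rewrite retrD retrD gerDl.
have -> : \tr (t%:C *: (- Y * X' - X' * - Y) * H) = - t%:C * \tr (Y * Y).
  rewrite -mxsAl linearZ /= [RHS]mulNr -[RHS]mulrN; congr (_ * _).
  have -> : (- Y * X' - X' * - Y) * H = X' * Y * H - Y * (X' * H).
    by rewrite mulNr mulrN opprK addrC mulrBl mulrA.
  have -> : Y * Y = Y * (X' * H) - Y * (H * X') by rewrite {2}eY mulrBr.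
  rewrite !trB opprB; congr (_ - _).
  by rewrite -[X' * Y * H]mulrA -mulmxE mxtrace_mulC mulmxE mulrA.
have hE2 : `|Re (\tr (E * H))| <= m%:R * (K * nrm H) * t ^+ 2.
  apply: le_trans (retr_le _) _; rewrite -!mulrA ler_wpM2l //; apply: le_trans (nrmM _ _) _.
  by rewrite mulrCA [leLHS]mulrC ler_wpM2l ?nrm_ge0.
move: hE2; rewrite ler_norml => /andP[hE2 _] h3.
move: h3 hE2; case: (\tr (Y * Y)) => y1 y2 /=; rewrite ?mul0r ?mulr0 ?oppr0.
by move: (Re _) (m%:R * (K * nrm H) * t ^+ 2) => p s; lra.
Qed.

End Conj.

(** * The Lie algebra of the maximal torus *)

Section CommLog.
Variables (R : realType) (m : nat).
Implicit Types X Y : 'M[R[i]]_m.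

Lemma comm_diff X Y (a : R) : 0 < a ->
  (forall t : R, 0 < t -> t <= a -> X * expm (t%:C *: Y) = expm (t%:C *: Y) * X) -> X * Y = Y * X.
Proof.
move=> a0 h; apply/eqP; rewrite -subr_eq0; apply/eqP/nrm_eq0/eqP.
rewrite eq_le nrm_ge0 andbT.
have r0 := rad_gt0 R; have nY := nrm_ge0 Y; have nX := nrm_ge0 X.
pose K0 := nrm Y ^+ 2 / rad R / 2.
have K00 : 0 <= K0 by rewrite divr_ge0 // divr_ge0 ?exprn_ge0 // ltW.
have N1 : 0 < nrm Y + 1 by exact: ltr_wpDl.
apply: (@small_eq0 _ _ (2 * (nrm X * K0)) (Num.min a (1 / (nrm Y + 1)))).
- by rewrite lt_min a0 divr_gt0.
- by apply: mulr_ge0 => //; apply: mulr_ge0.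
move=> t t0; rewrite le_min => /andP[ta tN].
have nt : nrm (t%:C *: Y) <= 1.
  rewrite nrmZR gtr0_norm //; apply: (@le_trans _ _ (1 / (nrm Y + 1) * nrm Y)); first by rewrite ler_wpM2r.
  by rewrite mulrAC mul1r ler_pdivrMr // mul1r lerDl.
have h1 := expm1_lin nt.
have est : nrm (t%:C *: Y) ^+ 2 / rad R / 2 = K0 * t ^+ 2.
  by rewrite nrmZR gtr0_norm // /K0; ring.
rewrite est in h1; set E1 := expm _ - 1 - _ in h1.
have -> : t * nrm (X * Y - Y * X) = nrm (t%:C *: (X * Y - Y * X)) by rewrite nrmZR gtr0_norm.
have -> : t%:C *: (X * Y - Y * X) = E1 * X - X * E1.
  rewrite scalerBr mxsAr mxsAl /E1 !(mulrBl, mulrBr) mulr1 mul1r (h t t0 ta); gmx.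
apply: le_trans (nrmB _ _) _.
have -> : 2 * (nrm X * K0) * t ^+ 2 = nrm X * (K0 * t ^+ 2) + nrm X * (K0 * t ^+ 2) by ring.
apply: lerD; apply: le_trans (nrmM _ _) _; last by rewrite ler_wpM2l.
by rewrite mulrC ler_wpM2l.
Qed.

Lemma commZZ X (a b : R[i]) : (a *: X) * (b *: X) = (b *: X) * (a *: X).
Proof. by rewrite -[LHS]mxsAl -[RHS]mxsAr -[in LHS]mxsAr -[in RHS]mxsAl. Qed.

Lemma comm_expm X Y : X * Y = Y * X -> X * expm Y = expm Y * X.
Proof. by move=> h; have := @expm_intertwine R m m Y Y X; rewrite !mulmxE h => /(_ erefl). Qed.

(** Conjugation by exp (tY), t small, fixes exp X. The conjugating factors have norm at most 2, so
    the bound [rad R / 4] keeps the conjugate of X within [rad], where logarithms are unique; hence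
    X is fixed for all small t. *)
Lemma comm_log X Y : nrm X <= rad R / 4 -> Y * expm X = expm X * Y -> X * Y = Y * X.
Proof.
move=> nX hc; have r0 := rad_gt0 R.
have [a a0 ha] := small_scale Y r0.
apply: (@comm_diff _ _ a) => // t t0 ta.
have nt : nrm (t%:C *: Y) <= rad R by apply: ha; rewrite gtr0_norm.
have r1 := rad_le1 R.
have b1 (Z : 'M[R[i]]_m) : nrm Z <= rad R -> nrm (expm Z) <= 2.
  move=> hZ; apply: le_trans (nrm_subl _ 1) _; apply: le_trans (lerD (expm1_le hZ) (nrm1 _ _)) _.
  by move: (nrm Z) hZ => p hZ; lra.
set Z := t%:C *: Y.
have cZ : expm X * expm Z = expm Z * expm X.
  by apply: comm_expm; rewrite /Z -mxsAr -mxsAl hc.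
have e1 : expm (expm Z * X * expm (- Z)) = expm X.
  have : expm (expm Z * X * expm (- Z)) * expm Z = expm Z * expm X.
    by apply: expm_intertwine; rewrite !mulmxE -mulrA expmNl mulr1.
  move/(congr1 (fun A => A * expm (- Z))); rewrite /= -[in X in X = _ -> _]mulrA expmN mulr1 => ->.
  by rewrite -cZ -mulrA expmN mulr1.
have e2 : expm Z * X * expm (- Z) = X.
  apply: expm_inj e1; last by move: nX; nrmgen; lra.
  have h1 := b1 _ nt; have h2 : nrm (expm (- Z)) <= 2 by apply: b1; rewrite nrmN.
  have h3 : nrm (expm Z * X) <= 2 * (rad R / 4).
    by apply: le_trans (nrmM _ _) _; apply: ler_pM; rewrite ?nrm_ge0.
  apply: le_trans (nrmM _ _) _; apply: (@le_trans _ _ (2 * (rad R / 4) * 2)).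
    by apply: ler_pM; rewrite ?nrm_ge0.
  lra.
by rewrite -{1}e2 -mulrA expmNl mulr1.
Qed.

Lemma expm_comm_diff X Y : (forall s t : R, expm (s%:C *: X) * expm (t%:C *: Y) = expm (t%:C *: Y) * expm (s%:C *: X)) ->
  X * Y = Y * X.
Proof.
move=> h; apply/esym; apply: (@comm_diff _ _ 1) => // s _ _; apply/esym.
by apply: (@comm_diff _ _ 1) => // t _ _; apply: h.
Qed.

End CommLog.

Section Tor.
Variables (R : realType) (G : topologicalGroupType) (d m : nat).
Variables (L : lie_structure R G d) (rho : G -> 'M[R[i]]_m).
Hypothesis hG : simple_compact G.
Hypothesis rho1 : rho 1%g = 1.
Hypothesis rhoM : forall x y, rho (x * y)%g = rho x * rho y.
Hypothesis rhoN : forall g0 (a : R), 0 < a -> \forall g \near g0, nrm (rho g - rho g0) < a.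
Hypothesis rho_nt : exists g, rho g <> 1.

Definition ophom (f : R -> G) :=
  (forall s t, f (s + t) = (f s * f t)%g) /\
  forall W : set G, nbhs 1%g W -> exists2 a : R, 0 < a & forall s, `|s| <= a -> W (f s).

Lemma ophom0 f : ophom f -> f 0 = 1%g.
Proof. by case=> h _; apply: (@mulgI _ (f 0)); rewrite -h addr0 mulg1. Qed.

Lemma ophomX f s n : ophom f -> f (n%:R * s) = (f s ^+ n)%g.
Proof.
move=> hf; elim: n => [|n IH]; first by rewrite mul0r (ophom0 hf).
by rewrite -natr1 mulrDl mul1r (hf.1) IH expgSr.
Qed.

Lemma ophomV f s : ophom f -> f (- s) = (f s)^-1%g.
Proof. by move=> hf; apply: (@mulgI _ (f s)); rewrite -hf.1 subrr mulgV (ophom0 hf). Qed.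

(** The two agree for small parameters because [rho] is injective near 1, and every parameter is a
    multiple of a small one. *)
Lemma ophom_eq f1 f2 : ophom f1 -> ophom f2 -> (forall s, rho (f1 s) = rho (f2 s)) -> f1 =1 f2.
Proof.
move=> h1 h2 e s; have [V hV kV] := ker_discrete hG rho1 rhoM rhoN rho_nt.
have [A hA AV] := tg_div1 hV.
have [a1 a10 ha1] := h1.2 _ hA; have [a2 a20 ha2] := h2.2 _ hA.
pose a := Num.min a1 a2; have a0 : 0 < a by rewrite lt_min a10.
have [n /andP[_ hn]] := nat_floor (divr_ge0 (normr_ge0 s) (ltW a0)).
have n0 : n.+1%:R != 0 :> R by rewrite pnatr_eq0.
have [sa1 sa2] : `|s / n.+1%:R| <= a1 /\ `|s / n.+1%:R| <= a2.
  have : `|s / n.+1%:R| <= a.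
    rewrite normrM normfV normr_nat ler_pdivrMr ?ltr0n //.
    by move: hn; rewrite ltr_pdivrMr // mulrC => /ltW.
  by rewrite le_min => /andP.
have e1 : f1 (s / n.+1%:R) = f2 (s / n.+1%:R).
  move: (s / n.+1%:R) sa1 sa2 => u sa1 sa2.
  apply: (@mulgI _ (f1 u)^-1%g); rewrite mulVg; apply/esym; apply: kV.
    by apply: AV; [exact: ha1 | exact: ha2].
  by rewrite rhoM -e -rhoM mulVg.
have -> : s = n.+1%:R * (s / n.+1%:R) by rewrite mulrC divfK.
by rewrite !ophomX // e1.
Qed.

Lemma rhoVexp g X : rho g = expm X -> rho (g^-1)%g = expm (- X).
Proof. by move=> h; rewrite -[LHS]mul1r -(expmNl X) -mulrA -h (rhoV rho1 rhoM) mulr1. Qed.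

(** For small s the preimage of exp (sX) near 1 is unique and additive in s; elsewhere f s is the
    n-th power of the preimage at s/n, independently of n. *)
Lemma lift X : lalg rho X -> exists2 f, ophom f & forall s, rho (f s) = expm (s%:C *: X).
Proof.
move=> hX; have [V hV kV] := ker_discrete hG rho1 rhoM rhoN rho_nt.
have [A1 hA1 A1V] := tg_div1 hV.
have [A2 hA2 A2A] := tg_mul1 hA1.
pose A := A1 `&` A2; have hA : nbhs (1%g : G) A by apply: filterI.
have inj x y : A x -> A1 y -> rho x = rho y -> x = y.
  move=> [Ax _] Ay e; apply: (@mulgI _ (x^-1)%g); rewrite mulVg; apply/esym; apply: kV; first exact: A1V.
  by rewrite rhoM -e -rhoM mulVg.
have sl W : nbhs (1%g : G) W -> exists2 a : R, 0 < a & forall s, `|s| <= a ->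
    exists2 g, W g & rho g = expm (s%:C *: X).
  move=> hW; have [b b0 hb] := small_lift L hG rho1 rhoM rhoN rho_nt hW.
  have [a a0 ha] := small_scale X b0.
  by exists a => // s hs; apply: hb; [exact: lalgZ | exact: ha].
have [a a0 ha] := sl _ hA.
have /choice [l hl] : forall s, exists g, `|s| <= a -> A g /\ rho g = expm (s%:C *: X).
  move=> s; have [/ha [g h1 h2]|h] := leP `|s| a; first by exists g.
  by exists 1%g.
have lD s t : `|s| <= a -> `|t| <= a -> `|s + t| <= a -> l (s + t) = (l s * l t)%g.
  move=> /hl [[_ s1] s2] /hl [[_ t1] t2] /hl [st1 st2]; apply: inj => //; first exact: A2A.
  by rewrite rhoM s2 t2 st2 rmorphD scalerDl expmD // commZZ.
have lX (s : R) (n k : nat) : `|s| <= a -> (k <= n.+1)%N -> l (k%:R * (s / n.+1%:R)) = (l (s / n.+1%:R)%R ^+ k)%g.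
  move=> hs; have hb j : (j <= n.+1)%N -> `|j%:R * (s / n.+1%:R)| <= a.
    move=> jn; rewrite mulrCA normrM; apply: le_trans hs; rewrite ler_piMr //.
    by rewrite normrM normfV !ger0_norm // ler_pdivrMr ?ltr0n // mul1r ler_nat.
  elim: k => [|k IH] kn.
    rewrite mul0r expg0; apply: inj; last first.
      by have [|_ ->] := hl 0; rewrite ?normr0 ?ltW // scale0r expm0 rho1.
      exact: nbhs_singleton hA1.
    by have [|[]] := hl 0; rewrite ?normr0 // ltW.
  have b1 := hb k (ltnW kn); have b3 := hb _ kn.
  have b2 : `|s / n.+1%:R| <= a by have := hb 1%N isT; rewrite mul1r.
  rewrite -natr1 mulrDl mul1r in b3 *.
  by rewrite lD // IH ?expgSr // ltnW.
have lN (s : R) (n k : nat) : `|s| <= a -> l s = (l (s / k.+1%:R)%R ^+ k.+1)%g.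
  move=> hs; rewrite -(@lX s k k.+1) // mulrCA divff ?mulr1 // pnatr_eq0 //.
have /choice [N hN] : forall s : R, exists n : nat, `|s / n.+1%:R| <= a.
  move=> s; have [n /andP[_ hn]] := nat_floor (divr_ge0 (normr_ge0 s) (ltW a0)).
  exists n; rewrite normrM normfV normr_nat ler_pdivrMr ?ltr0n //.
  by move: hn; rewrite ltr_pdivrMr // mulrC => /ltW.
pose f s := (l (s / (N s).+1%:R)%R ^+ (N s).+1)%g.
have fE (s : R) (n : nat) : `|s / n.+1%:R| <= a -> f s = (l (s / n.+1%:R)%R ^+ n.+1)%g.
  move=> hn; rewrite /f (@lN (s / (N s).+1%:R) 0 n) // (@lN (s / n.+1%:R) 0 (N s)) //.
  by rewrite -!expgnA mulnC -!mulrA -!invfM [_%:R * _]mulrC.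
have fR s : rho (f s) = expm (s%:C *: X).
  have rX g k : rho (g ^+ k)%g = rho g ^+ k.
    by elim: k => [|k IH]; rewrite ?expg0 ?expr0 // expgS rhoM IH exprS.
  have [_ h2] := hl _ (hN s); rewrite /f rX h2 -expmMn -scaler_nat scalerA.
  rewrite -(rmorph_nat (real_complex R)) -rmorphM; congr (expm (_%:C *: _)).
  by rewrite mulrC divfK // pnatr_eq0.
exists f => //; split.
(* A common denominator, for which s, t and s + t all fall within the local definition. *)
- move=> s t; pose n := (((N s).+1 * (N t).+1 * (N (s + t)%R).+1).-1)%N.
  have en : n.+1 = ((N s).+1 * (N t).+1 * (N (s + t)%R).+1)%N by rewrite /n prednK.
  have bd u k p : `|u / k.+1%:R| <= a -> n.+1 = (k.+1 * p.+1)%N -> `|u / n.+1%:R| <= a.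
    move=> hu ->; rewrite natrM invfM mulrA normrM; apply: le_trans hu.
    by rewrite ler_piMr // normfV ger0_norm // invf_le1 ?ltr0n // ler1n.
  have h1 : `|s / n.+1%:R| <= a.
    by apply: (bd _ (N s) ((N t).+1 * (N (s + t)%R).+1).-1) => //; rewrite prednK // en mulnA.
  have h2 : `|t / n.+1%:R| <= a.
    by apply: (bd _ (N t) ((N s).+1 * (N (s + t)%R).+1).-1) => //; rewrite prednK // en mulnCA mulnA.
  have h3 : `|(s + t) / n.+1%:R| <= a.
    by apply: (bd _ (N (s + t)%R) ((N s).+1 * (N t).+1).-1) => //; rewrite prednK // en mulnC.
  rewrite (fE _ n h1) (fE _ n h2) (fE _ n h3) mulrDl lD -?mulrDl //.
  apply: expgMn; rewrite /commute -!lD -?mulrDl //; first by rewrite addrC.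
  by rewrite addrC.
- move=> W hW; have [b b0 hb] := sl _ (filterI hW hA).
  exists (Num.min a b); first by rewrite lt_min a0.
  move=> s; rewrite le_min => /andP[sa sb].
  have -> : f s = l s by rewrite (fE s 0) ?expg1 divr1.
  have [g [Wg Ag] rg] := hb _ sb; have [[l1 _] l2] := hl _ sa.
  by rewrite -(inj g (l s) Ag l1) // l2 rg.
Qed.

Variables (r : nat) (tau : 'rV[R]_r -> G).
Hypothesis htau : maximal_torus tau.

Lemma tauc : continuous tau. Proof. by case: htau => [[]]. Qed.
Lemma tauD x y : tau (x + y) = (tau x * tau y)%g. Proof. by case: htau => [[]]. Qed.
Lemma tau_ker x : tau x = 1%g <-> forall i, x 0 i \is a Num.int.
Proof. by case: htau => [[_ _ h] _]; apply: h. Qed.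
Lemma tau0 : tau 0 = 1%g.
Proof. by apply: (@mulgI _ (tau 0)); rewrite -tauD addr0 mulg1. Qed.
Lemma tauN x : tau (- x) = (tau x)^-1%g.
Proof. by apply: (@mulgI _ (tau x)); rewrite -tauD subrr mulgV tau0. Qed.
Lemma tauC x y : (tau x * tau y = tau y * tau x)%g.
Proof. by rewrite -!tauD addrC. Qed.

Lemma tau_near1 (W : set G) : nbhs 1%g W -> exists2 a : R, 0 < a & forall x, `|x| <= a -> W (tau x).
Proof.
move=> hW; have : nbhs (0 : 'rV[R]_r) (fun x => W (tau x)) by apply: tauc; rewrite tau0.
by move/(@near_norm R r (fun x => W (tau x)) 0) => [e e0 he]; exists e => // x /he; rewrite add0r.
Qed.

Lemma tau_ophom x : ophom (fun s => tau (s *: x)).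
Proof.
split=> [s t|W /tau_near1 [a a0 ha]]; first by rewrite scalerDl tauD.
have x1 : 0 < `|x| + 1 by rewrite ltr_wpDl.
exists (a / (`|x| + 1)); first by rewrite divr_gt0.
move=> s hs; apply: ha; rewrite normrZ; apply: (@le_trans _ _ (a / (`|x| + 1) * `|x|)).
  by rewrite ler_wpM2r.
by rewrite mulrAC ler_pdivrMr // ler_pM2l // lerDl.
Qed.

(** Near 0 the logarithms of rho (tau x) are unique, commute by [comm_log] and are therefore
    additive in x; halving the argument extends them to all x, and boundedness near 0 makes the
    extension linear. *)
Lemma rho_tau_exp : exists Th : 'rV[R]_r -> 'M[R[i]]_m, [/\
  forall x y, Th (x + y) = Th x + Th y, forall (a : R) x, Th (a *: x) = a%:C *: Th x,
  forall x, lalg rho (Th x), forall x, rho (tau x) = expm (Th x)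
  & exists K : R, forall x, nrm (Th x) <= K * `|x|].
Proof.
have r0 := rad_gt0 R.
pose a := rad R / 4; have a0 : 0 < a by rewrite divr_gt0.
have a4 : a + a <= rad R by rewrite /a; lra.
have [b b0 hb] := small_log L hG rho1 rhoM rhoN rho_nt a0.
have [e e0 he] : exists2 e : R, 0 < e & forall x, `|x| <= e -> nrm (rho (tau x) - 1) < b.
  have := rhoN 1%g b0; rewrite rho1 => h; exact: tau_near1 h.
have /choice [T0 hT0] : forall x, exists X, `|x| <= e -> [/\ lalg rho X, nrm X <= a & rho (tau x) = expm X].
  move=> x; have [/he/hb [X hX]|h] := leP `|x| e; first by exists X.
  by exists 0.
have comm x y : `|x| <= e -> `|y| <= e -> T0 x * T0 y = T0 y * T0 x.
  move=> /hT0 [_ nx ex] /hT0 [_ ny ey]; apply: comm_log => //; apply/esym.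
  have : expm (T0 x) * expm (T0 y) = expm (T0 y) * expm (T0 x).
    by rewrite -ex -ey -!rhoM tauC.
  by move=> h; apply/esym; apply: comm_log.
have T0D x y : `|x| <= e -> `|y| <= e -> `|x + y| <= e -> T0 (x + y) = T0 x + T0 y.
  move=> hx hy /hT0 [_ nxy exy]; have c := comm x y hx hy.
  move: hx hy => /hT0 [_ nx ex] /hT0 [_ ny ey].
  apply: expm_inj; first by apply: le_trans nxy _; rewrite /a; lra.
    by apply: le_trans (nrmD _ _) _; apply: le_trans (lerD nx ny) _.
  by rewrite expmD // -exy -ex -ey -rhoM tauD.
have sc (x : 'rV[R]_r) k : `|x| <= e -> `|(2 ^+ k)^-1 *: x| <= e.
  move=> hx; rewrite normrZ normfV ger0_norm ?exprn_ge0 // mulrC ler_pdivrMr ?p2_gt0 //.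
  apply: le_trans hx _; apply: ler_peMr; first exact: ltW.
  by rewrite exprn_ege1 // ler1n.
have T0h x : `|x| <= e -> T0 x = T0 (2^-1 *: x) *+ 2.
  move=> hx; have h2 : `|2^-1 *: x| <= e by have := sc x 1%N hx; rewrite expr1.
  have ex : x = 2^-1 *: x + 2^-1 *: x by rewrite -scalerDl -[2^-1]div1r -splitr scale1r.
  by rewrite {1}ex T0D -?ex.
have T02 x k : `|x| <= e -> T0 x = T0 ((2 ^+ k)^-1 *: x) *+ 2 ^ k.
  move=> hx; elim: k => [|k IH]; first by rewrite expr0 invr1 scale1r mulr1n.
  by rewrite IH T0h ?sc // -mulrnA -expnS scalerA -invfM -exprS.
have /choice [k hk] : forall x : 'rV[R]_r, exists k : nat, `|x| / 2 ^+ k <= e.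
  by move=> x; exact: exists_p2.
have nsc (x : 'rV[R]_r) (j : nat) : `|(2 ^+ j)^-1 *: x| = `|x| / 2 ^+ j.
  by rewrite normrZ normfV ger0_norm ?exprn_ge0 // mulrC.
pose T x := T0 ((2 ^+ k x)^-1 *: x) *+ 2 ^ k x.
have TE x j : `|x| / 2 ^+ j <= e -> T x = T0 ((2 ^+ j)^-1 *: x) *+ 2 ^ j.
  move=> hj; rewrite /T (@T02 ((2 ^+ k x)^-1 *: x) j) ?nsc // (@T02 ((2 ^+ j)^-1 *: x) (k x)) ?nsc //.
  by rewrite -!mulrnA mulnC !scalerA mulrC.
have TD x y : T (x + y) = T x + T y.
  pose j := maxn (maxn (k x) (k y)) (k (x + y)).
  have hj z : (k z <= j)%N -> `|z| / 2 ^+ j <= e.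
    move=> kj; apply: le_trans (hk z); rewrite ler_wpM2l // lef_pV2 ?posrE ?p2_gt0 //.
    by rewrite ler_weXn2l // ler1n.
  have [jx jy jxy] : [/\ (k x <= j)%N, (k y <= j)%N & (k (x + y)%R <= j)%N].
    by rewrite /j !leq_max !leqnn !orbT.
  rewrite (TE _ j (hj _ jx)) (TE _ j (hj _ jy)) (TE _ j (hj _ jxy)) scalerDr T0D ?nsc ?hj //.
    by rewrite mulrnDl.
  by rewrite -scalerDr nsc hj.
have Tl x : lalg rho (T x).
  have [|h _ _] := hT0 ((2 ^+ k x)^-1 *: x); first by rewrite nsc.
  by rewrite /T -scaler_nat -(rmorph_nat (real_complex R)); apply: lalgZ.
have Te x : rho (tau x) = expm (T x).
  have rX g j : rho (g ^+ j)%g = rho g ^+ j.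
    by elim: j => [|j IH]; rewrite ?expg0 ?expr0 // expgS rhoM IH exprS.
  have [|_ _ h] := hT0 ((2 ^+ k x)^-1 *: x); first by rewrite nsc.
  rewrite /T expmMn -h -rX -(ophomX _ _ (tau_ophom x)).
  rewrite natrX mulfV ?lt0r_neq0 ?p2_gt0 //.
  by rewrite scale1r.
have T00 : T 0 = 0 by apply: (addrI (T 0)); rewrite -TD !addr0.
have TM x n : T (x *+ n) = T x *+ n.
  by elim: n => [|n IH]; rewrite ?mulr0n // !mulrS TD IH.
have Tb x : `|x| <= e / 2 -> nrm (T x) <= 2 * a / e * `|x|.
  move=> hx; have [->|x0] := eqVneq x 0; first by rewrite T00 nrm0 normr0 mulr0.
  have nx : 0 < `|x| by rewrite normr_gt0.
  have [n /andP[n1 n2]] := nat_floor (divr_ge0 (ltW e0) (ltW nx)).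
  rewrite ler_pdivlMr // in n1; rewrite ltr_pdivrMr // in n2.
  have h1 : `|x *+ n| <= e by rewrite normrMn -mulr_natl.
  have h2 : nrm (T (x *+ n)) <= a.
    have -> : T (x *+ n) = T0 (x *+ n) by rewrite (TE _ 0%N) expr0 ?divr1 // invr1 scale1r mulr1n.
    by have [] := hT0 _ h1.
  rewrite TM nrmMn in h2.
  have n0 : e / 2 <= n%:R * `|x| by rewrite -natr1 mulrDl mul1r in n2; lra.
  have h3 : e / 2 * nrm (T x) <= a * `|x|.
    apply: (@le_trans _ _ (n%:R * `|x| * nrm (T x))); first by rewrite ler_wpM2r ?nrm_ge0.
    by rewrite mulrAC ler_wpM2r.
  rewrite mulrAC ler_pdivlMr //; have -> : 2 * a * `|x| = 2 * (a * `|x|) by ring.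
  by move: (nrm _) (a * `|x|) h3 => p q h3; lra.
have e2 : 0 < e / 2 by rewrite divr_gt0.
have [TZ Tb'] := additive_linear e2 TD Tb.
by exists T; split=> //; exists (2 * a / e).
Qed.

End Tor.

Section Ints.
Variable R : realType.

Lemma int_small (x : R) : x \is a Num.int -> `|x| < 1 -> x = 0.
Proof.
case/intrP => z ->; rewrite -intr_norm -[1]/(1%:~R) ltr_int => h.
by have -> : z = 0 by move: h; rewrite -[X in `|X|]/z; lia.
Qed.

Lemma frac_red (x : R) : exists2 z : R, z \is a Num.int & 0 <= x - z < 1.
Proof.
exists (Num.floor x)%:~R; first exact: intr_int.
by have /andP[h1 h2] := floor_itv x; rewrite subr_ge0 h1 ltrBlDl -(intrD _ _ 1).
Qed.

Lemma half_int : ~ (2^-1 : R) \is a Num.int.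
Proof. by move=> h; have := int_small h; rewrite ger0_norm // invf_lt1 ?ltr1n // => /(_ isT)/eqP; rewrite invr_eq0 pnatr_eq0. Qed.

End Ints.

(** * The torus is its own centralizer in the Lie algebra *)

Section Tor2.
Variables (R : realType) (G : topologicalGroupType) (d m : nat).
Variables (L : lie_structure R G d) (rho : G -> 'M[R[i]]_m).
Hypothesis hG : simple_compact G.
Hypothesis rho1 : rho 1%g = 1.
Hypothesis rhoM : forall x y, rho (x * y)%g = rho x * rho y.
Hypothesis rhoN : forall g0 (a : R), 0 < a -> \forall g \near g0, nrm (rho g - rho g0) < a.
Hypothesis rho_nt : exists g, rho g <> 1.
Variables (r : nat) (tau : 'rV[R]_r -> G).
Hypothesis htau : maximal_torus tau.
Variable Th : 'rV[R]_r -> 'M[R[i]]_m.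
Hypothesis ThD : forall x y, Th (x + y) = Th x + Th y.
Hypothesis ThZ : forall (a : R) x, Th (a *: x) = a%:C *: Th x.
Hypothesis ThL : forall x, lalg rho (Th x).
Hypothesis ThE : forall x, rho (tau x) = expm (Th x).
Variable (KT : R).
Hypothesis Thb : forall x, nrm (Th x) <= KT * `|x|.

Lemma Th0 : Th 0 = 0.
Proof. by rewrite -[0 in LHS](scale0r (0 : 'rV[R]_r)) ThZ scale0r. Qed.

Lemma ThN x : Th (- x) = - Th x.
Proof. by rewrite -scaleN1r ThZ rmorphN1 scaleN1r. Qed.

Lemma triv_ophom : ophom (fun _ : R => 1%g : G).
Proof.
split=> [s t|W hW]; first by rewrite mulg1.
by exists 1 => // s _; exact: nbhs_singleton hW.
Qed.

(** The line through x would lie in the kernel of [tau], the integer vectors, but a multiple of x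
    has a coordinate equal to 1/2. *)
Lemma Th_inj x : Th x = 0 -> x = 0.
Proof.
move=> Tx; have h : forall s : R, tau (s *: x) = 1%g.
  apply: (ophom_eq hG rho1 rhoM rhoN rho_nt (tau_ophom htau x) triv_ophom) => s.
  by rewrite ThE ThZ Tx scaler0 expm0 rho1.
apply/rowP => i; rewrite mxE; apply/eqP; apply: contraT => xi; exfalso.
have /(tau_ker htau) := h (2^-1 / x 0 i); move/(_ i).
by rewrite mxE divfK //; exact: half_int.
Qed.

Lemma ThC x y : Th x * Th y = Th y * Th x.
Proof.
apply: expm_comm_diff => s t; rewrite -!ThZ -!ThE -!rhoM.
by rewrite (tauC htau).
Qed.

Lemma tau_red x : exists2 y : 'rV[R]_r, `|y| <= 1 & tau y = tau x.
Proof.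
have /choice [z hz] : forall i, exists z : R, z \is a Num.int /\ 0 <= x 0 i - z < 1.
  by move=> i; have [z h1 h2] := frac_red (x 0 i); exists z.
pose w := \row_i z i; have tw : tau w = 1%g by apply/(tau_ker htau) => i; rewrite mxE; case: (hz i).
exists (x - w); last by rewrite (tauD htau) (tauN htau) tw invg1 mulg1.
apply: mxnorm_le => // i j; rewrite ord1 !mxE; have [_ /andP[h1 h2]] := hz j.
by rewrite ger0_norm // ltW.
Qed.

(** Torus elements near 1 have representatives near 0: the vectors of the unit ball at distance at
    least [a] from all integer vectors have a compact image, which misses 1. *)
Lemma tau_near (a : R) : 0 < a -> exists2 W : set G, nbhs 1%g W &
  forall x, W (tau x) -> exists2 y : 'rV[R]_r, `|y| <= a & tau y = tau x.
Proof.
move=> a0; have [hh _ _ _ _] := hG.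
pose I := [set z : 'rV[R]_r | forall i, z 0 i \is a Num.int].
pose Q := [set y : 'rV[R]_r | `|y| <= 1] `&` \bigcap_(z in I) [set y | a <= `|y - z|].
have cn (z : 'rV[R]_r) : continuous (fun y : 'rV[R]_r => `|y - z|).
  move=> v; apply: (@lip_cont_at R r _ v 1 1) => // w _; rewrite mul1r.
  by apply: le_trans (ler_dist_dist _ _) _; rewrite opprB addrA subrK addrC addKr.
have cQ : compact Q.
  apply: bounded_closed_compact.
    exists 1; split; first exact: num_real.
    by move=> x hx w [/= hw _]; apply: le_trans hw _; apply: ltW.
  apply: closedI.
    have -> : [set y : 'rV[R]_r | `|y| <= 1] = (fun y => `|y - 0|) @^-1` [set x | x <= 1].
      by apply/seteqP; split=> y /=; rewrite subr0.
    by apply: closed_comp => [x _|]; [exact: cn | exact: closed_le].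
  apply: closed_bigI => z _.
  have -> : [set y | a <= `|y - z|] = (fun y => `|y - z|) @^-1` [set x | a <= x] by [].
  by apply: closed_comp => [x _|]; [exact: cn | exact: closed_ge].
exists (~` (tau @` Q)).
  apply: open_nbhs_nbhs; split.
    apply: closed_openC; apply: compact_closed => //.
    apply: continuous_compact cQ; exact: continuous_subspaceT (tauc htau).
  move=> [y [_ hy] /(tau_ker htau) ty]; have := hy y ty.
  by rewrite /= subrr normr0 leNgt a0.
move=> x nQ; have [y y1 yx] := tau_red x; apply: contrapT => hn; apply: nQ.
exists y => //; split=> // z Iz /=; rewrite leNgt; apply/negP => h.
apply: hn; exists (y - z); first exact: ltW.
rewrite (tauD htau) (tauN htau); have -> : tau z = 1%g by apply/(tau_ker htau).
by rewrite invg1 mulg1.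
Qed.

(** Compactness gives the sequence f (n) a cluster point, so two of its terms are close and their
    quotient is f (j), with j > 0 and image close to 1. *)
Lemma recur X (b : R) : lalg rho X -> 0 < b ->
  exists j : nat, (0 < j)%N /\ nrm (expm ((j%:R : R)%:C *: X) - 1) < b.
Proof.
move=> hX b0; have [_ cptG _ _ _] := hG.
have [f hf fX] := lift L hG rho1 rhoM rhoN rho_nt hX.
have [c hc] := rho_bounded hG rhoN.
have c0 : 0 <= c by apply: le_trans (hc 1%g); exact: nrm_ge0.
pose F := (fun n : nat => f n%:R) @ \oo.
have [x [_ hx]] := cptG F _ filterT.
pose b' := b / (2 * (c + 1)).
have b'0 : 0 < b' by rewrite divr_gt0 // mulr_gt0 // ltr_wpDl.
have step N : exists2 n : nat, (N <= n)%N & nrm (rho (f n%:R) - rho x) < b'.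
  have [|g [[n hn ->] hg]] := hx [set g | exists2 n : nat, (N <= n)%N & g = f n%:R] _ _ (rhoN x b'0).
    by exists N => // n /= hn; exists n.
  by exists n.
have [n1 _ h1] := step 0%N; have [n2 n12 h2] := step n1.+1.
exists (n2 - n1)%N; split; first by rewrite subn_gt0.
rewrite -fX natrB ?(ltnW n12) //.
have -> : rho (f (n2%:R - n1%:R)) - 1 = (rho (f n2%:R) - rho (f n1%:R)) * rho ((f n1%:R)^-1)%g.
  by rewrite hf.1 (ophomV _ hf) rhoM mulrBl (rhoV rho1 rhoM).
apply: le_lt_trans (nrmM _ _) _; apply: (@le_lt_trans _ _ (nrm (rho (f n2%:R) - rho (f n1%:R)) * c)).
  by rewrite ler_wpM2l ?nrm_ge0.
have h3 : nrm (rho (f n2%:R) - rho (f n1%:R)) <= 2 * b'.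
  apply: le_trans (nrm_tri (rho x) _ _) _; rewrite (nrm_subC (rho x)).
  by move: h1 h2; move: (nrm _) (nrm _) => p q; lra.
apply: (@le_lt_trans _ _ (2 * b' * c)); first by rewrite ler_wpM2r.
have -> : 2 * b' * c = b * c / (c + 1) by rewrite /b'; field; rewrite lt0r_neq0 // ltr_wpDl.
by rewrite ltr_pdivrMr ?ltr_wpDl // ltr_pM2l // ltrDl.
Qed.

(** All f (n) lie in the kernel of [rho], which is finite, so two of them coincide. *)
Lemma finite_order (f : R -> G) : ophom f -> rho (f 1) = 1 -> exists n : nat, (0 < n)%N /\ f n%:R = 1%g.
Proof.
move=> hf r1.
have ker n : rho (f n%:R) = 1.
  elim: n => [|n IH]; first by rewrite (ophom0 hf).
  by rewrite -natr1 hf.1 rhoM IH r1 mulr1.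
have [[n1 [n2 [n12 e]]]|inj] := pselect (exists n1 n2 : nat, (n1 < n2)%N /\ f n1%:R = f n2%:R).
  exists (n2 - n1)%N; split; first by rewrite subn_gt0.
  by rewrite natrB ?(ltnW n12) // hf.1 (ophomV _ hf) e mulgV.
exfalso; apply: infinite_nat.
have -> : [set: nat] = (fun n : nat => f n%:R) @^-1` [set g | rho g = 1].
  by apply/seteqP; split=> n //= _; exact: ker.
apply: finite_preimage (ker_finite hG rho1 rhoM rhoN rho_nt).
move=> n1 n2 _ _ /= e; have [h|h|//] := ltngtP n1 n2.
  by exfalso; apply: inj; exists n1, n2.
by exfalso; apply: inj; exists n2, n1.
Qed.

Section Transverse.
Variable X : 'M[R[i]]_m.
Hypotheses (hX : lalg rho X) (cX : forall x, X * Th x = Th x * X) (nX : forall x, X <> Th x).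

Lemma transverse_bound : exists2 K : R, 0 <= K & forall x (s : R), `|s| <= K * nrm (Th x + s%:C *: X).
Proof.
pose D (u : 'rV[R]_(r + 1)) := Th (lsubmx u) + (rsubmx u 0 0)%:C *: X.
have DD u w : D (u + w) = D u + D w.
  by rewrite /D !linearD /= ThD mxE rmorphD scalerDl addrACA.
have DZ (a : R) u : D (a *: u) = a%:C *: D u.
  by rewrite /D !linearZ /= ThZ mxE scalerDr realZZ.
have Dinj u : D u = 0 -> u = 0.
  rewrite /D => h; have [s0|s0] := eqVneq (rsubmx u 0 0) 0.
    move: h; rewrite s0 scale0r addr0 => /Th_inj l0.
    rewrite -(hsubmxK u) l0 -row_mx0; congr row_mx; apply/rowP => i.
    by rewrite ord1 s0 mxE.
  exfalso; apply: (nX (x := - ((rsubmx u 0 0)^-1 *: lsubmx u))).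
  rewrite ThN ThZ; move/eqP: h; rewrite addrC addr_eq0 => /eqP h.
  by rewrite -[LHS](realZKV _ s0) h scalerN.
have [J [K [K0 _ _ JK Jb]]] := real_linear_inv DD DZ Dinj.
exists K => // x s; have := Jb (D (row_mx x s%:M)); rewrite JK /D row_mxKl row_mxKr mxE eqxx mulr1n.
apply: le_trans; apply: le_trans (mxnorm_entry _ 0 (rshift r 0)).
by rewrite row_mxEr mxE eqxx mulr1n.
Qed.

(* Some multiple of [X] nearly returns to the identity; a small correction closes the circle. *)
Lemma closed_transverse : exists X3 f, [/\ [/\ lalg rho X3, forall x, X3 * Th x = Th x * X3 &
  forall x, X3 <> Th x], ophom f, forall s, rho (f s) = expm (s%:C *: X3) & f 1 = 1%g].
Proof.
have [K K0 hK] := transverse_bound.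
have r0 := rad_gt0 R.
(* The first bound serves [comm_log]; the second makes the correction Z too small for j X - Z, with
   j >= 1, to become tangent to the torus. *)
pose a := Num.min (rad R / 4) (1 / (2 * (K + 1))).
have K1 : 0 < K + 1 by exact: ltr_wpDl.
have a0 : 0 < a by rewrite lt_min !divr_gt0 // mulr_gt0.
have [a1 a2] : a <= rad R / 4 /\ a <= 1 / (2 * (K + 1)) by rewrite /a !ge_min !lexx orbT.
have [b b0 hb] := small_log L hG rho1 rhoM rhoN rho_nt a0.
have [j [j0 hj]] := recur hX b0.
have [g hg] := hX j%:R.
have [|Z [hZ nZ eZ]] := hb g; first by rewrite hg.
have comZ Y : Y * X = X * Y -> Z * Y = Y * Z.
  move=> hY; apply: comm_log; first exact: le_trans nZ a1.
  by rewrite -eZ hg; apply: comm_expm; rewrite -mxsAr -mxsAl hY.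
have jn : `|(j%:R : R)| = j%:R by rewrite normr_nat.
have cX2 x : ((j%:R : R)%:C *: X - Z) * Th x = Th x * ((j%:R : R)%:C *: X - Z).
  by rewrite mulrBl mulrBr -mxsAl -mxsAr cX comZ.
pose X2 := (j%:R : R)%:C *: X - Z.
have hX2 : lalg rho X2 by apply: (lalgB L hG rho1 rhoM rhoN rho_nt) => //; exact: lalgZ.
have nX2 x : X2 <> Th x.
  move=> e; have eZ' : Z = Th (- x) + (j%:R : R)%:C *: X.
    by rewrite ThN -e /X2 opprB subrK.
  have := hK (- x) j%:R; rewrite -eZ' jn => h.
  have : K * nrm Z <= K * (1 / (2 * (K + 1))) by rewrite ler_wpM2l // (le_trans nZ).
  have : K * (1 / (2 * (K + 1))) < 1.
    by rewrite mulrA mulr1 ltr_pdivrMr ?mulr_gt0 //; lra.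
  have : 1 <= j%:R :> R by rewrite ler1n.
  by move: h; move: (K * nrm Z) (K * _) (j%:R) => p q w; lra.
have eX2 : expm X2 = 1.
  rewrite /X2 expmD; first by rewrite -hg eZ expmN.
  by rewrite mulrN mulNr -mxsAl -mxsAr comZ.
have [f hf fX] := lift L hG rho1 rhoM rhoN rho_nt hX2.
have [|n [n0 fn]] := finite_order hf; first by rewrite fX rmorph1 scale1r.
have nn : n%:R != 0 :> R by rewrite pnatr_eq0 -lt0n.
exists ((n%:R : R)%:C *: X2), (fun s => f (s * n%:R)); split.
- split; first exact: lalgZ.
    by move=> x; rewrite -mxsAl -mxsAr cX2.
  move=> x e; apply: (@nX2 ((n%:R)^-1 *: x)).
  by rewrite ThZ -e realZKV.
- split=> [s t|W hW]; first by rewrite mulrDl hf.1.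
  have [e e0 he] := hf.2 _ hW; have n1 : 0 < n%:R :> R by rewrite ltr0n.
  exists (e / n%:R); first by rewrite divr_gt0.
  by move=> s hs; apply: he; rewrite normrM normr_nat -ler_pdivlMr.
- by move=> s; rewrite fX realZZ.
- by rewrite mul1r.
Qed.

End Transverse.

Section Extension.
Variables (X : 'M[R[i]]_m) (f : R -> G).
Hypotheses (hX : lalg rho X) (cX : forall x, X * Th x = Th x * X) (nX : forall x, X <> Th x).
Hypotheses (hf : ophom f) (fX : forall s, rho (f s) = expm (s%:C *: X)) (f1 : f 1 = 1%g).

Let K := [set s : R | exists x, f s = tau x].

Lemma KD s t : K s -> K t -> K (s + t).
Proof. by move=> [x hx] [y hy]; exists (x + y); rewrite hf.1 hx hy (tauD htau). Qed.

Lemma KN s : K s -> K (- s).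
Proof. by move=> [x hx]; exists (- x); rewrite (ophomV _ hf) hx (tauN htau). Qed.

Lemma KM s (z : R) : z \is a Num.int -> K s -> K (z * s).
Proof.
case/intrP => -[n|n] -> Ks.
  elim: n => [|n IH]; first by exists 0; rewrite mul0r (ophom0 hf) (tau0 htau).
  by rewrite -pmulrn -natr1 mulrDl mul1r; apply: KD.
rewrite NegzE intrN mulNr; apply: KN.
elim: n => [|n IH]; first by rewrite mul1r.
by rewrite -pmulrn -natr1 mulrDl mul1r; apply: KD.
Qed.

(** A small non-zero parameter in [K] would give s X = Th y with y small, by injectivity of the
    exponential, against the transversality of X. *)
Lemma K_discrete : exists2 e : R, 0 < e & forall s, K s -> `|s| <= e -> s = 0.
Proof.
have r0 := rad_gt0 R.
have K1 : 0 < `|KT| + 1 by rewrite ltr_wpDl.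
have a0 : 0 < rad R / (`|KT| + 1) by rewrite divr_gt0.
have [W hW tW] := tau_near a0.
have [e1 e10 he1] := hf.2 _ hW.
have [e2 e20 he2] := small_scale X r0.
exists (Num.min e1 e2); first by rewrite lt_min e10.
move=> s [x hx]; rewrite le_min => /andP[s1 s2].
have [|y y1 yx] := tW x; first by rewrite -hx; exact: he1.
apply/eqP; apply: contraT => s0; exfalso.
have e : s%:C *: X = Th y.
  apply: expm_inj; first exact: he2.
    apply: le_trans (Thb _) _; apply: (@le_trans _ _ (`|KT| * `|y|)).
      by rewrite ler_wpM2r // ler_norm.
    apply: (@le_trans _ _ (`|KT| * (rad R / (`|KT| + 1)))); first by rewrite ler_wpM2l.
    by rewrite mulrCA ler_piMr ?(ltW r0) // ler_pdivrMr // mul1r lerDl.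
  by rewrite -fX hx -yx ThE.
apply: (nX (x := s^-1 *: y)).
by rewrite ThZ -e realZKV.
Qed.

(** A discrete subgroup of the line containing 1 is generated by its least positive element;
    discreteness makes the infimum attained. *)
Lemma K_cyclic : exists2 s0 : R, 0 < s0 & K s0 /\ forall s, K s -> exists2 z : R, z \is a Num.int & s = z * s0.
Proof.
have [e e0 he] := K_discrete.
pose P := [set s | K s /\ 0 < s].
have hP : has_inf P.
  split; first by exists 1; split=> //; exists 0; rewrite f1 (tau0 htau).
  by exists 0 => s [_ /ltW].
have [s0 [K0 p0] h0] := inf_adherent e0 hP.
have small s : K s -> 0 <= s -> s < s0 -> s = 0.
  move=> Ks s_ge ss0; apply/eqP; apply: contraT => sn; exfalso.
  have sp : 0 < s by rewrite lt_neqAle eq_sym sn.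
  have hs : inf P <= s by apply: ge_inf; [exact: hP.2 | split].
  have : s0 - s = 0.
    apply: he; first by apply: KD => //; apply: KN.
    by rewrite ger0_norm; lra.
  by lra.
exists s0 => //; split=> // s Ks.
have [z zi /andP[h1 h2]] := frac_red (s / s0).
exists z => //; apply/eqP; rewrite -subr_eq0; apply/eqP; apply: small.
- by apply: KD => //; rewrite -mulNr; apply: KM => //; rewrite rpredN.
- by have := mulr_ge0 h1 (ltW p0); rewrite mulrBl divfK // lt0r_neq0.
- by move: h2; rewrite -(ltr_pM2r p0) mulrBl divfK ?mul1r // lt0r_neq0.
Qed.

(** The torus and the circle f together form a torus of rank r + 1 containing the given one.
    Maximality places the whole of f in the torus, while [K] is discrete. *)
Lemma extension_absurd : False.
Proof.
have [s0 p0 [[x0 hx0] hK]] := K_cyclic.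
have fC x s : (tau x * f s = f s * tau x)%g.
  have : (fun s => (tau x * f s * (tau x)^-1)%g) =1 f.
    apply: (ophom_eq hG rho1 rhoM rhoN rho_nt) => //.
      split=> [t u|W hW]; first by rewrite hf.1 !mulgA mulgVK.
      have : nbhs (1%g : G) (fun g => W (tau x * g * (tau x)^-1)%g).
        apply: (@tg_mull G (tau x) 1%g (fun y => W (y * (tau x)^-1)%g)).
        apply: (@tg_mulr G ((tau x)^-1)%g (tau x * 1)%g W).
        by rewrite mulg1 mulgV.
      by move/hf.2.
    move=> t; rewrite !rhoM fX ThE (rhoVexp rho1 rhoM (ThE x)).
    have -> : expm (Th x) * expm (t%:C *: X) = expm (t%:C *: X) * expm (Th x).
      apply/esym/comm_expm/esym/comm_expm.
      by rewrite -mxsAr -mxsAl cX.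
    by rewrite -mulrA expmN mulr1.
  by move=> /(_ s) e; rewrite -{2}e mulgVK.
(* Since f s0 = tau x0, subtracting the multiple of x0 sends the last basis vector to 1, so that the
   kernel is exactly the lattice of integer vectors. *)
pose sg (u : 'rV[R]_(r + 1)) := (tau (lsubmx u - rsubmx u 0 0 *: x0) * f (rsubmx u 0 0 * s0))%g.
have sgD u w : sg (u + w) = (sg u * sg w)%g.
  rewrite /sg !linearD /= mxE mulrDl hf.1 scalerDl opprD addrACA.
  move: (lsubmx u - _ *: _) (lsubmx w - _ *: _) => a b; rewrite (tauD htau).
  by rewrite !mulgA; congr (_ * _)%g; rewrite -!mulgA; congr (_ * _)%g; rewrite fC.
have sgl x : sg (row_mx x 0) = tau x.
  by rewrite /sg row_mxKl row_mxKr mxE scale0r subr0 mul0r (ophom0 hf) mulg1.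
have sgc : continuous sg.
  have loc W : nbhs (1%g : G) W -> exists2 e : R, 0 < e & forall u, `|u| <= e -> W (sg u).
    move=> /tg_mul1 [A hA AW].
    have [e1 e10 h1] := tau_near1 htau hA; have [e2 e20 h2] := hf.2 _ hA.
    pose c := 1 + `|x0| + s0; have c0 : 0 < c by rewrite addr_gt0 // ltr_wpDr.
    have c1 : 1 + `|x0| <= c by rewrite lerDl ltW.
    have c2 : s0 <= c by rewrite lerDr addr_ge0.
    exists (Num.min e1 e2 / c); first by rewrite divr_gt0 // lt_min e10.
    move=> u; rewrite ler_pdivlMr // le_min => /andP[u1 u2].
    have nl : `|lsubmx u| <= `|u|.
      by apply: mxnorm_le => // i j; rewrite mxE; exact: mxnorm_entry.
    have nr : `|rsubmx u 0 0| <= `|u| by rewrite mxE; exact: mxnorm_entry.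
    apply: AW.
      apply: h1; apply: le_trans u1; apply: le_trans (ler_normB _ _) _.
      apply: (@le_trans _ _ (`|u| * (1 + `|x0|))); last by rewrite ler_wpM2l.
      rewrite mulrDr mulr1; apply: lerD => //.
      by rewrite normrZ ler_wpM2r.
    apply: h2; apply: le_trans u2; rewrite normrM (gtr0_norm p0).
    by apply: ler_pM => //; exact: ltW.
  move=> u W hW; have : nbhs (1%g : G) (fun g => W (sg u * g)%g).
    by apply: (@tg_mull G (sg u) 1%g W); rewrite mulg1.
  move=> /loc [e e0 he]; apply/(@near_norm R (r + 1) (fun w => W (sg w)) u).
  by exists e => // w hw; rewrite sgD; exact: he.
have fint z : z \is a Num.int -> f (z * s0) = tau (z *: x0).
  have nat_case n : f (n%:R * s0) = tau (n%:R *: x0).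
    rewrite (ophomX _ _ hf) hx0; have := ophomX 1 n (tau_ophom htau x0).
    by rewrite mulr1 scale1r => ->.
  case/intrP => -[n|n] ->; first by rewrite -pmulrn.
  by rewrite NegzE intrN mulNr scaleNr (ophomV _ hf) (tauN htau) -pmulrn nat_case.
have tsg : torus sg.
  split=> // u; split.
    move=> h1.
    have /hK [z zi hz] : K (rsubmx u 0 0 * s0).
      exists (- (lsubmx u - rsubmx u 0 0 *: x0)); rewrite (tauN htau).
      by apply: (@mulgI _ (tau (lsubmx u - rsubmx u 0 0 *: x0))); rewrite mulgV.
    have ez : rsubmx u 0 0 = z by apply: (mulIf (lt0r_neq0 p0)).
    have fz := fint _ zi.
    move: h1; rewrite /sg ez fz -(tauD htau) subrK => /(tau_ker htau) hl i.
    case: (splitP i) => j hj.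
      by have := hl j; rewrite mxE; congr (u _ _ \is a _); apply/val_inj.
    have := zi; rewrite -ez mxE; congr (u _ _ \is a _); apply/val_inj => /=.
    by rewrite hj ord1.
  move=> hi; have zi : rsubmx u 0 0 \is a Num.int by rewrite mxE.
  rewrite /sg (fint _ zi) -(tauD htau) subrK; apply/(tau_ker htau) => i.
  by rewrite mxE.
have [_ hmax] := htau.
have rg : range sg = range tau.
  apply: hmax => // _ [x _ <-]; exists (row_mx x 0) => //.
(* The threshold [e] of discreteness is itself a parameter of f, hence would belong to [K]. *)
have [e e0 he] := K_discrete.
have Ke : K e.
  have : range sg (sg (row_mx ((e / s0) *: x0) (e / s0)%:M)) by exists (row_mx ((e / s0) *: x0) (e / s0)%:M).
  rewrite rg => -[x _ hx]; exists x; rewrite hx /sg row_mxKl row_mxKr mxE eqxx mulr1n subrr (tau0 htau).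
  by rewrite mul1g divfK // lt0r_neq0.
by have := he e Ke; rewrite gtr0_norm // => /(_ (lexx _)); lra.
Qed.

End Extension.

(* Otherwise some circle commuting with the torus and transverse to it would
   enlarge the torus. *)
Lemma centralizer X : lalg rho X -> (forall x, X * Th x = Th x * X) -> exists x, X = Th x.
Proof.
move=> hX cX; apply: contrapT => nX.
have nX' x : X <> Th x by move=> e; apply: nX; exists x.
have [X3 [f [[h1 h2 h3] h4 h5 h6]]] := closed_transverse hX cX nX'.
exact: (extension_absurd h2 h3 h4 h5 h6).
Qed.

End Tor2.

(** * Roots *)

Section Diff.
Variable R : realType.

Lemma expm1_quad n (X : 'M[R[i]]_n) : exists a K : R, [/\ 0 < a, 0 <= K &
  forall t, 0 < t -> t <= a -> nrm (expm (t%:C *: X) - 1 - t%:C *: X) <= K * t ^+ 2].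
Proof.
have r0 := rad_gt0 R; have nX := nrm_ge0 X.
have [a a0 ha] := small_scale X (@ltr01 R).
exists a, (nrm X ^+ 2 / rad R / 2); split=> //.
  by rewrite divr_ge0 // divr_ge0 ?exprn_ge0 // ltW.
move=> t t0 ta; have nt : nrm (t%:C *: X) <= 1 by apply: ha; rewrite gtr0_norm.
apply: le_trans (expm1_lin nt) _; rewrite nrmZR gtr0_norm //.
by rewrite le_eqVlt; apply/orP; left; apply/eqP; ring.
Qed.

Lemma intertwine_diff n p (A : 'M[R[i]]_n) (B : 'M[R[i]]_p) V :
  (forall s : R, expm (s%:C *: A) *m V = V *m expm (s%:C *: B)) -> A *m V = V *m B.
Proof.
move=> h; apply/eqP; rewrite -subr_eq0; apply/eqP/nrm_eq0/eqP.
rewrite eq_le nrm_ge0 andbT.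
have [a [K [a0 K0 hA]]] := expm1_quad A; have [b [K' [b0 K'0 hB]]] := expm1_quad B.
apply: (@small_eq0 _ _ (nrm V * K' + K * nrm V) (Num.min a b)).
- by rewrite lt_min a0.
- by rewrite addr_ge0 ?mulr_ge0 ?nrm_ge0.
move=> t t0; rewrite le_min => /andP[/(hA _ t0) h1 /(hB _ t0) h2].
have -> : t * nrm (A *m V - V *m B) = nrm (t%:C *: (A *m V - V *m B)) by rewrite nrmZR gtr0_norm.
have -> : t%:C *: (A *m V - V *m B) =
   V *m (expm (t%:C *: B) - 1 - t%:C *: B) - (expm (t%:C *: A) - 1 - t%:C *: A) *m V.
  rewrite !mulmxBr !mulmxBl mulmx1 mul1mx h -scalemxAl -scalemxAr scalerBr.
  move: (V *m expm _) (t%:C *: (A *m V)) (t%:C *: (V *m B)) => W P Q.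
  by rewrite opprB [RHS]addrC addrA subrK.
apply: le_trans (nrmB _ _) _; rewrite [leRHS]mulrDl; apply: lerD.
  by apply: le_trans (nrm_mulmx _ _) _; rewrite -mulrA ler_wpM2l ?nrm_ge0.
by apply: le_trans (nrm_mulmx _ _) _; rewrite mulrAC ler_wpM2r ?nrm_ge0.
Qed.

(** After removal of the integer part, cos (2 pi s) = 1 - 2 sin (pi s)^2 is less than 1 for 0 < s <
    1. *)
Lemma cis_int (t : R) : cis (2 * pi * t) = 1 -> t \is a Num.int.
Proof.
have [z zi /andP[h1 h2]] := frac_red t => hc.
have cz : forall z : R, z \is a Num.int -> cis (2 * pi * z) = 1 :> R[i].
  have c1 : cis (2 * pi) = 1 :> R[i].
    by rewrite /cis mulrC mulr_natr cos2pi sin2pi.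
  have cn n : cis (2 * pi * n%:R) = 1 :> R[i] by rewrite mulr_natr cisMn c1 expr1n.
  move=> _ /intrP [[n|n] ->]; first by rewrite -pmulrn.
  have := cn n.+1; rewrite NegzE intrN -pmulrn mulrN /cis cosN sinN => -[-> ->].
  by rewrite oppr0.
suff -> : t = z by [].
have {}hc : cis (2 * pi * (t - z)) = 1.
  have := cisD (2 * pi * (t - z)) (2 * pi * z); rewrite -mulrDr subrK hc (cz z zi) mulr1 => <-.
  by [].
apply/eqP; rewrite -subr_eq0; apply: contraT => tz; exfalso.
have s0 : 0 < sin (pi * (t - z)).
  have p1 : 0 < t - z by rewrite lt_neqAle eq_sym tz.
  by apply: sin_gt0_pi; rewrite mulr_gt0 ?pi_gt0 //= gtr_pMr ?pi_gt0.
move: hc; rewrite /cis => -[hc _].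
have : cos (2 * pi * (t - z)) = 1 - sin (pi * (t - z)) ^+ 2 *+ 2.
  have -> : 2 * pi * (t - z) = (pi * (t - z)) *+ 2 by rewrite -mulrA mulr_natl.
  have := cos2Dsin2 (pi * (t - z)); move: (pi * (t - z)) => u hu.
  rewrite mulr2n cosD -!expr2; move: (cos u ^+ 2) (sin u ^+ 2) hu => p q hu.
  by rewrite -hu mulr2n opprD addrA addrK.
rewrite hc => /eqP; rewrite eq_sym subr_eq addrC -subr_eq subrr eq_sym mulrn_eq0 /= sqrf_eq0.
by rewrite (gt_eqF s0).
Qed.

Lemma cisN (t : R) : cis (- t) * cis t = 1.
Proof. by rewrite -cisD addNr cis0. Qed.

Lemma cis_pi : cis pi = -1 :> R[i].
Proof. by rewrite /cis cospi sinpi; apply/eqP; rewrite eq_complex /= oppr0 !eqxx. Qed.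

Lemma cis_Npi : cis (- pi) = -1 :> R[i].
Proof. by rewrite /cis cosN sinN cospi sinpi oppr0; apply/eqP; rewrite eq_complex /= oppr0 !eqxx. Qed.

Lemma cis_2pi : cis (2 * pi) = 1 :> R[i].
Proof. by rewrite /cis mulrC mulr_natr cos2pi sin2pi. Qed.

Lemma cis_N2pi : cis (- (2 * pi)) = 1 :> R[i].
Proof. by have := cisN (2 * pi); rewrite cis_2pi mulr1. Qed.

End Diff.

Lemma cx_scale (R : realType) (V : lmodType R[i]) (a b : R) (A B : V) :
  (a +i* b) *: (A + (0 +i* 1) *: B) =
  (a%:C *: A - b%:C *: B) + (0 +i* 1) *: (a%:C *: B + b%:C *: A).
Proof.
have -> : a +i* b = a%:C + (0 +i* 1) * b%:C.
  by apply/eqP; rewrite eq_complex /=; apply/andP; split; apply/eqP; ring.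
rewrite !scalerDr !scalerDl !scalerA.
have -> : (0 +i* 1) * b%:C * (0 +i* 1) = - b%:C.
  by apply/eqP; rewrite eq_complex /=; apply/andP; split; apply/eqP; ring.
rewrite scaleNr [a%:C * _]mulrC.
move: (a%:C *: A) (_ *: B) (_ *: A) (b%:C *: B) => p q s t.
by rewrite addrACA [RHS]addrACA [- t + _]addrC.
Qed.

Section Bracket.
Variables (R : realType) (m : nat).
Implicit Types X Y Z : 'M[R[i]]_m.

Definition br X Y := X * Y - Y * X.

Lemma brDl X Y Z : br (X + Y) Z = br X Z + br Y Z.
Proof. by rewrite /br mulrDl mulrDr opprD addrACA. Qed.
Lemma brDr X Y Z : br Z (X + Y) = br Z X + br Z Y.
Proof. by rewrite /br mulrDl mulrDr opprD addrACA. Qed.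
Lemma brZl (c : R[i]) X Y : br (c *: X) Y = c *: br X Y.
Proof. by rewrite /br -mxsAl -mxsAr scalerBr. Qed.
Lemma brZr (c : R[i]) X Y : br X (c *: Y) = c *: br X Y.
Proof. by rewrite /br -mxsAl -mxsAr scalerBr. Qed.
Lemma brC X Y : br X Y = - br Y X.
Proof. by rewrite /br opprB. Qed.
Lemma brNl X Y : br (- X) Y = - br X Y.
Proof. by rewrite /br mulNr mulrN opprK opprB addrC. Qed.
Lemma brNr X Y : br X (- Y) = - br X Y.
Proof. by rewrite /br mulNr mulrN opprK opprB addrC. Qed.
Lemma brXX X : br X X = 0.
Proof. by rewrite /br subrr. Qed.
Lemma br0r X : br X 0 = 0.
Proof. by rewrite /br mulr0 mul0r subrr. Qed.
Lemma br0l X : br 0 X = 0.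
Proof. by rewrite /br mulr0 mul0r subrr. Qed.
Lemma br_eq0 X Y : br X Y = 0 <-> X * Y = Y * X.
Proof. by split=> [/eqP|h]; [rewrite subr_eq0 => /eqP | rewrite /br h subrr]. Qed.

Lemma jacobi X Y Z : br X (br Y Z) = br (br X Y) Z + br Y (br X Z).
Proof.
rewrite /br !mulrBl !mulrBr !mulrA.
by move: (X * Y * Z) (X * Z * Y) (Y * Z * X) (Z * Y * X) (Y * X * Z) (Z * X * Y) => a b c e f g; gmx.
Qed.

Lemma tr_br X Y Z : \tr (br X Y * Z) = \tr (X * br Y Z).
Proof.
rewrite /br mulrBl mulrBr !trB !mulrA; congr (_ - _).
by rewrite -[Y * X * Z]mulrA -[\tr (Y * _)]/(\tr (Y *m (X * Z))) mxtrace_mulC.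
Qed.

Lemma mulM_scalar X (c : R[i]) : X * c%:M = c *: X.
Proof. exact: mul_mx_scalar. Qed.

Lemma brE X Y : X * Y = Y * X + br X Y.
Proof. by rewrite /br addrC subrK. Qed.

End Bracket.

Lemma addself_inj (R : realType) (V : lmodType R[i]) (U W : V) : U + U = W + W -> U = W.
Proof.
move=> h; apply/eqP; rewrite -subr_eq0; have : (2 : R[i]) *: (U - W) == 0.
  by rewrite scaler_nat mulr2n addrACA -opprD h subrr.
by rewrite scaler_eq0 pnatr_eq0.
Qed.

(** The bracket with X rotates the plane of P and Q, with eigenvectors P + iQ and P - iQ for -i and
    i. When t is a multiple of pi both exponentials take the same value z, so conjugation by exp
    (tX) is scalar on the plane. *)
Lemma conj_rot (R : realType) m (X P Q : 'M[R[i]]_m) (t : R) (z : R[i]) :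
  br X P = Q -> br X Q = - P -> cis t = z -> cis (- t) = z ->
  expm (t%:C *: X) * P = z *: (P * expm (t%:C *: X)).
Proof.
move=> h1 h2 c1 c2; pose ii : R[i] := 0 +i* 1.
have i2 : ii * ii = -1 by rewrite /ii -expr2 sqr_i.
have key (V : 'M[R[i]]_m) (a : R) : br X V = (0 +i* a) *: V ->
    expm (t%:C *: X) * V = cis (t * a) *: (V * expm (t%:C *: X)).
  move=> hV; have hI : (t%:C *: X) *m V = V *m (t%:C *: X + (0 +i* (t * a))%:M).
    by rewrite mulmxDr mul_mx_scalar -scalemxAl -scalemxAr !mulmxE brE hV scalerDr scalerA scale_Im.
  have := expm_intertwine hI; rewrite !mulmxE => ->.
  rewrite expmD; last by rewrite -!mulmxE scalar_mxC.
  by rewrite expm_cis mulM_scalar -mxsAr.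
have k1 : br X (P + ii *: Q) = (0 +i* -1) *: (P + ii *: Q).
  have -> : 0 +i* -1 = - ii by apply/eqP; rewrite eq_complex /= oppr0 !eqxx.
  by rewrite brDr brZr h1 h2 scalerDr scalerA mulNr i2 opprK scale1r scalerN scaleNr addrC.
have k2 : br X (P - ii *: Q) = (0 +i* 1) *: (P - ii *: Q).
  by rewrite brDr brNr brZr h1 h2 scalerN opprK -/ii scalerBr scalerA i2 scaleN1r opprK addrC.
have e1 := key _ _ k1; have e2 := key _ _ k2.
rewrite mulrN1 c2 in e1; rewrite mulr1 c1 in e2.
have eP : P + P = (P + ii *: Q) + (P - ii *: Q) by rewrite addrACA subrr addr0.
have e3 : expm (t%:C *: X) * (P + P) = z *: ((P + P) * expm (t%:C *: X)).
  by rewrite eP mulrDr e1 e2 -scalerDr -mulrDl.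
by rewrite mulrDr mulrDl scalerDr in e3; exact: addself_inj e3.
Qed.

Section Root.
Variables (R : realType) (G : topologicalGroupType) (d m : nat).
Variables (L : lie_structure R G d) (rho : G -> 'M[R[i]]_m).
Hypothesis hG : simple_compact G.
Hypothesis rho1 : rho 1%g = 1.
Hypothesis rhoM : forall x y, rho (x * y)%g = rho x * rho y.
Hypothesis rhoN : forall g0 (a : R), 0 < a -> \forall g \near g0, nrm (rho g - rho g0) < a.
Hypothesis rho_nt : exists g, rho g <> 1.
Variables (r : nat) (tau : 'rV[R]_r -> G).
Hypothesis htau : maximal_torus tau.
Variable Th : 'rV[R]_r -> 'M[R[i]]_m.
Hypothesis ThD : forall x y, Th (x + y) = Th x + Th y.
Hypothesis ThZ : forall (a : R) x, Th (a *: x) = a%:C *: Th x.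
Hypothesis ThL : forall x, lalg rho (Th x).
Hypothesis ThE : forall x, rho (tau x) = expm (Th x).
Hypothesis cent : forall X, lalg rho X -> (forall x, X * Th x = Th x * X) -> exists x, X = Th x.

Local Notation ii := (0 +i* 1 : R[i]).
Local Notation g := (lalg rho).

(** The differential of the character of the torus attached to [a]. *)
Definition wt (a x : 'rV[R]_r) : R[i] := 0 +i* (2 * pi * pairing a x).

Lemma pairingDl (a b x : 'rV[R]_r) : pairing (a + b) x = pairing a x + pairing b x.
Proof. by rewrite /pairing mulmxDl mxE. Qed.
Lemma pairingDr (a b x : 'rV[R]_r) : pairing x (a + b) = pairing x a + pairing x b.
Proof. by rewrite /pairing linearD mulmxDr mxE. Qed.
Lemma pairingZl (c : R) (a x : 'rV[R]_r) : pairing (c *: a) x = c * pairing a x.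
Proof. by rewrite /pairing -scalemxAl mxE. Qed.
Lemma pairingZr (c : R) (a x : 'rV[R]_r) : pairing x (c *: a) = c * pairing x a.
Proof. by rewrite /pairing linearZ -scalemxAr mxE. Qed.
Lemma pairingNl (a x : 'rV[R]_r) : pairing (- a) x = - pairing a x.
Proof. by rewrite -scaleN1r pairingZl mulN1r. Qed.
Lemma pairing0l (x : 'rV[R]_r) : pairing 0 x = 0.
Proof. by rewrite /pairing mul0mx mxE. Qed.
Lemma pairing_ext (a b : 'rV[R]_r) : (forall x, pairing a x = pairing b x) -> a = b.
Proof.
move=> h; apply/rowP => i; have := h (delta_mx 0 i); rewrite /pairing trmx_delta.
by rewrite -!colE !mxE.
Qed.

Lemma wtE (a x : 'rV[R]_r) : wt a x = (2 * pi * pairing a x)%:C * ii.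
Proof. by apply/eqP; rewrite eq_complex /=; apply/andP; split; apply/eqP; ring. Qed.
Lemma wtD (a b x : 'rV[R]_r) : wt (a + b) x = wt a x + wt b x.
Proof. by rewrite !wtE pairingDl mulrDr rmorphD mulrDl. Qed.
Lemma wtN (a x : 'rV[R]_r) : wt (- a) x = - wt a x.
Proof. by rewrite !wtE pairingNl mulrN rmorphN mulNr. Qed.
Lemma wt_ext (a b : 'rV[R]_r) : (forall x, wt a x = wt b x) -> a = b.
Proof.
move=> h; apply: pairing_ext => x; have [] := h x => /eqP.
have p0 : 2 * pi != 0 :> R by rewrite mulf_neq0 // gt_eqF // pi_gt0.
by rewrite -subr_eq0 -mulrBr mulf_eq0 (negbTE p0) subr_eq0 => /eqP.
Qed.

Lemma expm_sc n (a x : 'rV[R]_r) (s : R) :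
  expm (s%:C *: (wt a x)%:M : 'M[R[i]]_n) = (expi2pi (pairing a (s *: x)))%:M.
Proof.
rewrite scale_scalar_mx scale_Im expm_cis pairingZr; congr (cis _)%:M; ring.
Qed.

Lemma expm_sc1 n (a x : 'rV[R]_r) :
  expm ((wt a x)%:M : 'M[R[i]]_n) = (expi2pi (pairing a x))%:M.
Proof. by rewrite -[_%:M]scale1r -[1]/(1%:C) expm_sc scale1r. Qed.

Lemma weightP a : weight tau rho a <->
  exists2 v : 'cV[R[i]]_m, v != 0 & forall x, Th x *m v = wt a x *: v.
Proof.
split=> -[v v0 hv]; exists v => // x.
  rewrite -mul_mx_scalar; apply: intertwine_diff => s.
  by rewrite -ThZ -ThE hv expm_sc mul_mx_scalar.
by rewrite ThE -mul_mx_scalar -expm_sc1; apply: expm_intertwine; rewrite hv mul_mx_scalar.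
Qed.

(** The complexified Lie algebra, inside the same matrices: the sum is direct since the Lie algebra
    meets its multiple by i in 0 only. *)
Definition gC X := exists A B, [/\ g A, g B & X = A + ii *: B].

Lemma ii2 : ii * ii = -1. Proof. by rewrite -expr2 sqr_i. Qed.

Lemma gC_inj A B A' B' : g A -> g B -> g A' -> g B' -> A + ii *: B = A' + ii *: B' -> A = A' /\ B = B'.
Proof.
move=> hA hB hA' hB' e.
have gB := lalgB L hG rho1 rhoM rhoN rho_nt.
have e1 : A - A' = ii *: (B' - B).
  by rewrite scalerBr; apply/eqP; rewrite subr_eq addrAC -subr_eq opprK e addrC.
have z : B' - B = 0.
  by apply: (lalg_i hG rhoN) => //; [exact: gB | rewrite -e1; exact: gB].
have e2 : B = B' by apply/esym/eqP; rewrite -subr_eq0 z.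
by split=> //; apply/eqP; rewrite -subr_eq0 e1 z scaler0.
Qed.

Lemma gCg A : g A -> gC A.
Proof. by move=> hA; exists A, 0; split=> //; [exact: lalg0 | rewrite scaler0 addr0]. Qed.

Lemma gCD X Y : gC X -> gC Y -> gC (X + Y).
Proof.
have gD := lalgD L hG rho1 rhoM rhoN rho_nt.
move=> [A [B [hA hB ->]]] [A' [B' [hA' hB' ->]]]; exists (A + A'), (B + B').
by split; [exact: gD|exact: gD|rewrite scalerDr addrACA].
Qed.

Lemma gCZ (c : R[i]) X : gC X -> gC (c *: X).
Proof.
have gD := lalgD L hG rho1 rhoM rhoN rho_nt.
have gB := lalgB L hG rho1 rhoM rhoN rho_nt.
case: c => x y [A [B [hA hB ->]]]; exists (x%:C *: A - y%:C *: B), (x%:C *: B + y%:C *: A).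
split; [by apply: gB; exact: lalgZ | by apply: gD; exact: lalgZ|].
exact: cx_scale.
Qed.

Lemma gCN X : gC X -> gC (- X).
Proof. by move=> h; rewrite -scaleN1r; exact: gCZ. Qed.

Lemma gCB X Y : gC X -> gC Y -> gC (X - Y).
Proof. by move=> h1 h2; apply: gCD => //; exact: gCN. Qed.

Lemma g_br X Y : g X -> g Y -> g (br X Y).
Proof. exact: (lalg_bracket L hG rho1 rhoM rhoN rho_nt). Qed.

Lemma gC_br X Y : gC X -> gC Y -> gC (br X Y).
Proof.
move=> [A [B [hA hB ->]]] [A' [B' [hA' hB' ->]]].
rewrite !brDl !brDr !brZl !brZr.
by apply: gCD; apply: gCD; do ?apply: gCZ; do ?apply: gCZ; apply: gCg; apply: g_br.
Qed.

(** Minus the squared norm of A + iB for the hermitian form attached to the conjugation A + iB -> A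
    - iB: the cross terms cancel in the trace. *)
Lemma gC_form A B : g A -> g B -> Re (\tr ((A + ii *: B) * (A - ii *: B))) <= 0 /\
  (Re (\tr ((A + ii *: B) * (A - ii *: B))) = 0 -> A = 0 /\ B = 0).
Proof.
move=> hA hB; have [a1 a2] := lalg_tr2 hG rhoN hA; have [b1 b2] := lalg_tr2 hG rhoN hB.
have -> : Re (\tr ((A + ii *: B) * (A - ii *: B))) = Re (\tr (A * A)) + Re (\tr (B * B)).
  rewrite mulrDl !mulrBr -!mxsAr -!mxsAl !scalerA ii2 scaleN1r opprK.
  rewrite !retrD retrN -!addrA; congr (_ + _).
  by rewrite !linearZ /= -[B * A]/(B *m A) mxtrace_mulC addrA addNr add0r.
split; first by rewrite -[0]addr0 lerD.
move=> h; have [h1 h2] : Re (\tr (A * A)) = 0 /\ Re (\tr (B * B)) = 0 by lra.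
by split; [exact: a2 | exact: b2].
Qed.

Definition isrv (a : 'rV[R]_r) E := gC E /\ forall x, br (Th x) E = wt a x *: E.

Lemma rv_conj a E x : isrv a E -> rho (tau x) * E = expi2pi (pairing a x) *: (E * rho (tau x)).
Proof.
move=> [_ hE]; have hTE : Th x *m E = E *m (Th x + (wt a x)%:M).
  rewrite mulmxDr mul_mx_scalar -hE !mulmxE brE //.
have := expm_intertwine hTE; rewrite expmD; last by rewrite -!mulmxE scalar_mxC.
rewrite expm_sc1 !mulmxE -ThE => ->.
by rewrite mulM_scalar -mxsAr.
Qed.

Lemma rv_of_conj a E : gC E ->
  (forall x, rho (tau x) * E = expi2pi (pairing a x) *: (E * rho (tau x))) -> isrv a E.
Proof.
move=> hE h; split=> // x.
have : Th x *m E = E *m (Th x + (wt a x)%:M).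
  apply: intertwine_diff => s; rewrite scalerDr expmD; last by rewrite -!mulmxE -scalemxAl -scalemxAr -[in RHS]scalemxAl -[in RHS]scalemxAr scalar_mxC.
  rewrite expm_sc -ThZ -ThE !mulmxE h.
  by rewrite -[_ * _%:M]/(_ *m _%:M) mul_mx_scalar -mxsAr.
by rewrite mulmxDr mul_mx_scalar !mulmxE /br => ->; rewrite addrC addKr.
Qed.

Lemma rho_cancel gg (A B : 'M[R[i]]_m) : A * rho gg = B -> A = B * rho (gg^-1)%g.
Proof. by move=> <-; rewrite -mulrA (rhoV rho1 rhoM) mulr1. Qed.

Section Complexify.
Variables (c : chart R G d) (D : 'rV[R]_d -> 'M[R[i]]_m).
Hypothesis hD : adapted rho c D.

Definition DC (u : 'rV[R[i]]_d) := D (map_mx (@complex.Re R) u) + ii *: D (map_mx (@complex.Im R) u).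

Lemma gD u : g (D u). Proof. by apply/(ad_range hD); exists u. Qed.

Lemma DC_gC u : gC (DC u).
Proof. by exists (D (map_mx (@complex.Re R) u)), (D (map_mx (@complex.Im R) u)); split=> //; exact: gD. Qed.

Lemma DC_onto X : gC X -> exists u, X = DC u.
Proof.
move=> [A [B [/(ad_range hD) [p ->] /(ad_range hD) [q ->] ->]]].
exists (\row_j (p 0 j +i* q 0 j)); rewrite /DC; congr (D _ + ii *: D _);
by apply/rowP => j; rewrite !mxE.
Qed.

Lemma DD0 : D 0 = 0.
Proof. by rewrite -[0 in LHS](scale0r (0 : 'rV[R]_d)) (adZ hD) scale0r. Qed.

Lemma DC_inj u : DC u = 0 -> u = 0.
Proof.
move=> h; have [] := @gC_inj _ _ 0 0 (gD _) (gD _) (@lalg0 _ _ _ _ rho1) (@lalg0 _ _ _ _ rho1) (etrans h _).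
  by rewrite scaler0 addr0.
move=> /(ad_inj hD)/rowP h1 /(ad_inj hD)/rowP h2; apply/rowP => j.
by have := h1 j; have := h2 j; rewrite !mxE; case: (u 0 j) => x y /= -> ->.
Qed.

Lemma DCD u w : DC (u + w) = DC u + DC w.
Proof.
rewrite /DC.
have -> : map_mx (@complex.Re R) (u + w) = map_mx (@complex.Re R) u + map_mx (@complex.Re R) w.
  by apply/rowP => j; rewrite !mxE; case: (u 0 j) => a b; case: (w 0 j).
have -> : map_mx (@complex.Im R) (u + w) = map_mx (@complex.Im R) u + map_mx (@complex.Im R) w.
  by apply/rowP => j; rewrite !mxE; case: (u 0 j) => a b; case: (w 0 j).
by rewrite !(adD hD) scalerDr addrACA.
Qed.

Lemma DCZ (z : R[i]) u : DC (z *: u) = z *: DC u.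
Proof.
case: z => a b; rewrite /DC.
have -> : map_mx (@complex.Re R) ((a +i* b) *: u) = a *: map_mx (@complex.Re R) u + (- b) *: map_mx (@complex.Im R) u.
  by apply/rowP => j; rewrite !mxE; case: (u 0 j) => p q /=; rewrite mulNr.
have -> : map_mx (@complex.Im R) ((a +i* b) *: u) = a *: map_mx (@complex.Im R) u + b *: map_mx (@complex.Re R) u.
  by apply/rowP => j; rewrite !mxE; case: (u 0 j) => p q /=.
rewrite !(adD hD) !(adZ hD).
by rewrite rmorphN scaleNr cx_scale.
Qed.

Lemma DC_Ad u x : DC (u *m (map_mx (real_complex R) (Ad c x))^T) = rho x * DC u * rho (x^-1)%g.
Proof.
rewrite /DC mulrDr mulrDl -mxsAr -mxsAl -!(ad_Ad hD).
have re (z : R[i]) (a : R) : complex.Re (z * a%:C) = complex.Re z * a by case: z => p q /=; rewrite mulr0 subr0.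
have im (z : R[i]) (a : R) : complex.Im (z * a%:C) = complex.Im z * a by case: z => p q /=; rewrite mulr0 add0r.
congr (D _ + ii *: D _); apply/rowP => j; rewrite !mxE raddf_sum /=; apply: eq_bigr => k _.
  by rewrite !mxE re.
by rewrite !mxE im.
Qed.

(** The complexified differential [DC] carries the adjoint action in the chart to conjugation by
    rho, so weight vectors become root vectors. *)
Lemma weight_Ad a : weight tau (fun x => map_mx (real_complex R) (Ad c x)) a <->
  exists2 E, E != 0 & isrv a E.
Proof.
split=> [[v v0 hv]|[E E0 hE]].
  exists (DC v^T).
    by apply: contra v0 => /eqP/DC_inj/(congr1 trmx); rewrite trmxK trmx0 => ->.
  apply: rv_of_conj; first exact: DC_gC.
  move=> x; have : DC (v^T *m (map_mx (real_complex R) (Ad c (tau x)))^T) = expi2pi (pairing a x) *: DC v^T.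
    by rewrite -trmx_mul hv linearZ /= DCZ.
  rewrite DC_Ad => /(congr1 (fun A => A * rho (tau x))).
  by rewrite -mulrA (rhoVl rho1 rhoM) mulr1 => ->; rewrite -mxsAl.
have [u eE] := DC_onto hE.1.
exists u^T.
  apply: contra E0 => /eqP/(congr1 trmx); rewrite trmxK trmx0 eE => ->.
  rewrite /DC; have z f : f 0 = 0 -> map_mx f (0 : 'rV[R[i]]_d) = 0 :> 'rV[R]_d.
    by move=> f0; apply/rowP => j; rewrite !mxE.
  by rewrite !z // DD0 scaler0 addr0.
move=> x; apply: trmx_inj; rewrite trmx_mul trmxK linearZ /= trmxK.
apply/eqP; rewrite -subr_eq0 -scaleN1r; apply/eqP/DC_inj; rewrite DCD !DCZ scaleN1r DC_Ad -eE.
by apply/eqP; rewrite subr_eq0 (rv_conj x hE) -mxsAl -mulrA (rhoV rho1 rhoM) mulr1.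
Qed.

End Complexify.

Lemma root_setP a : root_set L tau a <-> a != 0 /\ exists2 E, E != 0 & isrv a E.
Proof.
split=> [[a0 [c [ac dc hw]]]|[a0 hE]]; split=> //.
  by have [D hD] := adapted_ex hG rho1 rhoM rhoN rho_nt ac dc; apply/(weight_Ad hD).
have [c ac dc] := atlas_cover L 1%g.
have [D hD] := adapted_ex hG rho1 rhoM rhoN rho_nt ac dc.
by exists c; split=> //; apply/(weight_Ad hD).
Qed.

Definition th (a x : 'rV[R]_r) : R := 2 * pi * pairing a x.

Lemma rv_split a A B : g A -> g B -> isrv a (A + ii *: B) -> forall x,
  br (Th x) A = - (th a x)%:C *: B /\ br (Th x) B = (th a x)%:C *: A.
Proof.
move=> hA hB [_ hE] x; have := hE x; rewrite brDr brZr /wt cx_scale scale0r sub0r scale0r add0r.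
move/gC_inj => h; have [||||-> ->] := h; rewrite ?scaleNr //; try exact: g_br.
  by rewrite -scaleNr -rmorphN; exact: lalgZ.
exact: lalgZ.
Qed.

Lemma pairing_nz (a : 'rV[R]_r) : a != 0 -> exists x, pairing a x != 0.
Proof.
move=> a0; apply: contrapT => h; move/negP: a0; apply; apply/eqP/pairing_ext => x.
by rewrite pairing0l; apply/eqP; apply: contraT => hx; exfalso; apply: h; exists x.
Qed.

Lemma tpi : 2 * pi != 0 :> R.
Proof. by rewrite mulf_neq0 // gt_eqF // pi_gt0. Qed.

(** The compact form of an sl2-triple: X + iY is a root vector and y is the coroot. Since th a y = 4
    pi, the bracket of X and Y rotates the plane of X and Y at unit speed, as [sl_ZX] and [sl_ZY]
    express. *)
Record sl2 (a : 'rV[R]_r) (X Y : 'M[R[i]]_m) (y : 'rV[R]_r) : Prop := {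
  sl_X : g X ;
  sl_Y : g Y ;
  sl_hX : forall x, br (Th x) X = - (th a x)%:C *: Y ;
  sl_hY : forall x, br (Th x) Y = (th a x)%:C *: X ;
  sl_XY : br X Y = - ((4 * pi)^-1)%:C *: Th y ;
  sl_2 : pairing a y = 2 }.

Lemma retrZ (c : R) (A : 'M[R[i]]_m) : Re (\tr (c%:C *: A)) = c * Re (\tr A).
Proof. by rewrite linearZ /=; case: (\tr A) => p q /=; rewrite mul0r subr0. Qed.

(** For a root vector A + iB the bracket of A and B commutes with the torus, hence is some Th z by
    [centralizer]. Invariance and negative definiteness of the trace form give <a, z> < 0, which
    allows a real rescaling to <a, y> = 2. *)
Lemma sl2_ex a E : a != 0 -> E != 0 -> isrv a E -> exists X Y y, sl2 a X Y y.
Proof.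
move=> a0 E0 hE; have [A [B [hA hB eE]]] := hE.1; rewrite eE in hE E0.
have hs := rv_split hA hB hE.
have [x0 hx0] := pairing_nz a0.
have t0 : th a x0 != 0 by rewrite mulf_neq0 // tpi.
have A0 : A <> 0.
  move=> A0; have [h1 _] := hs x0; rewrite A0 br0r in h1.
  have B0 : B = 0.
    apply/eqP; move/esym/eqP: h1; rewrite scaler_eq0 oppr_eq0 => /orP[|//].
    by rewrite fmorph_eq0 (negbTE t0).
  by move/eqP: E0; apply; rewrite A0 B0 scaler0 addr0.
have [z hz] : exists z, br A B = Th z.
  apply: cent; first exact: g_br.
  move=> x; apply/br_eq0; rewrite brC jacobi (hs x).1 (hs x).2 brZl brZr !brXX.
  by rewrite !scaler0 addr0 oppr0.
have [tA1 tA2] := lalg_tr2 hG rhoN hA.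
have tA : Re (\tr (A * A)) < 0 by rewrite lt_neqAle tA1 andbT; apply/eqP => /tA2.
have tr x : Re (\tr (Th z * Th x)) = - (th a x * Re (\tr (A * A))).
  by rewrite -hz tr_br brC (hs x).2 mulrN -mxsAr retrN retrZ.
have Tz : Th z <> 0.
  move=> Tz; have := tr x0; rewrite Tz mul0r mxtrace0 /= => /esym/eqP.
  by rewrite oppr_eq0 mulf_eq0 (negbTE t0) (lt_eqF tA).
have [z1 z2] := lalg_tr2 hG rhoN (ThL z).
have z3 : Re (\tr (Th z * Th z)) < 0 by rewrite lt_neqAle z1 andbT; apply/eqP => /z2.
have pz : pairing a z < 0.
  move: z3; rewrite tr oppr_lt0 (nmulr_lgt0 _ tA) /th.
  by rewrite pmulr_rlt0 // mulr_gt0 // pi_gt0.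
have p0 := pi_gt0 R; have pn : pi != 0 :> R by rewrite gt_eqF.
have qn : pairing a z != 0 by rewrite lt_eqF.
(* Scaling A and B by s replaces z by y = - 4 pi s^2 z, and this s makes <a, y> equal to 2. *)
pose s := Num.sqrt (1 / (- (2 * pi * pairing a z))).
have c0 : 0 < - (2 * pi * pairing a z).
  by rewrite oppr_gt0 pmulr_rlt0 // mulr_gt0.
have s2 : s * s = 1 / (- (2 * pi * pairing a z)).
  by rewrite -expr2 sqr_sqrtr // divr_ge0 // ltW.
exists (s%:C *: A), (s%:C *: B), ((- (4 * pi * (s * s))) *: z); split.
- exact: lalgZ.
- exact: lalgZ.
- by move=> x; rewrite brZr (hs x).1 !scalerA mulrC.
- by move=> x; rewrite brZr (hs x).2 !scalerA mulrC.
- rewrite brZl brZr hz ThZ !scalerA -rmorphM -rmorphN -rmorphM; congr (_%:C *: _).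
  by rewrite mulrNN mulrA mulVf ?mul1r // mulf_neq0 // pnatr_eq0.
- rewrite pairingZr mulNr; have -> : 4 * pi * (s * s) * pairing a z = 2 * (2 * pi * pairing a z) * (s * s) by ring.
  rewrite s2; move: (2 * pi * pairing a z) c0 => w c0.
  by rewrite div1r invrN mulrN opprK mulfK // -oppr_eq0 gt_eqF.
Qed.

Definition is_root a := a != 0 /\ exists2 E, E != 0 & isrv a E.

Section Coroot.
Variables (a : 'rV[R]_r) (X Y : 'M[R[i]]_m) (y : 'rV[R]_r).
Hypothesis hs : sl2 a X Y y.

Let Z := br X Y.

Lemma sl_Z : Th y = - (4 * pi)%:C *: Z.
Proof.
rewrite /Z (sl_XY hs) scalerA mulrNN -rmorphM divff ?rmorph1 ?scale1r //.
by rewrite mulf_neq0 // gt_eqF // pi_gt0.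
Qed.

Lemma sl_ay : th a y = 4 * pi.
Proof. by rewrite /th (sl_2 hs); ring. Qed.

Lemma sl_ZX : br Z X = Y.
Proof.
rewrite /Z (sl_XY hs) brZl (sl_hX hs) sl_ay scalerA mulrNN -rmorphM mulVf ?rmorph1 ?scale1r //.
by rewrite mulf_neq0 // gt_eqF // pi_gt0.
Qed.

Lemma sl_ZY : br Z Y = - X.
Proof.
rewrite /Z (sl_XY hs) brZl (sl_hY hs) sl_ay scalerA mulNr -rmorphM mulVf ?rmorph1 ?scaleN1r //.
by rewrite mulf_neq0 // gt_eqF // pi_gt0.
Qed.

Definition reflx x := x - pairing a x *: y.
Definition refla b := b - pairing b y *: a.

Lemma pairing_refl b x : pairing b (reflx x) = pairing (refla b) x.
Proof.
rewrite /reflx /refla pairingDr pairingDl -!scaleNr pairingZr pairingZl.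
by rewrite !mulNr mulrC.
Qed.

Lemma pairing_reflx x : pairing a (reflx x) = - pairing a x.
Proof. by rewrite pairingDr -scaleNr pairingZr (sl_2 hs); ring. Qed.

Lemma reflxK x : reflx (reflx x) = x.
Proof.
by rewrite {1}/reflx pairing_reflx scaleNr opprK /reflx subrK.
Qed.

Lemma wZ : expm (pi%:C *: X) * Z = - (Z * expm (pi%:C *: X)).
Proof.
rewrite (@conj_rot R m X Z (- Y) pi (-1)) ?scaleN1r //; last 2 first.
- exact: cis_pi.
- exact: cis_Npi.
- by rewrite brC sl_ZX.
- by rewrite brNr.
Qed.

(** The element exp (pi X) commutes with Th u when <a, u> = 0, since then the bracket of Th u and X
    vanishes, and it negates the coroot: it acts as the reflection. *)
Lemma w_Th x : expm (pi%:C *: X) * Th x = Th (reflx x) * expm (pi%:C *: X).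
Proof.
pose c := pairing a x / 2; have [u uE] : exists u, u = x - c *: y by eexists.
have au : pairing a u = 0.
  by rewrite uE pairingDr -scaleNr pairingZr (sl_2 hs) /c mulNr divfK // subrr.
have cu : expm (pi%:C *: X) * Th u = Th u * expm (pi%:C *: X).
  apply/esym/comm_expm; rewrite -mxsAr -mxsAl; congr (_ *: _); apply/br_eq0.
  by rewrite (sl_hX hs) /th au mulr0 oppr0 scale0r.
have cy : expm (pi%:C *: X) * Th y = - Th y * expm (pi%:C *: X).
  by rewrite sl_Z -mxsAr wZ scalerN mulNr -mxsAl.
have -> : x = u + c *: y by rewrite uE subrK.
have -> : reflx (u + c *: y) = u + c *: (- y).
  rewrite /reflx pairingDr pairingZr au (sl_2 hs) add0r -addrA -scalerBl scalerN -scaleNr.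
  by congr (_ + _ *: _); ring.
have e : Th (- y) = - Th y by rewrite -scaleN1r ThZ rmorphN1 scaleN1r.
by rewrite !ThD !ThZ mulrDr mulrDl cu e -mxsAr cy -mxsAl.
Qed.

Lemma conj_ophom (gg : G) f : ophom f -> ophom (fun s : R => (gg * f s * gg^-1)%g).
Proof.
move=> hf; split=> [t u|W hW]; first by rewrite hf.1 !mulgA mulgVK.
have : nbhs (1%g : G) (fun h => W (gg * h * gg^-1)%g).
  apply: (@tg_mull G gg 1%g (fun y => W (y * gg^-1)%g)).
  apply: (@tg_mulr G (gg^-1)%g (gg * 1)%g W).
  by rewrite mulg1 mulgV.
by move/hf.2.
Qed.

Lemma weyl_refl : weyl_element tau (1%:M - a^T *m y) /\ exists gg, forall x, rho gg * Th x = Th (reflx x) * rho gg.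
Proof.
have [gg hgg] : exists gg, rho gg = expm (pi%:C *: X) by have [h] := sl_X hs pi; exists h.
have hT x : rho gg * Th x = Th (reflx x) * rho gg by rewrite hgg w_Th.
split; last by exists gg.
exists gg => x; have -> : x *m (1%:M - a^T *m y) = reflx x.
  rewrite mulmxBr mulmx1 mulmxA /reflx; congr (_ - _).
  rewrite [x *m a^T]mx11_scalar mul_scalar_mx; congr (_ *: _).
  by rewrite /pairing -[x *m a^T]trmxK trmx_mul trmxK [LHS]mxE.
have := ophom_eq hG rho1 rhoM rhoN rho_nt (conj_ophom gg (tau_ophom htau x)) (tau_ophom htau (reflx x)).
move=> h; have {h} := h _ 1; rewrite !scale1r; apply => s.
rewrite !rhoM !ThE -(expm_conj rho1 rhoM); congr expm.
rewrite !ThZ -mxsAr -mxsAl; congr (_ *: _).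
by rewrite hT -mulrA (rhoV rho1 rhoM) mulr1.
Qed.

(** The reflection sends a to -a; expanding the invariance of B on the pair b, a gives the
    identity. *)
Lemma coroot_ip (B : 'M[R]_r) : invariant_inner_product tau B ->
  forall b, pairing b y * ip B a a = 2 * ip B b a.
Proof.
move=> [Bs Bp Bw] b; have [/Bw h _] := weyl_refl.
have e c : c *m (1%:M - a^T *m y)^T = refla c.
  rewrite linearB /= trmx1 trmx_mul trmxK mulmxBr mulmx1 mulmxA /refla; congr (_ - _).
  by rewrite [c *m y^T]mx11_scalar mul_scalar_mx.
have := h b a; rewrite !e.
have -> : refla a = - a.
  by rewrite /refla (sl_2 hs) scaler_nat mulr2n opprD addrA subrr sub0r.
rewrite /refla /ip mulmxBl linearN mulmxN mulmxBl -!scalemxAl !mxE.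
by lra.
Qed.

(** exp (2 pi Z) commutes with X, hence with exp (pi X), which on the other hand conjugates it to
    its inverse. So exp (4 pi Z) = 1, and Th y = - 4 pi Z. The integrality of Cartan numbers
    follows. *)
Lemma exp_coroot : expm (Th y) = 1.
Proof.
set W := expm (pi%:C *: X).
have c1 : expm ((2 * pi)%:C *: Z) * X = X * expm ((2 * pi)%:C *: Z).
  rewrite (@conj_rot R m Z X Y (2 * pi) 1) ?scale1r //.
  - exact: sl_ZX.
  - exact: sl_ZY.
  - exact: cis_2pi.
  - exact: cis_N2pi.
have c2 : expm ((2 * pi)%:C *: Z) * W = W * expm ((2 * pi)%:C *: Z).
  by apply: comm_expm; rewrite -mxsAr -mxsAl c1.
have c3 : W * expm ((2 * pi)%:C *: Z) = expm (- ((2 * pi)%:C *: Z)) * W.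
  apply/esym; apply: expm_intertwine; rewrite !mulmxE mulNr -mxsAl -mxsAr wZ scalerN //.
have c4 : expm ((2 * pi)%:C *: Z) = expm (- ((2 * pi)%:C *: Z)).
  move: (etrans c2 c3) => /(congr1 (fun M => M * expm (- (pi%:C *: X)))).
  by rewrite -!mulrA expmN !mulr1.
have -> : Th y = - ((2 * pi)%:C *: Z) + - ((2 * pi)%:C *: Z).
  by rewrite sl_Z -scaleNr -scalerDl; congr (_ *: _); rewrite -!rmorphN -rmorphD; congr (_%:C); ring.
by rewrite expmD // -{1}c4 expmN.
Qed.

Lemma rv_int b E : E != 0 -> isrv b E -> pairing b y \is a Num.int.
Proof.
move=> E0 hE; apply: cis_int; have := rv_conj y hE; rewrite ThE exp_coroot mul1r mulr1.
move/esym/eqP; rewrite -subr_eq0 -[X in _ - X]scale1r -scalerBl scaler_eq0 (negbTE E0) orbF.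
by rewrite subr_eq0 => /eqP.
Qed.

Lemma gC_conj gg E : gC E -> gC (rho gg * E * rho (gg^-1)%g).
Proof.
move=> [A [B [hA hB ->]]]; exists (rho gg * A * rho (gg^-1)%g), (rho gg * B * rho (gg^-1)%g).
by split; [exact: (lalg_conj rho1 rhoM)|exact: (lalg_conj rho1 rhoM)|rewrite mulrDr mulrDl -mxsAr -mxsAl].
Qed.

Lemma root_refl b : is_root b -> is_root (refla b).
Proof.
move=> [b0 [E E0 hE]]; have [_ [gg hgg]] := weyl_refl.
have hV x : Th x * rho gg = rho gg * Th (reflx x) by rewrite hgg reflxK.
split.
  apply: contra b0 => /eqP h; apply/eqP/pairing_ext => x.
  by rewrite -[x]reflxK pairing_refl h !pairing0l.
exists (rho gg * E * rho (gg^-1)%g).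
  apply: contra E0 => /eqP h; apply/eqP.
  have := congr1 (fun M => rho (gg^-1)%g * M * rho gg) h.
  by rewrite /= !mulrA (rhoVl rho1 rhoM) mul1r -mulrA (rhoVl rho1 rhoM) mulr1 mulr0 mul0r.
split; first exact: gC_conj hE.1.
move=> x; have -> : wt (refla b) x = wt b (reflx x) by rewrite !wtE pairing_refl.
have hV2 : rho (gg^-1)%g * Th x = Th (reflx x) * rho (gg^-1)%g.
  apply: rho_cancel; rewrite -mulrA hV mulrA (rhoVl rho1 rhoM) mul1r //.
rewrite mxsAl mxsAr -hE.2 /br mulrBr mulrBl !mulrA hV; congr (_ - _).
by rewrite -!mulrA hV2.
Qed.

Lemma br_cx (U V A B : 'M[R[i]]_m) : br (U + ii *: V) (A + ii *: B) =
  (br U A - br V B) + ii *: (br U B + br V A).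
Proof.
rewrite brDl !brDr !brZl !brZr scalerA ii2 scaleN1r.
move: (br U A) (br U B) (br V A) (br V B) => p q s t.
by rewrite scalerDr -!addrA; congr (_ + _); rewrite addrA addrC.
Qed.

(* After subtraction of a multiple of [X + ii *: Y], [E] is orthogonal to
   [F = - X + ii *: Y] and commutes with it; by invariance of the trace form,
   the square norms of [br (X + ii *: Y) E] and of [E] then have opposite signs. *)
Lemma rv_dim1 E : isrv a E -> exists c : R[i], E = c *: (X + ii *: Y).
Proof.
move=> hE.
have hXY : isrv a (X + ii *: Y).
  split; first by exists X, Y; split; [exact: sl_X hs|exact: sl_Y hs|].
  move=> x; rewrite brDr brZr (sl_hX hs) (sl_hY hs) /wt cx_scale -/(th a x).
  by rewrite scale0r sub0r scale0r add0r scaleNr.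
pose F := - X + ii *: Y.
have hF x : br (Th x) F = - wt a x *: F.
  rewrite /F brDr brNr brZr (sl_hX hs) (sl_hY hs) -wtN /wt pairingNl mulrN cx_scale -/(th a x).
  by rewrite scale0r sub0r scale0r add0r scalerN rmorphN !scaleNr !opprK.
have trEF : \tr ((X + ii *: Y) * F) != 0.
  apply/eqP => h; have [_] := gC_form (sl_X hs) (sl_Y hs).
  have -> : X - ii *: Y = - F by rewrite /F opprD opprK.
  rewrite mulrN retrN h /= oppr0 => /(_ erefl) [X0 _].
  by have := sl_Z; rewrite /Z X0 br0l scaler0 => y0; have := sl_2 hs;
    have : y = 0; [exact: (Th_inj hG rho1 rhoM rhoN rho_nt htau ThZ ThE) | move=> ->; rewrite /pairing trmx0 mulmx0 mxE => /esym/eqP; rewrite pnatr_eq0].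
pose c := \tr (E * F) / \tr ((X + ii *: Y) * F).
exists c; apply/eqP; rewrite -subr_eq0; apply/eqP.
set E' := E - c *: (X + ii *: Y).
have hE' : isrv a E'.
  split; first by apply: gCB; [exact: hE.1 | apply: gCZ; exact: hXY.1].
  by move=> x; rewrite /E' brDr brNr brZr hE.2 hXY.2 scalerBr !scalerA mulrC.
have tE' : \tr (E' * F) = 0.
  by rewrite /E' mulrBl trB -mxsAl linearZ /= /c divfK // subrr.
have [A [B [hA hB eE']]] := hE'.1.
have gF : gC F by exists (- X), Y; split=> //; [apply: lalgN; exact: sl_X hs | exact: sl_Y hs].
have com x : br (Th x) (br E' F) = 0.
  by rewrite jacobi hE'.2 hF brZl brZr scaleNr subrr.
have [U [V [hU hV eUV]]] := gC_br hE'.1 gF.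
have comUV x : br (Th x) U = 0 /\ br (Th x) V = 0.
  have := com x; rewrite eUV brDr brZr => h.
  have := @gC_inj (br (Th x) U) (br (Th x) V) 0 0 (g_br (ThL x) hU) (g_br (ThL x) hV) (@lalg0 _ _ _ _ rho1) (@lalg0 _ _ _ _ rho1).
  by apply; rewrite h scaler0 addr0.
have [u eU] : exists u, U = Th u.
  by apply: cent => // x; apply/esym/br_eq0; exact: (comUV x).1.
have [v eV] : exists v, V = Th v.
  by apply: cent => // x; apply/esym/br_eq0; exact: (comUV x).2.
have tr0 x : \tr (br E' F * Th x) = 0.
  by rewrite tr_br brC hF scaleNr opprK -mxsAr linearZ /= tE' mulr0.
have BF0 : br E' F = 0.
  have [_ h] := gC_form hU hV.
  have [|U0 V0] := h; last by rewrite eUV U0 V0 scaler0 addr0.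
  by rewrite -eUV mulrBr -mxsAr eU eV trB linearZ /= !tr0 mulr0 subr0.
(* Minus the conjugate of [E'], so that the trace of E' F' measures the norm of E'. *)
pose F' := - A + ii *: B.
have gX := sl_X hs; have gY := sl_Y hs.
have eqs : br X A + br Y B = 0 /\ br Y A - br X B = 0.
  have : br F E' = (- (br X A + br Y B)) + ii *: (br Y A - br X B).
    by rewrite eE' /F br_cx !brNl; move: (br X A) (br Y B) (br Y A) (br X B) => p q s t;
      rewrite opprD [- t + _]addrC.
  rewrite brC BF0 oppr0 => /esym h.
  have gD := lalgD L hG rho1 rhoM rhoN rho_nt; have gB := lalgB L hG rho1 rhoM rhoN rho_nt.
  have := @gC_inj (- (br X A + br Y B)) (br Y A - br X B) 0 0 _ _ (@lalg0 _ _ _ _ rho1) (@lalg0 _ _ _ _ rho1).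
  rewrite h scaler0 addr0 => h2; have [||//|h3 h4] := h2.
  - by apply: lalgN; apply: gD; exact: g_br.
  - by apply: gB; exact: g_br.
  by split=> //; apply/eqP; rewrite -oppr_eq0 h3.
have EF'0 : br (X + ii *: Y) F' = 0.
  have -> : br (X + ii *: Y) F' = - (br X A + br Y B) - ii *: (br Y A - br X B).
    by rewrite /F' br_cx !brNr; move: (br X A) (br Y B) (br Y A) (br X B) => p q s t;
      rewrite opprD -scalerN opprB.
  by rewrite eqs.1 eqs.2 scaler0 subr0 oppr0.
have hF' x : br (Th x) F' = - wt a x *: F'.
  have [h1 h2] := rv_split hA hB (eq_ind _ (isrv a) hE' _ eE') x.
  rewrite /F' brDr brNr brZr h1 h2 -wtN /wt pairingNl mulrN cx_scale -/(th a x).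
  by rewrite scale0r sub0r scale0r add0r scalerN rmorphN !scaleNr !opprK.
have eH : br (X + ii *: Y) F = (2 : R[i]) *: (ii *: Z).
  rewrite /F !brDl !brDr !brZl !brZr !brNr !brXX !scaler0 addr0 oppr0 add0r.
  by rewrite [br Y X]brC opprK -/Z scaler_nat mulr2n.
have HF' : br (br (X + ii *: Y) F) F' = - (2 : R[i]) *: F'.
  rewrite eH !brZl /Z (sl_XY hs) brZl hF' wtE -/(th a y) sl_ay !scalerA; congr (_ *: _).
  have : ((4 * pi)^-1 : R)%:C * (4 * pi)%:C = 1 :> R[i].
    by rewrite -rmorphM mulVf ?rmorph1 // mulf_neq0 ?gt_eqF ?pi_gt0.
  move: (ii2); move: (_^-1)%:C (4 * pi)%:C ii => K K' i i2 e1.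
  have -> : 2 * i * - K * - (K' * i) = 2 * (K * K') * (i * i) by ring.
  by rewrite e1 i2 mulr1 mulrN1.
have key : \tr (br (X + ii *: Y) E' * br F F') = 2 * \tr (E' * F').
  rewrite brC mulNr raddfN /= tr_br jacobi HF' EF'0 br0r addr0 -mxsAr linearZ /= mulNr opprK //.
have f1 := gC_form hA hB.
have eF' : A - ii *: B = - F' by rewrite /F' opprD opprK.
rewrite -eE' eF' mulrN retrN in f1.
have [C' [D' [hC' hD' eN]]] := gC_br hXY.1 hE'.1.
have f2 := gC_form hC' hD'.
have eN2 : C' - ii *: D' = br F F'.
  have h3 := eN.
  have gD := lalgD L hG rho1 rhoM rhoN rho_nt; have gB := lalgB L hG rho1 rhoM rhoN rho_nt.
  have e4 : br (X + ii *: Y) E' = (br X A - br Y B) + ii *: (br X B + br Y A).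
    by rewrite eE' br_cx.
  rewrite e4 in h3.
  have [||//|//|<- <-] := gC_inj _ _ _ _ h3; [by apply: gB; exact: g_br|by apply: gD; exact: g_br|].
  by rewrite /F /F' br_cx !brNl !brNr opprK -opprD scalerN.
rewrite -eN eN2 key in f2.
have e5 : Re (2 * \tr (E' * F')) = 2 * Re (\tr (E' * F')).
  by case: (\tr (E' * F')) => p q /=; ring.
rewrite e5 in f2.
have z : - Re (\tr (E' * F')) = 0 by move: f1.1 f2.1; lra.
by have [A0 B0] := f1.2 z; rewrite eE' A0 B0 scaler0 addr0.
Qed.

End Coroot.

End Root.

(** * Weights *)

Section Ip.
Variables (R : realType) (r : nat) (B : 'M[R]_r).
Implicit Types a b c : 'rV[R]_r.

Lemma ipDl a b c : ip B (a + b) c = ip B a c + ip B b c.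
Proof. by rewrite /ip !mulmxDl mxE. Qed.
Lemma ipZl (z : R) a c : ip B (z *: a) c = z * ip B a c.
Proof. by rewrite /ip -!scalemxAl mxE. Qed.
Lemma ipNl a c : ip B (- a) c = - ip B a c.
Proof. by rewrite -scaleN1r ipZl mulN1r. Qed.
Lemma ipBl a b c : ip B (a - b) c = ip B a c - ip B b c.
Proof. by rewrite ipDl ipNl. Qed.
Lemma ip0l c : ip B 0 c = 0.
Proof. by rewrite /ip !mul0mx mxE. Qed.
Lemma ip_suml (s : seq 'rV[R]_r) c : ip B (\sum_(a <- s) a) c = \sum_(a <- s) ip B a c.
Proof.
elim: s => [|a s IH]; first by rewrite !big_nil ip0l.
by rewrite !big_cons ipDl IH.
Qed.

Definition cart b a := 2 * ip B b a / ip B a a.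
Definition refl a b := b - cart b a *: a.

Hypothesis symB : forall a b, ip B a b = ip B b a.
Hypothesis posB : forall a, a != 0 -> 0 < ip B a a.

Lemma ipDr a b c : ip B c (a + b) = ip B c a + ip B c b.
Proof. by rewrite symB ipDl !(symB c). Qed.
Lemma ipZr (z : R) a c : ip B c (z *: a) = z * ip B c a.
Proof. by rewrite symB ipZl (symB c). Qed.
Lemma ipNr a c : ip B c (- a) = - ip B c a.
Proof. by rewrite symB ipNl (symB c). Qed.
Lemma ipBr a b c : ip B c (a - b) = ip B c a - ip B c b.
Proof. by rewrite ipDr ipNr. Qed.

Lemma ip_eq0 a : ip B a a = 0 -> a = 0.
Proof. by move=> h; apply/eqP/negPn/negP => /posB; rewrite h ltxx. Qed.

Lemma cart_self a : a != 0 -> cart a a = 2.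
Proof. by move=> /posB h; rewrite /cart mulfK // gt_eqF. Qed.

Lemma cart_ip b a : a != 0 -> cart b a * ip B a a = 2 * ip B b a.
Proof. by move=> /posB h; rewrite /cart divfK // gt_eqF. Qed.

Lemma reflK a : a != 0 -> involutive (refl a).
Proof.
move=> a0 b; rewrite /refl -addrA -opprD -scalerDl.
suff -> : cart b a + cart (b - cart b a *: a) a = 0 by rewrite scale0r subr0.
rewrite {2}/cart ipBl ipZl mulrBr mulrCA -cart_ip // -mulrBr /cart.
by have := posB a0 => h; field; rewrite gt_eqF.
Qed.

Lemma refl_norm a b : a != 0 -> ip B (refl a b) (refl a b) = ip B b b.
Proof.
move=> a0; rewrite /refl ipBl !ipBr !ipZl !ipZr (symB a b).
have := cart_ip b a0; move: (cart b a) => c h.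
have -> : c * (c * ip B a a) = c * (2 * ip B b a) by rewrite h.
by ring.
Qed.

(* A sum of roots shorter than every root vanishes: some root of the sum makes
   an acute angle with it, hence can be subtracted without increasing the norm. *)
Lemma short_sum0 (root : 'rV[R]_r -> Prop) (M : R) :
  (forall a, root a -> a != 0 /\ M <= ip B a a) ->
  (forall a b, root a -> root b -> cart b a \is a Num.int) ->
  forall s : seq 'rV[R]_r, (forall c, c \in s -> root c) ->
  ip B (\sum_(c <- s) c) (\sum_(c <- s) c) < M -> \sum_(c <- s) c = 0.
Proof.
move=> hr hi s; move: {2}(size s) (erefl (size s)) => n.
elim: n s => [|n IH] s hn hs; first by rewrite (size0nil hn) big_nil.
set v := \sum_(c <- s) c => vM.
apply/eqP/negPn/negP => v0.
have vp := posB v0.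
have [a as_ av] : exists2 a, a \in s & 0 < ip B v a.
  apply/not_exists2P => hN.
  have : ip B v v <= 0.
    rewrite {1}/v ip_suml big_seq; apply: sumr_le0 => a as_.
    by rewrite symB leNgt; apply/negP => h; case: (hN a).
  by rewrite leNgt vp.
have [a0 aM] := hr a (hs _ as_).
have ap := posB a0.
have ci : 1 <= cart v a.
  have : cart v a \is a Num.int.
    have -> : cart v a = \sum_(c <- s) cart c a.
      by rewrite /cart /v ip_suml mulr_sumr mulr_suml.
    by rewrite big_seq; apply: rpred_sum => c /hs hc; apply: hi => //; exact: hs.
  have : 0 < cart v a by rewrite divr_gt0 // mulr_gt0.
  by move=> h /intrP [z e]; move: h; rewrite e ltr0z -[1]/(1%:~R) ler_int.
have e : \sum_(c <- rem a s) c = v - a.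
  by rewrite /v (big_rem a as_) /= addrAC subrr add0r.
have : v - a = 0.
  rewrite -e; apply: IH; first by rewrite size_rem // hn.
    by move=> c /mem_rem /hs.
  rewrite e ipBl !ipBr (symB a v); apply: le_lt_trans vM.
  have := cart_ip v a0; have : ip B a a <= cart v a * ip B a a by rewrite ler_peMl // ltW.
  by move: (ip B v a) (ip B a a) (ip B v v) (cart v a * _) => p q t c; lra.
by move=> /eqP; rewrite subr_eq0 => /eqP va; move: vM; rewrite va ltNge aM.
Qed.

End Ip.

Section Weights.
Variables (R : realType) (r m : nat).
Local Notation C := R[i].
Local Notation ii := (0 +i* 1 : C).
Implicit Types a b x : 'rV[R]_r.
Implicit Types X Y E F : 'M[C]_m.

Definition rootv (gC : 'M[C]_m -> Prop) (Th : 'rV[R]_r -> 'M[C]_m) a E :=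
  gC E /\ forall x, br (Th x) E = wt a x *: E.

Definition rooty gC Th a := a != 0 /\ exists2 E, E != 0 & rootv gC Th a E.

(* [mu] lists the weights: the Lie algebra of the torus acts diagonally. *)
Record rdat (gC : 'M[C]_m -> Prop) (Th : 'rV[R]_r -> 'M[C]_m) (mu : 'I_m -> 'rV[R]_r)
    (B : 'M[R]_r) : Prop := {
  rdD : forall X Y, gC X -> gC Y -> gC (X + Y) ;
  rdZ : forall (c : C) X, gC X -> gC (c *: X) ;
  rdbr : forall X Y, gC X -> gC Y -> gC (br X Y) ;
  rdTh : forall x, gC (Th x) ;
  rdinj : forall x, Th x = 0 -> x = 0 ;
  rddiag : forall x, Th x = diag_mx (\row_j wt (mu j) x) ;
  rdcent : forall X, gC X -> (forall x, br (Th x) X = 0) -> exists u v, X = Th u + ii *: Th v ;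
  rdform : forall X, gC X -> (forall Y, gC Y -> \tr (X * Y) = 0) -> X = 0 ;
  rdsl2 : forall a, rooty gC Th a -> exists E F y,
    [/\ rootv gC Th a E, rootv gC Th (- a) F, br E F = ((2 * pi)%:C * ii)^-1 *: Th y,
        forall b, pairing b y = cart B b a
      & forall E', rootv gC Th a E' -> exists c : C, E' = c *: E] ;
  rdweyl : forall a, rooty gC Th a -> exists y (w w' : 'M[C]_m),
    [/\ forall b, pairing b y = cart B b a, w' * w = 1
      & forall x, w * Th x = Th (x - pairing a x *: y) * w] ;
  rdrefl : forall a b, rooty gC Th a -> rooty gC Th b -> rooty gC Th (refl B a b) ;
  rdint : forall a b, rooty gC Th a -> rooty gC Th b -> cart B b a \is a Num.int ;
  rdirr : forall S : 'cV[C]_m -> Prop,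
    (forall u v, S u -> S v -> S (u + v)) -> (forall (c : C) u, S u -> S (c *: u)) ->
    (forall X u, gC X -> S u -> S (X *m u)) ->
    forall v, v != 0 -> S v -> forall u, S u ;
  rdsym : forall a b, ip B a b = ip B b a ;
  rdpos : forall a, a != 0 -> 0 < ip B a a }.

Variables (gC : 'M[C]_m -> Prop) (Th : 'rV[R]_r -> 'M[C]_m) (mu : 'I_m -> 'rV[R]_r).
Variable (B : 'M[R]_r).
Hypothesis H : rdat gC Th mu B.
Local Notation rv := (rootv gC Th).
Local Notation root := (rooty gC Th).

Lemma th_mul x X p q : (Th x * X) p q = wt (mu p) x * X p q.
Proof. by rewrite (rddiag H) -mulmxE mul_diag_mx !mxE. Qed.

Lemma mul_th x X p q : (X * Th x) p q = X p q * wt (mu q) x.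
Proof. by rewrite (rddiag H) -mulmxE mul_mx_diag !mxE. Qed.

Lemma br_th x X p q : br (Th x) X p q = wt (mu p - mu q) x * X p q.
Proof.
have -> : br (Th x) X p q = (Th x * X) p q - (X * Th x) p q by rewrite /br !mxE.
by rewrite th_mul mul_th wtD wtN mulrDl mulNr [X p q * _]mulrC.
Qed.

Lemma rv_entry a E p q : rv a E -> E p q != 0 -> mu p = mu q + a.
Proof.
move=> [_ hE] e0; apply/eqP; rewrite addrC -subr_eq; apply/eqP/wt_ext => x.
by apply: (mulIf e0); rewrite -br_th hE mxE.
Qed.

Lemma rv_th x : rv 0 (Th x).
Proof.
split=> [|y]; first exact: (rdTh H).
apply/matrixP => p q; rewrite br_th !mxE (rddiag H) !mxE.
by case: eqVneq => [->|_]; [rewrite subrr|rewrite mulr0n !mulr0].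
Qed.

Lemma gC_0 : gC 0.
Proof. by have := rdZ H 0 (rdTh H 0); rewrite scale0r. Qed.

Lemma gC_sm (I : Type) (s : seq I) (F : I -> 'M[C]_m) : (forall j, gC (F j)) -> gC (\sum_(j <- s) F j).
Proof.
move=> h; elim: s => [|a s IH]; first by rewrite big_nil; exact: gC_0.
by rewrite big_cons; apply: (rdD H).
Qed.

Lemma tr_rv0 a b X Y : rv a X -> rv b Y -> a + b != 0 -> \tr (X * Y) = 0.
Proof.
move=> hX hY ab; rewrite /mxtrace big1 // => p _.
rewrite mxE big1 // => q _.
have [->|x0] := eqVneq (X p q) 0; first by rewrite mul0r.
have [->|y0] := eqVneq (Y q p) 0; first by rewrite mulr0.
have e1 := rv_entry hX x0; have e2 := rv_entry hY y0.
case/eqP: ab; apply: (addrI (mu p)); rewrite addr0 {2}e1 e2.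
by rewrite -addrA [b + a]addrC.
Qed.

(** If v vanishes at x, move along some y with <v, y> non-zero by a t exceeding all the ratios |<u,
    x>/<u, y>|: no previous u can vanish at x + t y. *)
Lemma generic (s : seq 'rV[R]_r) : (forall v, v \in s -> v != 0) ->
  exists x, forall v, v \in s -> pairing v x != 0.
Proof.
elim: s => [|v s IH] hs; first by exists 0.
have [|x hx] := IH; first by move=> u us; apply: hs; rewrite inE us orbT.
have [y vy] : exists y, pairing v y != 0 by apply: pairing_nz; apply: hs; rewrite inE eqxx.
have [vx|vx] := eqVneq (pairing v x) 0; last first.
  by exists x => u; rewrite inE => /orP [/eqP -> //|/hx].
pose t := 1 + \sum_(u <- s) `|pairing u x / pairing u y|.
have tge u : u \in s -> `|pairing u x / pairing u y| < t.
  move=> us; rewrite /t (big_rem u) //=.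
  have : 0 <= \sum_(w <- rem u s) `|pairing w x / pairing w y| by apply: sumr_ge0.
  by move: (`|_|) (\sum_(w <- _) _) => p q; lra.
exists (x + t *: y) => u; rewrite inE => /orP [/eqP ->|us].
  rewrite pairingDr pairingZr vx add0r mulf_neq0 // gt_eqF // ltr_wpDr //.
  exact: sumr_ge0.
rewrite pairingDr pairingZr; have [uy|uy] := eqVneq (pairing u y) 0.
  by rewrite uy mulr0 addr0; exact: hx.
apply/eqP => h; have := tge u us.
have -> : pairing u x / pairing u y = - t.
  by apply: (mulIf uy); rewrite divfK // mulNr; apply/eqP; rewrite -subr_eq0 opprK h.
rewrite normrN ltNge ler_norm //.
Qed.

Definition dif := undup [seq mu pq.1 - mu pq.2 | pq <- enum {: 'I_m * 'I_m}].

Lemma mem_dif p q : mu p - mu q \in dif.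
Proof. by rewrite mem_undup; apply/mapP; exists (p, q) => //; rewrite mem_enum. Qed.

Definition comp a X := \matrix_(p, q) (if mu p - mu q == a then X p q else 0).

(** A polynomial in the bracket with Th x, at a generic x separating [a] from the other weight
    differences, kills all components but the one of weight [a]; it preserves gC. *)
Lemma gC_comp a X : gC X -> gC (comp a X).
Proof.
move=> hX.
pose s := [seq dl <- dif | dl != a].
have [|x hx] := generic (s := [seq dl - a | dl <- s]).
  by move=> v /mapP [dl]; rewrite mem_filter => /andP [h _] ->; rewrite subr_eq0.
pose f (l : seq 'rV[R]_r) (b : 'rV[R]_r) : C := \prod_(dl <- l) (wt b x - wt dl x).
have gl l : gC (\matrix_(p, q) (f l (mu p - mu q) * X p q)).
  elim: l => [|dl l IH].
    suff -> : \matrix_(p, q) (f [::] (mu p - mu q) * X p q) = X by [].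
    by apply/matrixP => p q; rewrite mxE /f big_nil mul1r.
  set Y := \matrix_(p, q) _ in IH.
  suff -> : \matrix_(p, q) (f (dl :: l) (mu p - mu q) * X p q) =
      br (Th x) Y + (- wt dl x) *: Y.
    by apply: (rdD H); [apply: (rdbr H) => //; exact: (rdTh H)|exact: (rdZ H)].
  apply/matrixP => p q; rewrite [in RHS]mxE br_th !mxE /f big_cons; ring.
have fa : f s a != 0.
  rewrite /f prodf_seq_neq0; apply/allP => dl ds /=.
  rewrite -wtN -wtD wtE mulf_neq0 // ?(eqCN0 _) //; last first.
    by apply/eqP; case=> /eqP; rewrite oner_eq0.
  apply/eqP => /(congr1 (@complex.Re R)) /= /eqP; apply/negP; rewrite mulf_neq0 ?tpi //.
  by rewrite -opprB pairingNl oppr_eq0; apply: hx; apply: map_f.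
suff -> : comp a X = (f s a)^-1 *: \matrix_(p, q) (f s (mu p - mu q) * X p q).
  exact: (rdZ H).
apply/matrixP => p q; rewrite !mxE; case: eqVneq => [->|ne]; first by rewrite mulKf.
suff -> : f s (mu p - mu q) = 0 by rewrite mul0r mulr0.
rewrite /f (big_rem (mu p - mu q)) /= ?subrr ?mul0r //.
by rewrite mem_filter ne mem_dif.
Qed.

Lemma comp_rv a X : gC X -> rv a (comp a X).
Proof.
move=> hX; split=> [|x]; first exact: gC_comp.
by apply/matrixP => p q; rewrite br_th !mxE; case: eqVneq => [->|]; rewrite ?mulr0.
Qed.

(** A non-zero entry of a root vector exhibits the root as a difference of two weights, so the roots
    form a finite list. *)
Definition phis := [seq a <- dif | `[< root a >]].

Lemma phis_uniq : uniq phis.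
Proof. by rewrite filter_uniq // undup_uniq. Qed.

Lemma mx_neq0 (n p : nat) (A : 'M[C]_(n, p)) : A != 0 -> exists i j, A i j != 0.
Proof.
move=> A0; apply: contrapT => h; case/eqP: A0; apply/matrixP => i j; rewrite mxE.
by apply: contrapT => /eqP h2; apply: h; exists i, j.
Qed.

Lemma phisP a : a \in phis <-> root a.
Proof.
rewrite mem_filter; split=> [/andP [/asboolP //]|ra].
have [a0 [E E0 hE]] := ra.
have [p [q e]] := mx_neq0 E0.
rewrite (asboolT ra) /=; have -> : a = mu p - mu q; last exact: mem_dif.
by rewrite (rv_entry hE e) addrC addKr.
Qed.

Lemma span X : gC X -> exists u v (Y : 'rV[R]_r -> 'M[C]_m),
  (forall a, rv a (Y a)) /\ X = Th u + ii *: Th v + \sum_(a <- phis) Y a.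
Proof.
move=> hX.
have [|u [v e]] := rdcent H (gC_comp 0 hX).
  by move=> x; have [_ ->] := comp_rv 0 hX; rewrite wtE pairing0l mulr0 rmorph0 mul0r scale0r.
exists u, v, (fun a => comp a X); split=> [a|]; first exact: comp_rv.
rewrite -e; apply/matrixP => p q; rewrite mxE summxE.
have -> : \sum_(a <- phis) comp a X p q = if mu p - mu q == 0 then 0 else X p q.
  case: eqVneq => [e0|ne0].
    rewrite big_seq big1 // => a /phisP [a0 _].
    by rewrite mxE e0 eq_sym (negbTE a0).
  have [x0|x0] := eqVneq (X p q) 0.
    by rewrite x0 big1 // => a _; rewrite mxE x0 if_same.
  have hr : mu p - mu q \in phis.
    apply/phisP; split=> //; exists (comp (mu p - mu q) X); last exact: comp_rv.
    by apply/eqP => /matrixP /(_ p q); rewrite !mxE eqxx => /eqP; rewrite (negbTE x0).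
  rewrite (bigD1_seq (mu p - mu q)) ?phis_uniq //= mxE eqxx big1 ?addr0 // => a ne.
  by rewrite mxE eq_sym (negbTE ne).
by rewrite mxE; case: eqP; rewrite ?addr0 ?add0r.
Qed.

End Weights.

(** * The Casimir operator *)

Section Casimir.
Variables (R : realType) (r m : nat).
Local Notation C := R[i].
Local Notation ii := (0 +i* 1 : C).
Variables (gC : 'M[C]_m -> Prop) (Th : 'rV[R]_r -> 'M[C]_m) (mu : 'I_m -> 'rV[R]_r).
Variable (B : 'M[R]_r).
Hypothesis H : rdat gC Th mu B.
Hypothesis m0 : (0 < m)%N.
Local Notation rv := (rootv gC Th).
Local Notation root := (rooty gC Th).
Local Notation phi := (phis gC Th mu).
Local Notation N := (size phi).

Definition mult b := #|[pred p | mu p == b]|.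

Definition al (k : 'I_N) := nth 0 phi k.

Lemma al_root k : root (al k).
Proof. by apply/(phisP H); rewrite mem_nth. Qed.

Lemma al_inj k l : al k = al l -> k = l.
Proof.
by move=> e; apply: val_inj; apply/eqP; rewrite -(nth_uniq 0 (ltn_ord k) (ltn_ord l) (phis_uniq gC Th mu)) -/(al k) e.
Qed.

Local Notation tp := (2 * pi : R).
Local Notation cN := ((tp)%:C * ii)^-1.

Lemma cN_wt (a x : 'rV[R]_r) : cN * wt a x = (pairing a x)%:C.
Proof.
have -> : wt a x = (tp%:C * ii) * (pairing a x)%:C by rewrite wtE rmorphM mulrAC.
rewrite mulKf //.
rewrite mulf_neq0 //; last by apply/eqP; case=> /eqP; rewrite oner_eq0.
by apply/eqP => /(congr1 (@complex.Re R)) /= /eqP; apply/negP; rewrite tpi.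
Qed.

(** Up to the factor - (2 pi)^2, the trace form on the Lie algebra of the torus. *)
Definition gram : 'M[R]_r := (\matrix_p mu p)^T *m (\matrix_p mu p).

Lemma gramE (x y : 'rV[R]_r) : ip gram x y = \sum_p pairing (mu p) x * pairing (mu p) y.
Proof.
rewrite /ip /gram mulmxA -mulmxA mxE; apply: eq_bigr => p _; congr (_ * _).
  by rewrite mxE [RHS]mxE; apply: eq_bigr => j _; rewrite !mxE mulrC.
by rewrite mxE [RHS]mxE; apply: eq_bigr => j _; rewrite !mxE.
Qed.

Lemma tr_thth x y : \tr (Th x * Th y) = (- tp ^+ 2 * ip gram x y)%:C.
Proof.
rewrite gramE mulr_sumr rmorph_sum; apply: eq_bigr => p _.
rewrite (th_mul H) (rddiag H) !mxE eqxx mulr1n !wtE.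
by apply/eqP; rewrite eq_complex /=; apply/andP; split; apply/eqP; ring.
Qed.

Lemma gram_unit : gram \in unitmx.
Proof.
rewrite -row_free_unit; apply: inj_row_free => v hv.
apply: (rdinj H).
have : ip gram v v = 0 by rewrite /ip hv mul0mx mxE.
rewrite gramE => h0.
have z p : pairing (mu p) v = 0.
  apply/eqP; rewrite -sqrf_eq0 expr2; apply/eqP.
  by apply: (psumr_eq0P _ h0) => // q _; rewrite -expr2 sqr_ge0.
by apply/matrixP => p q; rewrite (rddiag H) !mxE wtE z mulr0 rmorph0 mul0r mul0rn.
Qed.

Lemma th_sum x : Th x = \sum_i (x 0 i)%:C *: Th (delta_mx 0 i).
Proof.
apply/matrixP => p q; rewrite summxE (rddiag H) !mxE.
rewrite (eq_bigr (fun i => ((x 0 i)%:C * wt (mu p) (delta_mx 0 i)) *+ (p == q))); last first.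
  by move=> i _; rewrite !mxE (rddiag H) !mxE mulrnAr.
case: (p == q); last by rewrite big1.
under eq_bigr => i _ do rewrite mulr1n.
rewrite mulr1n.
rewrite [x in LHS](row_sum_delta x).
elim/big_ind2: _ => [|a b c e <- <-|i _]; first by rewrite wtE /pairing trmx0 mulmx0 mxE mulr0 rmorph0 mul0r.
  by rewrite !wtE pairingDr mulrDr rmorphD mulrDl.
by rewrite !wtE pairingZr mulrCA rmorphM mulrA.
Qed.

Section Basis.
Variables (E F : 'I_N -> 'M[C]_m) (y : 'I_N -> 'rV[R]_r).
Hypothesis hE : forall k, rv (al k) (E k).
Hypothesis hF : forall k, rv (- al k) (F k).
Hypothesis hEF : forall k, br (E k) (F k) = cN *: Th (y k).
Hypothesis hy : forall k b, pairing b (y k) = cart B b (al k).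
Hypothesis h1 : forall k E', rv (al k) E' -> exists c : C, E' = c *: E k.

Lemma th_diag k p q : (cN *: Th (y k)) p q = (cart B (mu p) (al k))%:C *+ (p == q).
Proof. by rewrite !mxE (rddiag H) !mxE mulrnAr cN_wt hy. Qed.

(** Both sides are tr (h^2) for h the bracket of E and F: invariance of the trace form moves one h
    onto F, on which it acts by -2, and the diagonal entries of h are the Cartan numbers of the
    weights. *)
Lemma tr_EF k : 2 * \tr (E k * F k) = (\sum_p cart B (mu p) (al k) ^+ 2)%:C.
Proof.
have e1 : br (F k) (cN *: Th (y k)) = 2%:R *: F k.
  rewrite brC brZl (hF k).2 scalerA -scaleNr cN_wt pairingNl rmorphN opprK hy cart_self //.
    by rewrite rmorph_nat.
  exact: (rdpos H).
  by have [] := al_root k.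
have := tr_br (E k) (F k) (cN *: Th (y k)).
rewrite e1 -mxsAr linearZ /= => <-; rewrite hEF rmorph_sum; apply: eq_bigr => p _.
rewrite mxE (bigD1 p) //= big1 ?addr0 => [|q qp]; last by rewrite th_diag eq_sym (negbTE qp) mulr0n mul0r.
by rewrite th_diag eqxx mulr1n -rmorphM expr2.
Qed.

Lemma tr_EF_neq0 k : \tr (E k * F k) != 0.
Proof.
apply/eqP => h0; have := tr_EF k; rewrite h0 mulr0 => /esym/(congr1 (@complex.Re R)) /= hs.
have z p : cart B (mu p) (al k) = 0.
  apply/eqP; rewrite -sqrf_eq0; apply/eqP.
  by apply: (psumr_eq0P _ hs) => // q _; rewrite sqr_ge0.
have [a0 _] := al_root k.
suff y0 : y k = 0.
  have := hy k (al k); rewrite y0 /pairing trmx0 mulmx0 mxE cart_self //; last exact: (rdpos H).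
  by move/esym/eqP; rewrite pnatr_eq0.
apply: (rdinj H); apply/matrixP => p q.
by rewrite (rddiag H) !mxE wtE hy z mulr0 rmorph0 mul0r mul0rn.
Qed.

Definition Bb (s : 'I_r + 'I_N) := match s with inl i => Th (delta_mx 0 i) | inr k => E k end.

(** The basis of gC dual to [Bb] for the trace form: the inverse Gram matrix on the torus, opposite
    root vectors elsewhere. *)
Definition Bd (s : 'I_r + 'I_N) := match s with
  | inl i => ((- tp ^+ 2)^-1)%:C *: Th (row i (invmx gram))
  | inr k => (\tr (E k * F k))^-1 *: F k end.

Lemma gC_Bb s : gC (Bb s).
Proof. by case: s => [i|k] /=; [exact: (rdTh H)|exact: (hE k).1]. Qed.

Lemma gC_Bd s : gC (Bd s).
Proof. by case: s => [i|k] /=; apply: (rdZ H); [exact: (rdTh H)|exact: (hF k).1]. Qed.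

Lemma Bb_Bd s t : \tr (Bb s * Bd t) = (s == t)%:R.
Proof.
have aN0 k : - al k != 0 by rewrite oppr_eq0; have [] := al_root k.
have a0 k : al k != 0 by have [] := al_root k.
case: s t => [i|k] [j|l] /=; rewrite -mxsAr linearZ /=.
- rewrite mxtrace_mulC tr_thth -rmorphM mulKf; last by rewrite oppr_eq0 sqrf_eq0 tpi.
  rewrite /ip -row_mul mulVmx ?gram_unit // row1 trmx_delta mul_delta_mx_cond.
  have -> : (inl i == inl j :> 'I_r + 'I_N) = (i == j) by [].
  by rewrite eq_sym; case: (i == j); rewrite ?mulr1n ?mulr0n mxE ?eqxx /= ?rmorph1 ?rmorph0.
- rewrite (tr_rv0 H (rv_th H _) (hF l)) ?mulr0 // add0r //.
- rewrite (tr_rv0 H (hE k) (rv_th H _)) ?mulr0 // addr0 //.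
- have [->|ne] := eqVneq k l; first by rewrite eqxx mulVf ?tr_EF_neq0.
  rewrite (tr_rv0 H (hE k) (hF l)) ?mulr0 ?[inr _ == _](negbTE ne) //.
  by rewrite subr_eq0; apply: contra ne => /eqP /al_inj ->.
Qed.

Lemma tr_suml (I : finType) (c : I -> C) (X : I -> 'M[C]_m) Y :
  \tr ((\sum_s c s *: X s) * Y) = \sum_s c s * \tr (X s * Y).
Proof.
by rewrite mulr_suml raddf_sum; apply: eq_bigr => s _ /=; rewrite -mxsAl linearZ.
Qed.

Lemma expand W : gC W -> W = \sum_s \tr (W * Bd s) *: Bb s.
Proof.
move=> hW; suff [c hc] : exists c, W = \sum_s c s *: Bb s.
  rewrite {1}hc; apply: eq_bigr => s _; congr (_ *: _).
  rewrite hc tr_suml (bigD1 s) //= Bb_Bd eqxx mulr1.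
  by rewrite big1 ?addr0 // => t ts; rewrite Bb_Bd (negbTE ts) mulr0.
have [u [v [Y [hY ->]]]] := span H hW.
have [c hc] := choice (fun k => h1 (hY (al k))).
exists (fun s => match s with inl i => (u 0 i)%:C + ii * (v 0 i)%:C | inr k => c k end).
rewrite big_sumType /=; congr (_ + _).
  rewrite (th_sum u) (th_sum v) scaler_sumr -big_split /=; apply: eq_bigr => i _.
  by rewrite scalerA scalerDl.
by rewrite (big_nth 0) big_mkord; apply: eq_bigr => k _; rewrite -hc.
Qed.

Lemma expand_dual W : gC W -> W = \sum_s \tr (W * Bb s) *: Bd s.
Proof.
move=> hW; apply/eqP; rewrite -subr_eq0; apply/eqP; set D := _ - _.
have zero s : \tr (D * Bb s) = 0.
  rewrite /D mulrBl trB tr_suml (bigD1 s) //= [\tr (Bd s * _)]mxtrace_mulC Bb_Bd eqxx mulr1.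
  rewrite big1 ?addr0 ?subrr // => t ts.
  by rewrite [\tr (Bd t * _)]mxtrace_mulC Bb_Bd eq_sym (negbTE ts) mulr0.
apply: (rdform H).
  rewrite /D -scaleN1r; apply: (rdD H) => //; apply: (rdZ H); apply: (gC_sm H) => s.
  by apply: (rdZ H); exact: gC_Bd.
move=> Y hY; rewrite (expand hY) mxtrace_mulC tr_suml big1 // => s _.
by rewrite [\tr (Bb s * D)]mxtrace_mulC zero mulr0.
Qed.

Definition Om := \sum_s Bb s * Bd s.

(** By invariance of the trace form, the matrix of the bracket with Z in the dual basis is minus the
    transpose of its matrix in the basis, so the two halves of the derivative of [Om] cancel. *)
Lemma Om_comm Z : gC Z -> Z * Om = Om * Z.
Proof.
move=> hZ; apply/br_eq0.
have e X Y : br Z (X * Y) = br Z X * Y + X * br Z Y.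
  by rewrite /br mulrBl mulrBr !mulrA addrA subrK.
have -> : br Z Om = \sum_s br Z (Bb s * Bd s).
  by rewrite /br /Om mulr_sumr mulr_suml -sumrB.
rewrite (eq_bigr _ (fun s _ => e (Bb s) (Bd s))) big_split /=.
pose c s t := \tr (br Z (Bb s) * Bd t).
have -> : \sum_s br Z (Bb s) * Bd s = \sum_s \sum_t c s t *: (Bb t * Bd s).
  apply: eq_bigr => s _; rewrite [br Z _]expand; last by apply: (rdbr H) => //; exact: gC_Bb.
  by rewrite mulr_suml; apply: eq_bigr => t _; rewrite mxsAl.
have -> : \sum_s Bb s * br Z (Bd s) = - \sum_s \sum_t c t s *: (Bb s * Bd t).
  rewrite -sumrN; apply: eq_bigr => s _.
  rewrite [br Z _]expand_dual; last by apply: (rdbr H) => //; exact: gC_Bd.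
  rewrite mulr_sumr -sumrN; apply: eq_bigr => t _.
  rewrite -mxsAr -scaleNr; congr (_ *: _).
  by rewrite brC mulNr raddfN /= tr_br /c mxtrace_mulC.
by rewrite exchange_big /= subrr.
Qed.

Lemma Om_scalar : exists c : C, Om = c%:M.
Proof.
have [c] := eigenvalue_closed Om^T m0.
move=> /eigenvalueP [v hv v0]; exists c; apply/matrixP => p q.
have h : forall u : 'cV_m, Om *m u = c *: u.
  apply: (rdirr H _ _ _ (v := v^T)).
  - by move=> a b ha hb; rewrite mulmxDr ha hb scalerDr.
  - by move=> z a ha; rewrite -scalemxAr ha !scalerA mulrC.
  - by move=> X a hX ha; rewrite mulmxA mulmxE -Om_comm // -mulmxE -mulmxA ha -scalemxAr.
  - by apply: contra v0 => /eqP h; rewrite -[v]trmxK h trmx0.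
  - by apply: trmx_inj; rewrite trmx_mul trmxK hv linearZ /= trmxK.
have := h (delta_mx q 0); rewrite -colE => /matrixP /(_ p 0).
by rewrite !mxE eqxx andbT mulr_natr.
Qed.

Hypothesis nw : forall a p, root a -> mu p != - (a + a).

(** By cyclicity the term of a root a is a trace of FE on the weight space of -a. There EF has zero
    diagonal, since -2a is not a weight, so FE is minus the bracket of E and F, namely 2. *)
Lemma zero_part s : \sum_(p | mu p == 0) (Bb s * Bd s) p p =
  if s is inr k then 2 * (mult (- al k))%:R / \tr (E k * F k) else 0.
Proof.
case: s => [i|k] /=.
  apply: big1 => p /eqP e; rewrite (th_mul H) e wtE pairing0l mulr0 rmorph0 mul0r mul0r //.
under eq_bigr => p _ do rewrite -mxsAr mxE.
rewrite -mulr_sumr mulrC; congr (_ / _).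
have a0 : al k != 0 by have [] := al_root k.
transitivity (\sum_(q | mu q == - al k) (F k * E k) q q).
  under eq_bigr => p _ do rewrite mxE.
  under [RHS]eq_bigr => q _ do rewrite mxE.
  rewrite big_mkcond [RHS]big_mkcond /=.
  rewrite (eq_bigr (fun p => \sum_q (if mu p == 0 then E k p q * F k q p else 0))); last first.
    by move=> p _; case: ifP => // _; rewrite big1.
  rewrite exchange_big /=; apply: eq_bigr => q _.
  rewrite (eq_bigr (fun p => if mu q == - al k then F k q p * E k p q else 0)); last first.
    move=> p _; have [->|e0] := eqVneq (E k p q) 0; first by rewrite mul0r mulr0 !if_same.
    have := rv_entry H (hE k) e0 => ->.
    by rewrite mulrC addr_eq0.
  by case: ifP => // _; rewrite big1.
rewrite (eq_bigr (fun=> 2)); first by rewrite sumr_const mulr_natr.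
move=> q /eqP e.
have : br (E k) (F k) q q = - 2.
  rewrite hEF th_diag eqxx mulr1n e.
  have -> : cart B (- al k) (al k) = - 2.
    by rewrite /cart ipNl mulrN mulNr -/(cart B (al k) (al k)) cart_self //; exact: (rdpos H).
  by rewrite rmorphN rmorph_nat.
have -> : br (E k) (F k) q q = (E k * F k) q q - (F k * E k) q q by rewrite /br !mxE.
have -> : (E k * F k) q q = 0.
  rewrite mxE big1 // => s _; have [->|e0] := eqVneq (E k q s) 0; first by rewrite mul0r.
  have := rv_entry H (hE k) e0; rewrite e => /eqP; rewrite -subr_eq => /eqP h.
  by have := nw s (al_root k); rewrite -h opprD eqxx.
by rewrite sub0r => /oppr_inj.
Qed.

(* The Casimir operator is a scalar. Its trace on the whole space is the dimension
   [r + N] of the Lie algebra, while on the zero weight space only the root vectors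
   whose roots are weights contribute. *)
Lemma casimir_basis : (mult 0)%:R * (r + N)%:R =
  m%:R * (\sum_k 4 * (mult (- al k))%:R / \sum_p cart B (mu p) (al k) ^+ 2) :> R.
Proof.
have [c hc] := Om_scalar.
have t1 : c * m%:R = (r + N)%:R.
  have := congr1 mxtrace hc; rewrite mxtrace_scalar mulr_natr => <-.
  rewrite /Om linear_sum /= (eq_bigr (fun=> 1)) => [|s _]; last by rewrite Bb_Bd eqxx.
  by rewrite sumr_const card_sum !card_ord.
have t2 : c * (mult 0)%:R = \sum_k 4 * (mult (- al k))%:R / (\sum_p cart B (mu p) (al k) ^+ 2)%:C.
  transitivity (\sum_(p | mu p == 0) Om p p).
    rewrite hc (eq_bigr (fun=> c)) => [|p _]; last by rewrite mxE eqxx.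
    by rewrite sumr_const mulr_natr.
  under eq_bigr => p _ do rewrite /Om summxE.
  rewrite exchange_big big_sumType /= big1 ?add0r => [|i _]; last exact: (zero_part (inl i)).
  apply: eq_bigr => k _; rewrite (zero_part (inr k)) -tr_EF.
  by have := tr_EF_neq0 k; move: (\tr _) ((mult _)%:R) => t u t0; field; rewrite t0.
apply: (fmorph_inj (real_complex R)).
have e : (\sum_k 4 * (mult (- al k))%:R / \sum_p cart B (mu p) (al k) ^+ 2)%:C = c * (mult 0)%:R.
  rewrite t2 rmorph_sum; apply: eq_bigr => k _.
  by rewrite rmorphM fmorphV rmorphM !rmorph_nat.
have eC (x z : R) : (x * z)%:C = x%:C * z%:C by rewrite rmorphM.
have eN n : (n%:R : R)%:C = n%:R by rewrite rmorph_nat.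
rewrite [LHS]eC [RHS]eC e !eN -t1 mulrCA [RHS]mulrCA; congr (_ * _).
by rewrite mulrC.
Qed.

End Basis.

Lemma casimir : (forall a p, root a -> mu p != - (a + a)) ->
  (mult 0)%:R * (r + N)%:R =
  m%:R * (\sum_(a <- phi) 4 * (mult (- a))%:R / \sum_p cart B (mu p) a ^+ 2) :> R.
Proof.
move=> nw.
have ex k : exists t : 'M[C]_m * 'M[C]_m * 'rV[R]_r,
    [/\ rv (al k) t.1.1, rv (- al k) t.1.2, br t.1.1 t.1.2 = cN *: Th t.2,
        forall b, pairing b t.2 = cart B b (al k)
      & forall E', rv (al k) E' -> exists c : C, E' = c *: t.1.1].
  by have [E [F [y hh]]] := rdsl2 H (al_root k); exists (E, F, y).
have [t ht] := choice ex.
rewrite (big_nth 0) big_mkord.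
by apply: (casimir_basis (E := fun k => (t k).1.1) (F := fun k => (t k).1.2) (y := fun k => (t k).2)) => //;
  move=> k; have [] := ht k.
Qed.

End Casimir.

(** * The highest weight *)

Section Highest.
Variables (R : realType) (r m : nat).
Local Notation C := R[i].
Local Notation ii := (0 +i* 1 : C).
Variables (gC : 'M[C]_m -> Prop) (Th : 'rV[R]_r -> 'M[C]_m) (mu : 'I_m -> 'rV[R]_r).
Variable (B : 'M[R]_r).
Hypothesis H : rdat gC Th mu B.
Local Notation rv := (rootv gC Th).
Local Notation root := (rooty gC Th).
Local Notation mult := (mult mu).
Variables (h lam : 'rV[R]_r).
Hypothesis hh : forall a, root a -> pairing a h != 0.
Hypothesis rlam : root lam.
Hypothesis lam_short : forall b, root b -> ip B lam lam <= ip B b b.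
Hypothesis lam_dom : forall b, root b -> 0 < pairing b h -> 0 <= ip B lam b.
Hypothesis lam_wt : exists p, mu p = lam.
Hypothesis lam_top : forall p, exists2 s : seq 'rV[R]_r,
  (forall c, c \in s -> root c /\ 0 < pairing c h) & lam - mu p = \sum_(c <- s) c.

Lemma mult_gt0 p : (0 < mult (mu p))%N.
Proof. by rewrite /mult; apply/card_gt0P; exists p; rewrite inE. Qed.

Lemma mult_ex b : (0 < mult b)%N -> exists p, mu p = b.
Proof. by case/card_gt0P => p; rewrite inE => /eqP; exists p. Qed.

(** Conjugation by [w] carries the projector on one weight space to the projector on the other, and
    traces of projectors count multiplicities. *)
Lemma mult_refl a b : root a -> mult (refl B a b) = mult b.
Proof.
move=> ra; have [a0 _] := ra.
have rK := reflK (rdpos H) a0.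
have [y [w [w' [hy ww hw]]]] := rdweyl H ra.
have ent p q : w p q != 0 -> mu q = refl B a (mu p).
  move=> w0; apply: wt_ext => x.
  have := congr1 (fun M : 'M[C]_m => M p q) (hw x); rewrite (mul_th H) (th_mul H) mulrC => /(mulIf w0) ->.
  rewrite !wtE; congr (_%:C * _); congr (_ * _).
  by rewrite /refl -hy !(pairingDr, pairingDl, pairingNl) -scaleNr !(pairingZr, pairingZl); ring.
pose P c : 'M[C]_m := diag_mx (\row_p (mu p == c)%:R).
have trP c : \tr (P c) = (mult c)%:R.
  rewrite mxtrace_diag (eq_bigr (fun p => if mu p == c then 1 else 0)); last first.
    by move=> p _; rewrite mxE; case: eqP.
  by rewrite -big_mkcond sumr_const.
have e : w * P b = P (refl B a b) * w.
  apply/matrixP => p q; rewrite -!mulmxE mul_mx_diag mul_diag_mx !mxE.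
  have [->|w0] := eqVneq (w p q) 0; first by rewrite mul0r mulr0.
  by rewrite mulrC (ent p q w0) (inv_eq rK).
have : \tr (P b) = \tr (P (refl B a b)).
  by rewrite -[P b]mul1r -ww -mulrA e mxtrace_mulC -mulmxE -mulmxA (mulmx1C ww) mulmx1.
by rewrite !trP => /eqP; rewrite eqr_nat => /eqP.
Qed.

Lemma root_opp a : root a -> root (- a).
Proof.
move=> ra; have := rdrefl H ra ra; rewrite /refl cart_self ?(ra.1) //; last exact: (rdpos H).
by rewrite scaler_nat mulr2n opprD addrA subrr sub0r.
Qed.

Lemma refl0 a : refl B a 0 = 0.
Proof. by rewrite /refl /cart ip0l mulr0 mul0r scale0r subr0. Qed.

(* A dominant weight [mu j] in the orbit of [mu p] satisfies
   |lam|^2 - |mu j|^2 = <lam - mu j, lam + mu j> >= 0; it equals [lam] in case of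
   equality and vanishes otherwise, being shorter than every root. *)
Lemma weight_reach p : mu p != 0 -> forall Q : 'rV[R]_r -> Prop, Q lam ->
  (forall a b, root a -> Q b -> Q (refl B a b)) -> Q (mu p).
Proof.
move=> p0 Q Ql hQ.
(* The indices of the weights from which [mu p] is reached by reflections, expressed through all
   reflection-stable predicates; maximising <., h> among them produces a dominant weight. *)
pose T (j : 'I_m) := `[< forall Q' : 'rV[R]_r -> Prop,
  (forall a b, root a -> Q' b -> Q' (refl B a b)) -> Q' (mu j) -> Q' (mu p) >].
have Tp : T p by apply/asboolP.
case: (@arg_maxP _ _ _ p T (fun j => pairing (mu j) h) Tp) => j /asboolP Tj jmax.
have jdom c : root c -> 0 < pairing c h -> 0 <= ip B (mu j) c.
  move=> rc cp; have [c0 _] := rc.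
  have [j' ej'] : exists j', mu j' = refl B c (mu j).
    by apply: mult_ex; rewrite mult_refl // mult_gt0.
  have Tj' : T j'.
    apply/asboolP => Q' hQ' Qj'; apply: Tj => //.
    by rewrite -[mu j](reflK (rdpos H) c0) -ej'; exact: hQ'.
  have := jmax j' Tj'; rewrite ej' /refl pairingDl pairingNl pairingZl.
  have := cart_ip (rdpos H) (mu j) c0; have := rdpos H c0.
  move: (cart _ _ _) (ip B c c) (ip B _ _) (pairing c h) (pairing (mu j) h) cp => x y z t u t0 y0 e hle.
  have x0 : 0 <= x by rewrite -(pmulr_lge0 _ t0); move: hle; rewrite /Order.ge /=; lra.
  by have := mulr_ge0 x0 (ltW y0); rewrite e; lra.
have [s hs es] := lam_top j.
have hl : 0 <= ip B (lam - mu j) lam.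
  rewrite es ip_suml big_seq; apply: sumr_ge0 => c /hs [rc cp].
  by rewrite (rdsym H); exact: lam_dom.
have hm : 0 <= ip B (lam - mu j) (mu j).
  rewrite es ip_suml big_seq; apply: sumr_ge0 => c /hs [rc cp].
  by rewrite (rdsym H); exact: jdom.
have [lt|ge] := ltP (ip B (mu j) (mu j)) (ip B lam lam).
  have mj0 : mu j = 0.
    have e : mu j = \sum_(c <- lam :: [seq - c | c <- s]) c.
      rewrite big_cons big_map sumrN -es opprB addrC subrK //.
    rewrite e; apply: (short_sum0 (rdsym H) (rdpos H) (root := root) (M := ip B lam lam)).
    - by move=> a ra; split; [exact: ra.1|exact: lam_short].
    - by move=> a b ra rb; exact: (rdint H).
    - move=> c; rewrite inE => /orP [/eqP -> //|/mapP [c' /hs [rc _] ->]]; exact: root_opp.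
    - by rewrite -e.
  case/eqP: p0; apply: (Tj (fun b => b = 0)) => // a b _ ->; exact: refl0.
apply: Tj => //; suff -> : mu j = lam by [].
apply/esym/eqP; rewrite -subr_eq0; apply/eqP/(ip_eq0 (rdpos H)).
rewrite (ipBr (rdsym H)); move: hl hm ge.
rewrite !ipBl (rdsym H (mu j) lam); move: (ip B lam lam) (ip B _ _) (ip B lam (mu j)) => x y z; lra.
Qed.

Lemma weight_root p : mu p != 0 -> root (mu p).
Proof. by move=> p0; apply: weight_reach => // a b; exact: (rdrefl H). Qed.

Lemma weight_norm p : mu p != 0 -> ip B (mu p) (mu p) = ip B lam lam.
Proof.
move=> p0; apply: (weight_reach p0 (Q := fun b => ip B b b = ip B lam lam)) => // a b ra <-.
by apply: (refl_norm (rdsym H) (rdpos H)); have [] := ra.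
Qed.

Lemma weight_mult p : mu p != 0 -> mult (mu p) = mult lam.
Proof.
move=> p0; apply: (weight_reach p0 (Q := fun b => mult b = mult lam)) => // a b ra <-.
exact: mult_refl.
Qed.

(** Non-zero weights are as short as the shortest roots, whereas 2a is twice as long as a root. This
    provides the assumption of [casimir]. *)
Lemma weight_double a p : root a -> mu p != - (a + a).
Proof.
move=> ra; have [a0 _] := ra; apply/eqP => e.
have mp0 : mu p != 0.
  rewrite e oppr_eq0 -mulr2n -scaler_nat scaler_eq0 negb_or a0 pnatr_eq0 //.
have := weight_norm mp0; have := lam_short ra; have := rdpos H a0.
rewrite e ipNl (ipNr (rdsym H)) ipDl (ipDr (rdsym H)).
by move: (ip B a a) (ip B lam lam) => x y; lra.
Qed.

Lemma lam_max p : pairing (mu p) h <= pairing lam h.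
Proof.
have [s hs es] := lam_top p; rewrite -subr_ge0 -pairingNl -pairingDl es big_seq.
elim/big_ind: _ => [|a b|c /hs [_ /ltW //]]; first by rewrite pairing0l.
by rewrite pairingDl => *; apply: addr_ge0.
Qed.

Section Generated.
Variable p0 : 'I_m.
Hypothesis hp0 : mu p0 = lam.

(* By irreducibility [gen] holds of every vector, but the vectors of weight [lam]
   that it reaches lie on one line. *)
Inductive gen : 'cV[C]_m -> Prop :=
  | gen_e : gen (delta_mx p0 0)
  | genD u v : gen u -> gen v -> gen (u + v)
  | genZ (c : C) u : gen u -> gen (c *: u)
  | genF a F u : root a -> 0 < pairing a h -> rv (- a) F -> gen u -> gen (F *m u).

(** Moving X past a lowering operator leaves a bracket, again in gC, so the induction reduces to the
    vector of weight [lam], which the torus scales and positive root vectors kill by [lam_max]. *)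
Lemma gen_gC u : gen u -> forall X, gC X -> gen (X *m u).
Proof.
elim=> [|{}u v _ IHu _ IHv|c {}u _ IHu|a F {}u ra ap hF gu IH] X hX.
- have [u1 [v1 [Y [hY ->]]]] := span H hX.
  have thg x : gen (Th x *m delta_mx p0 0).
    have -> : Th x *m delta_mx p0 0 = wt lam x *: delta_mx p0 0 :> 'cV[C]_m.
      apply/matrixP => i j; rewrite (rddiag H) mul_diag_mx !mxE.
      by have [->|_] := eqVneq i p0; rewrite ?hp0 // !mulr0.
    by apply: genZ; exact: gen_e.
  rewrite !mulmxDl -scalemxAl; apply: genD; first by apply: genD => //; apply: genZ.
  rewrite mulmx_suml big_seq; elim/big_ind: _ => [||a /(phisP H) ra].
  + by have := genZ 0 gen_e; rewrite scale0r.
  + exact: genD.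
  have := hh ra; rewrite neq_lt => /orP [an|ap].
    apply: (genF (a := - a)); [exact: root_opp| |by rewrite opprK|exact: gen_e].
    by rewrite pairingNl oppr_gt0.
  suff -> : Y a *m delta_mx p0 0 = 0 :> 'cV[C]_m by have := genZ 0 gen_e; rewrite scale0r.
  apply/matrixP => i j; rewrite (ord1 j) -colE !mxE; apply/eqP/negPn/negP => y0.
  have := lam_max i; rewrite (rv_entry H (hY a) y0) hp0 pairingDl.
  by rewrite leNgt ltrDl ap.
- by rewrite mulmxDr; apply: genD; [exact: IHu|exact: IHv].
- by rewrite -scalemxAr; apply: genZ; exact: IHu.
have -> : X *m (F *m u) = F *m (X *m u) + br X F *m u.
  by rewrite /br -!mulmxE mulmxBl !mulmxA addrC subrK.
apply: genD; first by apply: (genF ra ap hF); exact: IH.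
by apply: IH; apply: (rdbr H) => //; exact: hF.1.
Qed.

(** A lowering step reaching weight [lam] would start from lam + a, where <., h> exceeds its maximum
    over the weights. *)
Lemma gen_top u : gen u -> forall q, mu q = lam -> q != p0 -> u q 0 = 0.
Proof.
elim=> [|{}u v _ IHu _ IHv|c {}u _ IHu|a F {}u ra ap hF gu IH] q hq qp.
- by rewrite mxE (negbTE qp).
- by rewrite mxE IHu // IHv // addr0.
- by rewrite mxE IHu // mulr0.
rewrite mxE big1 // => s _; have [->|f0] := eqVneq (F q s) 0; first by rewrite mul0r.
have e := rv_entry H hF f0; rewrite hq in e.
have := lam_max s; have -> : mu s = lam + a by rewrite e subrK.
by rewrite pairingDl leNgt ltrDl ap.
Qed.

End Generated.

Lemma lam_mult : mult lam = 1%N.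
Proof.
have [p0 hp0] := lam_wt.
rewrite -[RHS](card1 p0); apply: eq_card => q; rewrite !inE.
apply/eqP/eqP => [hq|-> //]; apply/eqP/negPn/negP => qp.
have all_gen : forall u, gen p0 u.
  apply: (rdirr H (S := gen p0) _ _ _ (v := delta_mx p0 0)).
  - exact: genD.
  - exact: genZ.
  - by move=> X u hX hu; exact: gen_gC.
  - by apply/eqP => /matrixP /(_ p0 0); rewrite !mxE !eqxx => /eqP; rewrite oner_eq0.
  - exact: gen_e.
have := gen_top (all_gen (delta_mx q 0)) hq qp.
by rewrite mxE !eqxx => /eqP; rewrite oner_eq0.
Qed.

End Highest.

(** * Root systems in Euclidean coordinates *)

Section Model.
Variables (R : realType) (n : nat).
Implicit Types v w : 'rV[R]_n.

Definition scart v w : R := 2 * pairing v w / pairing w w.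

(* [sl] and [lal] list the short roots and all the roots of a root system in
   Euclidean coordinates. *)
Record model (sl lal : seq 'rV[R]_n) (K : R) : Prop := {
  mod_ul : uniq lal ;
  mod_us : uniq sl ;
  mod_sub : forall v, v \in sl -> v \in lal ;
  mod_n0 : forall v, v \in lal -> v != 0 ;
  mod_refl : forall v w, v \in lal -> w \in lal -> v - scart v w *: w \in lal ;
  mod_srefl : forall v w, v \in sl -> w \in lal -> v - scart v w *: w \in sl ;
  mod_orbit : forall Q : 'rV[R]_n -> Prop,
    (forall v w, v \in sl -> w \in lal -> Q v -> Q (v - scart v w *: w)) ->
    forall v w, v \in sl -> w \in sl -> Q v -> Q w ;
  mod_long : forall v, v \in lal -> v \notin sl -> exists w,
    [/\ w \in lal, pairing v w != 0 & pairing w w < pairing v v] ;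
  mod_K : forall w, w \in sl -> \sum_(v <- sl) scart v w ^+ 2 = K }.

Lemma pairingC v w : pairing v w = pairing w v.
Proof. by rewrite /pairing -[in LHS](trmxK v) -trmx_mul mxE. Qed.

Lemma pairingE v w : pairing v w = \sum_i v 0 i * w 0 i.
Proof. by rewrite /pairing mxE; apply: eq_bigr => i _; rewrite !mxE. Qed.

Lemma pairing_pos v : v != 0 -> 0 < pairing v v.
Proof.
move=> v0; rewrite lt_neqAle eq_sym pairingE; apply/andP; split.
  apply: contra v0 => /eqP h; apply/eqP/rowP => i; rewrite mxE.
  apply/eqP; rewrite -sqrf_eq0 expr2; apply/eqP.
  by apply: (psumr_eq0P _ h) => // j _; rewrite -expr2 sqr_ge0.
by apply: sumr_ge0 => i _; rewrite -expr2 sqr_ge0.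
Qed.

End Model.

Section Transport.
Variables (R : realType) (r m n : nat).
Local Notation C := R[i].
Variables (gC : 'M[C]_m -> Prop) (Th : 'rV[R]_r -> 'M[C]_m) (mu : 'I_m -> 'rV[R]_r).
Variable (B : 'M[R]_r).
Hypothesis H : rdat gC Th mu B.
Hypothesis m0 : (0 < m)%N.
Local Notation root := (rooty gC Th).
Variables (h lam : 'rV[R]_r).
Hypothesis hh : forall a, root a -> pairing a h != 0.
Hypothesis rlam : root lam.
Hypothesis lam_short : forall b, root b -> ip B lam lam <= ip B b b.
Hypothesis lam_dom : forall b, root b -> 0 < pairing b h -> 0 <= ip B lam b.
Hypothesis lam_wt : exists p, mu p = lam.
Hypothesis lam_top : forall p, exists2 s : seq 'rV[R]_r,
  (forall c, c \in s -> root c /\ 0 < pairing c h) & lam - mu p = \sum_(c <- s) c.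
Variables (f : 'M[R]_(r, n)) (sl lal : seq 'rV[R]_n) (K : R).
Hypothesis f_free : row_free f.
Hypothesis hM : model sl lal K.
Hypothesis f_root : forall v, v \in lal <-> exists2 a, root a & a *m f = v.

Lemma f_inj (a b : 'rV[R]_r) : a *m f = b *m f -> a = b.
Proof. exact: row_free_inj. Qed.

Lemma root_f a : root a -> a *m f \in lal.
Proof. by move=> ra; apply/f_root; exists a. Qed.

Lemma f_rootE a : a *m f \in lal -> root a.
Proof. by case/f_root => b rb /f_inj <-. Qed.

(* If the two Cartan integers differed, composing the two reflections would
   translate [b] along [a], producing infinitely many roots. *)
Lemma cart_std a b : root a -> root b -> cart B b a = scart (b *m f) (a *m f).
Proof.
move=> ra rb; have [a0 _] := ra.
have fa0 : a *m f != 0 := mod_n0 hM (root_f ra).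
pose dl (c : 'rV[R]_r) : R := cart B c a - scart (c *m f) (a *m f).
have dlD c t : dl (c + t *: a) = dl c.
  rewrite /dl /cart /scart ipDl ipZl mulmxDl -scalemxAl pairingDl pairingZl.
  have p1 := lt0r_neq0 (rdpos H a0); have p2 := lt0r_neq0 (pairing_pos fa0).
  move: (ip B c a) (pairing (c *m f) _) (ip B a a) (pairing _ _) p1 p2 => x y z u z0 u0.
  by field; rewrite z0 u0.
have step c : root c -> root (c + dl c *: a).
  move=> rc; apply: f_rootE.
  have := mod_refl hM (root_f (rdrefl H ra rc)) (root_f ra).
  rewrite /refl mulmxBl -scalemxAl; set s := scart (_ - _) _.
  have -> : s = scart (c *m f) (a *m f) - 2 * cart B c a.
    rewrite /s /scart pairingDl pairingNl pairingZl mulrBr mulrBl; congr (_ - _).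
    by rewrite mulrA mulfK // gt_eqF // pairing_pos.
  rewrite mulmxDl -scalemxAl -addrA -opprD -scalerDl -scaleNr.
  have -> : - (cart B c a + (scart (c *m f) (a *m f) - 2 * cart B c a)) = dl c by rewrite /dl; ring.
  by [].
have all_roots k : root (b + (k%:R * dl b) *: a).
  elim: k => [|k IH]; first by rewrite mul0r scale0r addr0.
  by have := step _ IH; rewrite dlD -addrA -scalerDl -[k.+1]addn1 natrD mulrDl mul1r.
apply/eqP; rewrite -subr_eq0 -/(dl b); apply/negPn/negP => d0.
pose s := [seq (b + (k%:R * dl b) *: a) *m f | k <- iota 0 (size lal).+1].
have us : uniq s.
  rewrite map_inj_uniq ?iota_uniq // => k l /f_inj /addrI /eqP.
  rewrite -subr_eq0 -scalerBl scaler_eq0 (negbTE a0) orbF subr_eq0 => /eqP /(mulIf d0) /eqP.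
  by rewrite eqr_nat => /eqP.
suff : (size s <= size lal)%N by rewrite size_map size_iota ltnn.
by apply: uniq_leq_size => // v /mapP [k _ ->]; apply: root_f.
Qed.

Lemma refl_std a b : root a -> root b ->
  refl B a b *m f = b *m f - scart (b *m f) (a *m f) *: (a *m f).
Proof. by move=> ra rb; rewrite /refl mulmxBl -scalemxAl cart_std. Qed.

(** Equal Cartan numbers force proportional lengths for non-orthogonal roots only, since the two
    numbers <b, a> and <a, b> share the same inner product. *)
Lemma ip_std a b : root a -> root b -> pairing (b *m f) (a *m f) != 0 ->
  ip B a a / pairing (a *m f) (a *m f) = ip B b b / pairing (b *m f) (b *m f).
Proof.
move=> ra rb ab; have [a0 _] := ra; have [b0 _] := rb.
have := cart_ip (rdpos H) b a0; have := cart_ip (rdpos H) a b0.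
rewrite !cart_std // (rdsym H a b) /scart (pairingC (a *m f)) => <-.
move: ab (lt0r_neq0 (pairing_pos (mod_n0 hM (root_f ra)))) (lt0r_neq0 (pairing_pos (mod_n0 hM (root_f rb)))).
move: (pairing (b *m f) (a *m f)) (pairing (a *m f) (a *m f)) (pairing (b *m f) (b *m f)) (ip B a a) (ip B b b).
move=> x y z p q x0 y0 z0 e; apply: (mulfI (x := 2 * x)); first by rewrite mulf_neq0 ?pnatr_eq0.
by rewrite mulrA mulrAC e mulrAC -mulrA.
Qed.

(** By [mod_long] a root outside [sl] has a shorter root not orthogonal to it, and [ip_std]
    transfers this comparison of lengths to B, where [lam] is shortest. *)
Lemma lam_sl : lam *m f \in sl.
Proof.
apply/negPn/negP => nl; have [w [wl vw lt]] := mod_long hM (root_f rlam) nl.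
have [a ra aw] := (f_root w).1 wl; rewrite -aw in vw lt wl.
have e := ip_std ra rlam vw.
have pa := pairing_pos (mod_n0 hM wl); have pl := pairing_pos (mod_n0 hM (root_f rlam)).
have := lam_short ra; rewrite leNgt => /negP; apply.
have [l0 _] := rlam; have il := rdpos H l0.
have -> : ip B a a = pairing (a *m f) (a *m f) * (ip B lam lam / pairing (lam *m f) (lam *m f)).
  by rewrite -e mulrCA mulfV ?mulr1 // gt_eqF.
by rewrite mulrA ltr_pdivrMr // mulrC ltr_pM2l.
Qed.

Let reach := weight_reach H rlam lam_short lam_dom lam_top.
Let wroot := weight_root H rlam lam_short lam_dom lam_top.

Lemma weight_sl p : mu p != 0 -> mu p *m f \in sl.
Proof.
move=> p0; suff [] : root (mu p) /\ mu p *m f \in sl by [].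
apply: (reach p0 (Q := fun b => root b /\ b *m f \in sl)); first by split=> //; exact: lam_sl.
move=> a b ra [rb bs]; split; first exact: (rdrefl H).
by rewrite refl_std //; apply: (mod_srefl hM) => //; exact: root_f.
Qed.

Lemma sl_weight v : v \in sl -> exists2 p, mu p != 0 & mu p *m f = v.
Proof.
move=> vs; apply: (mod_orbit hM (Q := fun v => exists2 p, mu p != 0 & mu p *m f = v) _ lam_sl vs).
  move=> {vs}v w vs wl [p p0 e]; have [a ra aw] := (f_root w).1 wl.
  have rp := wroot p0; have [a0 _] := ra.
  have [q hq] : exists q, mu q = refl B a (mu p).
    by apply: mult_ex; rewrite (mult_refl H) // mult_gt0.
  exists q; last by rewrite hq refl_std // e aw.
  by rewrite hq; have [] := rdrefl H ra rp.
have [p hp] := lam_wt; exists p; last by rewrite hp.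
by rewrite hp; have [] := rlam.
Qed.

Lemma weight_perm : perm_eq [seq mu p *m f | p <- index_enum 'I_m & mu p != 0] sl.
Proof.
apply: uniq_perm; last first.
- move=> v; apply/mapP/idP => [[p]|vs].
    by rewrite mem_filter => /andP [p0 _] ->; exact: weight_sl.
  by have [p p0 <-] := sl_weight vs; exists p; rewrite // mem_filter p0 mem_index_enum.
- exact: (mod_us hM).
rewrite map_inj_in_uniq ?filter_uniq ?index_enum_uniq // => p q.
rewrite !mem_filter => /andP [p0 _] /andP [q0 _] /f_inj e.
have : mult mu (mu p) = 1%N.
  rewrite (weight_mult H rlam lam_short lam_dom lam_top p0).
  exact: (lam_mult H hh lam_wt lam_top).
by move/eq_leq => /card_le1_eqP; apply; rewrite inE ?e.
Qed.

Lemma sum_weights (V : zmodType) (Phi : 'rV[R]_n -> V) :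
  \sum_p Phi (mu p *m f) = Phi 0 *+ mult mu 0 + \sum_(v <- sl) Phi v.
Proof.
rewrite (bigID (fun p => mu p == 0)) /=; congr (_ + _).
  rewrite (eq_bigr (fun=> Phi 0)) => [|p /eqP ->]; last by rewrite mul0mx.
  by rewrite sumr_const.
by rewrite -(perm_big _ weight_perm) /= big_map big_filter.
Qed.

Lemma root_perm : perm_eq [seq a *m f | a <- phis gC Th mu] lal.
Proof.
apply: uniq_perm; last first.
- move=> v; apply/mapP/idP => [[a /(phisP H) ra ->]|/f_root [a ra <-]]; first exact: root_f.
  by exists a => //; apply/(phisP H).
- exact: (mod_ul hM).
by rewrite map_inj_in_uniq ?phis_uniq // => a b _ _ /f_inj.
Qed.

Lemma cart_mu p a : root a -> cart B (mu p) a = scart (mu p *m f) (a *m f).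
Proof.
move=> ra; have [->|p0] := eqVneq (mu p) 0; last by rewrite cart_std //; exact: wroot.
by rewrite /cart /scart ip0l mul0mx pairing0l !(mulr0, mul0r).
Qed.

Lemma sl_opp v : v \in sl -> - v \in sl.
Proof.
move=> vs; have vl := mod_sub hM vs.
have := mod_srefl hM vs vl; rewrite /scart mulfK ?gt_eqF ?pairing_pos ?(mod_n0 hM) //.
by rewrite scaler_nat mulr2n opprD addrA subrr sub0r.
Qed.

Lemma dim_weights : m%:R = (mult mu 0 + size sl)%:R :> R.
Proof.
have := sum_weights (fun=> 1 : R); rewrite sumr_const card_ord natrD => ->.
by rewrite big_const_seq count_predT iter_addr_0.
Qed.

(** In [casimir] a short root contributes 4/K, because its opposite is a weight of multiplicity one,
    and any other root contributes 0. *)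
Lemma dim_equation : (mult mu 0)%:R * (r + size lal)%:R = m%:R * ((size sl)%:R * (4 / K)) :> R.
Proof.
have nw := weight_double H rlam lam_short lam_dom lam_top.
have := casimir H m0 (fun a p ra => nw a p ra).
rewrite -(perm_size root_perm) size_map => ->; congr (_ * _).
transitivity (\sum_(v <- lal) (if v \in sl then 4 / K else 0)); last first.
  rewrite -big_mkcond /= -big_filter big_const_seq count_predT iter_addr_0 -[LHS]mulr_natl.
  congr (_%:R * _); apply/eqP; rewrite -uniq_size_uniq ?(mod_us hM) ?filter_uniq ?(mod_ul hM) //.
  by move=> v; rewrite mem_filter; case vs : (v \in sl); rewrite //= (mod_sub hM).
rewrite -(perm_big _ root_perm) /= big_map big_seq [RHS]big_seq.
apply: eq_bigr => a /(phisP H) ra.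
have e : \sum_p cart B (mu p) a ^+ 2 = \sum_(v <- sl) scart v (a *m f) ^+ 2.
  under eq_bigr => p _ do rewrite cart_mu //.
  rewrite (sum_weights (fun v => scart v (a *m f) ^+ 2)).
  by rewrite {1}/scart pairing0l mulr0 mul0r expr0n /= mul0rn add0r.
have [as_|as_] := boolP (a *m f \in sl).
  have [p p0 ep] : exists2 p, mu p != 0 & mu p *m f = - (a *m f) by apply: sl_weight; exact: sl_opp.
  have -> : mult mu (- a) = 1%N.
    have <- : mu p = - a by apply: f_inj; rewrite ep mulNmx.
    rewrite (weight_mult H rlam lam_short lam_dom lam_top p0).
    exact: (lam_mult H hh lam_wt lam_top).
  by rewrite e (mod_K hM) // mulr1.
suff -> : mult mu (- a) = 0%N by rewrite mulr0 mul0r.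
apply/eqP; rewrite -leqn0 leqNgt; apply/negP => /mult_ex [p ep].
have p0 : mu p != 0 by rewrite ep oppr_eq0; have [] := ra.
have := weight_sl p0; rewrite ep mulNmx => /sl_opp; rewrite opprK; exact/negP.
Qed.

End Transport.

(** * The trace on the torus *)

Section Diagonalize.
Variables (R : realType) (m r : nat) (Th : 'rV[R]_r -> 'M[R[i]]_m).
Hypothesis ThD : forall x y, Th (x + y) = Th x + Th y.
Hypothesis ThZ : forall (a : R) x, Th (a *: x) = a%:C *: Th x.
Hypothesis Thc : forall x y, Th x * Th y = Th y * Th x.
Hypothesis Thb : forall x, bdd (Th x).

Lemma th_linear x : Th x = \sum_i (x 0 i)%:C *: Th (delta_mx 0 i).
Proof.
have Th0 : Th 0 = 0 by rewrite -(scale0r (0 : 'rV[R]_r)) ThZ scale0r.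
rewrite [x in LHS]row_sum_delta; elim/big_ind2: _ => [|a b c e <- <-|i _]; [exact: Th0|exact: ThD|exact: ThZ].
Qed.

(** The matrices Th of the basis vectors commute and are diagonalised together; their eigenvalues
    are imaginary, and division by 2 pi gives the coordinates of the weights. *)
Lemma diag_weights : exists (P : 'M[R[i]]_m) (mu : 'I_m -> 'rV[R]_r), P \in unitmx /\
  forall x, P *m Th x = diag_mx (\row_p wt (mu p) x) *m P.
Proof.
have [|P uP /allP hP] := (codiagonalizableP [seq Th (delta_mx 0 i) | i <- enum 'I_r]).1.
  split; first by move=> _ _ /mapP [i _ ->] /mapP [j _ ->]; exact: Thc.
  by move=> _ /mapP [i _ ->]; apply: bdd_diag.
have ex i : exists D, P *m Th (delta_mx 0 i) = diag_mx D *m P.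
  have /hP /= : Th (delta_mx 0 i) \in [seq Th (delta_mx 0 i) | i <- enum 'I_r].
    by apply: map_f; rewrite mem_enum.
  by move=> /diagonalizable_forPex [D /(simmxP uP)]; exists D.
have [D hD] := choice ex.
have reD i p : Re (D i 0 p) = 0.
  apply: (bdd_eig (u := row p P) (Thb (delta_mx 0 i))).
    apply/eqP => h0; have : row p P *m invmx P = 0 by rewrite h0 mul0mx.
    rewrite -row_mul mulmxV // => /rowP/(_ p); rewrite !mxE eqxx => /eqP.
    by rewrite oner_eq0.
  by rewrite -row_mul hD row_mul row_diag_mx -scalemxAl -rowE.
exists P, (fun p => \row_i (Im (D i 0 p) / (2 * pi))); split=> // x.
rewrite th_linear mulmx_sumr.
under eq_bigr => i _ do rewrite -scalemxAr hD scalemxAl.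
rewrite -mulmx_suml; congr (_ *m _); apply/matrixP => p q; rewrite summxE !mxE.
under eq_bigr => i _ do rewrite !mxE mulrnAr.
case: (p == q); last by rewrite big1.
rewrite mulr1n wtE pairingE mulr_sumr rmorph_sum mulr_suml; apply: eq_bigr => i _.
rewrite mxE mulr1n; move: (reD i p); case: (D i 0 p) => u w /= -> .
have := tpi R; move: (2 * pi) => t t0.
apply/eqP; rewrite eq_complex /= ; apply/andP; split; apply/eqP; first by ring.
by field.
Qed.

End Diagonalize.

(** * From the group to its weights and roots *)

Section Glue.
Variables (R : realType) (G : topologicalGroupType) (d m : nat).
Variables (L : lie_structure R G d) (rho : G -> 'M[R[i]]_m).
Hypothesis hG : simple_compact G.
Hypothesis rho1 : rho 1%g = 1.
Hypothesis rhoM : forall x y, rho (x * y)%g = rho x * rho y.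
Hypothesis rhoN : forall g0 (a : R), 0 < a -> \forall g \near g0, nrm (rho g - rho g0) < a.
Hypothesis rho_nt : exists g, rho g <> 1.
Variables (r : nat) (tau : 'rV[R]_r -> G).
Hypothesis htau : maximal_torus tau.
Variable Th : 'rV[R]_r -> 'M[R[i]]_m.
Hypothesis ThL : forall x, lalg rho (Th x).
Hypothesis ThE : forall x, rho (tau x) = expm (Th x).
Hypothesis cent : forall X, lalg rho X -> (forall x, X * Th x = Th x * X) -> exists x, X = Th x.
Variable mu : 'I_m -> 'rV[R]_r.
Hypothesis Thdiag : forall x, Th x = diag_mx (\row_p wt (mu p) x).
Variable B : 'M[R]_r.
Hypothesis hB : invariant_inner_product tau B.
Hypothesis irr : forall U : 'M[R[i]]_m,
  (forall g, stablemx U (rho g)^T) -> U = 0 \/ row_full U.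
Local Notation ii := (0 +i* 1 : R[i]).
Local Notation rooty := (rooty (gC rho) Th).

Lemma ThD x y : Th (x + y) = Th x + Th y.
Proof.
rewrite !Thdiag; apply/matrixP => p q; rewrite !mxE !wtE pairingDr.
by rewrite -mulrnDl mulrDr rmorphD mulrDl.
Qed.

Lemma ThZ (a : R) x : Th (a *: x) = a%:C *: Th x.
Proof.
rewrite !Thdiag; apply/matrixP => p q; rewrite !mxE !wtE pairingZr.
have -> : 2 * pi * (a * pairing (mu p) x) = a * (2 * pi * pairing (mu p) x) by ring.
move: (2 * pi * _) => z; case: (p == q); rewrite ?mulr1n ?mulr0n ?mulr0 //.
by rewrite rmorphM mulrA.
Qed.

Lemma sl2_rdat a : rooty a -> exists E F y,
    [/\ rootv (gC rho) Th a E, rootv (gC rho) Th (- a) F, br E F = ((2 * pi)%:C * ii)^-1 *: Th y,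
        forall b, pairing b y = cart B b a
      & forall E', rootv (gC rho) Th a E' -> exists c : R[i], E' = c *: E].
Proof.
move=> [a0 [E0 E00 hE0]].
have [X [Y [y hs]]] := sl2_ex L hG rho1 rhoM rhoN rho_nt ThZ ThL cent a0 E00 hE0.
exists (X + ii *: Y), (- X + ii *: Y), y; split.
- split; first by exists X, Y; split; [exact: sl_X hs|exact: sl_Y hs|].
  move=> x; rewrite brDr brZr (sl_hX hs) (sl_hY hs) /wt cx_scale -/(th a x).
  by rewrite scale0r sub0r scale0r add0r scaleNr.
- split; first by exists (- X), Y; split=> //; [apply: lalgN; exact: sl_X hs | exact: sl_Y hs].
  move=> x; rewrite brDr brNr brZr (sl_hX hs) (sl_hY hs) /wt pairingNl mulrN cx_scale -/(th a x).
  by rewrite scale0r sub0r scale0r add0r scalerN rmorphN !scaleNr !opprK.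
- rewrite br_cx !brNr !brXX [br Y X]brC opprK (sl_XY hs) !(oppr0, subr0, add0r).
  rewrite -mulr2n -scaler_nat !scalerA; congr (_ *: _).
  have t0 : (2 * pi)%:C * ii != 0.
    rewrite mulf_neq0 //; last by apply/eqP; case=> /eqP; rewrite oner_eq0.
    by apply/eqP => /(congr1 (@complex.Re R)) /= /eqP; apply/negP; rewrite tpi.
  apply: (mulIf t0); rewrite mulVf //.
  have : 2%:R * ((4 * pi)^-1)%:C * (2 * pi)%:C = 1 :> R[i].
    rewrite -(rmorph_nat (real_complex R)) -!rmorphM /=.
    by have := lt0r_neq0 (pi_gt0 R); move: pi => t t1; congr (_%:C); field.
  move: (ii2 R) (((4 * pi)^-1)%:C) ((2 * pi)%:C); move: ii => i i2 K t e.
  have -> : i * 2%:R * - K * (t * i) = - ((2%:R * K * t) * (i * i)) by ring.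
  by rewrite e i2 mul1r opprK.
- move=> b; have [_ posB _] := hB.
  rewrite /cart -(coroot_ip hG rho1 rhoM rhoN rho_nt htau ThD ThZ ThE hs hB) mulfK //.
  by rewrite gt_eqF // posB.
exact: (rv_dim1 L hG rho1 rhoM rhoN rho_nt htau ThZ ThL ThE cent hs).
Qed.

(** Irreducibility is stated for row spaces, [S] is a predicate. A row space of maximal rank inside
    [S] contains all of [S], is stable under the Lie algebra, hence under its exponentials, and
    these generate rho G. *)
Lemma invariant_submodule (S : 'cV[R[i]]_m -> Prop) :
    (forall u v, S u -> S v -> S (u + v)) -> (forall (c : R[i]) u, S u -> S (c *: u)) ->
    (forall X u, gC rho X -> S u -> S (X *m u)) ->
    forall v, v != 0 -> S v -> forall u, S u.
Proof.
move=> SD SZ SX v v0 Sv.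
have S0 : S 0 by have := SZ 0 _ Sv; rewrite scale0r.
pose P n := `[< exists U : 'M[R[i]]_m, \rank U = n /\ forall u : 'cV_m, (u^T <= U)%MS -> S u >].
have P0 : exists n, P n.
  exists 0%N; apply/asboolP; exists 0; split; first exact: mxrank0.
  by move=> u; rewrite submx0 => /eqP h; rewrite -[u]trmxK h trmx0.
have Pm n : P n -> (n <= m)%N by move=> /asboolP [U [<- _]]; exact: rank_leq_row.
case: (ex_maxnP P0 Pm) => n /asboolP [U [rU hU]] nmax.
have SU u : S u -> (u^T <= U)%MS.
  move=> Su.
  have hV : P (\rank (U + u^T)%MS).
    apply/asboolP; exists (U + u^T)%MS; split=> // w /sub_addsmxP [[A1 A2] /= e].
    have -> : w = (A1 *m U)^T + A2 0 0 *: u.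
      apply: trmx_inj; rewrite e linearD linearZ /= trmxK; congr (_ + _).
      by rewrite {1}[A2]mx11_scalar mul_scalar_mx.
    by apply: SD; [apply: hU; rewrite trmxK submxMl|exact: SZ].
  have := nmax _ hV; rewrite -rU => le.
  have sub : (U <= U + u^T)%MS := addsmxSl _ _.
  have := mxrank_leqif_sup sub => - [le2 /esym].
  rewrite eqn_leq le2 le => h; apply: submx_trans (addsmxSr U u^T) _.
  by rewrite h.
have st X : lalg rho X -> (U *m (expm X)^T <= U)%MS.
  move=> hX; have /submxP [Y hY] : (U *m X^T <= U)%MS.
    apply/row_subP => i; rewrite row_mul -[row i U]trmxK -trmx_mul; apply: SU.
    apply: SX; last by apply: hU; rewrite trmxK row_sub.
    by exists X, 0; split; rewrite ?scaler0 ?addr0 //; exact: (@lalg0 _ _ _ _ rho1).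
  have e : X *m U^T = U^T *m Y^T by rewrite -trmx_mul -hY trmx_mul trmxK.
  have := expm_intertwine e => /(congr1 trmx); rewrite trmx_mul trmxK => ->.
  by rewrite trmx_mul trmxK submxMl.
have [] := irr (U := U).
- apply: (gen_expm L hG rho1 rhoM rhoN rho_nt (P := fun M => stablemx U M^T)) => //.
  move=> M M' hM hM'; rewrite -mulmxE trmx_mul mulmxA.
  exact: submx_trans (submxMr _ hM') hM.
- move=> U0; have := SU _ Sv; rewrite U0 submx0 => /eqP h.
  by case/eqP: v0; rewrite -[v]trmxK h trmx0.
by move=> fU u; apply: hU; exact: submx_full.
Qed.

Lemma rdat_rho : rdat (gC rho) Th mu B.
Proof.
have [symB posB _] := hB.
split=> //.
- exact: (gCD L hG rho1 rhoM rhoN rho_nt).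
- exact: (gCZ L hG rho1 rhoM rhoN rho_nt).
- exact: (gC_br L hG rho1 rhoM rhoN rho_nt).
- by move=> x; exists (Th x), 0; split; rewrite ?scaler0 ?addr0 //; exact: (@lalg0 _ _ _ _ rho1).
- exact: (Th_inj hG rho1 rhoM rhoN rho_nt htau ThZ ThE).
- move=> _ [X [Y [hX hY ->]]] h.
  have h2 x : br (Th x) X = 0 /\ br (Th x) Y = 0.
    apply: (gC_inj L hG rho1 rhoM rhoN rho_nt).
    + exact: (g_br L hG rho1 rhoM rhoN rho_nt).
    + exact: (g_br L hG rho1 rhoM rhoN rho_nt).
    + exact: (@lalg0 _ _ _ _ rho1).
    + exact: (@lalg0 _ _ _ _ rho1).
    by rewrite scaler0 addr0 -(h x) brDr brZr.
  have [|u ->] := cent hX; first by move=> x; apply/esym/br_eq0; exact: (h2 x).1.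
  have [|v ->] := cent hY; first by move=> x; apply/esym/br_eq0; exact: (h2 x).2.
  by exists u, v.
- move=> _ [X [Y [hX hY ->]]] h.
  have hc : gC rho (X - ii *: Y) by exists X, (- Y); split; rewrite ?scalerN //; exact: lalgN.
  have [_ hz] := gC_form hG rhoN hX hY.
  by have [|-> ->] := hz; rewrite ?(h _ hc) // scaler0 addr0.
- exact: sl2_rdat.
- move=> a [a0 [E0 E00 hE0]].
  have [X [Y [y hs]]] := sl2_ex L hG rho1 rhoM rhoN rho_nt ThZ ThL cent a0 E00 hE0.
  have [_ [gg hgg]] := weyl_refl hG rho1 rhoM rhoN rho_nt htau ThD ThZ ThE hs.
  exists y, (rho gg), (rho (gg^-1)%g); split=> //; last exact: (rhoVl rho1 rhoM).
  move=> b; rewrite /cart -(coroot_ip hG rho1 rhoM rhoN rho_nt htau ThD ThZ ThE hs hB) mulfK //.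
  by rewrite gt_eqF // posB.
- move=> a b [a0 [E0 E00 hE0]] rb.
  have [X [Y [y hs]]] := sl2_ex L hG rho1 rhoM rhoN rho_nt ThZ ThL cent a0 E00 hE0.
  have := root_refl hG rho1 rhoM rhoN rho_nt htau ThD ThZ ThE hs rb.
  rewrite /refla /refl /cart -(coroot_ip hG rho1 rhoM rhoN rho_nt htau ThD ThZ ThE hs hB) mulfK //.
  by rewrite gt_eqF // posB.
- move=> a b [a0 [E0 E00 hE0]] [b0 [F0 F00 hF0]].
  have [X [Y [y hs]]] := sl2_ex L hG rho1 rhoM rhoN rho_nt ThZ ThL cent a0 E00 hE0.
  have := rv_int ThE hs F00 hF0.
  rewrite /cart -(coroot_ip hG rho1 rhoM rhoN rho_nt htau ThD ThZ ThE hs hB) mulfK //.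
  by rewrite gt_eqF // posB.
exact: invariant_submodule.
Qed.

Lemma tr_tau x : \tr (rho (tau x)) = \sum_p expi2pi (pairing (mu p) x).
Proof.
rewrite ThE; apply: eq_bigr => p _.
have e : Th x *m delta_mx p 0 = delta_mx p 0 *m (wt (mu p) x)%:M :> 'cV_m.
  rewrite mul_mx_scalar Thdiag; apply/matrixP => i j; rewrite mul_diag_mx !mxE.
  by have [->|_] := eqVneq i p; rewrite ?mulr1 // !mulr0.
have := expm_intertwine e; rewrite expm_sc1 -colE mul_mx_scalar => /matrixP /(_ p 0).
by rewrite !mxE !eqxx mulr1.
Qed.

(** Write rho g = exp X and use [hunt] to conjugate X to some Y commuting with Th h. As no root
    vanishes at h, Y has no component on a root, so it commutes with the torus and belongs to its
    Lie algebra. *)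
Lemma tr_torus h g : (forall a, rooty a -> pairing a h != 0) ->
  exists x, \tr (rho g) = \sum_p expi2pi (pairing (mu p) x).
Proof.
move=> hh; have [X hX eX] := expm_surj L hG rho1 rhoM rhoN rho_nt g.
have [g' hc] := hunt L hG rho1 rhoM rhoN rho_nt hX (ThL h).
have := lalg_conj rho1 rhoM g' hX; move: hc (erefl (rho g' * X * rho (g'^-1)%g)).
move: {1 2 3 5}(rho g' * X * rho (g'^-1)%g) => Y hc eY hY.
have gY : gC rho Y by exists Y, 0; split; rewrite ?scaler0 ?addr0 //; exact: (@lalg0 _ _ _ _ rho1).
have [|x ex] := cent hY.
  move=> x; apply/esym/br_eq0/matrixP => p q; rewrite (br_th rdat_rho) [RHS]mxE.
  have [->|y0] := eqVneq (Y p q) 0; first by rewrite mulr0.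
  have [e|ne] := eqVneq (mu p - mu q) 0.
    by rewrite e wtE pairing0l mulr0 rmorph0 !mul0r.
  have ra : rooty (mu p - mu q).
    split=> //; exists (comp mu (mu p - mu q) Y); last exact: (comp_rv rdat_rho).
    by apply/eqP => /matrixP /(_ p q); rewrite !mxE eqxx => /eqP; rewrite (negbTE y0).
  have := hh _ ra; have : br (Th h) Y = 0 by apply/br_eq0; rewrite hc.
  move=> /matrixP /(_ p q); rewrite (br_th rdat_rho) [RHS]mxE => /eqP.
  rewrite mulf_eq0 (negbTE y0) orbF => /eqP /(congr1 (@complex.Im R)) /= /eqP.
  by rewrite mulf_eq0 (negbTE (tpi R)) /= => ->.
exists x; rewrite -tr_tau ThE -ex eY expm_conj // -eX mxtrace_mulC -!mulmxE mulmxA mulmxE.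
by rewrite (rhoVl rho1 rhoM) mul1r.
Qed.

Variables (h lam : 'rV[R]_r).
Hypothesis m0 : (0 < m)%N.
Hypothesis hh : regular_vector (root_set L tau) h.
Hypothesis hlam : highest_short_root (root_set L tau) B h lam.
Hypothesis hw : highest_weight tau (root_set L tau) h rho lam.

Lemma rootP a : root_set L tau a <-> rooty a.
Proof. exact: (root_setP L hG rho1 rhoM rhoN rho_nt ThZ ThE). Qed.

Lemma weightE a : weight tau rho a <-> exists p, mu p = a.
Proof.
rewrite (weightP ThZ ThE); split=> [[v v0 hv]|[p <-]].
  have [p [j vp]] := mx_neq0 v0; exists p; apply: wt_ext => x.
  have := congr1 (fun w : 'cV[R[i]]_m => w p j) (hv x); rewrite Thdiag mul_diag_mx !mxE.
  exact: (mulIf vp).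
exists (delta_mx p 0).
  by apply/eqP => /matrixP /(_ p 0); rewrite !mxE !eqxx => /eqP; rewrite oner_eq0.
move=> x; rewrite Thdiag; apply/matrixP => i j; rewrite mul_diag_mx !mxE.
by have [->|_] := eqVneq i p; rewrite // !mulr0.
Qed.

Lemma reg_h a : rooty a -> pairing a h != 0.
Proof. by move/rootP; exact: hh. Qed.

Lemma root_lam : rooty lam.
Proof. by apply/rootP; have [[]] := hlam. Qed.

Lemma short_lam b : rooty b -> ip B lam lam <= ip B b b.
Proof. by move/rootP; have [[_ hs] _] := hlam; exact: hs. Qed.

Lemma dom_lam b : rooty b -> 0 < pairing b h -> 0 <= ip B lam b.
Proof. by move=> /rootP rb bp; have [_ hd] := hlam; apply: hd. Qed.

Lemma wt_lam : exists p, mu p = lam.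
Proof. by apply/weightE; have [] := hw. Qed.

Lemma top_lam p : exists2 s : seq 'rV[R]_r,
  (forall c, c \in s -> rooty c /\ 0 < pairing c h) & lam - mu p = \sum_(c <- s) c.
Proof.
have [_ ht] := hw; have [|s hs e] := ht (mu p); first by apply/weightE; exists p.
by exists s => // c /hs [/rootP].
Qed.

Let mult_one p : mu p != 0 -> mult mu (mu p) = 1%N.
Proof.
move=> p0; rewrite (weight_mult rdat_rho root_lam short_lam dom_lam top_lam p0).
exact: (lam_mult rdat_rho reg_h wt_lam top_lam).
Qed.

Lemma weight_opp p : exists q, mu q = - mu p.
Proof.
have [p0|p0] := eqVneq (mu p) 0; first by exists p; rewrite p0 oppr0.
have rp := weight_root rdat_rho root_lam short_lam dom_lam top_lam p0.
have [_ posB _] := hB.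
apply: mult_ex; have := mult_refl rdat_rho (mu p) rp.
have -> : refl B (mu p) (mu p) = - mu p.
  by rewrite /refl (cart_self posB) // scaler_nat mulr2n opprD addrA subrr sub0r.
by move=> ->; exact: mult_gt0.
Qed.

Lemma weight_sum_odd (F : 'rV[R]_r -> R) : (forall b, F (- b) = - F b) -> \sum_p F (mu p) = 0.
Proof.
move=> oF; have [s0 hs0] := choice weight_opp.
(* The choice [s0] may send several indices of weight 0 to the same one; the identity there keeps
   [s] injective. *)
pose s p := if mu p == 0 then p else s0 p.
have hs p : mu (s p) = - mu p by rewrite /s; case: eqP => // ->; rewrite oppr0.
have sI : injective s.
  move=> p q e; have epq : mu p = mu q by apply: oppr_inj; rewrite -!hs e.
  move: e; rewrite /s -epq; case: eqVneq => // p0 _.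
  by move: (eq_leq (mult_one p0)) => /card_le1_eqP; apply; rewrite inE ?epq.
have : \sum_p F (mu p) = - \sum_p F (mu p).
  by rewrite {1}(reindex_inj sI) /= -sumrN; apply: eq_bigr => p _; rewrite hs oF.
by move: (\sum_p _) => z; lra.
Qed.

(** In the partial order of R[i] an upper bound also requires real traces: weights come in opposite
    pairs, so the sines cancel. *)
Lemma trace_max : is_max (trace_values rho) m%:R.
Proof.
split; first by exists 1%g => //; rewrite rho1 mxtrace1.
move=> _ [g _ <-]; have [le _] := rho_trace hG rho1 rhoM rhoN g.
have im0 : Im (\tr (rho g)) = 0.
  have [x ->] := tr_torus g reg_h.
  rewrite raddf_sum (weight_sum_odd (F := fun b => sin (2 * pi * pairing b x))) //.
  by move=> b; rewrite pairingNl mulrN sinN.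
have mE : (m%:R : R[i]) = (m%:R)%:C by rewrite rmorph_nat.
by rewrite lecE mE /= im0 eqxx.
Qed.

(** Vectors x of the torus and parameters xi of the model correspond by x = xi f^T, a surjective map
    because [f] is free; weights then pair with x as short roots pair with xi. *)
Lemma trace_model n (f : 'M[R]_(r, n)) (sl lal : seq 'rV[R]_n) (K : R) :
  row_free f -> model sl lal K -> [set a *m f | a in root_set L tau] = [set` lal] ->
  exists k : nat, [/\ m = (k + size sl)%N,
    k%:R * (r + size lal)%:R = m%:R * ((size sl)%:R * (4 / K)) :> R,
    forall xi : 'rV[R]_n, trace_values rho (k%:R + \sum_(v <- sl) expi2pi (pairing v xi))
    & forall z, trace_values rho z ->
      exists xi : 'rV[R]_n, z = k%:R + \sum_(v <- sl) expi2pi (pairing v xi)].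
Proof.
move=> ff hM hf.
have f_root v : v \in lal <-> exists2 a, rooty a & a *m f = v.
  split=> [vl|[a /rootP ra <-]].
    by have : [set` lal] v by []; rewrite -hf => -[a /rootP ra <-]; exists a.
  by have : [set` lal] (a *m f) by rewrite -hf; exists a.
have sumE (V : zmodType) (Phi : 'rV[R]_n -> V) := sum_weights rdat_rho reg_h root_lam short_lam dom_lam wt_lam top_lam ff hM f_root Phi.
have trE (xi : 'rV[R]_n) : \sum_p expi2pi (pairing (mu p) (xi *m f^T)) =
    (mult mu 0)%:R + \sum_(v <- sl) expi2pi (pairing v xi).
  have -> : ((mult mu 0)%:R : R[i]) = expi2pi (pairing 0 xi) *+ mult mu 0.
    by rewrite pairing0l /expi2pi mulr0 cos0 sin0.
  rewrite -sumE; apply: eq_bigr => p _; congr expi2pi.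
  by rewrite /pairing trmx_mul trmxK mulmxA.
exists (mult mu 0); split.
- have := dim_weights rdat_rho reg_h root_lam short_lam dom_lam wt_lam top_lam ff hM f_root.
  by move/eqP; rewrite eqr_nat => /eqP.
- exact: (dim_equation rdat_rho m0 reg_h root_lam short_lam dom_lam wt_lam top_lam ff hM f_root).
- by move=> xi; rewrite -trE -tr_tau; exists (tau (xi *m f^T)).
move=> _ [g _ <-]; have [x ->] := tr_torus g reg_h.
have /row_fullP [Q hQ] : row_full f^T by rewrite /row_full mxrank_tr.
exists (x *m Q); rewrite -trE; apply: eq_bigr => p _.
by rewrite -mulmxA hQ mulmx1.
Qed.

End Glue.

Section Reduction.
Variables (R : realType) (G : topologicalGroupType) (d : nat).
Variables (L : lie_structure R G d) (r : nat) (tau : 'rV[R]_r -> G) (B : 'M[R]_r).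
Hypotheses (hG : simple_compact G) (htau : maximal_torus tau).
Hypothesis hB : invariant_inner_product tau B.
Variables (h lam : 'rV[R]_r).
Hypothesis hh : regular_vector (root_set L tau) h.
Hypothesis hlam : highest_short_root (root_set L tau) B h lam.
Variables (m : nat) (rho : G -> 'M[R[i]]_m).
Hypothesis hrho : irreducible_representation rho.
Hypothesis hw : highest_weight tau (root_set L tau) h rho lam.

(** On a trivial representation <lam, x> would be an integer for every x, while it takes the value
    1/2 as [lam] is non-zero. *)
Lemma rho_nontrivial : exists g, rho g <> 1.
Proof.
apply: contrapT => hN.
have r1 g : rho g = 1 by apply: contrapT => ng; apply: hN; exists g.
have [[v v0 hv] _] := hw; have [[[l0 _] _] _] := hlam.
have [x lx] := pairing_nz l0.
have hi s : pairing lam (s *: x) \is a Num.int.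
  apply: cis_int; have := hv (s *: x); rewrite r1 mul1mx => e.
  have [p [j vp]] := mx_neq0 v0.
  have := congr1 (fun w : 'cV[R[i]]_m => w p j) e; rewrite mxE => e2.
  by apply: (mulIf vp); rewrite mul1r [RHS]e2.
have := hi (2 * pairing lam x)^-1; rewrite pairingZr invfM -mulrA mulVf // mulr1.
move/intrP => [z hz]; have : 2 * z%:~R = 1 :> R by rewrite -hz mulfV // pnatr_eq0.
by rewrite -[2]/(2%:~R) -[1]/(1%:~R) -intrM => /eqP; rewrite eqr_int; lia.
Qed.

(** All hypotheses and the trace values are preserved when [rho] is conjugated by the matrix P that
    diagonalises the torus. *)
Lemma reduction : is_max (trace_values rho) m%:R /\
  forall n (f : 'M[R]_(r, n)) (sl lal : seq 'rV[R]_n) (K : R),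
  row_free f -> model sl lal K -> [set a *m f | a in root_set L tau] = [set` lal] ->
  exists k : nat, [/\ m = (k + size sl)%N,
    k%:R * (r + size lal)%:R = m%:R * ((size sl)%:R * (4 / K)) :> R,
    forall xi : 'rV[R]_n, trace_values rho (k%:R + \sum_(v <- sl) expi2pi (pairing v xi))
    & forall z, trace_values rho z ->
      exists xi : 'rV[R]_n, z = k%:R + \sum_(v <- sl) expi2pi (pairing v xi)].
Proof.
have [rhoC rho1 rhoM m0 irr] := hrho.
have rhoN := rho_near rhoC; have rho_nt := rho_nontrivial.
have [Th [ThD ThZ ThL ThE [KT Thb]]] := rho_tau_exp L hG rho1 rhoM rhoN rho_nt htau.
have cent := centralizer L hG rho1 rhoM rhoN rho_nt htau ThD ThZ ThE Thb.
have [||P [mu [uP hP]]] := @diag_weights R m r Th ThD ThZ.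
- exact: (ThC rhoM htau ThZ ThE).
- by move=> x; exact: (lalg_bdd hG rhoN).
pose cj (X : 'M[R[i]]_m) := P *m X *m invmx P.
have PK : invmx P *m P = 1%:M := mulVmx uP.
have PV : P *m invmx P = 1%:M := mulmxV uP.
have cjM X Y : cj (X *m Y) = cj X *m cj Y.
  by rewrite /cj !mulmxA -[P *m X *m invmx P *m P]mulmxA PK mulmx1.
have cj1 : cj 1%:M = 1%:M by rewrite /cj mulmx1.
have cjK X : invmx P *m cj X *m P = X.
  by rewrite /cj !mulmxA PK mul1mx -mulmxA PK mulmx1.
have cjVK X : cj (invmx P *m X *m P) = X.
  by rewrite /cj !mulmxA PV mul1mx -mulmxA PV mulmx1.
have cjZ (c : R[i]) X : cj (c *: X) = c *: cj X by rewrite /cj -scalemxAr -scalemxAl.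
have cjT X : \tr (cj X) = \tr X by rewrite /cj mxtrace_mulC mulmxA PK mul1mx.
have cjE X : cj (expm X) = expm (cj X).
  have e : P *m X = cj X *m P by rewrite /cj -mulmxA PK mulmx1.
  have := expm_intertwine (esym e) => e2.
  by rewrite /cj -e2 -mulmxA PV mulmx1.
have cjI X Y : cj X = cj Y -> X = Y by move=> e; rewrite -[X]cjK e cjK.
pose rho' g := cj (rho g).
have rho1' : rho' 1%g = 1 by rewrite /rho' rho1 cj1.
have rhoM' x y : rho' (x * y)%g = rho' x * rho' y by rewrite /rho' rhoM cjM.
have rhoN' g0 (a : R) : 0 < a -> \forall g \near g0, nrm (rho' g - rho' g0) < a.
  move=> a0; pose c := nrm P * nrm (invmx P) + 1.
  have c0 : 0 < c by rewrite ltr_wpDl // mulr_ge0 ?nrm_ge0.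
  have := rhoN g0 (a / c) (divr_gt0 a0 c0); apply: filterS => g hg.
  have -> : rho' g - rho' g0 = cj (rho g - rho g0) by rewrite /rho' /cj mulmxBr mulmxBl.
  have h1 := le_trans (nrm_mulmx _ _) (ler_wpM2r (nrm_ge0 (invmx P)) (nrm_mulmx P (rho g - rho g0))).
  apply: le_lt_trans h1 _; rewrite mulrAC.
  move: hg; rewrite ltr_pdivlMr //; apply: le_lt_trans; rewrite mulrC /c.
  by apply: ler_wpM2l; rewrite ?nrm_ge0 // lerDl.
have rho_nt' : exists g, rho' g <> 1.
  have [g hg] := rho_nt; exists g => e; apply: hg; apply: cjI.
  by rewrite -/(rho' g) e cj1.
have ThL' x : lalg rho' (cj (Th x)).
  by move=> s; have [g hg] := ThL x s; exists g; rewrite /rho' hg cjE cjZ.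
have ThE' x : rho' (tau x) = expm (cj (Th x)) by rewrite /rho' ThE cjE.
have cent' X : lalg rho' X -> (forall x, X * cj (Th x) = cj (Th x) * X) -> exists x, X = cj (Th x).
  move=> hX cX; have [| |x hx] := cent (invmx P *m X *m P).
  - move=> s; have [g hg] := hX s; exists g; apply: cjI.
    by rewrite -/(rho' g) hg cjE cjZ cjVK.
  - by move=> x; apply: cjI; rewrite -!mulmxE cjM cjVK cjM cjVK; exact: cX.
  by exists x; rewrite -hx cjVK.
have Thdiag' x : cj (Th x) = diag_mx (\row_p wt (mu p) x).
  by rewrite /cj hP -mulmxA PV mulmx1.
have irr' (U : 'M[R[i]]_m) : (forall g, stablemx U (rho' g)^T) -> U = 0 \/ row_full U.
  move=> hU; have uPt : P^T \in unitmx by rewrite unitmx_tr.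
  have [g|e|e] := irr (U *m (invmx P)^T); last 2 first.
  - by left; rewrite -[U](mulmxK (x := (invmx P)^T)) ?unitmx_tr ?unitmx_inv // e mul0mx.
  - by right; move: e; rewrite /row_full mxrankMfree // row_free_unit unitmx_tr unitmx_inv.
  have /submxP [Y hY] := hU g; rewrite -mulmxA -trmx_mul.
  have -> : rho g *m invmx P = invmx P *m rho' g by rewrite /rho' /cj !mulmxA PK mul1mx.
  by rewrite trmx_mul mulmxA hY -mulmxA submxMl.
have hw' : highest_weight tau (root_set L tau) h rho' lam.
  have e : weight tau rho' = weight tau rho.
    apply/seteqP; split=> a [v v0 hv].
      exists (invmx P *m v); first by apply: contra v0 => /eqP e; rewrite -[v]mul1mx -PV -mulmxA e mulmx0.
      by move=> x; rewrite scalemxAr -hv /rho' /cj !mulmxA PK mul1mx.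
    exists (P *m v); first by apply: contra v0 => /eqP e; rewrite -[v]mul1mx -PK -mulmxA e mulmx0.
    by move=> x; rewrite scalemxAr -hv /rho' /cj !mulmxA -[_ *m invmx P *m P]mulmxA PK mulmx1.
  by have := hw; rewrite /highest_weight e.
have eT : trace_values rho' = trace_values rho.
  by apply/seteqP; split=> _ [g _ <-]; exists g => //; rewrite /rho' cjT.
split; rewrite -eT.
  exact: (trace_max hG rho1' rhoM' rhoN' rho_nt' htau ThL' ThE' cent' Thdiag' hB irr' hh hlam hw').
move=> n f sl lal K ff hM hf.
exact: (trace_model hG rho1' rhoM' rhoN' rho_nt' htau ThL' ThE' cent' Thdiag' hB irr' m0 hh hlam hw' ff hM hf).
Qed.

End Reduction.

(** * Types B and C *)

Section Pairs.
Variables (R : realType) (n : nat).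
Local Notation e := (@evec R n).
Local Notation sg b := ((-1 : R) ^+ b).
Implicit Types (v w : 'rV[R]_n) (i j k l : 'I_n) (b c : bool).

Definition rfl w v := v - scart v w *: w.

Lemma rflD w v1 v2 : rfl w (v1 + v2) = rfl w v1 + rfl w v2.
Proof. by rewrite /rfl /scart pairingDl mulrDr mulrDl scalerDl opprD addrACA. Qed.

Lemma rflZ w (z : R) v : rfl w (z *: v) = z *: rfl w v.
Proof. rewrite /rfl /scart pairingZl scalerBr scalerA.
by move: (pairing v w) (pairing w w)^-1 => p q; congr (_ - _ *: _); ring. Qed.

Lemma sgsg b : sg b * sg b = 1.
Proof. by rewrite -expr2 sqrr_sign. Qed.

Lemma sg_neq0 b : sg b != 0.
Proof. by rewrite signr_eq0. Qed.

Lemma pair_e v i : pairing v (e i) = v 0 i.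
Proof.
rewrite pairingE (bigD1 i) //= big1 ?addr0 => [|j ji]; first by rewrite mxE !eqxx mulr1.
by rewrite mxE (negbTE ji) andbF mulr0.
Qed.

Lemma ee i j : e i 0 j = (i == j)%:R.
Proof. by rewrite mxE eqxx eq_sym. Qed.

Lemma sg_inj b c : sg b = sg c -> b = c.
Proof. by case: b; case: c => //=; rewrite expr1 expr0; lra. Qed.

Definition sgl (z : R) (t : 'I_n * bool) : 'rV[R]_n := sg t.2 *: (z *: e t.1).

Definition dbl (t : ('I_n * 'I_n) * (bool * bool)) : 'rV[R]_n :=
  sg t.2.1 *: e t.1.1 + sg t.2.2 *: e t.1.2.

Definition S1 (z : R) := [seq sgl z t | t <- enum {: 'I_n * bool}].

(** The order on the two indices lists each vector once. *)
Definition S2 := [seq dbl t | t <- enum [pred t : ('I_n * 'I_n) * (bool * bool) | t.1.1 < t.1.2]%N].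

Lemma mem_S1 z i b : sg b *: (z *: e i) \in S1 z.
Proof. by apply/mapP; exists (i, b); rewrite ?mem_enum. Qed.

Lemma S1P z v : v \in S1 z -> exists i b, v = sg b *: (z *: e i).
Proof. by case/mapP => -[i b] _ ->; exists i, b. Qed.

Lemma mem_S2 i j b c : i != j -> sg b *: e i + sg c *: e j \in S2.
Proof.
rewrite neq_ltn => /orP [ij|ij]; apply/mapP.
  by exists ((i, j), (b, c)); rewrite ?mem_enum ?inE.
by exists ((j, i), (c, b)); rewrite ?mem_enum ?inE // addrC.
Qed.

Lemma S2P v : v \in S2 -> exists i j b c, i != j /\ v = sg b *: e i + sg c *: e j.
Proof.
case/mapP => -[[i j] [b c]]; rewrite mem_enum inE /= => ij ->.
by exists i, j, b, c; split=> //; rewrite neq_ltn ij.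
Qed.

Lemma S1_uniq z : z != 0 -> uniq (S1 z).
Proof.
move=> z0; rewrite map_inj_uniq ?enum_uniq // => -[i b] [j c] /= h.
have ij : i = j.
  apply/eqP/negPn/negP => ij; move/rowP/(_ i)/eqP: h; rewrite !mxE !eqxx /= (negbTE ij) !mulr0 mulr1.
  by rewrite mulf_eq0 signr_eq0 (negbTE z0).
rewrite ij in h *; congr (_, _); move/rowP/(_ j): h; rewrite !mxE !eqxx !mulr1.
by move/(mulIf z0)/sg_inj => /= ->.
Qed.

Lemma S2_uniq : uniq S2.
Proof.
rewrite map_inj_in_uniq ?enum_uniq // => -[[i j] [b c]] [[k l] [b' c']].
rewrite !mem_enum !inE /= => ij kl h.
have hc q := congr1 (fun w : 'rV[R]_n => w 0 q) h.
have cE (i1 j1 : 'I_n) (b1 c1 : bool) q :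
    (sg b1 *: e i1 + sg c1 *: e j1) 0 q = sg b1 *+ (i1 == q) + sg c1 *+ (j1 == q).
  by rewrite !mxE !eqxx /= !(eq_sym q) !mulr_natr.
have {}hc q : sg b *+ (i == q) + sg c *+ (j == q) = sg b' *+ (k == q) + sg c' *+ (l == q).
  by have := hc q; rewrite /dbl /= !cE.
have nij : (i == j) = false by apply/negbTE; rewrite neq_ltn ij.
have nji : (j == i) = false by rewrite eq_sym.
have nkl : (k == l) = false by apply/negbTE; rewrite neq_ltn kl.
have nlk : (l == k) = false by rewrite eq_sym.
have ik_or : i = k \/ i = l.
  have := hc i; rewrite eqxx nji mulr1n mulr0n addr0.
  case: (eqVneq k i) => [->|_]; first by left.
  case: (eqVneq l i) => [->|_]; first by right.
  by rewrite !mulr0n addr0 => /eqP; rewrite signr_eq0.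
have jk_or : j = k \/ j = l.
  have := hc j; rewrite eqxx nij mulr1n mulr0n add0r.
  case: (eqVneq k j) => [->|_]; first by left.
  case: (eqVneq l j) => [->|_]; first by right.
  by rewrite !mulr0n addr0 => /eqP; rewrite signr_eq0.
have [ik jl] : i = k /\ j = l.
  case: ik_or jk_or => ei [] ej; [|by split| |]; exfalso; move: ij kl nij; rewrite ei ej ?eqxx //; lia.
rewrite -ik -jl in hc *.
have := hc i; rewrite eqxx nji !mulr0n !mulr1n !addr0 => /sg_inj ->.
have := hc j; rewrite eqxx nij !mulr0n !mulr1n !add0r => /sg_inj ->.
by [].
Qed.

Lemma rfl1 z i b j : z != 0 -> rfl (sg b *: (z *: e i)) (e j) = sg (i == j) *: e j.
Proof.
move=> z0; set w := sg b *: (z *: e i).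
have ww : pairing w w = z ^+ 2.
  by rewrite /w !(pairingZl, pairingZr) pair_e ee eqxx; case: b {w} => /=; rewrite ?expr1 ?expr0; ring.
have vw : pairing (e j) w = sg b * z * (i == j)%:R.
  by rewrite /w !pairingZr pair_e ee eq_sym mulrA.
rewrite /rfl /scart vw ww; case: (eqVneq i j) => [<-|ij].
  rewrite /w !scalerA -{1}[e i]scale1r -scalerBl; congr (_ *: _).
  by case: b {w ww vw} => /=; rewrite ?expr1 ?expr0; field.
by rewrite !mulr0 mul0r scale0r subr0 expr0 scale1r.
Qed.

Lemma rfl2 i j b c k : i != j ->
  rfl (sg b *: e i + sg c *: e j) (e k) =
  (if k == i then - (sg b * sg c) *: e j else if k == j then - (sg b * sg c) *: e i else e k).
Proof.
move=> ij; set w := _ + _.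
have ww : pairing w w = 2.
  rewrite /w !(pairingDl, pairingDr, pairingZl, pairingZr) !pair_e !ee !eqxx (eq_sym j) (negbTE ij).
  by case: b {w}; case: c => /=; rewrite ?expr1 ?expr0; ring.
have vw : pairing (e k) w = sg b * (k == i)%:R + sg c * (k == j)%:R.
  by rewrite /w pairingDr !pairingZr !pair_e !ee.
rewrite /rfl /scart vw ww [2 * _]mulrC mulfK ?pnatr_eq0 //.
case: (eqVneq k i) => [->|ki].
  rewrite (negbTE ij) mulr0 mulr1 addr0 /w scalerDr !scalerA sgsg scale1r opprD addrA subrr sub0r.
  by rewrite scaleNr.
case: (eqVneq k j) => [->|kj].
  rewrite mulr0 mulr1 add0r /w scalerDr !scalerA sgsg scale1r opprD addrCA subrr addr0.
  by rewrite scaleNr mulrC.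
by rewrite !mulr0 addr0 scale0r subr0.
Qed.

(* Reflections in the roots of B_n and C_n are signed permutations of the coordinates. *)
Lemma rfl_sperm z w : z != 0 -> w \in S1 z ++ S2 ->
  exists (s : {perm 'I_n}) (t : 'I_n -> bool), forall k, rfl w (e k) = sg (t k) *: e (s k).
Proof.
move=> z0; rewrite mem_cat => /orP [/S1P [i [b ->]]|/S2P [i [j [b [c [ij ->]]]]]].
  by exists 1%g, (fun k => i == k) => k; rewrite rfl1 // perm1.
exists (tperm i j), (fun k => ((k == i) || (k == j)) && ~~ (b (+) c)) => k.
have sE : - (sg b * sg c) = sg (~~ (b (+) c)).
  by case: b; case: c => /=; rewrite ?expr1 ?expr0; ring.
rewrite rfl2 //; case: (eqVneq k i) => [->|ki]; first by rewrite tpermL sE.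
case: (eqVneq k j) => [->|kj]; first by rewrite tpermR sE.
by rewrite tpermD 1?eq_sym // expr0 scale1r.
Qed.

Lemma rfl_S1 z z' v w : z != 0 -> w \in S1 z ++ S2 -> v \in S1 z' -> rfl w v \in S1 z'.
Proof.
move=> z0 /(rfl_sperm z0) [s [t hs]] /S1P [i [b ->]].
rewrite !rflZ hs [z' *: _]scalerA [z' * _]mulrC -scalerA scalerA -signr_addb.
exact: mem_S1.
Qed.

Lemma rfl_S2 z v w : z != 0 -> w \in S1 z ++ S2 -> v \in S2 -> rfl w v \in S2.
Proof.
move=> z0 /(rfl_sperm z0) [s [t hs]] /S2P [i [j [b [c [ij ->]]]]].
rewrite rflD !rflZ !hs !scalerA -!signr_addb; apply: mem_S2.
by apply: contra ij => /eqP/perm_inj ->.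
Qed.

Lemma sum_pairs (V : nmodType) (F : 'I_n -> 'I_n -> V) :
  \sum_k \sum_(l | k != l) F k l = \sum_(t : 'I_n * 'I_n | (t.1 < t.2)%N) (F t.1 t.2 + F t.2 t.1).
Proof.
rewrite big_split /= !(pair_big_dep xpredT) /=.
rewrite (bigID (fun t : 'I_n * 'I_n => (t.1 < t.2)%N)) /=; congr (_ + _).
  by apply: eq_bigl => -[k l] /=; rewrite -val_eqE /=; lia.
rewrite (reindex_inj (h := fun t : 'I_n * 'I_n => (t.2, t.1))) /=; last by move=> [a b] [c d] [-> ->].
by apply: eq_bigl => -[k l] /=; rewrite -val_eqE /=; lia.
Qed.

Lemma sum_S1 (V : nmodType) z (F : 'rV[R]_n -> V) :
  \sum_(v <- S1 z) F v = \sum_i (F (- (z *: e i)) + F (z *: e i)).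
Proof.
rewrite big_map big_enum /= (eq_bigr (fun t : 'I_n * bool => F (sg t.2 *: (z *: e t.1)))) //.
rewrite -(pair_bigA _ (fun i b => F (sg b *: (z *: e i)))) /=; apply: eq_bigr => i _.
by rewrite big_bool /= expr1 scaleN1r expr0 scale1r.
Qed.

Lemma sum_S2 (V : nmodType) (F : 'rV[R]_n -> V) :
  \sum_(v <- S2) F v = \sum_(t : 'I_n * 'I_n | (t.1 < t.2)%N)
    (F (- e t.1 - e t.2) + F (- e t.1 + e t.2) + (F (e t.1 - e t.2) + F (e t.1 + e t.2))).
Proof.
rewrite big_map big_enum_cond /=.
rewrite (eq_bigl (fun t : ('I_n * 'I_n) * (bool * bool) => (t.1.1 < t.1.2)%N && true)); last first.
  by move=> t; rewrite inE andbT.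
rewrite -(pair_big (fun t : 'I_n * 'I_n => (t.1 < t.2)%N) xpredT (fun t u => F (dbl (t, u)))) /=.
apply: eq_bigr => t _.
rewrite -(pair_bigA _ (fun b c => F (dbl (t, (b, c))))) /= !big_bool /= /dbl /=.
by rewrite !expr1 !scaleN1r !expr0 !scale1r.
Qed.

Lemma size_sum (s : seq 'rV[R]_n) : (size s)%:R = \sum_(v <- s) 1 :> R.
Proof. by rewrite big_const_seq count_predT iter_addr_0. Qed.

Lemma size_S1 z : (size (S1 z))%:R = 2 * n%:R :> R.
Proof. by rewrite size_sum sum_S1 sumr_const card_ord [RHS]mulr_natr. Qed.

Lemma sum_neq (F : 'I_n -> R) : \sum_k \sum_(l | k != l) F k = (n%:R - 1) * \sum_k F k.
Proof.
rewrite mulr_sumr; apply: eq_bigr => k _.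
have : \sum_(l < n) F k = F k + \sum_(l | k != l) F k.
  by rewrite (bigD1 k) //=; congr (_ + _); apply: eq_bigl => l; rewrite eq_sym.
rewrite sumr_const card_ord => e; rewrite mulrBl mul1r mulr_natl e.
by rewrite addrC addKr.
Qed.

Lemma size_S2 : (size S2)%:R = 2 * n%:R * (n%:R - 1) :> R.
Proof.
rewrite size_sum sum_S2 (eq_bigr (fun=> 2 + 2)) => [|t _]; last by ring.
rewrite -(sum_pairs (fun _ _ => 2)) (sum_neq (fun=> 2)) sumr_const card_ord -mulr_natr; ring.
Qed.

(** Among the short roots only w and -w have a non-zero Cartan number against w, namely 2 and -2:
    hence 8 = 4 + 4. *)
Lemma model_B : model (S1 1) (S1 1 ++ S2) 8.
Proof.
have o0 : 1 != 0 :> R := oner_neq0 _.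
split.
- rewrite cat_uniq S1_uniq // S2_uniq andbT /=.
  apply/hasPn => v /S2P [i [j [b [c [ij ->]]]]]; apply/negP => /S1P [k [b' h]].
  have hc q := congr1 (fun w : 'rV[R]_n => w 0 q) h.
  have := hc i; have := hc j; rewrite !mxE !eqxx /= (negbTE ij) [j == i]eq_sym (negbTE ij).
  rewrite !mulr0 !mulr1 !mul1r addr0 add0r.
  have [ik|ik] := eqVneq i k; last by move=> _; rewrite mulr0 => /eqP; rewrite signr_eq0.
  have [jk|jk] := eqVneq j k; first by rewrite ik jk eqxx in ij.
  by rewrite mulr0 => /eqP; rewrite signr_eq0.
- exact: S1_uniq.
- by move=> v; rewrite mem_cat => ->.
- move=> v; rewrite mem_cat => /orP [/S1P [i [b ->]]|/S2P [i [j [b [c [ij ->]]]]]].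
    rewrite scale1r scaler_eq0 signr_eq0 /=; apply/eqP => /rowP/(_ i)/eqP.
    by rewrite !mxE !eqxx oner_eq0.
  apply/eqP => /rowP/(_ i)/eqP; rewrite !mxE !eqxx (negbTE ij) mulr1 mulr0 addr0.
  by rewrite signr_eq0.
- move=> v w; rewrite mem_cat => /orP [vs|vs] wl; rewrite mem_cat -/(rfl w v).
    by rewrite (rfl_S1 o0 wl vs).
  by rewrite (rfl_S2 o0 wl vs) orbT.
- by move=> v w vs wl; exact: (rfl_S1 o0 wl vs).
- move=> Q hQ _ _ /S1P [i [b ->]] /S1P [j [c ->]] Qv.
  rewrite !scale1r in Qv *.
  have mi : sg b *: e i \in S1 1 by rewrite -[e i]scale1r; exact: mem_S1.
  have [ij|ij] := eqVneq i j.
    rewrite -ij; have [->//|bc] := eqVneq c b.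
    have -> : sg c = - sg b.
      by case: b c bc {mi Qv} => [] [] //= _; rewrite ?expr1 ?expr0 ?opprK.
    have := hQ _ (sg b *: e i) mi; rewrite mem_cat mi => /(_ isT Qv).
    rewrite -/(rfl _ _) rflZ -{1}[e i]scale1r rfl1 // eqxx expr1 scalerA mulrN1.
    by [].
  have wl : sg b *: e i + sg (~~ c) *: e j \in S1 1 ++ S2 by rewrite mem_cat mem_S2 ?orbT.
  have := hQ _ _ mi wl Qv; rewrite -/(rfl _ _) rflZ rfl2 // eqxx scalerA.
  suff -> : sg b * - (sg b * sg (~~ c)) = sg c by [].
  by case: b {mi Qv wl}; case: c => /=; rewrite ?expr1 ?expr0; ring.
- move=> v; rewrite mem_cat => /orP [->//|/S2P [i [j [b [c [ij ->]]]]] _].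
  exists (1 *: e i); split.
  + by rewrite mem_cat -[1 *: _]scale1r -[X in X *: (1 *: _)](expr0 (-1)) (mem_S1 1 i false).
  + rewrite scale1r pair_e !mxE !eqxx (negbTE ij) mulr1 mulr0 addr0 signr_eq0 //.
  rewrite scale1r !(pairingDl, pairingDr, pairingZl, pairingZr) !pair_e !ee !eqxx (eq_sym j) (negbTE ij).
  by case: b; case: c => /=; rewrite ?expr1 ?expr0; lra.
move=> _ /S1P [i [b ->]]; rewrite sum_S1.
rewrite (bigD1 i) //= big1 ?addr0 => [|j ji].
  rewrite /scart !scale1r !(pairingNl, pairingZl, pairingZr) !pair_e !ee !eqxx.
  by case: b => /=; rewrite ?expr1 ?expr0; field.
rewrite /scart !scale1r !(pairingNl, pairingZl, pairingZr) !pair_e !ee !eqxx (negbTE ji).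
by rewrite !(mulr0, oppr0, mul0r, expr0n, addr0).
Qed.

Lemma S2_pairing w : \sum_(v <- S2) pairing v w ^+ 2 = 4 * (n%:R - 1) * pairing w w.
Proof.
rewrite sum_S2 pairingE.
rewrite (eq_bigr (fun t : 'I_n * 'I_n => 4 * w 0 t.1 ^+ 2 + 4 * w 0 t.2 ^+ 2)) => [|t _]; last first.
  by rewrite !(pairingDl, pairingNl) ![pairing (e _) w]pairingC !pair_e; ring.
rewrite -(sum_pairs (fun k _ => 4 * w 0 k ^+ 2)) (sum_neq (fun k => 4 * w 0 k ^+ 2)) -mulr_sumr.
rewrite mulrCA mulrA; congr (_ * _); apply: eq_bigr => k _; exact: expr2.
Qed.

(** All short roots have square length 2, so Cartan numbers are inner products and [S2_pairing]
    gives K = 4 (n - 1) * 2. *)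
Lemma model_C : (2 <= n)%N -> model S2 (S1 2 ++ S2) (8 * (n%:R - 1)).
Proof.
move=> n2; have t0 : 2 != 0 :> R by rewrite pnatr_eq0.
have norm2 i j b c : i != j -> pairing (sg b *: e i + sg c *: e j) (sg b *: e i + sg c *: e j) = 2.
  move=> ij; rewrite !(pairingDl, pairingDr, pairingZl, pairingZr) !pair_e !ee !eqxx (eq_sym j) (negbTE ij).
  by case: b; case: c => /=; rewrite ?expr1 ?expr0; ring.
split.
- rewrite cat_uniq S1_uniq // S2_uniq andbT /=.
  apply/hasPn => v /S2P [i [j [b [c [ij ->]]]]]; apply/negP => /S1P [k [b' h]].
  have hc q := congr1 (fun w : 'rV[R]_n => w 0 q) h.
  have := hc i; have := hc j; rewrite !mxE !eqxx /= (negbTE ij) [j == i]eq_sym (negbTE ij).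
  rewrite !mulr0 !mulr1 addr0 add0r.
  have [ik|ik] := eqVneq i k; last by move=> _; rewrite !mulr0 => /eqP; rewrite signr_eq0.
  have [jk|jk] := eqVneq j k; first by rewrite ik jk eqxx in ij.
  by rewrite !mulr0 => /eqP; rewrite signr_eq0.
- exact: S2_uniq.
- by move=> v; rewrite mem_cat orbC => ->.
- move=> v; rewrite mem_cat => /orP [/S1P [i [b ->]]|/S2P [i [j [b [c [ij ->]]]]]].
    rewrite !scaler_eq0 signr_eq0 (negbTE t0) /=; apply/eqP => /rowP/(_ i)/eqP.
    by rewrite !mxE !eqxx oner_eq0.
  apply/eqP => /rowP/(_ i)/eqP; rewrite !mxE !eqxx (negbTE ij) mulr1 mulr0 addr0.
  by rewrite signr_eq0.
- move=> v w; rewrite mem_cat => /orP [vs|vs] wl; rewrite mem_cat -/(rfl w v).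
    by rewrite (rfl_S1 t0 wl vs).
  by rewrite (rfl_S2 t0 wl vs) orbT.
- by move=> v w vs wl; exact: (rfl_S2 t0 wl vs).
- move=> Q hQ.
  (* One reflection replaces the second term while keeping the first; two such moves, with the terms
     exchanged in between, join any two short roots. *)
  have step i b j c l c' : i != j -> i != l ->
      Q (sg b *: e i + sg c *: e j) -> Q (sg b *: e i + sg c' *: e l).
    move=> ij il Qv; have mv := mem_S2 b c ij.
    have [jl|jl] := eqVneq j l.
      have [->|cc] := eqVneq c' c; first by rewrite -jl.
      have wl : sg false *: (2 *: e j) \in S1 2 ++ S2 by rewrite mem_cat mem_S1.
      have := hQ _ _ mv wl Qv; rewrite -/(rfl _ _) rflD !rflZ !rfl1 // eqxx (eq_sym j) (negbTE ij).
      rewrite expr0 scale1r expr1 scaleN1r scalerN -scaleNr jl.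
      by have -> : - sg c = sg c' by case: c c' cc {mv Qv wl} => [] [] //= _; rewrite ?expr1 ?expr0 ?opprK.
    have wl : sg c *: e j + sg (~~ c') *: e l \in S1 2 ++ S2 by rewrite mem_cat mem_S2 ?orbT.
    have := hQ _ _ mv wl Qv; rewrite -/(rfl _ _) rflD !rflZ !rfl2 // eqxx (negbTE ij) (negbTE il) scalerA.
    suff -> : sg c * - (sg c * sg (~~ c')) = sg c' by [].
    by case: c {Qv mv wl}; case: c' => /=; rewrite ?expr1 ?expr0; ring.
  move=> _ _ /S2P [i [j [b [c [ij ->]]]]] /S2P [k [l [b' [c' [kl ->]]]]] Qv.
  have [li|li] := eqVneq l i.
    rewrite -li in ij Qv *; rewrite eq_sym in kl.
    have := step _ _ _ _ k b' ij kl Qv; rewrite addrC => Q1.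
    by apply: (step _ _ _ b _ _ _ _ Q1); rewrite eq_sym.
  rewrite eq_sym in li; have := step _ _ _ _ l c' ij li Qv; rewrite addrC => Q1.
  rewrite addrC; apply: (step _ _ _ b _ _ _ _ Q1); by rewrite eq_sym.
- move=> v; rewrite mem_cat orbC => /orP [->//|/S1P [i [b ->]] _].
  have [j ji] : exists j, i != j.
    have h0 : (0 < n)%N by exact: leq_trans n2.
    have [e0|e0] := eqVneq i (Ordinal h0); last by exists (Ordinal h0).
    by exists (Ordinal n2); rewrite e0.
  exists (sg false *: e i + sg false *: e j); split.
  + by rewrite mem_cat mem_S2 ?orbT.
  + rewrite expr0 !scale1r !(pairingZl, pairingDr) !pair_e !ee eqxx (negbTE ji) addr0 mulr1.
    by rewrite mulf_neq0 ?sg_neq0.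
  rewrite norm2 // !(pairingZl, pairingZr) pair_e ee eqxx.
  by case: b => /=; rewrite ?expr1 ?expr0; lra.
move=> _ /S2P [i [j [b [c [ij ->]]]]].
under eq_bigr => v _ do rewrite /scart norm2 // [2 * _]mulrC mulfK //.
by rewrite S2_pairing norm2 //; ring.
Qed.

End Pairs.

(** * Minimal traces for types B and C *)

Section Traces.
Variable R : realType.
Local Notation cp t := (cos (2 * pi * t) : R).

Lemma expi2pi_pm (t : R) : expi2pi (- t) + expi2pi t = (2 * cp t)%:C.
Proof.
rewrite /expi2pi mulrN cosN sinN; apply/eqP; rewrite eq_complex /=.
by apply/andP; split; apply/eqP; ring.
Qed.

Lemma is_min_real (X : Type) (T : set R[i]) (F : X -> R) (x : R) :
  (forall xi, T (F xi)%:C) -> (forall z, T z -> exists xi, z = (F xi)%:C) ->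
  (exists xi, F xi = x) -> (forall xi, x <= F xi) -> is_min T x%:C.
Proof.
move=> h1 h2 [xi <-] h3; split=> // z /h2 [xi' ->]; by rewrite lecR.
Qed.

(** The second conclusion of [reduction], with the group forgotten: what remains for each type is a
    root model and a trigonometric minimum. *)
Definition weight_data (r m : nat) (Phi : set 'rV[R]_r) (T : set R[i]) :=
  forall n (f : 'M[R]_(r, n)) (sl lal : seq 'rV[R]_n) (K : R),
  row_free f -> model sl lal K -> [set a *m f | a in Phi] = [set` lal] ->
  exists k : nat, [/\ m = (k + size sl)%N,
    k%:R * (r + size lal)%:R = m%:R * ((size sl)%:R * (4 / K)) :> R,
    forall xi : 'rV[R]_n, T (k%:R + \sum_(v <- sl) expi2pi (pairing v xi))
    & forall z, T z ->
      exists xi : 'rV[R]_n, z = k%:R + \sum_(v <- sl) expi2pi (pairing v xi)].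

(** The rank r occurs in the dimension equation; it equals n as soon as the image of the root system
    contains multiples of all basis vectors. *)
Lemma rank_iso (r n : nat) (f : 'M[R]_(r, n)) : row_free f ->
  (forall i, exists a (c : R), c != 0 /\ a *m f = c *: evec R i) -> r = n.
Proof.
move=> /eqP fr h; suff /eqP <- : row_full f by rewrite fr.
rewrite -sub1mx; apply/row_subP => i.
have [a [c [c0 e]]] := h i; rewrite row1 -[delta_mx _ _]scale1r -(mulVf c0) -scalerA.
by rewrite -[delta_mx _ _]/(evec R i) -e scalemx_sub // submxMl.
Qed.

Section Families.
Variables (r m : nat) (Phi : set 'rV[R]_r) (T : set R[i]).
Hypothesis hT : weight_data m Phi T.

Lemma min_B n : (2 <= n)%N -> root_system_iso Phi (@roots_B R n) ->
  is_min T (1 - 2 * n%:R) /\ m = (2 * n + 1)%N.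
Proof.
move=> n2 [f [ff hf]].
have hB : [set a *m f | a in Phi] = [set` S1 n (1 : R) ++ S2 R n].
  rewrite hf; apply/seteqP; split=> v /=.
    rewrite mem_cat => -[[i [b ->]]|[i [j [b [c [ij ->]]]]]].
      by rewrite -[evec R i]scale1r mem_S1.
    by rewrite mem_S2 ?orbT.
  rewrite mem_cat => /orP [/S1P [i [b ->]]|/S2P [i [j [b [c [ij ->]]]]]].
    by left; exists i, b; rewrite scale1r.
  by right; exists i, j, b, c.
have rn : r = n.
  apply: (rank_iso ff) => i.
  have he : (-1) ^+ false *: (1 *: evec R i) \in S1 n (1 : R) ++ S2 R n by rewrite mem_cat mem_S1.
  have : [set` S1 n (1 : R) ++ S2 R n] ((-1) ^+ false *: (1 *: evec R i)) := he.
  by rewrite -hB => -[a _ e]; exists a, 1; rewrite oner_neq0 e expr0 !scale1r.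
have [k [em ek T1 T2]] := hT ff (@model_B R n) hB.
have n0 : (n%:R : R) != 0 by rewrite pnatr_eq0; lia.
have s1 := size_S1 n (1 : R); have s2 := size_S2 R n.
(* The dimension equation reads k (2 n^2 + n) = (k + 2n) n. *)
have k1 : k = 1%N.
  apply/eqP; rewrite -(eqr_nat R); apply/eqP.
  move: ek; rewrite em rn size_cat !natrD s1 s2 => ek.
  have : (k%:R - 1) * (n%:R * n%:R) = 0 :> R by move: ek; move: (k%:R : R) (n%:R : R) => x y; lra.
  by move/eqP; rewrite mulf_eq0 mulf_eq0 (negbTE n0) !orbF subr_eq0 => /eqP.
have sz : size (S1 n (1 : R)) = (2 * n)%N by apply/eqP; rewrite -(eqr_nat R) s1 natrM.
split; last by rewrite em sz k1; lia.
have trE (xi : 'rV[R]_n) : k%:R + \sum_(v <- S1 n (1 : R)) expi2pi (pairing v xi) =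
    (1 + \sum_i 2 * cp (xi 0 i))%:C.
  rewrite k1 sum_S1 rmorphD rmorph1 rmorph_sum; congr (_ + _); apply: eq_bigr => i _.
  by rewrite scale1r pairingNl pairingC pair_e expi2pi_pm.
have -> : 1 - 2 * n%:R = (1 - 2 * n%:R : R)%:C by rewrite rmorphB rmorphM !rmorph_nat rmorph1.
apply: (is_min_real (F := fun xi : 'rV[R]_n => 1 + \sum_i 2 * cp (xi 0 i))).
- by move=> xi; rewrite -trE.
- by move=> z /T2 [xi ->]; exists xi; rewrite trE.
- exists (const_mx 2^-1); congr (_ + _); rewrite (eq_bigr (fun=> - 2)) => [|i _].
    by rewrite sumr_const card_ord mulNrn mulr_natr.
  by rewrite mxE mulrAC mulfV ?pnatr_eq0 // mul1r cospi mulrN1.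
move=> xi; rewrite lerD2l.
have -> : - (2 * n%:R) = \sum_(i < n) - 2 :> R by rewrite sumr_const card_ord mulNrn mulr_natr.
apply: ler_sum => i _; have := cos_geN1 (2 * pi * xi 0 i).
by move: (cos _) => c; lra.
Qed.

Lemma sum_neq2 n (F : 'I_n -> R) :
  \sum_k \sum_(l | k != l) F k * F l = (\sum_k F k) ^+ 2 - \sum_k F k ^+ 2.
Proof.
rewrite expr2 mulr_suml -sumrB; apply: eq_bigr => k _.
rewrite mulr_sumr [in RHS](bigD1 k) //= addrAC -expr2 subrr add0r; apply: eq_bigl => l; by rewrite eq_sym.
Qed.

(* The left-hand side is affine in each entry of [s], so that only entries equal to 1 or -1 matter. *)
Lemma odd_sum (s : seq R) (z : int) : (forall c, c \in s -> -1 <= c <= 1) ->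
  odd (`|z| + size s) -> 1 <= (z%:~R + \sum_(c <- s) c) ^+ 2 + \sum_(c <- s) (1 - c ^+ 2).
Proof.
elim: s z => [|c s IH] z hs /= hz.
  rewrite !big_nil !addr0 -rmorphXn /= ler1z.
  have : z != 0 by apply/eqP => z0; move: hz; rewrite z0.
  by move=> z0; rewrite -gtz0_ge1 lt_neqAle eq_sym sqrf_eq0 z0 sqr_ge0.
have hc : -1 <= c <= 1 by apply: hs; rewrite inE eqxx.
have hs' c' : c' \in s -> -1 <= c' <= 1 by move=> cs; apply: hs; rewrite inE cs orbT.
rewrite !big_cons; set S := \sum_(x <- s) x; set Q := \sum_(x <- s) _.
have h1 := IH (z + 1) hs'; have h2 := IH (z - 1) hs'.
have {}h1 : 1 <= (z%:~R + 1 + S) ^+ 2 + Q.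
  by have := h1; rewrite intrD; apply; lia.
have {}h2 : 1 <= (z%:~R - 1 + S) ^+ 2 + Q.
  by have := h2; rewrite intrB; apply; lia.
move: hc h1 h2; move: (z%:~R : R) S Q => x u q /andP [c1 c2] h1 h2.
(* The expression is affine in c with slope 2 (x + u), whose sign tells whether the end point -1 or
   1 is the smaller. *)
have [s0|s0] := leP 0 (x + u).
  apply: le_trans h2 _; have : 0 <= (c + 1) * (x + u) by rewrite mulr_ge0 //; lra.
  by nra.
apply: le_trans h1 _; have : 0 <= (1 - c) * - (x + u) by rewrite mulr_ge0 //; lra.
by nra.
Qed.

Lemma min_C n : (2 <= n)%N -> root_system_iso Phi (@roots_C R n) ->
  is_min T (if odd n then 1 - n%:R else - 1 - n%:R) /\ m = (2 * n ^ 2 - n - 1)%N.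
Proof.
move=> n2 [f [ff hf]].
have hC : [set a *m f | a in Phi] = [set` S1 n (2 : R) ++ S2 R n].
  rewrite hf; apply/seteqP; split=> v /=.
    rewrite mem_cat => -[[i [b ->]]|[i [j [b [c [ij ->]]]]]].
      by rewrite mem_S1.
    by rewrite mem_S2 ?orbT.
  rewrite mem_cat => /orP [/S1P [i [b ->]]|/S2P [i [j [b [c [ij ->]]]]]].
    by left; exists i, b.
  by right; exists i, j, b, c.
have rn : r = n.
  apply: (rank_iso ff) => i.
  have he : (-1) ^+ false *: (2 *: evec R i) \in S1 n (2 : R) ++ S2 R n by rewrite mem_cat mem_S1.
  have : [set` S1 n (2 : R) ++ S2 R n] ((-1) ^+ false *: (2 *: evec R i)) := he.
  by rewrite -hC => -[a _ e]; exists a, 2; rewrite pnatr_eq0 e expr0 !scale1r.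
have [k [em ek T1 T2]] := hT ff (model_C R n2) hC.
have n0 : (n%:R : R) != 0 by rewrite pnatr_eq0; lia.
have n1 : (n%:R - 1 : R) != 0 by rewrite subr_eq0 (eqr_nat R n 1); lia.
have s1 := size_S1 n (2 : R); have s2 := size_S2 R n.
(* The dimension equation reads k (2 n^2 + n) = (k + 2n (n - 1)) n. *)
have kn : k = n.-1.
  apply/eqP; rewrite -(eqr_nat R) -subn1 natrB ?(ltnW n2) //; apply/eqP.
  move: ek; rewrite em rn size_cat !natrD s1 s2 => ek.
  have e2 : 2 * n%:R * (n%:R - 1) * (4 / (8 * (n%:R - 1))) = n%:R :> R by field.
  rewrite e2 in ek.
  have : (k%:R - (n%:R - 1)) * (n%:R * n%:R) = 0 :> R by move: ek; move: (k%:R : R) (n%:R : R) => x y; lra.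
  by move/eqP; rewrite !mulf_eq0 (negbTE n0) !orbF subr_eq0 => /eqP.
have sz : size (S2 R n) = (2 * n * n.-1)%N.
  by apply/eqP; rewrite -(eqr_nat R) s2 !natrM -subn1 natrB ?(ltnW n2).
split; last first.
  rewrite em sz kn; clear -n2; case: n n2 => // n _.
  by rewrite /= expnS expn1; nia.
pose F (xi : 'rV[R]_n) : R := n%:R - 1 +
  2 * ((\sum_i cp (xi 0 i)) ^+ 2 - \sum_i cp (xi 0 i) ^+ 2).
have trE (xi : 'rV[R]_n) : k%:R + \sum_(v <- S2 R n) expi2pi (pairing v xi) = (F xi)%:C.
  rewrite kn -subn1 natrB ?(ltnW n2) // /F rmorphD rmorphB rmorph_nat rmorph1; congr (_ + _).
  rewrite sum_S2 -sum_neq2 mulr_sumr.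
  under [in RHS]eq_bigr => i _ do rewrite mulr_sumr.
  rewrite sum_pairs rmorph_sum; apply: eq_bigr => t _.
  rewrite !(pairingDl, pairingNl) ![pairing (evec R _) _]pairingC !pair_e.
  move: (xi 0 t.1) (xi 0 t.2) => u v.
  have := expi2pi_pm (u + v); have := expi2pi_pm (u - v).
  rewrite [- (u - v)]opprB [v - u]addrC opprD.
  move: (expi2pi _) (expi2pi _) (expi2pi (- u - v)) (expi2pi (u + v)) => w1 w2 w3 w4 e1 e2.
  have -> : w3 + w2 + (w1 + w4) = (w3 + w4) + (w2 + w1) by ring.
  rewrite e1 e2 -rmorphD; congr (_%:C); rewrite !mulrDr mulrN cosB cosD; ring.
have -> : (if odd n then 1 - n%:R else - 1 - n%:R) =
    (n%:R - 1 + 2 * ((odd n)%:R - n%:R) : R)%:C.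
  case: (odd n); rewrite rmorphD rmorphB rmorphM rmorphB !rmorph_nat rmorph1 /=; ring.
apply: (is_min_real (F := F)).
- by move=> xi; rewrite -trE.
- by move=> z /T2 [xi ->]; exists xi; rewrite trE.
(* The cosines alternate between 1 and -1: their squares sum to n and their sum is 0 or 1 according
   to the parity of n. *)
- exists (\row_i ((odd i)%:R / 2)).
  have cE (i : 'I_n) : cp ((\row_i ((odd i)%:R / 2)) 0 i) = (-1) ^+ (odd i).
    rewrite mxE; case: (odd i); last by rewrite mul0r mulr0 cos0.
    by rewrite mul1r mulrAC mulfV ?pnatr_eq0 // mul1r cospi.
  rewrite /F (eq_bigr (fun i : 'I_n => (-1) ^+ (odd i))) => [|i _]; last exact: cE.
  have -> : \sum_(i < n) cp ((\row_i ((odd i)%:R / 2)) 0 i) ^+ 2 = n%:R.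
    rewrite (eq_bigr (fun=> 1)) => [|i _]; last by rewrite cE sqrr_sign.
    by rewrite sumr_const card_ord.
  congr (_ + 2 * (_ - _)).
  have -> : \sum_(i < n) (-1) ^+ odd i = (odd n)%:R :> R.
    elim: (n) => [|p IH]; first by rewrite big_ord0.
    by rewrite big_ord_recr /= IH; case: (odd p); rewrite /= ?expr1 ?expr0; lra.
  by case: (odd n); rewrite ?expr1n ?expr0n.
move=> xi; rewrite lerD2l ler_pM2l //.
have qn : \sum_i cp (xi 0 i) ^+ 2 <= n%:R.
  have -> : n%:R = \sum_(i < n) 1 :> R by rewrite sumr_const card_ord.
  apply: ler_sum => i _.
  have := cos_geN1 (2 * pi * xi 0 i); have := cos_le1 (2 * pi * xi 0 i).
  by move: (cos _) => c; nra.
(* For even n it is enough that the squared sum is nonnegative and the squares sum to at most n; for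
   odd n [odd_sum], started at 0, gains the missing 1. *)
case on: (odd n); last first.
  have := sqr_ge0 (\sum_i cp (xi 0 i)); move: qn; move: (\sum_i cp (xi 0 i) ^+ 2) ((\sum_i _) ^+ 2) => p q /=; lra.
have := @odd_sum [seq cp (xi 0 i) | i <- index_enum 'I_n] 0.
rewrite !big_map size_map -[size _]/(size (index_enum 'I_n)).
have -> : size (index_enum 'I_n) = n by rewrite -[RHS]card_ord cardT enumT.
rewrite sumrB sumr_const card_ord add0r on => /(_ _ isT).
move: (\sum_i cp (xi 0 i) ^+ 2) ((\sum_i _) ^+ 2) => p q /= hq.
suff : 1 <= q + (n%:R - p) by lra.
apply: hq => _ /mapP [i _ ->].
by rewrite cos_geN1 cos_le1.
Qed.

End Families.
End Traces.

(** * Types F4 and G2 *)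

Section Integral.
Implicit Types s t : seq int.

Definition idot s t : int := foldr +%R 0 [seq p.1 * p.2 | p <- zip s t].

Definition irfl t s : seq int :=
  [seq p.1 - (2 * idot s t %/ idot t t)%Z * p.2 | p <- zip s t].

Definition iint t s : bool := (2 * idot s t %/ idot t t)%Z * idot t t == 2 * idot s t.

(** A decidable form of [model]. Divisions are exact by [iint], transitivity is asked through one
    reflection applied to v or to -v, and the condition on K is cleared of denominators. *)
Definition imodel (n : nat) (sl lal : seq (seq int)) (K : int) : bool :=
  [&& all (fun s => size s == n) lal, uniq lal, uniq sl, all (fun s => s \in lal) sl,
      all (fun s => idot s s != 0) lal,
      all (fun t => all (fun s => iint t s && (irfl t s \in lal)) lal) lal,
      all (fun t => all (fun s => irfl t s \in sl) sl) lal,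
      all (fun v => all (fun w => has (fun a => (irfl a v == w) || (irfl a (irfl v v) == w)) lal) sl) sl,
      all (fun v => (v \in sl) || has (fun w => (idot v w != 0) && (idot w w < idot v v)) lal) lal
    & all (fun w => foldr (fun v acc => (2 * idot v w) ^+ 2 + acc) 0 sl == K * idot w w ^+ 2) sl].

Variables (R : realType) (n : nat).

Definition ivec s : 'rV[R]_n := \row_i (nth 0 s i)%:~R.

Lemma ivec_inj s t : size s = n -> size t = n -> ivec s = ivec t -> s = t.
Proof.
move=> hs ht /rowP h; apply: (@eq_from_nth _ 0); first by rewrite hs ht.
move=> i; rewrite hs => ik; have := h (Ordinal ik); rewrite !mxE /= => /eqP.
by rewrite eqr_int => /eqP.
Qed.

Lemma pairing_ivec s t : size s = n -> size t = n ->
  pairing (ivec s) (ivec t) = (idot s t)%:~R.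
Proof.
move=> hs ht; rewrite pairingE /idot foldrE big_map (big_nth (0, 0)) big_mkord size_zip hs ht minnn.
rewrite rmorph_sum; apply: eq_bigr => i _.
by rewrite !mxE nth_zip ?hs ?ht //= rmorphM.
Qed.

Lemma rfl_ivec s t : size s = n -> size t = n -> idot t t != 0 -> iint t s ->
  rfl (ivec t) (ivec s) = ivec (irfl t s).
Proof.
move=> hs ht t0 /eqP h; apply/rowP => i; rewrite /rfl.
have -> : scart (ivec s) (ivec t) = (2 * idot s t %/ idot t t)%Z%:~R.
  rewrite /scart !pairing_ivec //.
  have t1 : (idot t t)%:~R != 0 :> R by rewrite intr_eq0.
  by apply: (mulIf t1); rewrite divfK // -intrM h intrM.
rewrite !mxE (nth_map (0, 0)) ?size_zip ?hs ?ht ?minnn //.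
by rewrite nth_zip ?hs ?ht //= intrB intrM.
Qed.

Lemma imodelP sl lal K : imodel n sl lal K -> model (map ivec sl) (map ivec lal) (K%:~R : R).
Proof.
case/and5P => /allP hsz ul us /allP hsub.
case/and5P => /allP hn0 /allP hr /allP hsr /allP ho /andP [/allP hl /allP hK].
have sz s : s \in lal -> size s = n by move/hsz/eqP.
have int t s : t \in lal -> s \in lal -> iint t s.
  by move=> tl sl'; have /allP/(_ _ sl')/andP [] := hr _ tl.
have rE t s : t \in lal -> s \in lal -> rfl (ivec t) (ivec s) = ivec (irfl t s).
  by move=> tl sl'; apply: rfl_ivec; rewrite ?sz ?hn0 ?int.
split.
- by rewrite map_inj_in_uniq // => s t /sz hs /sz ht; exact: ivec_inj.
- by rewrite map_inj_in_uniq // => s t /hsub/sz hs /hsub/sz ht; exact: ivec_inj.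
- by move=> _ /mapP [s ss ->]; apply: map_f; exact: hsub.
- move=> _ /mapP [s ss ->]; apply/eqP => h0.
  have : pairing (ivec s) (ivec s) = 0 by rewrite h0 pairing0l.
  by rewrite pairing_ivec ?sz // => /eqP; rewrite intr_eq0 (negbTE (hn0 _ ss)).
- move=> _ _ /mapP [s ss ->] /mapP [t tt ->]; rewrite -/(rfl _ _) rE //; apply: map_f.
  by have /allP/(_ _ ss)/andP [] := hr _ tt.
- move=> _ _ /mapP [s ss ->] /mapP [t tt ->]; rewrite -/(rfl _ _) (rE _ _ tt (hsub _ ss)); apply: map_f.
  by have /allP := hsr _ tt; apply.
- move=> Q hQ _ _ /mapP [s ss ->] /mapP [t tt ->] Qs.
  have stp a v : a \in lal -> v \in sl -> Q (ivec v) -> Q (ivec (irfl a v)).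
    move=> al vs Qv; rewrite -(rE _ _ al (hsub _ vs)); apply: hQ => //; exact: map_f.
  have /allP/(_ _ tt)/hasP [a al /orP [/eqP <-|/eqP <-]] := ho _ ss; first exact: stp.
  apply: (stp) => //; last by apply: (stp) => //; exact: hsub.
  by have /allP := hsr _ (hsub _ ss); apply.
- move=> _ /mapP [s ss ->] hs.
  have := hl _ ss; rewrite orbC => /orP [/hasP [w ww /andP [h1 h2]]|h1]; last first.
    by rewrite map_f in hs.
  exists (ivec w); split; first exact: map_f.
    by rewrite pairing_ivec ?sz // intr_eq0.
  by rewrite !pairing_ivec ?sz // ltr_int.
move=> _ /mapP [w ww ->]; have wl := hsub _ ww; rewrite big_map big_seq.
have w0 : (idot w w)%:~R != 0 :> R by rewrite intr_eq0 hn0.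
rewrite (eq_bigr (fun v => ((2 * idot v w) ^+ 2)%:~R / (idot w w)%:~R ^+ 2)) => [|v vs]; last first.
  by rewrite /scart !pairing_ivec ?sz ?hsub // exprMn exprVn rmorphXn /= intrM.
rewrite -big_seq -mulr_suml -rmorph_sum /=.
have /eqP := hK _ ww; rewrite -foldr_map foldrE big_map => ->.
by rewrite rmorphM rmorphXn /= mulfK // expf_neq0.
Qed.

End Integral.

Fixpoint signs n : seq (seq bool) :=
  if n is n'.+1 then [seq false :: l | l <- signs n'] ++ [seq true :: l | l <- signs n'] else [:: [::]].

Definition nat_pairs n := [seq p <- [seq (i, j) | i <- iota 0 n, j <- iota 0 n] | p.1 != p.2].

Definition dl (k i : nat) : int := (k == i)%:Z.

(* The roots of F4, multiplied by 2. *)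
Definition F4_axis i (b : bool) : seq int := mkseq (fun k => (-1 : int) ^+ b * (2 * dl k i)) 4.
Definition F4_half l : seq int := mkseq (fun k => (-1 : int) ^+ (nth false l k)) 4.
Definition F4_diag ij (b c : bool) : seq int :=
  mkseq (fun k => (-1 : int) ^+ b * (2 * dl k ij.1) + (-1) ^+ c * (2 * dl k ij.2)) 4.
Definition F4_short := flatten [seq [:: F4_axis i true; F4_axis i false] | i <- iota 0 4] ++
  [seq F4_half l | l <- signs 4].
(** Ordered pairs produce each long root twice, hence [undup]. *)
Definition F4_all := F4_short ++ undup (flatten [seq [:: F4_diag ij true true; F4_diag ij true false;
  F4_diag ij false true; F4_diag ij false false] | ij <- nat_pairs 4]).

Definition G2_diff ij : seq int := mkseq (fun k => dl k ij.1 - dl k ij.2) 3.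
Definition G2_triple i jl (b : bool) : seq int :=
  mkseq (fun k => (-1 : int) ^+ b * (2 * dl k i - dl k jl.1 - dl k jl.2)) 3.
Definition G2_short := [seq G2_diff ij | ij <- nat_pairs 3].
Definition G2_all := G2_short ++ undup (flatten [seq flatten [seq [:: G2_triple i jl true; G2_triple i jl false]
  | jl <- nat_pairs 3 & (i != jl.1) && (i != jl.2)] | i <- iota 0 3]).

(** The 24 short roots form a system of type D4 up to scale: against a fixed one the Cartan numbers
    2 and -2 occur once each, 1 and -1 eight times each, and the squares sum to 24. *)
Lemma imodel_F4 : imodel 4 F4_short F4_all 24. Proof. by vm_compute. Qed.
Lemma size_F4 : (size F4_short == 24%N) && (size F4_all == 48%N). Proof. by vm_compute. Qed.
(** The 6 short roots form a system of type A2: the Cartan numbers 2 and -2 occur once each, 1 and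
    -1 twice each, and the squares sum to 12. *)
Lemma imodel_G2 : imodel 3 G2_short G2_all 12. Proof. by vm_compute. Qed.
Lemma size_G2 : (size G2_short == 6%N) && (size G2_all == 12%N). Proof. by vm_compute. Qed.

Lemma mem_signs n (l : seq bool) : size l = n -> l \in signs n.
Proof.
elim: n l => [|n IH] [|b l] //= [/IH hl]; rewrite mem_cat.
by apply/orP; case: b; [right|left]; exact: map_f.
Qed.

Lemma mem_nat_pairs n i j : (i, j) \in nat_pairs n = [&& i != j, (i < n)%N & (j < n)%N].
Proof.
rewrite mem_filter /=; congr (_ && _); apply/allpairsP/andP => [[[a b] /= [ha hb [-> ->]]]|[hi hj]].
  by move: ha hb; rewrite !mem_iota.
by exists (i, j); rewrite !mem_iota.
Qed.

Lemma F4_allP (s : seq int) : s \in F4_all <-> [\/ exists i b, (i < 4)%N /\ s = F4_axis i b,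
  exists2 l, l \in signs 4 & s = F4_half l |
  exists i j b c, [&& i != j, (i < 4)%N & (j < 4)%N] /\ s = F4_diag (i, j) b c].
Proof.
rewrite mem_cat mem_undup [s \in F4_short]mem_cat; split=> [/orP [/orP [hs|/mapP [l hl ->]]|hs]|].
- have [q] := flatten_mapP hs; rewrite mem_iota => hi; rewrite !inE => /orP [] /eqP ->; constructor 1.
    by exists q, true.
  by exists q, false.
- by constructor 2; exists l.
- have [[i j]] := flatten_mapP hs; rewrite mem_nat_pairs => hij; rewrite !inE => /or4P [] /eqP ->; constructor 3; exists i, j.
  + by exists true, true.
  + by exists true, false.
  + by exists false, true.
  by exists false, false.
case=> [[i [b [hi ->]]]|[l hl ->]|[i [j [b [c [hij ->]]]]]].
- apply/orP; left; apply/orP; left; apply/flatten_mapP; exists i; first by rewrite mem_iota.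
  by rewrite !inE; case: b; rewrite eqxx ?orbT.
- by apply/orP; left; apply/orP; right; exact: map_f.
apply/orP; right; apply/flatten_mapP; exists (i, j); first by rewrite mem_nat_pairs.
by rewrite !inE; case: b; case: c; rewrite eqxx ?orbT.
Qed.

Lemma G2_allP (s : seq int) : s \in G2_all <->
  (exists i j, [&& i != j, (i < 3)%N & (j < 3)%N] /\ s = G2_diff (i, j)) \/
  exists i j l b, [/\ (i < 3)%N, [&& j != l, (j < 3)%N & (l < 3)%N], (i != j) && (i != l) & s = G2_triple i (j, l) b].
Proof.
rewrite mem_cat mem_undup; split=> [/orP [/mapP [[i j] hij ->]|/flatten_mapP [i hi /flatten_mapP [[j l]]]]|].
- by left; exists i, j; rewrite -mem_nat_pairs.
- rewrite mem_filter mem_nat_pairs => /andP [h1 h2]; rewrite mem_iota in hi.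
  rewrite !inE => /orP [] /eqP ->; right; exists i, j, l.
    by exists true.
  by exists false.
case=> [[i [j [hij ->]]]|[i [j [l [b [hi hjl hne ->]]]]]].
  by apply/orP; left; apply: (map_f G2_diff (x := (i, j))); rewrite mem_nat_pairs.
apply/orP; right; apply/flatten_mapP; exists i; first by rewrite mem_iota.
apply/flatten_mapP; exists (j, l); first by rewrite mem_filter mem_nat_pairs hne hjl.
by rewrite !inE; case: b; rewrite eqxx ?orbT.
Qed.

(** * Minimal traces for F4 and G2 *)

Section Exceptional.
Variable R : realType.
Local Notation cp t := (cos (2 * pi * t) : R).

Lemma model_F4 : model (map (ivec R 4) F4_short) (map (ivec R 4) F4_all) 24.
Proof. by have := imodelP R imodel_F4; rewrite rmorph_nat. Qed.

Lemma model_G2 : model (map (ivec R 3) G2_short) (map (ivec R 3) G2_all) 12.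
Proof. by have := imodelP R imodel_G2; rewrite rmorph_nat. Qed.

Lemma ivec_mkseq n (F : nat -> int) (k : 'I_n) : ivec R n (mkseq F n) 0 k = (F k)%:~R.
Proof. by rewrite mxE nth_mkseq. Qed.

Lemma pairing_mkseq n (F : nat -> int) (xi : 'rV[R]_n) :
  pairing (ivec R n (mkseq F n)) xi = \sum_(k < n) (F k)%:~R * xi 0 k.
Proof. by rewrite pairingE; apply: eq_bigr => k _; rewrite ivec_mkseq. Qed.

Lemma axisE (i : 'I_4) b : ivec R 4 (F4_axis i b) = 2 *: ((-1) ^+ b *: evec R i).
Proof.
apply/rowP => k; rewrite ivec_mkseq !mxE !eqxx /= !rmorphM rmorph_sign rmorph_nat.
by rewrite [RHS]mulrCA.
Qed.

Lemma diagE (i j : 'I_4) b c : ivec R 4 (F4_diag (nat_of_ord i, nat_of_ord j) b c) =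
  2 *: ((-1) ^+ b *: evec R i + (-1) ^+ c *: evec R j).
Proof.
apply/rowP => k; rewrite ivec_mkseq !mxE !eqxx /= rmorphD !rmorphM !rmorph_sign !rmorph_nat.
rewrite [RHS]mulrDr.
by congr (_ + _); rewrite [RHS]mulrCA.
Qed.

Lemma diffE (i j : 'I_3) : ivec R 3 (G2_diff (nat_of_ord i, nat_of_ord j)) = evec R i - evec R j.
Proof. by apply/rowP => k; rewrite ivec_mkseq !mxE !eqxx /= rmorphB. Qed.

Lemma tripleE (i j l : 'I_3) b : ivec R 3 (G2_triple i (nat_of_ord j, nat_of_ord l) b) =
  (-1) ^+ b *: (2 *: evec R i - evec R j - evec R l).
Proof.
apply/rowP => k; rewrite ivec_mkseq !mxE !eqxx /= !rmorphM !rmorphB rmorphM rmorph_sign rmorph_nat.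
by [].
Qed.

Lemma F4_image (v : 'rV[R]_4) : roots_F4 v <-> 2 *: v \in map (ivec R 4) F4_all.
Proof.
have t0 : 2 != 0 :> R by rewrite pnatr_eq0.
split=> [[[[i [b ->]]|[i [j [b [c [ij ->]]]]]]|hv]|].
- by rewrite -axisE; apply: map_f; apply/F4_allP; constructor 1; exists i, b.
- rewrite -diagE; apply: map_f; apply/F4_allP; constructor 3; exists (nat_of_ord i), (nat_of_ord j), b, c.
  by rewrite val_eqE ij !ltn_ord.
- pose l := mkseq (fun k => v 0 (inord k) < 0) 4.
  have -> : 2 *: v = ivec R 4 (F4_half l).
    apply/rowP => k; rewrite ivec_mkseq mxE rmorph_sign nth_mkseq // inord_val.
    have := hv k; case: (ltP (v 0 k) 0) => hk.
      by rewrite ltr0_norm //= expr1 => e; lra.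
    by rewrite ger0_norm //= expr0 => e; lra.
  apply: map_f; apply/F4_allP; constructor 2; exists l => //.
  by apply: mem_signs; rewrite size_mkseq.
case/mapP => s /F4_allP [[i [b [hi ->]]]|[l _ ->]|[i [j [b [c [/and3P [ij hi hj] ->]]]]]] e.
- left; left; exists (Ordinal hi), b; apply: (scalerI t0); rewrite e; exact: (axisE (Ordinal hi)).
- right => i; have := congr1 (fun w : 'rV[R]_4 => w 0 i) e; rewrite ivec_mkseq mxE rmorph_sign => e2.
  have -> : v 0 i = 2^-1 * (-1) ^+ (nth false l i) by rewrite -e2 mulKf.
  by rewrite normrM normr_sign mulr1 ger0_norm // invr_ge0.
left; right; exists (Ordinal hi), (Ordinal hj), b, c; split; first by rewrite -val_eqE.
by apply: (scalerI t0); rewrite e; exact: (diagE (Ordinal hi) (Ordinal hj)).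
Qed.

Lemma G2_image (v : 'rV[R]_3) : roots_G2 v <-> v \in map (ivec R 3) G2_all.
Proof.
split=> [[[i [j [ij ->]]]|[i [j [l [b [u ->]]]]]]|/mapP [s /G2_allP hs ->]].
- rewrite -diffE; apply: map_f; apply/G2_allP; left; exists (nat_of_ord i), (nat_of_ord j).
  by rewrite val_eqE ij !ltn_ord.
- have /and3P [ij il jl] : [&& i != j, i != l & j != l].
    by move: u; rewrite /= !inE negb_or andbT -andbA.
  rewrite -tripleE; apply: map_f; apply/G2_allP; right; exists (nat_of_ord i), (nat_of_ord j), (nat_of_ord l), b.
  by rewrite !val_eqE ij il jl !ltn_ord.
case: hs => [[i [j [/and3P [ij hi hj] ->]]]|[i [j [l [b [hi /and3P [jl hj hl] /andP [ij il] ->]]]]]].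
  left; exists (Ordinal hi), (Ordinal hj); split; first by rewrite -val_eqE.
  exact: (diffE (Ordinal hi) (Ordinal hj)).
right; exists (Ordinal hi), (Ordinal hj), (Ordinal hl), b; split.
  by rewrite /= !inE -!val_eqE /= negb_or ij il jl.
exact: (tripleE (Ordinal hi) (Ordinal hj) (Ordinal hl)).
Qed.

Lemma expi2piD (s t : R) : expi2pi (s + t) = expi2pi s * expi2pi t.
Proof.
rewrite /expi2pi mulrDr cosD sinD; apply/eqP; rewrite eq_complex /=.
by apply/andP; split; apply/eqP; ring.
Qed.

(** The expansion of the product of the sums of an exponential and its inverse. *)
Lemma sum_signs n (x : nat -> R) :
  \sum_(l <- signs n) expi2pi (\sum_(k < n) (-1) ^+ (nth false l k) * x k) =
  \prod_(k < n) (2 * cp (x k))%:C.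
Proof.
elim: n x => [|n IH] x.
  by rewrite big_seq1 !big_ord0 /expi2pi mulr0 cos0 sin0.
rewrite [signs _]/= big_cat !big_map big_ord_recl -expi2pi_pm mulrDl -(IH (fun k => x k.+1)).
rewrite addrC !mulr_sumr; congr (_ + _); apply: eq_bigr => l _;
  by rewrite big_ord_recl expi2piD /= ?expr1 ?expr0 ?mulN1r ?mul1r.
Qed.

(** With p = |ab| and q = |cd|, both at most 1, the expression is at least 2p + 2q - 4pq = 2p (1 -
    q) + 2q (1 - p). *)
Lemma quartic_ge0 (a b c d : R) : -1 <= a <= 1 -> -1 <= b <= 1 -> -1 <= c <= 1 -> -1 <= d <= 1 ->
  0 <= a ^+ 2 + b ^+ 2 + (c ^+ 2 + d ^+ 2) + 4 * (a * b * (c * d)).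
Proof.
rewrite -!ler_norml => a1 b1 c1 d1.
have amgm (u w : R) : 2 * `|u * w| <= u ^+ 2 + w ^+ 2.
  have := sqr_ge0 (`|u| - `|w|); rewrite normrM -(real_normK (num_real u)) -(real_normK (num_real w)).
  by move: `|u| `|w| => p q h; lra.
have ab1 : `|a * b| <= 1 by rewrite normrM mulr_ile1.
have cd1 : `|c * d| <= 1 by rewrite normrM mulr_ile1.
have := amgm a b; have := amgm c d; have := ler_norm (- (a * b * (c * d))); rewrite normrN normrM.
have := mulr_ge0 (normr_ge0 (a * b)) (_ : 0 <= 1 - `|c * d|); rewrite subr_ge0 => /(_ cd1).
have := mulr_ge0 (normr_ge0 (c * d)) (_ : 0 <= 1 - `|a * b|); rewrite subr_ge0 => /(_ ab1).
move: (`|a * b|) (`|c * d|) (a ^+ 2 + b ^+ 2) (c ^+ 2 + d ^+ 2) (a * b * (c * d)) => p q x y z.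
by lra.
Qed.

Section Cases.
Variables (r m : nat) (Phi : set 'rV[R]_r) (T : set R[i]).
Hypothesis hT : weight_data m Phi T.

Lemma min_F4 : root_system_iso Phi (@roots_F4 R) -> is_min T (- 6) /\ m = 26%N.
Proof.
move=> [f [ff hf]]; have /andP [/eqP sz1 /eqP sz2] := size_F4.
have t0 : 2 != 0 :> R by rewrite pnatr_eq0.
(* The integral lists hold the doubled roots, so the isomorphism is doubled as well. *)
have ff2 : row_free (2 *: f) by rewrite /row_free mxrank_scale_nz.
have hF : [set a *m (2 *: f) | a in Phi] = [set` map (ivec R 4) F4_all].
  apply/seteqP; split=> v.
    move=> [a pa <-]; rewrite -scalemxAr; apply/F4_image; rewrite -hf; by exists a.
  have e0 : v = 2 *: (2^-1 *: v) by rewrite scalerA mulfV // scale1r.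
  move=> hv; have : roots_F4 (2^-1 *: v) by apply/F4_image; rewrite -e0.
  by rewrite -hf => -[a pa e]; exists a => //; rewrite -scalemxAr e -e0.
have rn : r = 4%N.
  apply: (rank_iso ff) => i.
  have : @roots_F4 R (evec R i) by left; left; exists i, false; rewrite expr0 scale1r.
  by rewrite -hf => -[a _ e]; exists a, 1; rewrite oner_neq0 e scale1r.
have [k [em ek T1 T2]] := hT ff2 model_F4 hF.
rewrite !(size_map (ivec R 4)) sz1 sz2 in em ek.
(* The dimension equation reads 52 k = 4 (k + 24). *)
have k2 : k = 2%N.
  have : (k * (4 + 48))%:R = ((k + 24) * 4)%:R :> R.
    rewrite rn in ek; rewrite natrM ek em natrM; congr (_ * _); by field.
  by move/eqP; rewrite eqr_nat; lia.
split; last by rewrite em k2.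
pose F (xi : 'rV[R]_4) : R := 2 + ((\sum_(i < 4) 2 * cp (2 * xi 0 i)) + \prod_(i < 4) (2 * cp (xi 0 i))).
have trE (xi : 'rV[R]_4) : k%:R + \sum_(v <- map (ivec R 4) F4_short) expi2pi (pairing v xi) = (F xi)%:C.
  rewrite k2 /F rmorphD rmorph_nat big_map big_cat rmorphD; congr (_ + (_ + _)).
    rewrite big_flatten big_map rmorph_sum -[iota 0 4]/(index_iota 0 4) big_mkord.
    apply: eq_bigr => i _; rewrite !big_cons big_nil /= addr0 !axisE !pairingZl.
    by rewrite pairingC pair_e expr1 expr0 mulN1r mulrN mul1r expi2pi_pm.
  rewrite big_map rmorph_prod (eq_bigr (fun i : 'I_4 => (2 * cp (xi 0 (inord i)))%:C)) => [|i _]; last by rewrite inord_val.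
  rewrite -(sum_signs 4 (fun i => xi 0 (inord i))); apply: eq_bigr => l _; congr expi2pi.
  by rewrite pairing_mkseq; apply: eq_bigr => i _; rewrite rmorph_sign inord_val.
have -> : - 6 = (- 6 : R)%:C by rewrite rmorphN rmorph_nat.
have c2 t : cp (2 * t) = 2 * cp t ^+ 2 - 1.
  have := cos_mulr2n (2 * pi * t); have -> : (2 * pi * t) *+ 2 = 2 * pi * (2 * t) by rewrite mulr2n; ring.
  by move=> ->; rewrite mulr2n; ring.
apply: (is_min_real (F := F)).
- by move=> xi; rewrite -trE.
- by move=> z /T2 [xi ->]; exists xi; rewrite trE.
- exists (const_mx 4^-1).
  have c0 : cp 4^-1 = 0 by rewrite -[RHS]cos_pihalf; congr cos; field.
  by rewrite /F !big_ord_recl !big_ord0 !mxE !c2 c0; lra.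
(* In terms of the cosines c_i the trace is -6 + 4 (sum c_i^2 + 4 prod c_i). *)
move=> xi; rewrite /F !big_ord_recl !big_ord0 !c2.
have hc i : -1 <= cp (xi 0 i) <= 1 by rewrite cos_geN1 cos_le1.
have := quartic_ge0 (hc ord0) (hc (fintype.lift ord0 ord0)) (hc (fintype.lift ord0 (fintype.lift ord0 ord0))) (hc (fintype.lift ord0 (fintype.lift ord0 (fintype.lift ord0 ord0)))).
by do 4!move: (cos _) => ?; lra.
Qed.

Lemma min_G2 : root_system_iso Phi (@roots_G2 R) -> is_min T (- 2) /\ m = 7%N.
Proof.
move=> [f [ff hf]]; have /andP [/eqP sz1 /eqP sz2] := size_G2.
have hG2 : [set a *m f | a in Phi] = [set` map (ivec R 3) G2_all].
  by rewrite hf; apply/seteqP; split=> v /G2_image.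
have r3 : (r <= 3)%N by move/eqP: ff => <-; exact: rank_leq_col.
have [k [em ek T1 T2]] := hT ff model_G2 hG2.
rewrite !(size_map (ivec R 3)) sz1 sz2 in em ek.
(* The model spans a plane of the space of dimension 3, so [rank_iso] does not apply; but k (r + 12)
   = 2 (k + 6), that is k (r + 10) = 12, leaves k = 1 and r = 2 when r <= 3. *)
have k1 : k = 1%N.
  have : (k * (r + 12))%:R = ((k + 6) * 2)%:R :> R.
    rewrite natrM ek em natrM; congr (_ * _); by field.
  by move/eqP; rewrite eqr_nat => /eqP; move: r3; case: (r) => [|[|[|[|]]]] //; lia.
split; last by rewrite em k1.
pose x (xi : 'rV[R]_3) i := xi 0 (inord i).
pose F (xi : 'rV[R]_3) : R := 1 + (2 * cp (x xi 0 - x xi 1) + 2 * cp (x xi 0 - x xi 2) + 2 * cp (x xi 1 - x xi 2)).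
have trE (xi : 'rV[R]_3) : k%:R + \sum_(v <- map (ivec R 3) G2_short) expi2pi (pairing v xi) = (F xi)%:C.
  have pE i j : (i < 3)%N -> (j < 3)%N -> pairing (ivec R 3 (G2_diff (i, j))) xi = x xi i - x xi j.
    move=> hi hj; have := diffE (inord i) (inord j); rewrite !inordK // => ->.
    by rewrite pairingDl pairingNl !(pairingC (evec R _)) !pair_e.
  transitivity (1 + ((2 * cp (x xi 0 - x xi 1))%:C + (2 * cp (x xi 0 - x xi 2))%:C +
    (2 * cp (x xi 1 - x xi 2))%:C)); last by rewrite !rmorphD rmorph1.
  rewrite k1 -!expi2pi_pm; congr (_ + _).
  rewrite !big_map.
  have -> : nat_pairs 3 = [:: (0, 1); (0, 2); (1, 0); (1, 2); (2, 0); (2, 1)]%N by [].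
  rewrite !big_cons big_nil !pE // !opprB; ring.
have -> : - 2 = (- 2 : R)%:C by rewrite rmorphN rmorph_nat.
apply: (is_min_real (F := F)).
- by move=> xi; rewrite -trE.
- by move=> z /T2 [xi ->]; exists xi; rewrite trE.
(* The angle 2 pi / 3: the angles 0, t and -t give the three cube roots of unity, whose sum
   vanishes. *)
- pose t : R := acos (- 2^-1).
  have ct : cos t = - 2^-1 by rewrite acosK // in_itv /=; apply/andP; split; lra.
  have [u ut] : exists u, 2 * pi * u = t by exists (t / (2 * pi)); rewrite mulrC divfK ?tpi.
  have st : sin t * sin t = 3 / 4.
    by have := cos2Dsin2 t; rewrite ct; lra.
  exists (\row_i (if i == inord 1 then u else if i == inord 2 then - u else 0)).
  have e01 : (inord 0 == inord 1 :> 'I_3) = false by rewrite -val_eqE /= !inordK.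
  have e02 : (inord 0 == inord 2 :> 'I_3) = false by rewrite -val_eqE /= !inordK.
  have e21 : (inord 2 == inord 1 :> 'I_3) = false by rewrite -val_eqE /= !inordK.
  rewrite /F /x !mxE !eqxx e01 e02 e21 !sub0r opprK mulrN cosN.
  have -> : cp (u + u) = - 2^-1 by rewrite mulrDr ut cosD ct st; lra.
  by rewrite ut ct; lra.
move=> xi; rewrite /F !mulrBr !cosB.
have := cos2Dsin2 (2 * pi * x xi 0); have := cos2Dsin2 (2 * pi * x xi 1); have := cos2Dsin2 (2 * pi * x xi 2).
move: (cos (_ * x xi 0)) (sin (_ * x xi 0)) (cos (_ * x xi 1)) (sin (_ * x xi 1)) (cos (_ * x xi 2)) (sin (_ * x xi 2)).
move=> c0 s0 c1 s1 c2 s2 h2 h1 h0.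
have := sqr_ge0 (c0 + c1 + c2); have := sqr_ge0 (s0 + s1 + s2); lra.
Qed.

End Cases.
End Exceptional.

Close Scope complex_scope.
Unset Implicit Arguments.
Set Strict Implicit.

Theorem proposition2p5 (R : realType) (G : topologicalGroupType) (d : nat)
    (L : lie_structure R G d) (hG : simple_compact G)
    (r : nat) (tau : 'rV[R]_r -> G) (htau : maximal_torus tau)
    (B : 'M[R]_r) (hB : invariant_inner_product tau B)
    (hlen : two_lengths (root_set L tau) B)
    (h : 'rV[R]_r) (hh : regular_vector (root_set L tau) h)
    (lam : 'rV[R]_r) (hlam : highest_short_root (root_set L tau) B h lam)
    (m : nat) (rho : G -> 'M[R[i]]_m)
    (hrho : irreducible_representation rho)
    (hw : highest_weight tau (root_set L tau) h rho lam) :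
  [/\ is_max (trace_values rho) m%:R,
      forall n : nat, (2 <= n)%N ->
        root_system_iso (root_set L tau) (@roots_B R n) ->
        is_min (trace_values rho) (1 - 2 * n%:R) /\ m = (2 * n + 1)%N,
      forall n : nat, (2 <= n)%N ->
        root_system_iso (root_set L tau) (@roots_C R n) ->
        is_min (trace_values rho) (if odd n then 1 - n%:R else - 1 - n%:R) /\
        m = (2 * n ^ 2 - n - 1)%N,
      root_system_iso (root_set L tau) (@roots_F4 R) ->
        is_min (trace_values rho) (- 6) /\ m = 26%N
    & root_system_iso (root_set L tau) (@roots_G2 R) ->
        is_min (trace_values rho) (- 2) /\ m = 7%N].
Proof.
have [hmax hT] := reduction hG htau hB hh hlam hrho hw.
split=> //.
- exact: (min_B hT).
- exact: (min_C hT).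
- exact: (min_F4 hT).
exact: (min_G2 hT).
Qed.
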